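(* For any root ideal $\Psi\subset\Delta^+_\ell$ and partition $\mu=(\mu_1\ge\cdots\ge\mu_\ell\ge0)$, \[ H(\Psi;\mu;\mathsf w_0)(\mathbf x;q)=\sum_{\substack{U\in\mathrm{SSYT}_\ell(\mu)\\ U\ \mathrm{nr}(\Psi)\text{-katabolizable}}}q^{\mathrm{charge}(U)}\,s_{\mathrm{sh}(U)}(x_1,\dots,x_\ell). \]
   Context: Catalan functions. $\pi_i(f)=\frac{x_if-x_{i+1}s_i(f)}{x_i-x_{i+1}}$; $H_\ell$ the 0-Hecke monoid on $\bar s_1,\dots,\bar s_{\ell-1}$ ($\bar s_i^2=\bar s_i$, far commutation, braid relations); $\pi_w=\pi_{i_1}\cdots\pi_{i_m}$ for $w=\bar s_{i_1}\cdots\bar s_{i_m}$; $\mathsf w_0$ the longest element. $H_\ell$ acts on $\mathbb{Z}^\ell$ by $\bar s_i\alpha=s_i\alpha$ if $\alpha_i\ge\alpha_{i+1}$, else $\alpha$; $\kappa_\alpha=\pi_{\mathsf p(\alpha)}\mathbf x^{\alpha^+}$ ($\alpha^+$ decreasing rearrangement, $\mathsf p(\alpha)$ shortest with $\mathsf p(\alpha)\alpha^+=\alpha$); $\mathrm{poly}$ is linear on Laurent polynomials (coefficientwise in $q$) with $\mathrm{poly}(\kappa_\alpha)=\kappa_\alpha$ for $\alpha\ge0$ and $0$ otherwise. A root ideal is an upper order ideal of $\Delta^+_\ell=\{(i,j):i<j\}$ ($(a,b)\le(c,d)$ iff $a\ge c,b\le d$); $H(\Psi;\gamma;w)=\pi_w\mathrm{poly}\big(\prod_{(i,j)\in\Psi}(1-qx_i/x_j)^{-1}\mathbf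 x^\gamma\big)$. $\mathrm{nr}(\Psi)_i=|\{j\in\{i,\dots,\ell\}:(i,j)\notin\Psi\}|$, $i\in[\ell-1]$. $s_\lambda$ is the Schur polynomial. Tabloids and katabolism. A tabloid of shape $\alpha\in\mathbb{Z}^\ell_{\ge0}$: rows of lengths $\alpha_1,\dots,\alpha_\ell$ (row 1 on top), entries positive integers weakly increasing along rows; content counts entries. $\mathrm{SSYT}_\ell(\mu)$: tabloids of content $\mu$ with partition shape and strictly increasing columns (tableaux with at most $\ell$ rows); $\mathrm{sh}$ is the shape. For a tabloid $T$ with rows $T^i$ and rows $i..\ell-1$ forming a tableau, $P_{i,\ell}(T)$ keeps rows $1..i-1$ and replaces rows $i..\ell$ by the result of column inserting $T^\ell$ into the tableau formed by rows $i..\ell-1$ (equivalently the Schensted insertion tableau of $T^\ell T^{\ell-1}\cdots T^i$). $\mathrm{kat}(T)$: delete all 1's and left-justify, move row 1 to the bottom (row $\ell$), subtract 1 from all entries. For $\mathbf n\in[\ell]^{\ell-1}$, a tableau $U$ of content $\mu$ is $\mathbf n$-katabolizable if for every $i\in[\ell-1]$ the tabloid $P_{n_i,\ell}\circ\mathrm{kat}\circ\cdots\circ P_{n_1,\ell}\circ\mathrm{kat}(U)$ has all its 1's in its first row (for $\mathbf n=\mathrm{nr}(\Psi)$ each $P_{n_i,\ell}$ is applied to a tabloid whose rows $n_i..\ell-1$ form a tableau). Charge is the unique function from words whose content is a partition to $\mathbb{Z}_{\ge0}$ such that: (C1) the empty word has charge 0; (C2) if $u=v1^{\lambda_1}$ has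 content $\lambda$, then $\mathrm{charge}(u)=\mathrm{charge}(v^-)$ where $v^-$ subtracts 1 from every letter of $v$; (C3) if $u=vx$ with $x\ne1$ a letter, $\mathrm{charge}(vx)=\mathrm{charge}(xv)+1$; (C4) charge is constant on Knuth equivalence classes. For a tabloid $T$, $\mathrm{charge}(T)=\mathrm{charge}(T^\ell\cdots T^2T^1)$. *)

(* Defs.v *)
From Stdlib Require Import ClassicalEpsilon.
From HB Require Import structures.
From mathcomp Require Import all_boot all_order all_fingroup all_algebra.
From mathcomp Require Import generic_quotient fraction.
From mathcomp Require Import mpoly.

Set Implicit Arguments.
Unset Strict Implicit.
Unset Printing Implicit Defensive.

Import Order.TTheory GRing.Theory Num.Theory.
Local Open Scope ring_scope.

(* All indices are 0-based: row, variable or part number i of the mathematical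
   text is the ordinal i - 1.  Letters and entries of tabloids are not shifted:
   they are the positive integers 1, 2, ... of type nat. *)

(* ** Laurent polynomials and Demazure operators *)

(* Laurent polynomials live in the field Q(x_1, ..., x_l), so that the quotient
   defining the Demazure operators can be written down literally. *)
Notation ratfun l := {fraction {mpoly int[l]}}.

Notation weight l := {ffun 'I_l -> int}.

Definition toratfun l (p : {mpoly int[l]}) : ratfun l := FracField.tofrac p.

Definition xvar l (i : 'I_l) : ratfun l := toratfun 'X_i.

Definition xmon l (a : weight l) : ratfun l := \prod_(i < l) xvar i ^ a i.

Definition laurent l (f : ratfun l) : Prop :=
  exists (p : {mpoly int[l]}) (m : nat),
    f = toratfun p / (\prod_(i < l) xvar i) ^+ m.

(* The positions i and i + 1 moved by the i-th generator. *)
Definition lpos n (i : 'I_n) : 'I_n.+1 := widen_ord (leqnSn n) i.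
Definition rpos n (i : 'I_n) : 'I_n.+1 := lift ord0 i.

Definition fperm l (s : 'S_l) (f : ratfun l) : ratfun l :=
  toratfun (msym s (repr f).1) / toratfun (msym s (repr f).2).

(* The choice of representative in fperm is immaterial. *)
Lemma fperm_div l (s : 'S_l) (p q : {mpoly int[l]}) : q != 0 ->
  fperm s (toratfun p / toratfun q) = toratfun (msym s p) / toratfun (msym s q).
Proof.
move=> q0; set f := _ / _.
have d0 := denom_ratioP (repr f).
have msym_neq0 r : r != 0 -> toratfun (msym s r) != 0.
  move=> r0; rewrite tofrac_eq0; apply: contra r0 => /eqP e.
  by apply/eqP/(@inj_msym _ _ s); rewrite e msym0.
have fE : f = toratfun (repr f).1 / toratfun (repr f).2.
  rewrite -{1}[f]reprK; apply/eqP; rewrite eq_sym.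
  rewrite -[X in _ == X](mulfK (_ : toratfun (repr f).2 != 0)) ?tofrac_eq0 //.
  apply/eqP; congr (_ / _).
  rewrite /toratfun; move: (repr f) d0 => y d0.
  rewrite !piE; apply/eqP; rewrite FracField.equivf_def /FracField.equivf.
  by rewrite /FracField.mulf !numden_Ratio ?mulr1 ?mul1r ?oner_eq0 // mulrC.
have e : p * (repr f).2 = (repr f).1 * q.
  apply/eqP; rewrite -tofrac_eq !tofracM.
  rewrite -eqr_div ?tofrac_eq0 //; apply/eqP; exact: fE.
rewrite /fperm; apply/eqP; rewrite eqr_div ?msym_neq0 // -!tofracM -!msymM.
by rewrite e.
Qed.

Definition demazure n (i : 'I_n) (f : ratfun n.+1) : ratfun n.+1 :=
  (xvar (lpos i) * f - xvar (rpos i) * fperm (tperm (lpos i) (rpos i)) f)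
  / (xvar (lpos i) - xvar (rpos i)).

(* ** The 0-Hecke monoid: its elements are given by words in the generators,
   considered up to hecke_eq. *)

Inductive hecke_rel n : seq 'I_n -> seq 'I_n -> Prop :=
| HeckeIdem (i : 'I_n) : hecke_rel [:: i; i] [:: i]
| HeckeComm (i j : 'I_n) : (i.+1 < j)%N -> hecke_rel [:: i; j] [:: j; i]
| HeckeBraid (i j : 'I_n) :
    j = i.+1 :> nat -> hecke_rel [:: i; j; i] [:: j; i; j].

Inductive hecke_eq n : seq 'I_n -> seq 'I_n -> Prop :=
| HeckeStep u a b v : hecke_rel a b -> hecke_eq (u ++ a ++ v) (u ++ b ++ v)
| HeckeRefl w : hecke_eq w w
| HeckeSym v w : hecke_eq v w -> hecke_eq w v
| HeckeTrans u v w : hecke_eq u v -> hecke_eq v w -> hecke_eq u w.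

Definition hecke_reduced n (w : seq 'I_n) : Prop :=
  forall v, hecke_eq w v -> (size w <= size v)%N.

Definition hecke_longest n (w : seq 'I_n) : Prop :=
  hecke_reduced w /\ forall v : seq 'I_n, hecke_reduced v -> (size v <= size w)%N.

Definition hecke_w0 n : seq 'I_n := epsilon (inhabits [::]) (@hecke_longest n).

Definition demazure_word n (w : seq 'I_n) (f : ratfun n.+1) : ratfun n.+1 :=
  foldr (@demazure n) f w.

Definition hecke_act n (i : 'I_n) (a : weight n.+1) : weight n.+1 :=
  if a (rpos i) <= a (lpos i)
  then [ffun k => a (tperm (lpos i) (rpos i) k)] else a.

Definition hecke_act_word n (w : seq 'I_n) (a : weight n.+1) : weight n.+1 :=
  foldr (@hecke_act n) a w.

(* ** Key polynomials and polynomial truncation *)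

Definition decr_rearr l (a : weight l) : weight l :=
  [ffun i : 'I_l => nth 0 (sort >=%R (codom a)) i].

(* A word of minimal size carrying the decreasing rearrangement of a to a; it is
   a reduced word of the shortest such element of the monoid. *)
Definition key_word n (a : weight n.+1) : seq 'I_n :=
  epsilon (inhabits [::]) (fun w =>
    hecke_act_word w (decr_rearr a) = a /\
    forall v : seq 'I_n, hecke_act_word v (decr_rearr a) = a -> (size w <= size v)%N).

Definition key n (a : weight n.+1) : ratfun n.+1 :=
  demazure_word (key_word a) (xmon (decr_rearr a)).

Definition is_poly_trunc n (P : ratfun n.+1 -> ratfun n.+1) : Prop :=
  (forall (c : int) f g, laurent f -> laurent g ->
     P (f *~ c + g) = P f *~ c + P g) /\
  (forall a : weight n.+1,
     P (key a) = if [forall i, 0 <= a i] then key a else 0).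

(* The key polynomials form a Z-basis of the Laurent polynomials, so these
   conditions determine poly_trunc on all Laurent polynomials, and it is only
   ever applied to these. *)
Definition poly_trunc n : ratfun n.+1 -> ratfun n.+1 :=
  epsilon (inhabits id) (@is_poly_trunc n).

(* ** Root ideals and Catalan functions *)

Definition root_le l (r s : 'I_l * 'I_l) : bool :=
  (s.1 <= r.1)%N && (r.2 <= s.2)%N.

Definition root_ideal l (Psi : {set 'I_l * 'I_l}) : Prop :=
  (forall r, r \in Psi -> (r.1 < r.2)%N) /\
  (forall r s : 'I_l * 'I_l,
     r \in Psi -> (s.1 < s.2)%N -> root_le r s -> s \in Psi).

(* Formal power series in q are coefficient sequences. *)
Definition ser_one (F : pzSemiRingType) : nat -> F := fun d => (d == 0%N)%:R.

Definition ser_mul (F : pzSemiRingType) (f g : nat -> F) : nat -> F :=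
  fun d => \sum_(k < d.+1) f k * g (d - k)%N.

(* (1 - q r)^-1 *)
Definition ser_geom (F : pzSemiRingType) (r : F) : nat -> F := fun d => r ^+ d.

Lemma ser_geomE (F : pzRingType) (r : F) :
  ser_mul (fun d => if d is d'.+1 then - r *+ (d' == 0%N) else 1) (ser_geom r)
  =1 ser_one F.
Proof.
case=> [|d]; rewrite /ser_mul /ser_geom /ser_one.
  by rewrite big_ord_recl big_ord0 mul1r expr0 addr0.
rewrite 2!big_ord_recl big1 => [|k _]; last by rewrite /= mulr0n mul0r.
by rewrite /= mul1r subn0 addr0 /bump /= subSS subn0 mulr1n mulNr -exprS subrr.
Qed.

(* The coefficient of q^d in H(Psi; gamma; w). *)
Definition catalan n (Psi : {set 'I_n.+1 * 'I_n.+1}) (gamma : weight n.+1)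
    (w : seq 'I_n) : nat -> ratfun n.+1 :=
  fun d => demazure_word w (poly_trunc
    ((\big[@ser_mul _/@ser_one _]_(r in Psi) ser_geom (xvar r.1 / xvar r.2)) d
     * xmon gamma)).

Definition nr n (Psi : {set 'I_n.+1 * 'I_n.+1}) : seq nat :=
  [seq #|[set j : 'I_n.+1 | (i <= j)%N && ((lpos i, j) \notin Psi)]|
  | i : 'I_n <- enum 'I_n].

(* The Schur polynomial of a partition with at most n + 1 parts, as a quotient
   of alternants. *)
Definition schur n (la : seq nat) : ratfun n.+1 :=
  \det (\matrix_(i < n.+1, j < n.+1) xvar i ^+ (nth 0%N la j + (n - j)))
  / \det (\matrix_(i < n.+1, j < n.+1) xvar i ^+ (n - j)).

(* ** Tabloids: lists of rows, top row first; their number l of rows is the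
   length of the list, empty rows included. *)

Local Open Scope nat_scope.

Notation tabloid := (seq (seq nat)).

Definition is_tabloid l (T : tabloid) : bool :=
  [&& size T == l, all (sorted leq) T & all (all (leq 1)) T].

Definition has_content l (mu : l.-tuple nat) (T : tabloid) : bool :=
  all (fun x => 0 < x <= l) (flatten T) &&
  [forall i : 'I_l, count_mem i.+1 (flatten T) == tnth mu i].

Definition col_lt (r s : seq nat) : bool :=
  all (fun j => nth 0 r j < nth 0 s j) (iota 0 (size s)).

Definition is_ssyt l (mu : l.-tuple nat) (T : tabloid) : bool :=
  [&& is_tabloid l T, has_content mu T, sorted geq (shape T) & sorted col_lt T].

(* The duplicate-free list of all T satisfying is_ssyt mu; see mem_SSYT and
   SSYT_uniq. *)
Definition SSYT l (mu : l.-tuple nat) : seq tabloid :=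
  [seq T <- [seq [seq [seq nat_of_ord x | x <- bseqval r] | r <- tval t]
            | t <- enum {: l.-tuple ((sumn mu).-bseq 'I_l.+1)}]
  | is_ssyt mu T].

Lemma SSYT_uniq l (mu : l.-tuple nat) : uniq (SSYT mu).
Proof.
apply: filter_uniq; rewrite map_inj_uniq ?enum_uniq // => s t.
move/(inj_map (inj_comp (inj_map val_inj) val_inj)); exact: val_inj.
Qed.

Lemma mem_SSYT l (mu : l.-tuple nat) (T : tabloid) :
  (T \in SSYT mu) = is_ssyt mu T.
Proof.
rewrite mem_filter andb_idr // => /and3P[/and3P[/eqP szT _ _] /andP[bT cT] _].
have szf : size (flatten T) = sumn mu.
  have -> : size (flatten T) = \sum_(i < l) count_mem i.+1 (flatten T).
    elim: (flatten T) bT => [|x s IH] /=; first by rewrite big1.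
    case/andP=> /andP[x0 xl] /IH ->; rewrite big_split /=.
    have xl' : x.-1 < l by rewrite prednK.
    rewrite -add1n; congr (_ + _); rewrite (bigD1 (Ordinal xl')) //= prednK //.
    rewrite big1 ?eqxx // => i ne.
    apply/eqP; rewrite eqb0; apply: contra ne => /eqP xE.
    by apply/eqP/val_inj; rewrite /= xE.
  rewrite sumnE big_tuple; apply: eq_bigr => i _; apply/eqP.
  by move/forallP: cT.
have szr r : r \in T -> size r <= sumn mu.
  move=> rT; rewrite -szf size_flatten sumnE big_map.
  by rewrite (big_rem r) //= leq_addr.
have enc : exists s : seq ((sumn mu).-bseq 'I_l.+1),
    [seq [seq nat_of_ord x | x <- bseqval r] | r <- s] = T.
  elim: T szr bT {szT cT szf} => [|r T IH] szr; first by exists [::].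
  rewrite /= all_cat => /andP[br /IH[t tT|s <-]].
    by apply: szr; rewrite inE tT orbT.
  have szr' : size [seq inord x : 'I_l.+1 | x <- r] <= sumn mu.
    by rewrite size_map szr ?mem_head.
  exists (Bseq szr' :: s) => /=; congr (_ :: _).
  rewrite -map_comp map_id_in // => x /(allP br)/andP[_ xl] /=.
  by rewrite inordK.
case: enc => s sT; have szs : size s == l by apply/eqP; move: szT; rewrite -sT size_map.
by apply/mapP; exists (Tuple szs); rewrite ?mem_enum.
Qed.

(* ** Column insertion and katabolism *)

(* Exchanges the lists of rows and of columns of a tableau. *)
Definition transpose (T : tabloid) : tabloid :=
  [seq [seq nth 0 r j | r <- T & j < size r]
  | j <- iota 0 (foldr maxn 0 (shape T))].

(* Column insertion of a letter into a tableau given by its list of columns: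
   x bumps the topmost entry >= x of the column into the next column. *)
Fixpoint col_insert (x : nat) (C : tabloid) : tabloid :=
  if C is c :: C' then
    let k := find (leq x) c in
    if k < size c then set_nth 0 c k x :: col_insert (nth 0 c k) C'
    else rcons c x :: C'
  else [:: [:: x]].

(* Column insertion of a row, its rightmost letter first. *)
Definition col_insert_row (r : seq nat) (T : tabloid) : tabloid :=
  transpose (foldr col_insert (transpose T) r).

(* P_{m,l}, for l = size T and 1 <= m <= l. *)
Definition Pins (m : nat) (T : tabloid) : tabloid :=
  let S := drop m.-1 T in
  let R := col_insert_row (last [::] S) (take (size S).-1 S) in
  take m.-1 T ++ R ++ nseq (size S - size R) [::].

Definition kat (T : tabloid) : tabloid :=
  rot 1 [seq [seq x.-1 | x <- r & x != 1] | r <- T].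

Definition ones_in_first_row (T : tabloid) : bool := 1 \notin flatten (behead T).

(* scanl lists the tabloids P_{n_i} kat ... P_{n_1} kat U for i = 1, 2, ... *)
Definition katabolizable (ns : seq nat) (U : tabloid) : bool :=
  all ones_in_first_row (scanl (fun T m => Pins m (kat T)) U ns).

(* ** Charge *)

Inductive knuth_rel : seq nat -> seq nat -> Prop :=
| Knuth1 x y z : x <= y < z -> knuth_rel [:: x; z; y] [:: z; x; y]
| Knuth2 x y z : x < y <= z -> knuth_rel [:: y; x; z] [:: y; z; x].

Inductive knuth_eq : seq nat -> seq nat -> Prop :=
| KnuthStep u a b v : knuth_rel a b -> knuth_eq (u ++ a ++ v) (u ++ b ++ v)
| KnuthRefl w : knuth_eq w w
| KnuthSym v w : knuth_eq v w -> knuth_eq w v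
| KnuthTrans u v w : knuth_eq u v -> knuth_eq v w -> knuth_eq u w.

Definition partition_content (w : seq nat) : Prop :=
  0 \notin w /\ forall k, 0 < k -> count_mem k.+1 w <= count_mem k w.

(* In the second clause, 1 \notin v says that the m trailing letters are all
   the 1's. *)
Definition is_charge (c : seq nat -> nat) : Prop :=
  [/\ c [::] = 0,
      forall v m, partition_content (v ++ nseq m 1) -> 1 \notin v ->
        c (v ++ nseq m 1) = c [seq x.-1 | x <- v],
      forall v x, partition_content (rcons v x) -> x != 1 ->
        c (rcons v x) = (c (x :: v)).+1
    & forall v w, partition_content v -> knuth_eq v w -> c v = c w].

(* is_charge determines charge on the words of partition content; its values on
   other words are irrelevant. *)
Definition charge : seq nat -> nat := epsilon (inhabits (fun=> 0)) is_charge.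

Definition charge_tabloid (T : tabloid) : nat := charge (flatten (rev T)).

(* Main.v *)
Require Import Defs.

(* A tabloid of content mu is read as the sequence of the rows occupied by its
   letters, grouped by letter; on such words the insertion P_(m,l) is the 0-Hecke
   operator of the longest element on the nodes m, ..., l - 1, and kat shifts the
   rows cyclically.  The set of words whose images stay katabolizable is built by
   prepending the letter 1 (multiplication by x_1^(mu_1), after the cyclic shift)
   and closing under 0-Hecke operators; such sets meet every string of the
   crystal in nothing, its head or all of it, so their characters are obtained
   with the corresponding Demazure operators, and charge follows the power of q
   by the rotation rule (C3).
   On the other side, triangularity of the key polynomials shows that pi_w0 poly
   sends x^alpha to the Jacobi-Trudi determinant of alpha.  Expanding the
   geometric series over Psi one row at a time gives the recursion satisfied by
   the characters, and both sides agree degree by degree in q. *)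

Set Implicit Arguments.
Unset Strict Implicit.
Unset Printing Implicit Defensive.

(** The obstacle is the cyclic shift. Rotating the rows turns the joint between the last and the
    first row into an ordinary node, so an induction over the blocks needs the string property at
    all nodes of a cycle, while words in [l] rows only see a segment. Therefore the rows are
    unrolled: finitely many copies lie on a line, a shift only moves the origin, and the joints
    between copies act as the affine node. Every shift spoils one copy at an end, which dictates the
    numbers of copies. Prefixing a highest weight word keeps the string property by a combinatorial
    form of Joseph's theorem: it is proved for one column, carried to all highest weight words by
    Knuth moves, and to larger weights by comparison ([FG_dom]). Changing one copy at a time leads
    back to a single copy. Both sides are written with Jacobi-Trudi determinants of arbitrary
    integer sequences, so the two expansions match term by term. The longest word, the truncation
    and charge are given by choice operators; that objects with the required properties exist is
    part of the proof. *)

Module Scan.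
From mathcomp Require Import all_boot zify.

(** * Raising operators on words, by bracketing *)

Fixpoint scan p c w := if w is x :: w' then
  if x == p then x :: scan p c.+1 w'
  else if x == p.+1 then
    (if c is c'.+1 then x :: scan p c' w' else p :: scan p 0 w')
  else x :: scan p c w' else [::].
Fixpoint cnt p c w := if w is x :: w' then
  if x == p then cnt p c.+1 w' else if x == p.+1 then cnt p c.-1 w'
  else cnt p c w' else c.
(** Bracketing rule: [p] opens, [p.+1] closes, [c] counts the open brackets, and every unmatched
    [p.+1] becomes [p]. Thus [E p] goes to the head of the [p]-string in one step, and [cnt p 0 w]
    is the number of unmatched [p] in [w] itself. *)
Definition E p := scan p 0.
(** The first letter of [v] acts first, so that preimages under [Eword v] compose in the same order
    as the Demazure operators of [v], whose last letter acts first. *)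
Definition Eword (v w : seq nat) := foldl (fun w p => E p w) w v.

Lemma size_scan p c w : size (scan p c w) = size w.
Proof.
elim: w c => //= x w IH c; do 2 (case: ifP => _ /=; rewrite ?IH //).
by case: c => /= [|c]; rewrite ?IH.
Qed.

Lemma scan_cat p c u v : scan p c (u ++ v) = scan p c u ++ scan p (cnt p c u) v.
Proof.
elim: u c => //= x u IH c; do 2 (case: ifP => _ /=; rewrite ?IH //).
by case: c => /= [|c]; rewrite ?IH.
Qed.

Lemma cnt_cat p c u v : cnt p c (u ++ v) = cnt p (cnt p c u) v.
Proof. by elim: u c => //= x u IH c; do 2 (case: ifP => _ //=). Qed.

Lemma scan_ge p c d w : d <= c -> scan p c (scan p d w) = scan p d w.
Proof.
elim: w c d => //= x w IH c d le; case: ifP => [/eqP->|xp] /=.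
  by rewrite eqxx IH.
case: ifP => [/eqP->|xp1] /=; last by rewrite xp xp1 IH.
case: d le => [|d] le /=; first by rewrite eqxx IH.
rewrite ifN_eq ?eqxx; last by lia.
by case: c le => //= c le; rewrite IH.
Qed.

Lemma scan_le p c d w : c <= d -> scan p c (scan p d w) = scan p c w.
Proof.
elim: w c d => //= x w IH c d le; case: ifP => [/eqP->|xp] /=.
  by rewrite eqxx IH.
case: ifP => [/eqP->|xp1] /=; last by rewrite xp xp1 IH.
case: d le => [|d] le /=.
  by move: le; rewrite leqn0 => /eqP->; rewrite eqxx scan_ge.
rewrite ifN_eq ?eqxx; last by lia.
by case: c le => //= [|c] le; rewrite IH.
Qed.

Lemma E_idem p w : E p (E p w) = E p w. Proof. exact: scan_ge. Qed.

Lemma scan_comm p q c d w : p.+1 < q ->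
  scan p c (scan q d w) = scan q d (scan p c w).
Proof.
move=> pq; elim: w c d => //= x w IH c d.
case: (x =P p) => [->|xp].
  have -> : (p == q) = false by lia. have -> : (p == q.+1) = false by lia.
  by rewrite /= eqxx ifN_eq ?ifN_eq ?IH //; lia.
case: (x =P p.+1) => [->|xp1].
  have -> : (p.+1 == q) = false by lia. have -> : (p.+1 == q.+1) = false by lia.
  rewrite /= eqxx [p.+1 == p]gtn_eqF //.
  case: c => [|c] /=; first by rewrite ifN_eq ?ifN_eq ?IH //; lia.
  by rewrite ifN_eq ?ifN_eq ?IH //; lia.
case: (x =P q) => [xq|xq] /=.
  have -> : (x == p) = false by lia. have -> : (x == p.+1) = false by lia.
  by rewrite ?xq ?eqxx IH.
case: (x =P q.+1) => [xq1|xq1] /=.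
  case: d => [|d] /=.
    have -> : (q == p) = false by lia. have -> : (q == p.+1) = false by lia.
    have -> : (x == q) = false by lia.
    by rewrite ?xq1 ?eqxx IH.
  have -> : (x == p) = false by lia. have -> : (x == p.+1) = false by lia.
  have -> : (x == q) = false by lia.
  by rewrite ?xq1 ?eqxx IH.
have e1 : (x == p) = false by lia. have e2 : (x == p.+1) = false by lia.
have e3 : (x == q) = false by lia. have e4 : (x == q.+1) = false by lia.
by rewrite ?e1 ?e2 ?e3 ?e4 IH.
Qed.

Definition lastE p w x := if (x == p.+1) && (cnt p 0 w == 0) then p else x.
Lemma E_rcons p w x : E p (rcons w x) = rcons (E p w) (lastE p w x).
Proof.
rewrite /E -!cats1 scan_cat /lastE; congr cat => /=.
case: (x =P p) => [->|]; first by rewrite ltn_eqF.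
by case: (x =P p.+1) => //= ->; case: (cnt p 0 w).
Qed.
Lemma cnt_rcons p w x : cnt p 0 (rcons w x) =
  if x == p then (cnt p 0 w).+1 else if x == p.+1 then (cnt p 0 w).-1 else cnt p 0 w.
Proof. by rewrite -cats1 cnt_cat. Qed.

(* The counters met along the two sides of the braid relation determine each
   other; this is the rank two string parametrisation change. *)
Lemma E_braid_cnt p w : [/\ E p (E p.+1 (E p w)) = E p.+1 (E p (E p.+1 w)),
  cnt p 0 (E p.+1 w) = minn (cnt p 0 w) (cnt p 0 (E p.+1 (E p w))),
  cnt p.+1 0 w = cnt p.+1 0 (E p w) + (cnt p 0 (E p.+1 (E p w)) - cnt p 0 w)
  & cnt p.+1 0 (E p (E p.+1 w)) =
    cnt p.+1 0 (E p w) + (cnt p 0 w - cnt p 0 (E p.+1 (E p w)))].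
Proof.
elim/last_ind: w => [|w x [IH H2 H1 H3]] //.
rewrite !E_rcons !cnt_rcons IH /lastE; move: H2 H1 H3 {IH}.
set A1 := cnt p 0 w; set A2 := cnt p.+1 0 (E p w).
set A3 := cnt p 0 (E p.+1 (E p w)); set B1 := cnt p.+1 0 w.
set B2 := cnt p 0 (E p.+1 w); set B3 := cnt p.+1 0 (E p (E p.+1 w)).
(* Only the six counters matter from here on: a new letter changes them piecewise linearly, which
   leaves a finite check for each of the four kinds of letter. *)
move: (E p.+1 (E p (E p.+1 w))) A1 A2 A3 B1 B2 B3 => wf A1 A2 A3 B1 B2 B3 H2 H1 H3.
have n1 : (p == p.+1) = false by lia. have n2 : (p == p.+2) = false by lia.
have n3 : (p.+1 == p) = false by lia. have n4 : (p.+1 == p.+2) = false by lia.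
have n5 : (p.+2 == p) = false by lia. have n6 : (p.+2 == p.+1) = false by lia.
pose rl := (eqxx, n1, n2, n3, n4, n5, n6).
have fin : [\/ x = p, x = p.+1, x = p.+2 |
  [/\ (x == p) = false, (x == p.+1) = false & (x == p.+2) = false]].
  case: (x =P p) => [|?]; first by constructor 1.
  case: (x =P p.+1) => [|?]; first by constructor 2.
  case: (x =P p.+2) => [|?]; first by constructor 3.
  by constructor 4.
case: fin => [->|->|->|[x0 x1 x2]]; rewrite ?rl ?(x0, x1, x2) /= ?rl ?(x0, x1, x2) /=.
- by split; [congr rcons|lia|lia|lia].
- case: (A1 =P 0) => a1; case: (A3 =P 0) => a3; case: (B2 =P 0) => b2;
    rewrite ?andbT ?andbF ?rl /= ?rl /=;
    by split; [congr rcons; lia|lia|lia|lia].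
- case: (A2 =P 0) => a2; case: (A3 =P 0) => a3; case: (B1 =P 0) => b1;
    case: (B2 =P 0) => b2; case: (B3 =P 0) => b3;
    rewrite ?andbT ?andbF ?rl /= ?rl /= ?andbT ?andbF ?rl /= ?rl;
    by split; [congr rcons; lia|lia|lia|lia].
- by split; [congr rcons|lia|lia|lia].
Qed.

Lemma E_braid p w : E p (E p.+1 (E p w)) = E p.+1 (E p (E p.+1 w)).
Proof. by case: (E_braid_cnt p w). Qed.

(** * 0-Hecke words over the natural numbers and their Bruhat order *)

Inductive hrel : seq nat -> seq nat -> Prop :=
| Hidem i : hrel [:: i; i] [:: i]
| Hcomm i j : i.+1 < j -> hrel [:: i; j] [:: j; i]
| Hbraid i : hrel [:: i; i.+1; i] [:: i.+1; i; i.+1].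
Inductive heq : seq nat -> seq nat -> Prop :=
| Hstep u a b v : hrel a b -> heq (u ++ a ++ v) (u ++ b ++ v)
| Hrefl w : heq w w
| Hsym v w : heq v w -> heq w v
| Htrans u v w : heq u v -> heq v w -> heq u w.

Lemma Eword_cat u v w : Eword (u ++ v) w = Eword v (Eword u w).
Proof. exact: foldl_cat. Qed.

Lemma Eword_heq u v w : heq u v -> Eword u w = Eword v w.
Proof.
move=> h; elim: h w => {u v} [u a b v r|//|u v _ IH|u v w' _ IH _ IH'] w //.
  rewrite !Eword_cat; congr (Eword v _); move: (Eword u w) => {}w.
  case: r => [i|i j ij|i] /=; first exact: E_idem.
    by rewrite /E -scan_comm.
  exact: E_braid.
by rewrite IH IH'.
Qed.

Lemma heq_cat u a b v : heq a b -> heq (u ++ a ++ v) (u ++ b ++ v).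
Proof.
elim=> {a b} [u' a b v' r|w|a b _ IH|a b c _ IH _ IH'].
- by rewrite -!catA !(catA u); apply: Hstep.
- exact: Hrefl.
- exact: Hsym.
- exact: Htrans IH IH'.
Qed.
Lemma heq_cons i a b : heq a b -> heq (i :: a) (i :: b).
Proof. by move/(heq_cat [:: i] [::]); rewrite !cats0. Qed.
Lemma heq_catl u a b : heq a b -> heq (u ++ a) (u ++ b).
Proof. by move/(heq_cat u [::]); rewrite !cats0. Qed.
Lemma heq_catr a b v : heq a b -> heq (a ++ v) (b ++ v).
Proof. exact: (heq_cat [::] v). Qed.
Lemma heq_all (N : pred nat) a b : heq a b -> all N a = all N b.
Proof.
elim=> {a b} [u a b v r|//|//|a b c _ -> _ ->] //.
rewrite !all_cat; congr (_ && (_ && _)); case: r => [i|i j _|i] /=.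
- by rewrite !andbT andbb.
- by rewrite !andbT andbC.
- by rewrite !andbT; case: (N i); case: (N i.+1).
Qed.

(** One half of the subword property, which makes the Bruhat order independent of the chosen
    words. *)
Definition subh a b := forall x, subseq x b -> exists2 y, subseq y a & heq y x.
Lemma subh_trans a b c : subh a b -> subh b c -> subh a c.
Proof.
by move=> ab bc x /bc [y /ab [z za zy] yx]; exists z => //; apply: Htrans yx.
Qed.
Lemma subseq_catl (x s1 s2 : seq nat) : subseq x (s1 ++ s2) ->
  exists x1 x2, [/\ x = x1 ++ x2, subseq x1 s1 & subseq x2 s2].
Proof.
case/subseqP=> m sm ->; exists (mask (take (size s1) m) s1), (mask (drop (size s1) m) s2).
rewrite !mask_subseq; split=> //.
rewrite -{1}[m](cat_take_drop (size s1)) mask_cat // size_take sm size_cat.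
by case: ltnP => // h; apply/eqP; rewrite eqn_leq h leq_addr.
Qed.
Lemma subh_ctx u a b v : subh a b -> subh (u ++ a ++ v) (u ++ b ++ v).
Proof.
move=> ab x /subseq_catl [x1 [y [-> xu /subseq_catl [x2 [x3 [-> /ab [z za zx] xv]]]]]].
by exists (x1 ++ z ++ x3); [rewrite !cat_subseq | apply: heq_cat].
Qed.
Lemma hrel_heq a b : hrel a b -> heq a b.
Proof. by move=> r; have := Hstep [::] [::] r; rewrite !cats0. Qed.
Lemma subseq_small (a b : seq nat) :
  (forall m, size m = size b -> exists2 y, subseq y a & heq y (mask m b)) -> subh a b.
Proof. by move=> H x /subseqP [m sm ->]; apply: H. Qed.

(** All masks of both sides are tried. A subword with a repeated letter, left over from a braid,
    collapses by idempotency. *)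
Lemma subh_hrel a b : hrel a b -> subh a b /\ subh b a.
Proof.
case=> [i|i j ij|i].
- split; apply: subseq_small.
    move=> [|[] [|? ?]] //= _; [exists [:: i]|exists [::]] => //=; try exact: Hrefl.
    by rewrite eqxx.
  move=> [|b1 [|b2 [|? ?]]] //= _; case: b1 b2 => [] [] /=.
  + by exists [:: i]; [rewrite /= ?eqxx|apply/Hsym/hrel_heq/Hidem].
  + by exists [:: i]; [rewrite /= ?eqxx|exact: Hrefl].
  + by exists [:: i]; [rewrite /= ?eqxx|exact: Hrefl].
  + by exists [::]; last exact: Hrefl.
- have nij : (i == j) = false by lia. have nji : (j == i) = false by lia.
  split; apply: subseq_small => [] [|b1 [|b2 [|? ?]]] //= _; case: b1 b2 => [] [] /=.
  + by exists [:: i; j]; [rewrite /= ?eqxx|apply/hrel_heq/Hcomm].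
  + by exists [:: j]; [rewrite /= ?(nij, nji, eqxx)|exact: Hrefl].
  + by exists [:: i]; [rewrite /= ?(nij, nji, eqxx)|exact: Hrefl].
  + by exists [::]; last exact: Hrefl.
  + by exists [:: j; i]; [rewrite /= ?eqxx|apply/Hsym/hrel_heq/Hcomm].
  + by exists [:: i]; [rewrite /= ?(nij, nji, eqxx)|exact: Hrefl].
  + by exists [:: j]; [rewrite /= ?(nij, nji, eqxx)|exact: Hrefl].
  + by exists [::]; last exact: Hrefl.
- have n1 : (i == i.+1) = false by lia. have n2 : (i.+1 == i) = false by lia.
  split; apply: subseq_small => [] [|b1 [|b2 [|b3 [|? ?]]]] //= _;
    case: b1 b2 b3 => [] [] [] /=.
  + by exists [:: i; i.+1; i]; [rewrite /= ?eqxx|apply/hrel_heq/Hbraid].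
  + by exists [:: i.+1; i]; [rewrite /= ?(n1, n2, eqxx)|exact: Hrefl].
  + by exists [:: i.+1]; [rewrite /= ?(n1, n2, eqxx)|apply/Hsym/hrel_heq/Hidem].
  + by exists [:: i.+1]; [rewrite /= ?(n1, n2, eqxx)|exact: Hrefl].
  + by exists [:: i; i.+1]; [rewrite /= ?(n1, n2, eqxx)|exact: Hrefl].
  + by exists [:: i]; [rewrite /= ?(n1, n2, eqxx)|exact: Hrefl].
  + by exists [:: i.+1]; [rewrite /= ?(n1, n2, eqxx)|exact: Hrefl].
  + by exists [::]; last exact: Hrefl.
  + by exists [:: i.+1; i; i.+1]; [rewrite /= ?eqxx|apply/Hsym/hrel_heq/Hbraid].
  + by exists [:: i; i.+1]; [rewrite /= ?(n1, n2, eqxx)|exact: Hrefl].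
  + by exists [:: i]; [rewrite /= ?(n1, n2, eqxx)|apply/Hsym/hrel_heq/Hidem].
  + by exists [:: i]; [rewrite /= ?(n1, n2, eqxx)|exact: Hrefl].
  + by exists [:: i.+1; i]; [rewrite /= ?(n1, n2, eqxx)|exact: Hrefl].
  + by exists [:: i.+1]; [rewrite /= ?(n1, n2, eqxx)|exact: Hrefl].
  + by exists [:: i]; [rewrite /= ?(n1, n2, eqxx)|exact: Hrefl].
  + by exists [::]; last exact: Hrefl.
Qed.

Lemma subh_heq a b : heq a b -> subh a b /\ subh b a.
Proof.
elim=> {a b} [u a b v /subh_hrel [ab ba]|w|a b _ [] //|a b c _ [ab ba] _ [bc cb]].
- by split; apply: subh_ctx.
- by split=> x xw; exists x => //; apply: Hrefl.
- by split; apply: subh_trans; eassumption.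
Qed.

(** The Bruhat order: the element of [v] lies below that of [w]. *)
Definition Low w v := exists2 v', subseq v' w & heq v' v.
Lemma Low_sub w v x : Low w v -> subseq x v -> Low w x.
Proof.
move=> [v' v'w vv'] xv; case: (subh_heq vv') => /(_ _ xv) [y yv' yx] _.
by exists y => //; apply: subseq_trans yv' v'w.
Qed.
Lemma Low_trans w v x : Low w v -> Low v x -> Low w x.
Proof.
move=> wv [x' xv xx']; have [y yw yx] := Low_sub wv xv.
by exists y => //; apply: Htrans xx'.
Qed.
Lemma Low_heq w v : heq w v -> Low w v. Proof. by exists w. Qed.
Lemma Low_cons i w v : Low w v -> Low (i :: w) (i :: v).
Proof. by move=> [v' h1 h2]; exists (i :: v'); [rewrite /= eqxx|apply: heq_cons]. Qed.
Lemma Low_consr i w v : Low w v -> Low (i :: w) v.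
Proof. by move=> [v' h1 h2]; exists v' => //; apply: subseq_trans h1 (subseq_cons _ _). Qed.
Lemma Low_all (N : pred nat) w v : Low w v -> all N w -> all N v.
Proof. by move=> [v' h1 /(heq_all N) <-] /allP h; apply/allP=> x /(mem_subseq h1) /h. Qed.
End Scan.

(** * Sets of words with the string property; exchange for orbits of columns *)

Module FilteredSets.
From mathcomp Require Import all_boot zify.
Import Scan.

Definition wset := seq nat -> Prop.
Definition Fw v (X : wset) : wset := fun w => X (Eword v w).
Definition nice p (X : wset) := forall w, X w -> X (E p w) /\
  (E p w <> w -> forall w', E p w' = E p w -> X w').
(** All preimages under [N]-words are included, so that the property is stable under further
    operators of [N] by construction ([FG_F]). *)
Definition FG (N : pred nat) (X : wset) :=
  forall v p, all N v -> N p -> nice p (Fw v X).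
Definition pre (H : seq nat) (X : wset) : wset := fun w => exists2 x, w = H ++ x & X x.

Lemma nice_ext p (X Y : wset) : (forall w, X w <-> Y w) -> nice p X -> nice p Y.
Proof.
move=> e nX w /e /nX [h1 h2]; split; first exact/e.
by move=> h w' /h2-/(_ h)/e.
Qed.
Lemma FG_ext N (X Y : wset) : (forall w, X w <-> Y w) -> FG N X -> FG N Y.
Proof. by move=> e fX v p av Np; apply: nice_ext (fX v p av Np) => w; apply: e. Qed.
Lemma FG_F N v X : all N v -> FG N X -> FG N (Fw v X).
Proof.
move=> av fX v' p av' Np; apply: nice_ext (fX (v' ++ v) p _ Np) => [w|].
  by rewrite /Fw Eword_cat.
by rewrite all_cat av av'.
Qed.
Lemma FG_sub (N N' : pred nat) X : (forall p, N' p -> N p) -> FG N X -> FG N' X.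
Proof.
move=> s fX v p av Np; apply: fX; last exact: s.
by apply/allP=> x /(allP av) /s.
Qed.
Lemma FG_union (I : Type) N (X : I -> wset) :
  (forall i, FG N (X i)) -> FG N (fun w => exists i, X i w).
Proof.
move=> fX v p av Np w [i /(fX i v p av Np) [h1 h2]]; split; first by exists i.
by move=> h w' /(h2 h) h3; exists i.
Qed.

Lemma scan_notin p c w : p \notin w -> p.+1 \notin w -> scan p c w = w /\ cnt p c w = c.
Proof.
elim: w c => //= x w IH c; rewrite !inE !negb_or => /andP[xp pw] /andP[xp1 p1w].
rewrite [x == p]eq_sym (negPf xp) [x == p.+1]eq_sym (negPf xp1).
by case: (IH c pw p1w) => -> ->.
Qed.

(** Lowering on a column, that is, a strictly increasing word. A column has at most one letter to
    lower at [p], so this is the 0-Hecke action going down, opposite to [E p]. *)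
Definition act p c : seq nat := if (p \in c) && (p.+1 \notin c)
  then [seq if x == p then p.+1 else x | x <- c] else c.
Definition dn p c : seq nat := [seq if x == p.+1 then p else x | x <- c].
Definition actw v u := foldr act u v.

Lemma mem_up p (c : seq nat) x : p.+1 \notin c ->
  (x \in [seq if x == p then p.+1 else x | x <- c]) =
  ((x == p.+1) && (p \in c)) || ((x != p) && (x \in c)).
Proof.
move=> nc; apply/mapP/idP => [[y yc ->]|].
  case: (y =P p) yc => [->|/eqP yp] yc; first by rewrite eqxx yc.
  by rewrite yp yc orbT.
case/orP=> /andP[h1 h2]; first by exists p => //; rewrite eqxx (eqP h1).
by exists x => //; rewrite (negPf h1).
Qed.
Lemma mem_dn p (c : seq nat) x : p \notin c ->
  (x \in dn p c) = ((x == p) && (p.+1 \in c)) || ((x != p.+1) && (x \in c)).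
Proof.
move=> nc; apply/mapP/idP => [[y yc ->]|].
  case: (y =P p.+1) yc => [->|/eqP yp] yc; first by rewrite eqxx yc.
  by rewrite yp yc orbT.
case/orP=> /andP[h1 h2]; first by exists p.+1 => //; rewrite eqxx (eqP h1).
by exists x => //; rewrite (negPf h1).
Qed.
Lemma mem_act p c x : (x \in act p c) = if (p \in c) && (p.+1 \notin c)
  then (x == p.+1) || ((x != p) && (x \in c)) else x \in c.
Proof.
rewrite /act; case: ifP => // /andP[pc p1c].
by rewrite mem_up // pc andbT.
Qed.
Lemma sorted_map_inj (f : nat -> nat) c : sorted ltn c ->
  {in c &, forall x y, x < y -> f x < f y} -> sorted ltn [seq f x | x <- c].
Proof.
move=> sc h; rewrite sorted_map.
have hh : {in mem c &, subrel ltn (relpre f ltn)} by move=> x y xc yc; apply: h.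
by apply: (sub_in_sorted hh) sc; apply/allP.
Qed.
Lemma sorted_act p c : sorted ltn c -> sorted ltn (act p c).
Proof.
rewrite /act; case: ifP => // /andP[pc p1c] sc; apply: sorted_map_inj => // x y xc yc xy.
have : y != p.+1 by apply: contraNneq p1c => <-.
by case: (x =P p) => [?|/eqP ?]; case: (y =P p) => [?|/eqP ?]; lia.
Qed.
Lemma sorted_dn p c : sorted ltn c -> p \notin c -> sorted ltn (dn p c).
Proof.
move=> sc pc; apply: sorted_map_inj => // x y xc yc xy.
have : x != p by apply: contraNneq pc => <-.
by case: (x =P p.+1) => [?|/eqP ?]; case: (y =P p.+1) => [?|/eqP ?]; lia.
Qed.
Lemma sorted_actw v u : sorted ltn u -> sorted ltn (actw v u).
Proof. by move=> su; elim: v => //= p v; apply: sorted_act. Qed.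
Lemma eq_col (c c' : seq nat) : sorted ltn c -> sorted ltn c' -> c =i c' -> c = c'.
Proof. exact: (irr_sorted_eq ltn_trans ltnn). Qed.

Lemma act_idem p c : act p (act p c) = act p c.
Proof.
rewrite {1}/act !mem_act; case: ifP => //; case: ifP => [/andP[pc p1c]|->] //.
by rewrite !eqxx [p == p.+1]ltn_eqF.
Qed.
Lemma act_comm p q c : sorted ltn c -> p.+1 < q -> act p (act q c) = act q (act p c).
Proof.
move=> sc pq; apply: eq_col; rewrite ?sorted_act // => x.
have [e1 e2 e3 e4] : [/\ (p == q) = false, (p == q.+1) = false,
   (p.+1 == q) = false & (p.+1 == q.+1) = false] by split; lia.
have [f1 f2 f3 f4] : [/\ (q == p) = false, (q.+1 == p) = false,
   (q == p.+1) = false & (q.+1 == p.+1) = false] by split; lia.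
rewrite !mem_act.
case: (p \in c); case: (p.+1 \in c); case: (q \in c); case: (q.+1 \in c);
  rewrite /= ?e1 ?e2 ?e3 ?e4 ?f1 ?f2 ?f3 ?f4 ?eqxx //=.
all: case: (x =P p) => [?|?]; case: (x =P p.+1) => [?|?];
  case: (x =P q) => [?|?]; case: (x =P q.+1) => [?|?] => //=; lia.
Qed.
Lemma act_braid p c : sorted ltn c ->
  act p (act p.+1 (act p c)) = act p.+1 (act p (act p.+1 c)).
Proof.
move=> sc; apply: eq_col; rewrite ?sorted_act // => x.
have [e1 e2 e3] : [/\ (p == p.+1) = false, (p == p.+2) = false & (p.+1 == p.+2) = false] by split; lia.
have [f1 f2 f3] : [/\ (p.+1 == p) = false, (p.+2 == p) = false & (p.+2 == p.+1) = false] by split; lia.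
rewrite !mem_act.
case: (p \in c); case: (p.+1 \in c); case: (p.+2 \in c);
  rewrite /= ?e1 ?e2 ?e3 ?f1 ?f2 ?f3 ?eqxx //=.
all: rewrite ?e1 ?e2 ?e3 ?f1 ?f2 ?f3 ?eqxx /=.
all: case: (x =P p) => [?|?]; case: (x =P p.+1) => [?|?];
  case: (x =P p.+2) => [?|?] => //=; lia.
Qed.
Lemma actw_heq u v c : sorted ltn c -> heq u v -> actw u c = actw v c.
Proof.
move=> sc h; elim: h => {u v} [u a b v r|//|//|u v w _ -> _ ->] //.
rewrite /actw !foldr_cat; congr (foldr act _ u).
have := sorted_actw v sc; rewrite /actw; move: (foldr act c v) => d sd.
by case: r => [i|i j ij|i] /=; [exact: act_idem|exact: act_comm|exact: act_braid].
Qed.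

Lemma eqSn k : (k.+1 == k) = false. Proof. exact: gtn_eqF. Qed.
Lemma eqnS k : (k == k.+1) = false. Proof. exact: ltn_eqF. Qed.
Lemma eqSSn k : (k.+2 == k) = false. Proof. by rewrite gtn_eqF. Qed.
Lemma eqnSS k : (k == k.+2) = false. Proof. by rewrite ltn_eqF. Qed.
Definition neqS := (eqSn, eqnS, eqSSn, eqnSS).

(** Exchange condition on the orbit of a dominant column: a column with [i.+1] but not [i] must have
    been lowered at [i], so [i] can be brought to the front of [v]. Strong induction on the size. A
    first letter equal to [i] or far from it is immediate; a neighbour [j] acts trivially, and
    exchanging first at [i], then at [j], produces one side of the braid relation. *)
Lemma exchange (u : seq nat) i v : sorted ltn u ->
  (i.+1 \in u -> i \in u) -> (forall j, j \in v -> j.+1 \in u -> j \in u) ->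
  i \notin actw v u -> i.+1 \in actw v u ->
  exists v1, [/\ heq v (i :: v1), Low v v1, size v1 < size v,
     actw v1 u = dn i (actw v u)
     & (i \in actw v1 u) && (i.+1 \notin actw v1 u)].
Proof.
move=> su; have [n] := ubnP (size v); elim: n => // n IH in v i *.
case: v => [|j v] /=.
  by move=> _ ui _ iu i1u; rewrite (ui i1u) in iu.
rewrite ltnS => sv ui uv iA i1A.
have uv' k : k \in v -> k.+1 \in u -> k \in u by move=> kv; apply: uv; rewrite inE kv orbT.
have uj : j.+1 \in u -> j \in u by apply: uv; rewrite inE eqxx.
have sA := sorted_actw v su.
have dnA p c : sorted ltn c -> p \in c -> p.+1 \notin c -> dn p (act p c) = c.
  move=> sc pc p1c; have pa : p \notin act p c by rewrite mem_act pc p1c eqxx orbF ltn_eqF.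
  apply: eq_col => // [|x]; first by rewrite sorted_dn ?sorted_act.
  rewrite mem_dn // !mem_act pc p1c /= eqxx /= andbT.
  have [->|_] := eqVneq x p; first by rewrite pc.
  by have [->|_] := eqVneq x p.+1; rewrite ?(negPf p1c).
set A := actw v u in sA iA i1A *.
have IHi c (uc : c.+1 \in u -> c \in u) := IH v c sv uc uv'; rewrite -/A in IHi.
have eqdn p B C : sorted ltn B -> sorted ltn C -> p \notin B -> 
    (forall x, (x \in C) = ((x == p) && (p.+1 \in B)) || ((x != p.+1) && (x \in B))) -> C = dn p B.
  by move=> sB sC pB h; apply: eq_col => // [|x]; rewrite ?sorted_dn // mem_dn.
have [ji|ji] := eqVneq j i.
  subst j; move: iA i1A; rewrite !mem_act; case: ifP => [/andP[iA i1A] _ _|_ iA i1A].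
    exists v; split; rewrite -/A ?dnA ?iA ?i1A //; first exact: Hrefl.
    by exists v; [exact: subseq_cons|exact: Hrefl].
  have [v1 [h1 h2 h3 h4 /andP[h5 h6]]] := IHi i ui iA i1A.
  exists v1; split=> //; rewrite ?h5 ?h6 ?ltnS ?(ltnW h3) //.
  - apply: Htrans (heq_cons i h1) _.
    by apply: (@heq_catr [:: i; i] [:: i] v1); apply/hrel_heq/Hidem.
  - exact: Low_consr.
  - by rewrite h4 /act (negPf iA).
have [far|near] := boolP ((i.+1 < j) || (j.+1 < i)).
  have hc : heq [:: j; i] [:: i; j].
    by case/orP: far => h; [apply/Hsym|]; apply/hrel_heq/Hcomm.
  have [n1 n2 n3 n4] : [/\ (i == j) = false, (i == j.+1) = false,
    (i.+1 == j) = false & (i.+1 == j.+1) = false] by clear -far; split; lia.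
  move: iA i1A; rewrite !mem_act !n1 !n2 !n3 !n4 /= !if_same => iA i1A.
  have [v1 [h1 h2 h3 h4 /andP[h5 h6]]] := IHi i ui iA i1A.
  exists (j :: v1); split=> //=.
  - apply: Htrans (heq_cons j h1) _; exact: (@heq_catr [:: j; i] [:: i; j] v1).
  - exact: Low_cons.
  - have sv1 := sorted_actw v1 su.
    apply: eqdn; rewrite ?sorted_act //.
      by rewrite mem_act n1 n2 /= if_same.
    have [m1 m2 m3 m4] : [/\ (j == i) = false, (j == i.+1) = false,
      (j.+1 == i) = false & (j.+1 == i.+1) = false] by clear -far; split; lia.
    move=> x; rewrite !mem_act h4 !mem_dn // ?(n1, n2, n3, n4, m1, m2, m3, m4) /=.
    case: ifP => _ //.
    have [->|x1] := eqVneq x i; first by rewrite ?(n1, n2, i1A).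
    have [->|x2] := eqVneq x i.+1; first by rewrite ?(n3, n4).
    by rewrite /= ?andbT.
  - by rewrite !mem_act !n1 !n2 !n3 !n4 /= !if_same h5 h6.
have brd k m s : (k == m.+1) || (m == k.+1) -> heq [:: k, m, k & s] [:: m, k, m & s].
  by case/orP=> /eqP->; [apply/Hsym|]; apply: (@heq_catr [:: _;_;_] [::_;_;_]);
     apply/hrel_heq/Hbraid.
have adj : (j == i.+1) || (i == j.+1) by clear -near ji; lia.
(* A genuine move at the neighbour [j] would remove [i.+1] or create [i], against the hypotheses on
   the final column. *)
have [iA' i1A' nadd] : [/\ i \notin A, i.+1 \in A & (j \in A) && (j.+1 \notin A) = false].
  case/orP: adj => /eqP e; subst; move: iA i1A; rewrite !mem_act; case: ifP => //.
    by rewrite eqxx !neqS.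
  by rewrite eqxx.
have nj : act j A = A by rewrite /act nadd.
have [v1 [h1 h2 h3 h4 /andP[h5 h6]]] := IHi i ui iA' i1A'.
have sv1 := sorted_actw v1 su.
have [jv1 j1v1] : j \notin actw v1 u /\ j.+1 \in actw v1 u.
  rewrite h4 !mem_dn //; case/orP: adj => /eqP e; subst; move: nadd.
    by rewrite i1A' !neqS /= eqxx /= => /negbFE ->.
  by rewrite (negPf iA') andbT eqxx i1A' => ->; rewrite !neqS.
have v1v k : k \in v1 -> k.+1 \in u -> k \in u.
  move=> kv1; apply: uv'; have := Low_all (N := mem v) h2; rewrite /= => /(_ _)/allP h.
  by apply: h => //; apply/allP.
have [v2 [g1 g2 g3 g4 /andP[g5 g6]]] := IH v1 j (ltn_trans h3 sv) uj v1v jv1 j1v1.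
have sv2 := sorted_actw v2 su.
have e1 : heq (j :: v) [:: j, i, j & v2].
  by apply: heq_cons; apply: Htrans h1 _; apply: heq_cons.
have [iv2 i1v2] : (i \in actw v2 u) = (i.+1 \in actw v2 u) /\
    ((j \in actw v2 u) && (j.+1 \notin actw v2 u)).
  rewrite g5 g6; split=> //; rewrite g4 !mem_dn //.
  by case/orP: adj => /eqP e; subst; rewrite ?neqS ?eqxx /= ?j1v1 ?h5 ?(negPf h6) ?andbF ?orbF.
have ai : act i (actw v2 u) = actw v2 u.
  by rewrite /act iv2; case: (i.+1 \in _).
exists [:: j, i & v2]; split.
- by apply: Htrans e1 _; apply: brd.
- apply: Low_trans (Low_heq e1) _; exists [:: j, i & v2]; last exact: Hrefl.
  by rewrite /= !eqxx /=; apply: subseq_cons.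
- by rewrite /= ltnS; apply: leq_trans h3; rewrite ltnS.
- rewrite /= ai -/A nj -h4; apply: eq_col; rewrite ?sorted_act // => x.
  rewrite mem_act i1v2 g4 mem_dn //.
  have [->|_] := eqVneq x j; first by rewrite (negPf jv1) ltn_eqF.
  by have [->|_] := eqVneq x j.+1; rewrite ?j1v1.
- rewrite /= ai; have -> : act j (actw v2 u) = actw v1 u; last by rewrite h5 h6.
  apply: eq_col; rewrite ?sorted_act // => x.
  rewrite mem_act i1v2 g4 mem_dn //.
  have [->|_] := eqVneq x j; first by rewrite (negPf jv1) ltn_eqF.
  by have [->|_] := eqVneq x j.+1; rewrite ?j1v1.
Qed.
End FilteredSets.

(** * Prefixing a dominant column: Joseph's theorem for columns *)

Module Columns.
From mathcomp Require Import all_boot zify.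
Import Scan FilteredSets.

Lemma dn_id p (c : seq nat) : p.+1 \notin c -> dn p c = c.
Proof.
move=> h; rewrite /dn map_id_in // => x xc; case: eqP => // e.
by rewrite e in xc; rewrite xc in h.
Qed.

Lemma col_scan (p : nat) d (c : seq nat) : sorted ltn c ->
  scan p d c = (if [&& p.+1 \in c, p \notin c & d == 0] then dn p c else c) /\
  cnt p d c = (if p \in c then if p.+1 \in c then d else d.+1
               else if p.+1 \in c then d.-1 else d).
Proof.
elim: c d => //= x c IH d xc.
have sc : sorted ltn c := path_sorted xc.
have /allP gx : all (ltn x) c := order_path_min ltn_trans xc.
have ngx y : y <= x -> y \notin c by move=> h; apply/negP => /gx /=; lia.
rewrite !inE; have [e|xp] := eqVneq x p.
  rewrite e eqSn eqnS /= andbF; have np : p \notin c by apply: ngx; rewrite e.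
  by case: (IH d.+1 sc) => -> ->; rewrite np (negPf np) /= andbF; case: (p.+1 \in c).
rewrite /=; have [e|xp1] := eqVneq x p.+1.
  rewrite e /=.
  have n1 : p \notin c by apply: ngx; rewrite e.
  have n2 : p.+1 \notin c by apply: ngx; rewrite e.
  rewrite (negPf n1); case: d => [|d].
    by case: (IH 0 sc) => -> ->; rewrite (negPf n1) (negPf n2) /= dn_id.
  by case: (IH d sc) => -> ->; rewrite (negPf n1) (negPf n2).
rewrite /=; case: (IH d sc) => -> ->.
by case: ifP; rewrite /dn /= ?(negPf xp1).
Qed.

(** A column contains at most one [p], so at most one letter of [A] can have been raised. *)
Lemma col_preim (p : nat) d (c A : seq nat) : sorted ltn c -> scan p d A = c ->
  A = c \/ [/\ d = 0, p \in c, p.+1 \notin c & A = act p c].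
Proof.
elim: A d c => [|y A IH] d c sc /=; first by left.
case: (y =P p) => [->|yp].
  case: c sc => // x c sc [<-] /(IH _ _ (path_sorted sc)) [->|[]//]; by left.
case: (y =P p.+1) => [->|yp1].
  case: d => [|d].
    case: c sc => // x c /= sc [e h]; subst x.
    have /allP gx : all (ltn p) c := order_path_min ltn_trans sc.
    have np : p \notin c by apply/negP => /gx /=; rewrite ltnn.
    case: (IH _ _ (path_sorted sc) h) => [e|[_ pc]]; last by rewrite pc in np.
    subst A; have np1 : p.+1 \notin c.
      apply/negP => p1; case: (col_scan p 0 (path_sorted sc)) => + _.
      rewrite h p1 np /= => /(congr1 (fun s => p.+1 \in s)).
      by rewrite mem_dn // eqSn eqxx p1.
    right; rewrite /act !inE !eqxx eqSn /= np1 eqxx; split=> //; congr cons.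
    by rewrite map_id_in // => z zc; case: eqP => // ez; rewrite -ez zc in np.
  case: c sc => // x c /= sc [ex h]; subst x.
  have /allP gx : all (ltn p.+1) c := order_path_min ltn_trans sc.
  case: (IH _ _ (path_sorted sc) h) => [->|[_ /gx /= + _ _]]; first by left.
  by lia.
case: c sc => // x c /= sc [e h]; subst y.
case: (IH _ _ (path_sorted sc) h) => [->|[-> pc p1c ->]]; first by left.
right; rewrite /act !inE [p == x]eq_sym [p.+1 == x]eq_sym.
by rewrite (introF eqP yp) (introF eqP yp1) pc p1c /= (introF eqP yp).
Qed.

(** One more open bracket rescues the first unmatched [p.+1]; if it changes nothing, there is
    none. *)
Lemma scan1_eq p c x : scan p c.+1 x = scan p c x -> scan p c x = x.
Proof.
elim: x c => //= y x IH c; case: (y =P p) => [->|yp].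
  by case=> /IH ->.
case: (y =P p.+1) => [->|yp1]; last by case=> /IH ->.
case: c => [|c]; first by case=> e; lia.
by case=> /IH ->.
Qed.

Section Joseph.
Variables (N : pred nat) (X : wset) (u : seq nat).
Hypotheses (su : sorted ltn u) (hu : forall p, N p -> p.+1 \in u -> p \in u).
Hypothesis (fX : FG N X).

(* The Demazure closure of u ++ X: over the column v.u sits F_v X. *)
Definition Zset w : wset := fun y =>
  exists v x, [/\ Low w v, y = actw v u ++ x & Fw v X x].

Lemma exch w v p : all N w -> N p -> Low w v -> p \notin actw v u -> p.+1 \in actw v u ->
  exists v1, [/\ heq v (p :: v1), Low w v1 & actw v1 u = dn p (actw v u)].
Proof.
move=> Nw Np wv h1 h2; have Nv := Low_all wv Nw.
have [|v1 [? ? _ ? _]] := exchange su (hu Np) _ h1 h2.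
  by move=> j /(allP Nv); apply: hu.
by exists v1; split=> //; apply: Low_trans wv _.
Qed.

Lemma col_split (p : nat) (c y x : seq nat) :  sorted ltn c -> E p y = c ++ x ->
  exists A x', [/\ y = A ++ x', scan p 0 A = c & scan p (cnt p 0 A) x' = x].
Proof.
move=> sc e; exists (take (size c) y), (drop (size c) y); rewrite cat_take_drop.
have := e; rewrite -{1}[y](cat_take_drop (size c)) /E scan_cat.
have sz : size (scan p 0 (take (size c) y)) = size c.
  rewrite size_scan size_take; case: ltnP => // h.
  have := congr1 size e; rewrite /E size_scan size_cat => e'.
  by apply/eqP; rewrite eqn_leq h e' leq_addr.
by move/eqP; rewrite eqseq_cat // => /andP[/eqP -> /eqP ->].
Qed.

(** A column at a node has one of three signatures: an opening bracket here, a closing one in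
    [remE], none in [neuE]. All arguments below split accordingly. *)
Lemma addE p c : sorted ltn c -> p \in c -> p.+1 \notin c ->
  [/\ scan p 0 c = c, cnt p 0 c = 1, scan p 0 (act p c) = c & cnt p 0 (act p c) = 0].
Proof.
move=> sc pc p1c; case: (col_scan p 0 sc) => -> ->; rewrite pc (negPf p1c) /=.
case: (col_scan p 0 (sorted_act p sc)) => -> ->.
rewrite !mem_act pc p1c /= !eqxx eqnS /=; split=> //.
apply: eq_col => // [|x].
  by rewrite sorted_dn ?sorted_act // mem_act pc p1c /= eqxx eqnS.
rewrite mem_dn !mem_act pc p1c /= eqxx ?eqnS //=.
have [->|_] := eqVneq x p; first by rewrite pc.
by have [->|_] := eqVneq x p.+1; rewrite ?(negPf p1c).
Qed.

Lemma remE p c : sorted ltn c -> p \notin c -> p.+1 \in c ->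
  [/\ scan p 0 c = dn p c, cnt p 0 c = 0, p \in dn p c, p.+1 \notin dn p c & act p (dn p c) = c].
Proof.
move=> sc pc p1c; case: (col_scan p 0 sc) => -> ->; rewrite (negPf pc) p1c /=.
have h1 : p \in dn p c by rewrite mem_dn // eqxx p1c.
have h2 : p.+1 \notin dn p c by rewrite mem_dn // eqSn eqxx.
split=> //; apply: eq_col => // [|x]; first by rewrite sorted_act ?sorted_dn.
rewrite mem_act h1 h2 mem_dn //=.
have [->|_] := eqVneq x p; first by rewrite (negPf pc) eqnS.
by have [->|_] := eqVneq x p.+1; rewrite ?p1c.
Qed.

Lemma neuE p c : sorted ltn c -> (p \in c) = (p.+1 \in c) ->
  [/\ scan p 0 c = c, cnt p 0 c = 0 & act p c = c].
Proof.
move=> sc e; case: (col_scan p 0 sc) => -> ->; rewrite /act e.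
by case: (p.+1 \in c).
Qed.

Lemma col_case p (c : seq nat) : [\/ (p \in c) /\ (p.+1 \notin c),
  (p \notin c) /\ (p.+1 \in c) | (p \in c) = (p.+1 \in c)].
Proof.
case: (p \in c); case: (p.+1 \in c); by [constructor 1|constructor 2|constructor 3].
Qed.

(** By the signature of the column. With an opening bracket the string of [A ++ x] is that of [x]
    without its last raising, and the string property of [Fw v X] suffices. With a closing bracket
    [exch] gives [v = p v1], so the raised column carries [Fw v1 X] and the two columns together
    contain the whole string. A neutral column is transparent. *)
Lemma nice_Z w (p : nat) : all N w -> N p -> nice p (Zset w).
Proof.
move=> Nw Np y [v [x [wv -> Xx]]]; have sA := sorted_actw v su.
have Nv := Low_all wv Nw; have nY := fX Nv Np.
set A := actw v u in sA *.
case: (col_case p A) => [[pA p1A]|[pA p1A]|eA].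
- have [e1 e2 e3 e4] := addE sA pA p1A.
  have EE : E p (A ++ x) = A ++ scan p 1 x by rewrite /E scan_cat e1 e2.
  have [n1 n2] := nY _ Xx; rewrite EE.
  have E1 : E p x = x -> scan p 1 x = x by move=> h; rewrite -{1}h scan_ge.
  have E2 z : E p (scan p 1 z) = E p z by rewrite /E scan_le.
  split.
    exists v, (scan p 1 x); split=> //; case: (E p x =P x) => [/E1->|h] //.
    exact: n2.
  move=> ne w' ew'; have nx : E p x <> x by move=> /E1 h; apply: ne; rewrite h.
  have [B [x' [-> h1 h2]]] := col_split sA ew'.
  case: (col_preim sA h1) => [e|[_ _ _ e]]; subst B.
    exists v, x'; split=> //; apply: (n2 nx).
    by rewrite -E2 -[in RHS]E2 -h2 e2.
  rewrite e4 in h2; case: nx; have := @scan1_eq p 0 x; apply; rewrite -h2.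
  by rewrite -[RHS]E2 -h2 E_idem.
- have [e1 e2 e3 e4 e5] := remE sA pA p1A.
  have [v1 [hv wv1 ev1]] := exch Nw Np wv pA p1A; rewrite -/A in ev1.
  have EE : E p (A ++ x) = dn p A ++ E p x by rewrite /E scan_cat e1 e2.
  have sB : sorted ltn (dn p A) by rewrite sorted_dn.
  have [f1 f2 f3 f4] := addE sB e3 e4.
  have Fv z : Fw v X z <-> Fw v1 X (E p z) by rewrite /Fw (Eword_heq _ hv).
  rewrite EE; split; first by exists v1, (E p x); split; rewrite ?ev1 //; apply/Fv.
  move=> _ w' ew'; have [B [x' [-> h1 h2]]] := col_split sB ew'.
  case: (col_preim sB h1) => [e|[_ _ _ e]]; subst B.
    rewrite f2 in h2.
    have ex : E p x' = E p x by rewrite -[RHS]E_idem -h2 /E scan_le.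
    have := @scan1_eq p 0 x'; rewrite h2 -/(E p x') ex => /(_ erefl) e.
    exists v1, x'; split; rewrite ?ev1 // -e; exact/Fv.
  exists v, x'; split=> //; rewrite ?e5 //; apply/Fv.
  by move: h2; rewrite e5 e2 /E => ->; apply/Fv.
- have [e1 e2 _] := neuE sA eA.
  have EE : E p (A ++ x) = A ++ E p x by rewrite /E scan_cat e1 e2.
  have [n1 n2] := nY _ Xx; rewrite EE; split; first by exists v, (E p x).
  move=> ne w' ew'; have nx : E p x <> x by move=> h; apply: ne; rewrite h.
  have [B [x' [-> h1 h2]]] := col_split sA ew'.
  case: (col_preim sA h1) => [e|[_ h3 h4]]; last by rewrite -eA h3 in h4.
  by subst B; exists v, x'; split=> //; apply: (n2 nx); rewrite -h2 e2.
Qed.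

(** What lies below [p :: w] in Bruhat order is what lies below [w], together with its products by
    [p]; for each signature these products account for the words that [E p] sends into [Zset w]. *)
Lemma Z_step w (p : nat) y : all N w -> N p -> Zset (p :: w) y <-> Zset w (E p y).
Proof.
move=> Nw Np; split.
  move=> [v [x [[v' + vv'] ey Xx]]] /=; case: v' vv' => [|q v'] vv' /=.
    move=> _; have : Zset w y by exists v, x; split=> //; exists [::] => //; exact: sub0seq.
    by case/(nice_Z Nw Np).
  case: (q =P p) => [eq|_] sub; last first.
    have : Zset w y by exists v, x; split=> //; exists (q :: v').
    by case/(nice_Z Nw Np).
  subst q; have wv' : Low w v' by exists v' => //; exact: Hrefl.
  have sA := sorted_actw v' su.
  have eA : actw v u = act p (actw v' u) by rewrite -(actw_heq su vv').
  have Xx' : Fw v' X (E p x) by move: Xx; rewrite /Fw -(Eword_heq _ vv').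
  rewrite ey eA; case: (col_case p (actw v' u)) => [[pA p1A]|[pA p1A]|e].
  - have [e1 e2 e3 e4] := addE sA pA p1A.
    by exists v', (E p x); rewrite /E scan_cat e3 e4.
  - have [e1 e2 e3 e4 e5] := remE sA pA p1A.
    have [v1 [hv wv1 ev1]] := exch Nw Np wv' pA p1A.
    exists v1, (E p x); rewrite ev1 /act (negPf pA) /= /E scan_cat e1 e2; split=> //.
    by move: Xx'; rewrite /Fw (Eword_heq _ hv) /= E_idem.
  - have [e1 e2 e3] := neuE sA e.
    by exists v', (E p x); rewrite e3 /E scan_cat e1 e2.
move=> [v [x [wv ey Xx]]]; have sA := sorted_actw v su.
have Nv := Low_all wv Nw; have nY := fX Nv Np.
have [B [x' [-> h1 h2]]] := col_split sA ey.
case: (col_preim sA h1) => [e|[_ pA p1A e]]; subst B; last first.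
  have [e1 e2 e3 e4] := addE sA pA p1A; rewrite e4 in h2.
  exists (p :: v), x'; split=> //; first exact: Low_cons.
  by rewrite /Fw /= [E p x']h2.
case: (col_case p (actw v u)) => [[pA p1A]|[pA p1A]|e].
- have [e1 e2 e3 e4] := addE sA pA p1A; rewrite e2 in h2.
  exists v, x'; split=> //; first exact: Low_consr.
  have ex : E p x' = E p x by rewrite -h2 /E scan_le.
  case: (E p x =P x) => [e|ne]; last by case: (nY _ Xx) => _ /(_ ne); apply.
  have := @scan1_eq p 0 x'; rewrite h2 -/(E p x') ex e => /(_ erefl) <- //.
- have [e1 _ e3 e4 _] := remE sA pA p1A.
  by move: h1 pA; rewrite e1 => <-; rewrite e3.
- have [e1 e2 e3] := neuE sA e; rewrite e2 in h2.
  exists (p :: v), x'; rewrite /= e3; split=> //; first exact: Low_cons.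
  by rewrite /Fw /= [E p x']h2.
Qed.

Lemma Z_F w y : all N w -> Fw w (pre u X) y <-> Zset w y.
Proof.
elim: w y => [|p w IH] y /=.
  rewrite /Fw /=; move=> _; split=> [[x -> Xx]|[v [x [[v' /eqP]]]]].
    by exists [::], x; split=> //; exists [::] => //; exact: Hrefl.
  move=> -> hv -> Xx; exists x.
    by rewrite -(actw_heq su hv).
  by move: Xx; rewrite /Fw -(Eword_heq _ hv).
by case/andP=> Np Nw; rewrite Z_step // -IH.
Qed.

(** By [Z_F] the preimages of [pre u X] are the sets [Zset w], so [nice_Z] is the whole claim. *)
Theorem FG_col : FG N (pre u X).
Proof.
move=> v p Nv Np; apply: nice_ext (nice_Z Nv Np) => y.
by rewrite Z_F.
Qed.
End Joseph.
End Columns.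

(** * Knuth moves commute with the raising operators *)

Module KnuthMoves.
From mathcomp Require Import all_boot zify.
Import Scan FilteredSets Columns.

(* The Knuth move on a triple, in the convention in which columns are read
   increasingly and rows decreasingly: y x z <-> y z x for x <= y < z and
   z x y <-> x z y for x < y <= z. *)
Definition th (a b c : nat) : seq nat :=
  if (b <= a < c) || (c <= a < b) then [:: a; c; b]
  else if (b < c <= a) || (a < c <= b) then [:: b; a; c] else [:: a; b; c].
Definition th3 s := if s is [:: a; b; c] then th a b c else s.

(** Each letter is classified as [p], [p.+1], smaller or larger, and [fs] records all its
    comparisons with [p] and [p.+1]. The rest is a case check over triples of classes and small
    counters. *)
Lemma th_scan (p : nat) d a b c : scan p d (th a b c) = th3 (scan p d [:: a; b; c]) /\
  cnt p d (th a b c) = cnt p d [:: a; b; c].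
Proof.
pose fs (x : nat) (e0 e1 l : bool) := (((x == p) = e0) * ((x == p.+1) = e1) *
   ((x <= p) = l) * ((x < p) = l && ~~ e0) * ((x <= p.+1) = l || e1) * ((x < p.+1) = l) *
   ((p <= x) = ~~ l || e0) * ((p < x) = ~~ l) * ((p.+1 < x) = ~~ l && ~~ e1))%type.
have cs x : [\/ x = p, x = p.+1, fs x false false true | fs x false false false].
  case: (ltngtP x p) => h; [constructor 3|case: (ltngtP x p.+1) => h'|by constructor 1].
  - by do !split; lia.
  - lia.
  - by constructor 4; do !split; lia.
  - by constructor 2.
have fp : fs p true false true by do !split; lia.
have fp1 : fs p.+1 false true false by do !split; lia.
rewrite /th.
case: (cs a) => [->|->|fa|fa]; case: (cs b) => [->|->|fb|fb];
case: (cs c) => [->|->|fc|fc];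
rewrite /fs in fp fp1 *; try rewrite /fs in fa; try rewrite /fs in fb; try rewrite /fs in fc.
all: do 6 ?(rewrite /= ?fp ?fp1 /th; try rewrite ?fa; try rewrite ?fb; try rewrite ?fc).
all: try by [].
all: try by case: d => [|[|[|d]]] /=; do 3 ?(rewrite /= ?fp ?fp1 /th; try rewrite ?fa; try rewrite ?fb; try rewrite ?fc).
all: try by do ?[case: ifP => ?]; do 3 ?(rewrite /= ?fp ?fp1; try rewrite ?fa; try rewrite ?fb; try rewrite ?fc).
all: case: d => [|d]; do 3 ?(rewrite /= ?fp ?fp1 /th ?andbT ?andbF ?orbF ?orbT; try rewrite ?fa; try rewrite ?fb; try rewrite ?fc);
  do ?[case: ifP => ?]; do 3 ?(rewrite /= ?fp ?fp1; try rewrite ?fa; try rewrite ?fb; try rewrite ?fc).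
all: by [|clear -h; lia|exfalso; clear fs cs fp fp1; lia].
Qed.

Lemma thK a b c : th3 (th a b c) = [:: a; b; c].
Proof.
rewrite /th; do ?[case: ifP => ? //=]; rewrite /th; do ?[case: ifP => ? //=]; lia.
Qed.
Lemma size_th a b c : size (th a b c) = 3.
Proof. by rewrite /th; do ?case: ifP. Qed.

Fixpoint Theta k (w : seq nat) := if k is k'.+1 then
    if w is x :: w' then x :: Theta k' w' else w
  else if w is a :: b :: c :: w' then th a b c ++ w' else w.

Lemma Theta_short w : size w < 3 -> Theta 0 w = w.
Proof. by case: w => [|a [|b [|c w]]]. Qed.
Lemma Theta_scan k (p : nat) d w : scan p d (Theta k w) = Theta k (scan p d w).
Proof.
elim: k d w => [|k IH] d w.
  have [h|] := ltnP (size w) 3; first by rewrite !Theta_short ?size_scan.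
  case: w => [|a [|b [|c w]]] // _; rewrite [Theta 0 _]/=.
  rewrite scan_cat; case: (th_scan p d a b c) => -> ->.
  have -> : scan p d [:: a, b, c & w] = scan p d [:: a; b; c] ++ scan p (cnt p d [:: a; b; c]) w.
    by rewrite -scan_cat.
  by have := size_scan p d [:: a; b; c]; case: (scan p d _) => [|x [|y [|z []]]].
case: w => //= a w; do 2 (case: ifP => /= _; rewrite ?IH //).
by case: d => //= d; rewrite IH.
Qed.

Lemma ThetaK k : involutive (Theta k).
Proof.
elim: k => [|k IH] [|a w] //=; last by rewrite IH.
case: w => [|b [|c w]] //=; have := thK a b c; have := size_th a b c.
by case: (th a b c) => [|x [|y [|z []]]] //= _ ->.
Qed.
Lemma Theta_E k p w : Theta k (E p w) = E p (Theta k w).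
Proof. by rewrite /E Theta_scan. Qed.
Lemma Theta_Ew k v w : Theta k (Eword v w) = Eword v (Theta k w).
Proof. by elim: v w => //= p v IH w; rewrite IH Theta_E. Qed.

Lemma FG_Theta N k X : FG N X -> FG N (fun w => X (Theta k w)).
Proof.
move=> fX v p Nv Np w; rewrite /Fw Theta_Ew => Xw.
have [h1 h2] := fX v p Nv Np _ Xw; split; first by rewrite Theta_Ew Theta_E.
move=> ne w' e; rewrite Theta_Ew; apply: h2.
  by rewrite -Theta_E => /(can_inj (ThetaK k)).
by rewrite -!Theta_E e.
Qed.

Inductive keq : seq nat -> seq nat -> Prop :=
| Kstep u a b c v : keq (u ++ [:: a; b; c] ++ v) (u ++ th a b c ++ v)
| Krefl w : keq w w
| Ksym v w : keq v w -> keq w v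
| Ktrans u v w : keq u v -> keq v w -> keq u w.

Lemma Theta_ctx u a b c v : Theta (size u) (u ++ [:: a; b; c] ++ v) = u ++ th a b c ++ v.
Proof. by elim: u => //= x u ->. Qed.

(** A move at a fixed position is an involution on all words that commutes with every [E p], so it
    carries strings to strings. *)
Lemma keq_pre N H H' X : keq H H' -> FG N (pre H X) <-> FG N (pre H' X).
Proof.
elim=> {H H'} [u a b c v|//|H H' _ ->//|H H' H'' _ -> _ ->//].
have e x : Theta (size u) ((u ++ [:: a; b; c] ++ v) ++ x) = (u ++ th a b c ++ v) ++ x.
  by rewrite -!catA Theta_ctx.
split=> /(@FG_Theta _ (size u)); apply: FG_ext => w; split.
- by case=> x /(congr1 (Theta (size u))); rewrite ThetaK e => -> Xx; exists x.
- by case=> x -> Xx; exists x => //; rewrite -e ThetaK.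
- by case=> x /(congr1 (Theta (size u))); rewrite ThetaK -e ThetaK => -> Xx; exists x.
- by case=> x -> Xx; exists x => //; rewrite e.
Qed.

Lemma keq_cat u a b v : keq a b -> keq (u ++ a ++ v) (u ++ b ++ v).
Proof.
elim=> {a b} [u' a b c v'|w|a b _ IH|a b c _ IH _ IH'].
- by rewrite -!catA !(catA u); apply: Kstep.
- exact: Krefl.
- exact: Ksym.
- exact: Ktrans IH IH'.
Qed.
Lemma keq_catl u a b : keq a b -> keq (u ++ a) (u ++ b).
Proof. by move/(keq_cat u [::]); rewrite !cats0. Qed.
Lemma keq_catr a b v : keq a b -> keq (a ++ v) (b ++ v).
Proof. exact: (keq_cat [::] v). Qed.
Lemma keq_scan p d a b : keq a b -> cnt p d a = cnt p d b.
Proof.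
elim=> {a b} [u a b c v|//|//|u v w _ -> _ ->//].
by rewrite !cnt_cat; case: (th_scan p (cnt p d u) a b c) => _ ->.
Qed.

Lemma iota_rcons m n : iota m n.+1 = iota m n ++ [:: m + n].
Proof. by rewrite -addn1 iotaD. Qed.

Definition Dc a q := iota a (q.+1 - a).
(** The letter travels left, first through the larger entries and then through the smaller ones; the
    copy of [r] inside the column is the witness of the Knuth moves at the turning point. *)
Lemma keq_col_letter a q r : a <= r <= q -> keq (Dc a q ++ [:: r]) (r :: Dc a q).
Proof.
move=> h.
have up s : r <= s -> keq (iota r (s.+1 - r) ++ [:: r]) (r :: iota r (s.+1 - r)).
  elim: s => [|s IH] rs.
    have -> : r = 0 by lia. exact: Krefl.
  case: (ltnP s r) => sr; first have -> : s.+2 - r = 1 by lia.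
    exact: Krefl.
  have -> : s.+2 - r = (s.+1 - r).+1 by lia.
  rewrite iota_rcons -catA /=; have -> : r + (s.+1 - r) = s.+1 by lia.
  have e : iota r (s.+1 - r) = iota r (s - r) ++ [:: s].
    have -> : s.+1 - r = (s - r).+1 by lia.
    by rewrite iota_rcons; congr (_ ++ [:: _]); lia.
  apply: (@Ktrans _ ((iota r (s.+1 - r) ++ [:: r]) ++ [:: s.+1])); last first.
    by rewrite -cat_cons; apply: keq_catr; apply: IH.
  rewrite e -!catA; apply: keq_catl => /=.
  have := Kstep [::] s s.+1 r [::]; rewrite /= /th.
  by have -> : (s.+1 <= s < r) || (r <= s < s.+1) by lia.
have eD : Dc a q = iota a (r - a) ++ iota r (q.+1 - r).
  by rewrite /Dc -{2}(subnKC (_ : a <= r)) -?iotaD; [congr iota; lia|lia].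
rewrite eD -catA; apply: Ktrans (keq_catl _ (up q _)) _; first lia.
have [m em] : exists m, iota r (q.+1 - r) = r :: m.
  by exists (iota r.+1 (q - r)); have -> : q.+1 - r = (q - r).+1 by lia.
rewrite em.
have down s : keq (iota (r - s) s ++ [:: r; r] ++ m) (r :: iota (r - s) s ++ [:: r] ++ m) \/ r < s.
  elim: s => [|s [IH|IH]]; [by left; exact: Krefl | | by right; lia].
  case: (ltnP r s.+1) => rs; [by right|left].
  have -> : iota (r - s.+1) s.+1 = (r - s.+1) :: iota (r - s) s.
    by rewrite /=; congr (_ :: iota _ _); lia.
  rewrite !cat_cons; apply: Ktrans (keq_catl [:: r - s.+1] IH) _ => /=.
  have [y [m' [e ylt]]] : exists y m', iota (r - s) s ++ [:: r] ++ m = y :: m' /\ r - s.+1 < y <= r.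
    case: s {IH} rs => [|s] rs /=; first by exists r, m; split=> //; lia.
    by exists (r - s.+1), (iota (r - s.+1).+1 s ++ r :: m); split=> //; lia.
  rewrite /= in e; rewrite e; have := Kstep [::] (r - s.+1) r y m'; rewrite /= /th.
  have -> : (r <= r - s.+1 < y) || (y <= r - s.+1 < r) = false by lia.
  by have -> : (r < y <= r - s.+1) || (r - s.+1 < y <= r) by lia.
case: (down (r - a)) => [|]; last by lia.
have -> : r - (r - a) = a by lia.
by [].
Qed.

Lemma keq_col_col a q q' : a <= q' <= q -> keq (Dc a q ++ Dc a q') (Dc a q' ++ Dc a q).
Proof.
move=> h; have : all (fun r => a <= r <= q) (Dc a q').
  by apply/allP => x; rewrite mem_iota; lia.
elim: (Dc a q') => [|r s IH] /=; first by rewrite cats0 => _; exact: Krefl.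
case/andP=> hr hs; rewrite -cat1s catA.
apply: Ktrans (keq_catr s (keq_col_letter hr)) _; rewrite cat_cons.
exact: (keq_catl [:: r] (IH hs)).
Qed.

Definition colprod a hs := flatten [seq Dc a q | q <- hs].
Lemma colprod_front a h hs1 hs2 : all (leq a) (h :: hs1) ->
  keq (colprod a (hs1 ++ h :: hs2)) (colprod a (h :: hs1 ++ hs2)).
Proof.
elim: hs1 => [|k hs1 IH] /=; first by move=> _; exact: Krefl.
case/and3P=> ah ak ahs; rewrite /colprod /=.
apply: Ktrans (keq_catl _ (IH _)) _; first by rewrite /= ah.
rewrite /colprod /= !catA; apply: keq_catr.
by case: (leqP h k) => hk; [|apply: Ksym]; apply: keq_col_col; lia.
Qed.
Lemma colprod_perm a hs hs' : all (leq a) hs -> perm_eq hs hs' ->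
  keq (colprod a hs) (colprod a hs').
Proof.
elim: hs hs' => [|h hs IH] hs'.
  by move=> _; rewrite perm_sym => /perm_nilP ->; exact: Krefl.
move=> ah p; have : h \in hs' by rewrite -(perm_mem p) inE eqxx.
move=> /splitPr e; case: e p => s1 s2 p.
have p' : perm_eq hs (s1 ++ s2).
  by rewrite -(perm_cons h); apply: perm_trans p _; rewrite perm_catC /= perm_cons perm_catC.
have a12 : all (leq a) (h :: s1 ++ s2) by rewrite /= -(perm_all _ p').
apply: Ktrans (Ksym (colprod_front _ _)); last first.
  by move: a12; rewrite /= all_cat => /and3P[-> ->].
by apply: (keq_catl (Dc a h)); apply: IH => //; case/andP: ah.
Qed.
End KnuthMoves.

(** * Comparison of highest weight prefixes *)

Module Dominance.
From mathcomp Require Import all_boot zify.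
Import Scan FilteredSets Columns KnuthMoves.

Lemma scan_take_drop k p c (w : seq nat) : 
  take k (scan p c w) = scan p c (take k w) /\
  drop k (scan p c w) = scan p (cnt p c (take k w)) (drop k w).
Proof.
elim: k c w => [|k IH] c [|x w] //=; first by rewrite take0 drop0.
case: ifP => _ /=; first by case: (IH c.+1 w) => -> ->.
case: ifP => _ /=; last by case: (IH c w) => -> ->.
by case: c => [|c] /=; [case: (IH 0 w) | case: (IH c w)] => -> ->.
Qed.

Definition ins (k q : nat) (w : seq nat) := take k w ++ q :: drop k w.

Lemma scan_ins k q p c (w : seq nat) : q != p -> q != p.+1 ->
  scan p c (ins k q w) = ins k q (scan p c w).
Proof.
move=> q1 q2; rewrite /ins scan_cat /= (negPf q1) (negPf q2).
by case: (scan_take_drop k p c w) => -> ->.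
Qed.

Lemma ins_inj k q (w w' : seq nat) : ins k q w = ins k q w' -> size w = size w' -> w = w'.
Proof.
move=> e s; rewrite -[w](cat_take_drop k) -[w'](cat_take_drop k).
have := e; rewrite /ins => /eqP; rewrite eqseq_cat ?size_take ?s //.
by case/andP=> /eqP -> /eqP [->].
Qed.

Lemma scan_ins_inv (k q p c : nat) (w w' : seq nat) : q != p -> q != p.+1 -> k <= size w ->
  scan p c w' = ins k q w -> exists2 w'', w' = ins k q w'' & scan p c w'' = w.
Proof.
move=> q1 q2 kw e; have sw : size w' = (size w).+1.
  have := congr1 size e; rewrite size_scan /ins size_cat size_take /= size_drop; case: ltnP => h; lia.
have := congr1 (drop k) e; case: (scan_take_drop k p c w') => e1 ->.
have sk : size (take k w) = k by rewrite size_takel.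
have e3 : drop k (ins k q w) = q :: drop k w by rewrite /ins drop_size_cat.
rewrite e3; case ed : (drop k w') => [|y z] // h.
have yq : y = q.
  move: h => /=; case: eqP => [->|_]; first by case=> h; rewrite h eqxx in q1.
  case: eqP => [->|_]; last by case.
  by case: (cnt _ _ _) => [|?] [h _]; [rewrite h eqxx in q1|rewrite h eqxx in q2].
subst y; have ew' : w' = ins k q (take k w' ++ z).
  rewrite /ins take_size_cat ?drop_size_cat ?size_takel ?sw //; try lia.
  by rewrite -ed cat_take_drop.
exists (take k w' ++ z) => //; apply: (@ins_inj k q); first by rewrite -scan_ins // -ew'.
rewrite size_scan size_cat size_takel; last by rewrite sw ltnW.
by have := congr1 size ed; rewrite size_drop /=; lia.
Qed.

Section Ins.
Variables (k q : nat) (N : pred nat).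
Hypothesis hq : forall p, N p -> (q != p) && (q != p.+1).
Definition insS (X : wset) : wset := fun w => exists2 x, X x & w = ins k q x.
Definition longS (X : wset) := forall x, X x -> k <= size x.

Lemma size_Eword v w : size (Eword v w) = size w.
Proof. by elim: v w => //= p v IH w; rewrite IH size_scan. Qed.
Lemma Eword_ins v w : all N v -> Eword v (ins k q w) = ins k q (Eword v w).
Proof.
elim: v w => //= p v IH w /andP[/hq/andP[q1 q2] av].
by rewrite /E scan_ins // IH.
Qed.
Lemma Eword_ins_inv v w w' : all N v -> k <= size w -> Eword v w' = ins k q w ->
  exists2 w'', w' = ins k q w'' & Eword v w'' = w.
Proof.
elim: v w' => [|p v IH] w' /=; first by exists w.
move=> /andP[/hq/andP[q1 q2] av] kw /(IH _ av kw) [w1 e1 e2].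
have [|w2 e3 e4] := scan_ins_inv q1 q2 _ e1; first by rewrite -(size_Eword v) e2.
by exists w2 => //; rewrite /E e4.
Qed.
Lemma Fw_ins v X : all N v -> longS X -> forall w, insS (Fw v X) w <-> Fw v (insS X) w.
Proof.
move=> av lX w; split=> [[x Xx ->]|[x Xx e]].
  by exists (Eword v x) => //; rewrite Eword_ins.
have [w'' -> e'] := Eword_ins_inv av (lX _ Xx) e.
by exists w'' => //; rewrite /Fw e'.
Qed.
Lemma nice_ins p X : N p -> longS X -> nice p (insS X) <-> nice p X.
Proof.
move=> /hq/andP[q1 q2] lX; split=> nX.
  move=> w Xw; have [|[x Xx e] h] := nX (ins k q w); first by exists w.
  have ex : x = E p w.
    rewrite /E scan_ins // in e; have := congr1 size e.
    move/esym: e => e s; apply: (ins_inj e); move: s.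
    rewrite !size_cat /=  !size_takel ?size_drop ?size_scan ?lX // => s.
    by move/addnI: s => [s]; rewrite -(subnK (lX _ Xw)) -(subnK (lX _ Xx)) s.
  split; first by rewrite -ex.
  move=> ne w' e'; have s' : size w' = size w by rewrite -(size_scan p 0) [scan _ _ _]e' size_scan.
  have [||y Xy ey] := h _ (ins k q w').
  - rewrite /E scan_ins // => /ins_inj; rewrite size_scan => /(_ erefl); exact: ne.
  - by rewrite /E !scan_ins // [scan p 0 w']e'.
  - have := congr1 size ey; rewrite !size_cat /= !size_takel ?size_drop ?s' ?lX // => s.
    rewrite (ins_inj ey) // s'; move/addnI: s => [s].
    by rewrite -(subnK (lX _ Xw)) -(subnK (lX _ Xy)) s.
move=> w [x Xx ->]; have [h1 h2] := nX _ Xx; split.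
  by exists (E p x) => //; rewrite /E scan_ins.
rewrite /E scan_ins // => ne w' e.
have [|w1 -> e2] := scan_ins_inv q1 q2 _ e; first by rewrite size_scan lX.
exists w1 => //; apply: h2 => // h; apply: ne; congr ins; exact: h.
Qed.
(** A letter on which no node of [N] acts never interferes with the bracketing; [longS] guarantees
    that its position exists in all words of the set. *)
Lemma FG_ins X : longS X -> FG N (insS X) <-> FG N X.
Proof.
move=> lX; split=> f v p av Np.
  have := f v p av Np; move/(nice_ext (fun w => iff_sym (Fw_ins av lX w))).
  by rewrite nice_ins // => x /lX; rewrite size_Eword.
apply: (nice_ext (Fw_ins av lX)); rewrite nice_ins //; first exact: f.
by move=> x /lX; rewrite size_Eword.
Qed.
End Ins.

Lemma FG_pre_del (N : pred nat) (G : seq nat) (D : pred nat) Y :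
  (forall q p : nat, ~~ D q -> N p -> (q != p) && (q != p.+1)) ->
  FG N (pre G Y) <-> FG N (pre (filter D G) Y).
Proof.
move=> hD; rewrite -[G in pre G](cat0s) -[filter D G]cat0s.
elim: G [::] => [|q G IH] G0; first by rewrite /=.
case Dq: (D q); rewrite /= Dq; first by rewrite -!cat_rcons.
have H1 p : N p -> (q != p) && (q != p.+1) by apply: hD; rewrite Dq.
have H2 : longS (size G0) (pre (G0 ++ G) Y).
  by move=> x [z -> _]; rewrite !size_cat -addnA leq_addr.
rewrite -IH -(FG_ins H1 H2).
have ei x : ins (size G0) q ((G0 ++ G) ++ x) = (G0 ++ q :: G) ++ x.
    by rewrite /ins -!catA take_size_cat // drop_size_cat.
split; apply: FG_ext => w; split.
- by move=> [x -> Yx]; exists ((G0 ++ G) ++ x); [exists x|rewrite ei].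
- by move=> [x [y -> Yy] ->]; exists y; rewrite ?ei.
- by move=> [x [y -> Yy] ->]; exists y; rewrite ?ei.
- by move=> [x -> Yx]; exists ((G0 ++ G) ++ x); [exists x|rewrite ei].
Qed.

(** A prefix with empty signature: operators pass through it to the remaining word. *)
Definition neutral (N : pred nat) (u : seq nat) := forall p, N p -> E p u = u /\ cnt p 0 u = 0.
Lemma E_neutral N u p x : neutral N u -> N p -> E p (u ++ x) = u ++ E p x.
Proof. by move=> h /h [h1 h2]; rewrite /E scan_cat h2 -/(E p u) h1. Qed.
Lemma Eword_neutral N u v x : neutral N u -> all N v -> Eword v (u ++ x) = u ++ Eword v x.
Proof.
by move=> h; elim: v x => //= p v IH x /andP[Np av]; rewrite (E_neutral _ h) // IH.
Qed.

(** Each raised letter is a new unmatched [p], so the counter detects whether a word has been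
    changed. *)
Lemma cnt_scan p c m w : m + cnt p c w <= cnt p (c + m) (scan p c w) /\
  (cnt p (c + m) (scan p c w) = m + cnt p c w -> scan p c w = w).
Proof.
elim: w c m => [|x w IH] c m /=; first by rewrite addnC.
case: (x =P p) => [->|xp].
  by rewrite /= eqxx -addSn; case: (IH c.+1 m) => h1 h2; split=> // /h2 ->.
case: (x =P p.+1) => [->|xp1]; last first.
  by rewrite /= (introF eqP xp) (introF eqP xp1); case: (IH c m) => h1 h2; split=> // /h2 ->.
case: c => [|c] /=; rewrite ?eqSn ?eqxx.
  by rewrite add0n; have [h1 _] := IH 0 m.+1; rewrite add0n in h1; split; lia.
by case: (IH c m) => h1 h2; split=> // /h2 ->.
Qed.
Lemma neutral_inv p u u' : E p u' = u -> cnt p 0 u = 0 -> u' = u.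
Proof.
move=> <- h; have [h1 h2] := cnt_scan p 0 0 u'.
rewrite /E h2 //; move: h1; rewrite /E in h.
by rewrite !addn0 !add0n h leqn0 => /eqP ->.
Qed.
Lemma E_split p (u x w : seq nat) : E p w = u ++ x ->
  exists u' y, [/\ w = u' ++ y, E p u' = u & scan p (cnt p 0 u') y = x].
Proof.
move=> e; exists (take (size u) w), (drop (size u) w); rewrite cat_take_drop.
case: (scan_take_drop (size u) p 0 w); rewrite -/(E p w) e.
by rewrite take_size_cat // drop_size_cat // /E => <- <-.
Qed.
Lemma E_neutral_inv N u p w x : neutral N u -> N p -> E p w = u ++ x ->
  exists2 y, w = u ++ y & E p y = x.
Proof.
move=> nu Np /E_split [u' [y [-> e1 e2]]]; have [h1 h2] := nu p Np.
have eu := neutral_inv e1 h2; subst u'.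
by exists y => //; rewrite /E -e2 h2.
Qed.
Lemma Eword_neutral_inv N u v w x : neutral N u -> all N v -> Eword v w = u ++ x ->
  exists2 y, w = u ++ y & Eword v y = x.
Proof.
move=> nu; elim: v w => [|p v IH] w /=; first by exists x.
move=> /andP[Np av] /(IH _ av) [y /(E_neutral_inv nu Np) [z -> <-] <-].
by exists z.
Qed.
Lemma Fw_neutral N u v X w : neutral N u -> all N v -> pre u (Fw v X) w <-> Fw v (pre u X) w.
Proof.
move=> nu av; split=> [[x -> Xx]|[x /(Eword_neutral_inv nu av) [y -> <-] Xx]]; last by exists y.
by exists (Eword v x) => //; rewrite (Eword_neutral _ nu).
Qed.
Lemma FG_neutral N u X : neutral N u -> FG N (pre u X) <-> FG N X.
Proof.
move=> nu; split=> f v p av Np.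
  have h := nice_ext (fun w => iff_sym (Fw_neutral X w nu av)) (f v p av Np).
  move=> w Xw; have [|[x e Xx] h2] := h (u ++ w); first by exists w.
  rewrite (E_neutral _ nu) // in e h2.
  have {}e : E p w = x by move/eqP: e; rewrite eqseq_cat // eqxx => /eqP.
  split; first by rewrite e.
  move=> ne w' e'; have [||y /eqP] := h2 _ (u ++ w').
  - by move/eqP; rewrite eqseq_cat // eqxx => /eqP.
  - by rewrite (E_neutral _ nu) // e'.
  - by rewrite eqseq_cat // eqxx => /eqP ->.
apply: (nice_ext (fun w => Fw_neutral X w nu av)) => w [x -> Xx].
have [h1 h2] := f v p av Np _ Xx; rewrite (E_neutral _ nu) //; split; first by exists (E p x).
move=> ne w' /(E_neutral_inv nu Np) [y -> ey]; exists y => //.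
by apply: h2 => // h; apply: ne; rewrite h.
Qed.

Section Dominant.
Variables a b : nat.
Let N p := a <= p < b.
Definition hw (G : seq nat) := forall p, N p -> E p G = G.

Lemma cnt_Dc p d q : a <= p -> scan p d (Dc a q) = Dc a q /\ cnt p d (Dc a q) = (p == q) + d.
Proof.
move=> ap; have sD : sorted ltn (Dc a q) by exact: iota_ltn_sorted.
case: (col_scan p d sD) => -> ->; rewrite !mem_iota.
have -> : [&& a <= p.+1 < a + (q.+1 - a), ~~ (a <= p < a + (q.+1 - a)) & d == 0] = false by lia.
split=> //; case: (ltngtP p q) => h; last by do 2 (case: ifP => ?); lia.
  by have [-> ->] : a <= p < a + (q.+1 - a) /\ a <= p.+1 < a + (q.+1 - a) by split; lia.
by have [-> ->] : (a <= p < a + (q.+1 - a)) = false /\ (a <= p.+1 < a + (q.+1 - a)) = false by split; lia.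
Qed.
Lemma cnt_colprod p d hs : a <= p -> scan p d (colprod a hs) = colprod a hs /\
  cnt p d (colprod a hs) = count_mem p hs + d.
Proof.
move=> ap; elim: hs d => //= q hs IH d; rewrite /colprod /= scan_cat cnt_cat.
have [-> ->] := cnt_Dc d q ap; have [-> ->] := IH ((p == q) + d).
by split=> //; rewrite eq_sym; lia.
Qed.
(** Induction on the last letter [x]. If [x] is [a], a new column begins. Otherwise [x] is not
    raised at the node [x.-1], so its counter is positive and some column ends in [x.-1]; that
    column is moved to the end by Knuth moves and lengthened by [x]. *)
Lemma hw_colprod G : hw G -> all (fun x => a <= x <= b) G ->
  exists2 hs, keq G (colprod a hs) & all (fun x => a <= x <= b) hs.
Proof.
elim/last_ind: G => [|G x IH] hG; first by exists [::] => //; exact: Krefl.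
rewrite all_rcons => /andP[xab aG].
have hl p : N p -> E p G = G /\ lastE p G x = x.
  by move/hG; rewrite E_rcons => /rcons_inj [].
have [hs k ahs] := IH (fun p Np => (hl p Np).1) aG.
have [xa|xa] := eqVneq x a.
  exists (rcons hs x); last by rewrite all_rcons xab.
  rewrite -!cats1 /colprod map_cat flatten_cat /= cats0.
  by apply: Ktrans (keq_catr _ k) _; rewrite xa /Dc subSnn; exact: Krefl.
have Nx : N x.-1 by rewrite /N; lia.
have [_] := hl _ Nx; rewrite /lastE prednK; last by lia.
rewrite eqxx /= (keq_scan _ _ k) (cnt_colprod 0 hs _).2; last by lia.
case: ifP => [|+ _]; first by lia.
rewrite addn0 => c0; have : x.-1 \in hs by rewrite -has_pred1 has_count lt0n c0.
move=> /splitPr; move: ahs k => + + e; case: e => s1 s2 ahs k.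
exists (s1 ++ s2 ++ [:: x]); last by move: ahs; rewrite !all_cat /= xab andbT => /and3P[-> _ ->].
have p1 : perm_eq (s1 ++ x.-1 :: s2) (s1 ++ s2 ++ [:: x.-1]).
  by rewrite perm_cat2l -cat1s perm_catC.
rewrite -cats1; apply: Ktrans (keq_catr _ (Ktrans k (colprod_perm _ p1))) _.
  by apply: sub_all ahs => y /andP[].
rewrite /colprod !map_cat !flatten_cat /= !cats0 -!catA.
have -> : Dc a x.-1 ++ [:: x] = Dc a x; last exact: Krefl.
rewrite /Dc prednK; last by lia.
have -> : x.+1 - a = (x - a).+1 by lia.
by rewrite iota_rcons; congr (_ ++ [:: _]); lia.
Qed.

Lemma neutral_Dc : neutral N (Dc a b).
Proof.
by move=> p /andP[ap pb]; rewrite /E; have [-> ->] := cnt_Dc 0 b ap; rewrite ltn_eqF.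
Qed.
Lemma pre_cat G G' Y : forall w, pre G (pre G' Y) w <-> pre (G ++ G') Y w.
Proof.
move=> w; split=> [[x -> [y -> Yy]]|[y -> Yy]]; first by exists y; rewrite ?catA.
by exists (G' ++ y); [rewrite catA|exists y].
Qed.
Lemma FG_colprod hs Y : FG N Y -> FG N (pre (colprod a hs) Y).
Proof.
move=> fY; elim: hs => [|q hs IH]; first by apply: FG_ext fY => w; split=> [?|[x ->]//]; exists w.
apply: (FG_ext (pre_cat (Dc a q) (colprod a hs) Y)).
apply: (FG_col _ _ IH); first exact: iota_ltn_sorted.
by move=> p; rewrite /N !mem_iota; lia.
Qed.
Lemma FG_full m Y : FG N (pre (colprod a (nseq m b)) Y) <-> FG N Y.
Proof.
elim: m => [|m IH]; first by split; apply: FG_ext => w; [split=> [[x ->]//|?]|split=> [?|[x ->]//]]; exists w.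
rewrite -IH -[X in _ <-> X](FG_neutral _ neutral_Dc).
by split; apply: FG_ext => w; rewrite pre_cat.
Qed.

(* Up to the Knuth moves and letters on which no node of N acts, a highest
   weight word is a product of columns, determined by the counters. *)
Lemma FG_hw_colprod G : hw G -> exists hs, [/\ all (fun x => a <= x <= b) hs,
  forall p, N p -> count_mem p hs = cnt p 0 G
  & forall Y, FG N (pre G Y) <-> FG N (pre (colprod a hs) Y)].
Proof.
move=> hG; pose D := fun x => a <= x <= b.
have sc p c w : N p -> scan p c (filter D w) = filter D (scan p c w) /\
    cnt p c (filter D w) = cnt p c w.
  move=> Np; elim: w c => //= x w IH c.
  case: (x =P p) => [->|xp].
    have Dp : D p by rewrite /D; move: Np; rewrite /N; lia.
    by rewrite /= Dp /= eqxx; case: (IH c.+1) => -> ->.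
  case: (x =P p.+1) => [->|xp1].
    have Dp : D p by rewrite /D; move: Np; rewrite /N; lia.
    have Dp1 : D p.+1 by rewrite /D; move: Np; rewrite /N; lia.
    rewrite Dp1 /= eqSn eqxx; case: c => [|c] /=; rewrite ?Dp ?Dp1.
      by case: (IH 0) => -> ->.
    by case: (IH c) => -> ->.
  by rewrite /=; case: ifP => _ /=; rewrite ?(introF eqP xp) ?(introF eqP xp1); case: (IH c) => -> ->.
have hG' : hw (filter D G) by move=> p Np; rewrite /E (sc _ _ _ Np).1 [scan p 0 G]hG.
have [hs k ahs] := hw_colprod hG' (filter_all _ _).
exists hs; split=> // [p Np|Y].
  have /andP[ap _] := Np; rewrite -(sc p 0 G Np).2 (keq_scan _ _ k).
  by rewrite (cnt_colprod 0 hs ap).2 addn0.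
rewrite -(keq_pre _ _ k); apply: FG_pre_del => q p; rewrite /D /N; lia.
Qed.

Lemma FG_colprod_perm hs hs' Y : all (leq a) hs -> perm_eq hs hs' ->
  FG N (pre (colprod a hs) Y) <-> FG N (pre (colprod a hs') Y).
Proof. by move=> h1 h2; apply: keq_pre; apply: colprod_perm. Qed.

(** Both prefixes become multisets of columns, and that of [G'] is that of [G] enlarged by the
    columns [add], up to full columns. Columns may be prefixed ([FG_col]) and permuted (Knuth
    moves), and full ones may be cancelled since they are neutral. *)
Theorem FG_dom G G' Y : hw G -> hw G' -> (forall p, N p -> cnt p 0 G <= cnt p 0 G') ->
  FG N (pre G Y) -> FG N (pre G' Y).
Proof.
move=> hG hG' le.
have [hs [ahs c1 ->]] := FG_hw_colprod hG.
have [hs' [ahs' c1' ->]] := FG_hw_colprod hG'.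
pose add := flatten [seq nseq (cnt p 0 G' - cnt p 0 G) p | p <- iota a (b - a)].
(* The counters do not see the full columns, those ending at [b]; each side is therefore padded with
   the full columns of the other. *)
pose hs1 := nseq (count_mem b hs') b ++ add ++ hs.
pose hs2 := nseq (count_mem b hs) b ++ hs'.
have cadd p : count_mem p add = if N p then cnt p 0 G' - cnt p 0 G else 0.
  rewrite /add count_flatten -map_comp.
  have -> : N p = (p \in iota a (b - a)) by rewrite mem_iota /N; lia.
  elim: (iota a _) (iota_uniq a (b - a)) => //= q s IH /andP[qs us].
  rewrite inE count_nseq IH // eq_sym /=; case: (q =P p) => [e|_] /=.
    by rewrite -e (negPf qs) mul1n addn0.
  by rewrite mul0n.
have ge_a : all (leq a) hs1.
  rewrite !all_cat; apply/and3P; split.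
  - case: (b =P a) => [->|ba]; first by apply/allP => x /nseqP [->].
    have [h|h] := posnP (count_mem b hs'); first by rewrite h.
    apply/allP => x /nseqP [-> _]; move: h; rewrite -has_count => /hasP [y + /eqP ey].
    by subst y => /(allP ahs'); lia.
  - by apply/allP => x /flattenP [s /mapP [p + ->]] /nseqP [-> _]; rewrite mem_iota => /andP[].
  - by apply: sub_all ahs => x /andP[].
have pe : perm_eq hs1 hs2.
  apply/allP => p _ /=; apply/eqP; rewrite /hs1 /hs2 !count_cat !count_nseq cadd.
  rewrite /=; case Np : (N p).
    have e : (b == p) = false by move: Np; rewrite /N; lia.
    have -> : nat_of_bool (b == p) = 0 by rewrite e.
    by rewrite !mul0n !add0n c1 // c1' // subnK // le.
  case: (b =P p) => [->|bp]; first by lia.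
  have nm (s : seq nat) : all (fun x => a <= x <= b) s -> count_mem p s = 0.
    move=> as_; apply/count_memPn/negP => /(allP as_); move: Np bp; rewrite /N; lia.
  by rewrite !nm //; lia.
move=> f; have f1 : FG N (pre (colprod a hs1) Y).
  have h := @FG_colprod add _ f; have {}h := (FG_full (count_mem b hs') _).2 h.
  apply: FG_ext h => w; rewrite /hs1 /colprod !map_cat !flatten_cat.
  by rewrite pre_cat pre_cat -!catA.
have f2 := (FG_colprod_perm Y ge_a pe).1 f1.
have := (FG_full (count_mem b hs) (pre (colprod a hs') Y)).1; apply.
by apply: FG_ext f2 => w; rewrite /hs2 /colprod map_cat flatten_cat pre_cat.
Qed.
End Dominant.

Lemma scan_far p q c d w : (p.+1 < q) || (q.+1 < p) ->
  scan q d (scan p c w) = scan p c w -> scan q d w = w.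
Proof.
move=> far; elim: w c d => //= x w IH c d.
case: (x =P p) => [->|xp].
  have [-> ->] : (p == q) = false /\ (p == q.+1) = false by lia.
  by rewrite /= ; have [-> ->] : (p == q) = false /\ (p == q.+1) = false by [lia]; case=> /IH ->.
case: (x =P p.+1) => [->|xp1].
  have [-> ->] : (p.+1 == q) = false /\ (p.+1 == q.+1) = false by lia.
  have [n1 n2] : (p == q) = false /\ (p == q.+1) = false by lia.
  have [n3 n4] : (p.+1 == q) = false /\ (p.+1 == q.+1) = false by lia.
  by case: c => [|c] /=; rewrite ?(n1,n2,n3,n4); case=> /IH ->.
rewrite /=; case: eqP => [_|_]; first by case=> /IH ->.
case: eqP => [e|_]; last by case=> /IH ->.
by case: d => [|d] []; [lia|move/IH->].
Qed.
Lemma E_comm_far p q w : (p.+1 < q) || (q.+1 < p) -> E p (E q w) = E q (E p w).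
Proof. by case/orP=> h; rewrite /E; [|symmetry]; apply: scan_comm. Qed.
(** [E p] commutes with the operators of [N], and by [scan_far] it does not turn a word that is no
    head at [q] into a head at [q]. *)
Lemma FG_far (N : pred nat) p X : (forall q, N q -> (p.+1 < q) || (q.+1 < p)) ->
  FG N X -> FG N (Fw [:: p] X).
Proof.
move=> far fX v q av Nq; have cw w : Eword v (E p w) = E p (Eword v w).
  elim: v w av => //= r v IH w /andP[Nr av].
  by rewrite -IH // E_comm_far // orbC far.
apply: (@nice_ext _ (fun w => Fw v X (E p w))) => [w|w Xw]; first by rewrite /Fw /= cw.
have [h1 h2] := fX v q av Nq _ Xw.
have ec u : E p (E q u) = E q (E p u) by apply: E_comm_far; rewrite far.
rewrite ec; split=> // ne w' e; apply: h2; last by rewrite -!ec e.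
by move=> h; apply: ne; apply: scan_far h; exact: far.
Qed.
End Dominance.

(** * The rows unrolled on a line *)

Module Windows.
From mathcomp Require Import all_boot zify.
Import Scan FilteredSets Columns KnuthMoves Dominance.

Notation bword := (seq (seq nat)).

Fixpoint scanB (p c : nat) (u : bword) : bword :=
  if u is b :: u' then scan p c b :: scanB p (cnt p c b) u' else [::].
Definition EB p := scanB p 0.
Definition EBw (v : seq nat) (u : bword) := foldl (fun u p => EB p u) u v.

Lemma flatten_scanB p c u : flatten (scanB p c u) = scan p c (flatten u).
Proof. by elim: u c => //= b u IH c; rewrite IH scan_cat. Qed.
Lemma flatten_EBw v u : flatten (EBw v u) = Eword v (flatten u).
Proof. by elim: v u => //= p v IH u; rewrite IH flatten_scanB. Qed.
Lemma shape_scanB p c u : shape (scanB p c u) = shape u.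
Proof. by rewrite /shape; elim: u c => //= b u IH c; rewrite IH size_scan. Qed.
Lemma shape_EBw v u : shape (EBw v u) = shape u.
Proof. by elim: v u => //= p v IH u; rewrite IH shape_scanB. Qed.
Lemma EBw_cat v v' u : EBw (v ++ v') u = EBw v' (EBw v u).
Proof. exact: foldl_cat. Qed.

(* Reduced word of the longest element on the nodes lo, ..., hi - 1. *)
Fixpoint w0w (m lo : nat) : seq nat :=
  if m is m'.+1 then rev (iota lo m) ++ w0w m' lo.+1 else [::].
Lemma mem_w0w m lo p : p \in w0w m lo -> lo <= p < lo + m.
Proof.
elim: m lo => //= m IH lo; rewrite mem_cat mem_rev => /orP[|/IH]; last by lia.
rewrite -[_ :: _]/(iota lo m.+1) mem_iota; lia.
Qed.

Section Unrolled.
Variables (l K M b : nat).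
Hypothesis l1 : 1 < l.

(** Row [r] of copy [k] at stage [i]. Since [row i.+1 k r] is [row i k r.+1], and row [l] of a copy
    is row 0 of the next one, the cyclic shift of rows is just the passage from [i] to [i.+1]. *)
Definition row i k r := i + k * l + r.
Definition Wn m := w0w (l.-1 - m.-1) m.-1.
Lemma mem_Wn m p : p \in Wn m -> p < l.-1.
Proof. by move/mem_w0w; lia. Qed.
Lemma row_inj i k r k' r' : row i k r = row i k' r' -> r < l -> r' < l -> k = k' /\ r = r'.
Proof.
rewrite /row -!addnA => /addnI e rl rl'; have l0 : 0 < l by lia.
have := congr1 (fun x => x %/ l) e; rewrite !divnMDl // !divn_small // !addn0 => ek.
by subst k'; move/addnI: e.
Qed.
Lemma leq_row i k k' : k <= k' -> row i k 0 <= row i k' 0.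
Proof. by move=> h; rewrite /row !addn0 leq_add2l leq_mul2r h orbT. Qed.
Lemma row_lt i k r : r < l -> row i k r < row i k.+1 0.
Proof. by rewrite /row mulSn; lia. Qed.
Definition allw i (v : seq nat) := flatten [seq [seq row i k r | r <- v] | k <- iota 0 K].
(** The positions controlled at stage [i]: copies [M - i] to [b - 1]. The lower end moves down by
    one copy per stage because the origin moves up by one position, which would otherwise lose the
    bottom node. *)
Definition actv i x := row i (M - i) 0 <= x < row i b 0.
(** All nodes within the controlled range, including the joints between copies, which stand for the
    affine node. *)
Definition Nact i p := row i (M - i) 0 <= p < (row i b 0).-1.
Definition topw i m := flatten [seq nseq m (row i k 0) | k <- rev (iota (M - i) (b - (M - i)))].

(** The katabolism test in all controlled copies at once: the first block must occupy exactly the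
    first rows, then the insertion operator acts in each of the [K] copies. No rotation is
    performed, only [i] changes. *)
Fixpoint NP i (ns ms : seq nat) (u : bword) : Prop := match ms, u with
  | m :: ms', b :: u' => filter (actv i) b = topw i m /\
      NP i.+1 (behead ns) ms' (EBw (allw i.+1 (Wn (head 0 ns))) u')
  | [::], [::] => True
  | _, _ => False end.

Definition NPw i ns ms sg : wset := fun w =>
  exists u, [/\ shape u = sg, w = flatten u & NP i ns ms u].

Lemma NPw_cons i ns m ms s sg w : NPw i ns (m :: ms) (s :: sg) w <-> exists b,
  [/\ size b = s, filter (actv i) b = topw i m &
   pre b (Fw (allw i.+1 (Wn (head 0 ns))) (NPw i.+1 (behead ns) ms sg)) w].
Proof.
split.
  move=> [[|c u] [//= [e1 e2] -> [h1 h2]]]; exists c; split=> //.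
  exists (flatten u) => //; rewrite /Fw -flatten_EBw.
  by eexists; split; [|reflexivity|exact: h2]; rewrite shape_EBw.
move=> [c [e1 h1 [x -> [u [e2 e3 h2]]]]].
exists (c :: reshape sg x); have sx : sumn sg = size x.
  by rewrite -e2 -size_flatten -e3 size_Eword.
have sr : shape (reshape sg x) = sg by apply: reshapeKl; rewrite sx.
have fr : flatten (reshape sg x) = x by apply: reshapeKr; rewrite sx.
split=> /=; rewrite ?e1 -?/(shape _) ?sr ?fr //; split=> //.
set u' := EBw _ _; have -> // : u' = u.
rewrite -[u']flattenK -[u]flattenK e2; congr reshape; first by rewrite /u' shape_EBw.
by rewrite /u' flatten_EBw fr.
Qed.


Lemma allw_mem i v p : p \in allw i v -> exists k r, [/\ k < K, r \in v & p = row i k r].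
Proof.
move=> /flattenP [s /mapP [k + ->] /mapP [r rv ->]]; rewrite mem_iota => h.
by exists k, r; split=> //; lia.
Qed.

Lemma scan_top p c (m : nat) (q : nat) : p != q ->
  scan p c (nseq m q) = (if q == p.+1 then nseq (minn c m) q ++ nseq (m - c) p else nseq m q) /\
  cnt p c (nseq m q) = (if q == p.+1 then c - m else c).
Proof.
rewrite eq_sym => /negPf qp; elim: m c => [|m IH] c.
  by case: eqP; rewrite /= ?minn0 ?sub0n ?subn0.
rewrite /= qp; case: (q =P p.+1) IH => [->|_] IH; last by case: (IH c) => -> ->.
case: c => [|c]; first by case: (IH 0) => -> ->; rewrite !min0n !subn0 !sub0n.
by rewrite minnSS !subSS /=; case: (IH c) => -> ->.
Qed.
Lemma scan_nseq_p p c m : scan p c (nseq m p) = nseq m p /\ cnt p c (nseq m p) = c + m.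
Proof.
elim: m c => [|m IH] c /=; first by rewrite addn0.
by rewrite eqxx; case: (IH c.+1) => -> ->; rewrite addSnnS.
Qed.

(* Tops of windows are met in decreasing order; a node p with p.+1 a top sees
   m closing brackets, a node which is a top sees m opening ones. *)
Lemma scan_tops i m ks p c : (forall k, k \in ks -> p.+1 = row i k 0 -> m <= c) ->
  sorted gtn ks ->
  scan p c (flatten [seq nseq m (row i k 0) | k <- ks]) =
    flatten [seq nseq m (row i k 0) | k <- ks] /\
  cnt p c (flatten [seq nseq m (row i k 0) | k <- ks]) =
    (c - (if has (fun k => p.+1 == row i k 0) ks then m else 0)) +
    (if has (fun k => p == row i k 0) ks then m else 0).
Proof.
elim: ks c => [|k ks IH] c hc sk; first by rewrite /= addn0 subn0.
have sk' : sorted gtn ks by exact: path_sorted sk.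
have gk : all (fun k' => k' < k) ks by move: sk => /=; apply: order_path_min => x y z /=; lia.
have nk r : r \in ks -> (row i r 0 == row i k 0) = false.
  move=> /(allP gk) h; apply/eqP => /row_inj [||e _]; try lia.
rewrite [flatten _]/= scan_cat cnt_cat.
have [e|ne] := eqVneq p (row i k 0).
  have [e1 e2] := scan_nseq_p p c m; rewrite -e e1 e2.
  have n1 : has (fun k0 => p.+1 == row i k0 0) (k :: ks) = false.
    apply/negP => /hasP [k' _ /eqP]; rewrite e => h.
    have /row_inj : row i k 1 = row i k' 0 by rewrite -h /row; lia.
    by case; lia.
  have n2 : has (fun k0 => p == row i k0 0) ks = false.
    by apply/negP => /hasP [k' h /eqP]; rewrite e => h'; have := nk _ h; rewrite -h' eqxx.
  have [||-> ->] := IH (c + m) => // [k' k'in ek'|].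
    by exfalso; move/hasP: n1; apply; exists k'; rewrite ?inE ?k'in ?orbT ?ek'.
  rewrite n1 n2 /= e eqxx /= -e.
  move: n1; rewrite /= => /norP [_ /negPf ->].
  by split=> //; lia.
have [e1 e2] := scan_top c m ne; rewrite e1 e2 [_ == p.+1]eq_sym /= [p == _](negPf ne).
have [e|ne1] := eqVneq p.+1 (row i k 0); last first.
  by have [||-> ->] := IH c => // k' k'in; apply: hc; rewrite inE k'in orbT.
have mc : m <= c by apply: (hc k) => //; rewrite inE eqxx.
have n2 : has (fun k0 => p.+1 == row i k0 0) ks = false.
  by apply/negP => /hasP [k' h /eqP]; rewrite e => h'; have := nk _ h; rewrite -h' eqxx.
have [||-> ->] := IH (c - m) => // [k' k'in ek'|].
  by exfalso; move/hasP: n2; apply; exists k'; rewrite ?ek'.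
rewrite n2 subn0 (minn_idPr mc); have -> : m - c = 0 by lia.
by rewrite cats0.
Qed.

Lemma topwE i m p c : (forall k, p.+1 = row i k 0 -> M - i <= k < b -> m <= c) ->
  scan p c (topw i m) = topw i m /\
  cnt p c (topw i m) = (c - (if has (fun k => p.+1 == row i k 0) (iota (M - i) (b - (M - i))) then m else 0)) +
    (if has (fun k => p == row i k 0) (iota (M - i) (b - (M - i))) then m else 0).
Proof.
move=> h; have [||-> ->] := @scan_tops i m (rev (iota (M - i) (b - (M - i)))) p c.
- by move=> k; rewrite mem_rev mem_iota => hk /h; apply; lia.
- by rewrite rev_sorted; apply: iota_ltn_sorted.
- by rewrite !has_rev.
Qed.

(** A highest weight word leaving [m] open brackets at the node just before the top of each
    controlled copy except the lowest: precisely what a block of [m] tops per copy consumes. *)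
Definition H0 i m := colprod (row i (M - i) 0)
  (flatten [seq nseq m (row i k 0).-1 | k <- iota (M - i) (b - (M - i))]).

Lemma actv_Nact i p : Nact i p -> actv i p && actv i p.+1.
Proof. rewrite /actv /Nact; lia. Qed.

Lemma scan_filter (D : pred nat) p c w : D p -> D p.+1 ->
  scan p c (filter D w) = filter D (scan p c w) /\ cnt p c (filter D w) = cnt p c w.
Proof.
move=> Dp Dp1; elim: w c => //= x w IH c.
case: (x =P p) => [->|xp].
  by rewrite /= Dp /= eqxx; case: (IH c.+1) => -> ->.
case: (x =P p.+1) => [->|xp1].
  rewrite Dp1 /= eqSn eqxx; case: c => [|c] /=; rewrite ?Dp ?Dp1.
    by case: (IH 0) => -> ->.
  by case: (IH c) => -> ->.
by rewrite /=; case: ifP => _ /=; rewrite ?(introF eqP xp) ?(introF eqP xp1); case: (IH c) => -> ->.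
Qed.

Lemma scan_filter_fix (D : pred nat) p c w : D p -> D p.+1 ->
  scan p c (filter D w) = filter D w -> scan p c w = w.
Proof.
move=> Dp Dp1; elim: w c => //= x w IH c.
case: (x =P p) => [->|xp]; first by rewrite Dp /= eqxx => [] [/IH ->].
case: (x =P p.+1) => [->|xp1].
  by rewrite Dp1 /= eqSn eqxx; case: c => [|c] [] => [|/IH ->//]; lia.
case: ifP => _ /=; rewrite ?(introF eqP xp) ?(introF eqP xp1); last by move/IH ->.
by case=> /IH ->.
Qed.

Lemma count_tops (f : nat -> nat) m ks p : {in ks &, injective f} -> uniq ks ->
  count_mem p (flatten [seq nseq m (f k) | k <- ks]) = if has (fun k => p == f k) ks then m else 0.
Proof.
elim: ks => //= k ks IH fi /andP[kks uks]; rewrite count_cat count_nseq IH //; last first.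
  by move=> x y xk yk; apply: fi; rewrite inE ?xk ?yk orbT.
rewrite /= [f k == p]eq_sym; case: eqP => [e|_] /=; last by rewrite mul0n.
have -> : has (fun k => p == f k) ks = false; last by rewrite mul1n addn0.
apply/negP => /hasP [k' hk' /eqP]; rewrite e => /fi ek.
by rewrite ek ?inE ?eqxx ?hk' ?orbT // in kks.
Qed.

Lemma H0E i m p : row i (M - i) 0 <= p -> 0 < i ->
  E p (H0 i m) = H0 i m /\
  cnt p 0 (H0 i m) = if has (fun k => p == (row i k 0).-1) (iota (M - i) (b - (M - i))) then m else 0.
Proof.
move=> ap i0; rewrite /E /H0.
have [-> ->] := cnt_colprod 0 (flatten [seq nseq m (row i k 0).-1 | k <- iota (M - i) (b - (M - i))]) ap.
split=> //; rewrite addn0 count_tops ?iota_uniq // => k k' _ _ e.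
have /row_inj [||//] : row i k 0 = row i k' 0; try lia.
by move: e; rewrite /row; lia.
Qed.
(** The columns of [H0] end at the joints, so no node inside a copy feels them. *)
Lemma H0_neutral i m v : 0 < i -> (forall r, r \in v -> r < l.-1) ->
  neutral (fun p => p \in allw i v) (H0 i m).
Proof.
move=> i0 hv p /allw_mem [k [r [kK rv ->]]]; have rl := hv r rv.
have [ka|ka] := leqP (M - i) k.
  have [|//|-> ->] := @H0E i m (row i k r).
    by apply: leq_trans (leq_row i ka) _; rewrite /row; lia.
  split=> //; case: hasP => // [] [k' _ /eqP e]; exfalso.
  have /row_inj [||_] : row i k r.+1 = row i k' 0; try lia.
  by move: e; rewrite /row; lia.
have lt : (row i k r).+1 < row i (M - i) 0.
  apply: leq_trans (leq_row i ka); have := @row_lt i k r.+1; rewrite /row; lia.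
have ge x : x \in H0 i m -> row i (M - i) 0 <= x.
  by move=> /flattenP [s /mapP [q _ ->]]; rewrite mem_iota => /andP[].
have [] := @scan_notin (row i k r) 0 (H0 i m) => //; apply/negP => /ge; lia.
Qed.

Lemma FG_mixed (N : pred nat) v X :
  (forall p, p \in v -> N p \/ forall q, N q -> (p.+1 < q) || (q.+1 < p)) ->
  FG N X -> FG N (Fw v X).
Proof.
elim: v X => [|p v IH] X h fX; first exact: FG_ext fX.
apply: (@FG_ext _ (Fw [:: p] (Fw v X))) => [w|]; first by rewrite /Fw.
have {}IH : FG N (Fw v X) by apply: IH => // q qv; apply: h; rewrite inE qv orbT.
case: (h p (mem_head _ _)) => hp; first by apply: FG_F => //=; rewrite hp.
exact: FG_far.
Qed.
Lemma allw_mixed i v p : (forall r, r \in v -> r < l.-1) -> p \in allw i v ->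
  Nact i p \/ forall q, Nact i q -> (p.+1 < q) || (q.+1 < p).
Proof.
move=> hv /allw_mem [k [r [kK rv ->]]]; have rl := hv r rv; rewrite /Nact.
have hr : (row i k r).+1 < row i k.+1 0 by have := @row_lt i k r.+1; rewrite /row; lia.
have hk : row i k 0 <= row i k r by rewrite /row; lia.
have [ka|ka] := leqP (M - i) k; last by right=> q; have := leq_row i ka; lia.
have [bk|kb] := leqP b k; first by right=> q; have := leq_row i bk; lia.
by left; have := leq_row i ka; have := leq_row i kb; lia.
Qed.

(** Induction on the blocks. An admissible first block [bb] makes [H ++ bb] a highest weight word
    with at least [m] open brackets at the tops of stage [i]. These tops are the nodes just before
    the tops of stage [i.+1], and the next part is at most [m]; hence [H ++ bb] dominates the word
    [H0] of the induction hypothesis and [FG_dom] applies. *)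
Theorem FG_NP i ns ms sg H : i + size ms <= M -> M < b -> sorted geq ms ->
  hw (row i (M - i) 0) (row i b 0).-1 H ->
  (forall k, M - i < k < b -> head 0 ms <= cnt (row i k 0).-1 0 H) ->
  FG (Nact i) (pre H (NPw i ns ms sg)).
Proof.
elim: ms i ns sg H => [|m ms IH] i ns sg H iM Mb sms hH cH.
  case: sg => [|s sg]; last by move=> v p av Np w; rewrite /Fw => [] [x _ [[|c u] []]].
  apply: (@FG_dom (row i (M - i) 0) (row i b 0).-1 [::] H) => //.
  have X0 : forall w, pre [::] (NPw i ns [::] [::]) w <-> w = [::].
    move=> w; split; first by case=> x -> [[|? ?] [_ -> //]].
    by move=> ->; exists [::] => //; exists [::].
  apply: (@FG_ext _ (fun w => w = [::])) => [w|]; first by rewrite X0.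
  move=> v p _ _ w; rewrite /Fw => e; have {}e : w = [::].
    by apply: size0nil; rewrite -(size_Eword v) e.
  subst w; split; last by case.
  by apply: size0nil; rewrite size_Eword.
case: sg => [|s sg].
  by move=> v p av Np w; rewrite /Fw => [] [x _ [[|c u] []]].
apply: (@FG_ext _ (fun w => exists bb : {bb | size bb = s /\ filter (actv i) bb = topw i m},
  pre (H ++ sval bb) (Fw (allw i.+1 (Wn (head 0 ns))) (NPw i.+1 (behead ns) ms sg)) w)).
  move=> w; split.
    move=> [[bb [h1 h2]] /= /pre_cat [x -> h]]; exists x => //.
    by apply/NPw_cons; exists bb.
  move=> [x -> /NPw_cons [bb [h1 h2 h3]]].
  by exists (exist _ bb (conj h1 h2)); apply/pre_cat; exists x.
apply: FG_union => [] [bb [_ hb]] /=.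
set Y := Fw _ _.
(* [H0] is neutral for the insertion nodes, so it can be moved inside the preimage, where the
   induction hypothesis applies. *)
have fY : FG (Nact i.+1) (pre (H0 i.+1 (head 0 ms)) Y).
  have W1 r : r \in Wn (head 0 ns) -> r < l.-1 by exact: mem_Wn.
  have aw : all (fun p => p \in allw i.+1 (Wn (head 0 ns))) (allw i.+1 (Wn (head 0 ns))).
    by apply/allP.
  apply: (FG_ext (fun w => iff_sym (Fw_neutral _ w (@H0_neutral i.+1 (head 0 ms) _ (ltn0Sn i) W1) aw))).
  apply: FG_mixed => [p|]; first exact: allw_mixed.
  apply: IH => //; first by rewrite addSnnS.
  - exact: path_sorted sms.
  - by move=> p /andP[ap _]; case: (H0E (head 0 ms) ap (ltn0Sn i)).
  - move=> k hk; have [||_ ->] := @H0E i.+1 (head 0 ms) (row i.+1 k 0).-1 => //.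
      have := @leq_row i.+1 (M - i.+1).+1 k; have := @row_lt i.+1 (M - i.+1) 0; lia.
    by case: hasP => // [] []; exists k => //; rewrite mem_iota; lia.
have le0 : row i.+1 (M - i.+1) 0 <= row i (M - i) 0.
  have -> : M - i = (M - i.+1).+1 by move: iM => /=; lia.
  by rewrite /row mulSn; lia.
have cp p : row i (M - i) 0 <= p -> p < (row i b 0).-1 -> 
   (forall k, p.+1 = row i k 0 -> M - i <= k < b -> m <= cnt p 0 H).
  move=> ap pb k ek hk; have := cH k; rewrite -ek /=; apply.
  have : k <> M - i by move=> e; rewrite e in ek; lia.
  lia.
have aD p : Nact i p -> actv i p /\ actv i p.+1 by move/actv_Nact/andP.
have fil : filter (actv i) (H ++ bb) = filter (actv i) H ++ topw i m by rewrite filter_cat hb.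
apply: (@FG_dom (row i (M - i) 0) (row i b 0).-1 (H0 i.+1 (head 0 ms))) => //.
- by move=> p /andP[ap _]; case: (@H0E i.+1 (head 0 ms) p) => //; exact: leq_trans ap.
- move=> p Np; have [D1 D2] := aD p Np; have /andP[ap pb] := Np.
  apply: (scan_filter_fix D1 D2); rewrite fil scan_cat.
  have [-> ->] := scan_filter 0 H D1 D2; rewrite [scan p 0 H]hH //.
  by have [-> _] := topwE (cp p ap pb).
- move=> p Np; have [D1 D2] := aD p Np; have /andP[ap pb] := Np.
  have [|//|_ ->] := @H0E i.+1 (head 0 ms) p; first exact: leq_trans ap.
  case: hasP => // [] [k _ /eqP ek].
  have [_ <-] := scan_filter 0 (H ++ bb) D1 D2; rewrite fil cnt_cat.
  have [_ ->] := scan_filter 0 H D1 D2; have [_ ->] := topwE (cp p ap pb).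
  have ek' : p = row i k 0 by rewrite ek /row.
  apply: leq_trans (leq_addl _ _); case: hasP => [_|[]]; last first.
    exists k; last by rewrite ek'.
    rewrite mem_iota; have [h1|h1] := ltnP k (M - i).
      by have := leq_row i h1; have := @row_lt i k 0; lia.
    have [h2|h2] := leqP b k; first by have := leq_row i h2; lia.
    lia.
  by case: (ms) sms => //= m' ms' /andP[].
- apply: FG_sub fY => p /andP[ap pb]; rewrite /Nact; apply/andP; split; first exact: leq_trans ap.
  by move: pb; rewrite /row; lia.
Qed.
End Unrolled.
End Windows.

(** * From the line back to a single period *)

Module Folding.
From mathcomp Require Import all_boot zify.
Import Scan FilteredSets Columns KnuthMoves Dominance Windows.

Lemma path_scan p (b : seq nat) x c : (x = p -> 0 < c) ->
  path geq x (scan p c b) = path geq x b.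
Proof.
suff [H _] : (forall x c, (x = p -> 0 < c) -> path geq x (scan p c b) = path geq x b) /\
  path geq p (scan p 0 b) = path geq p.+1 b by exact: H.
elim: b => [|z b [IH1 IH2]] {x c} //=; split.
  move=> x c hx; case: (z =P p) => [->|zp] /=; first by rewrite IH1.
  case: (z =P p.+1) => [->|zp1] /=; last by rewrite IH1.
  case: c hx => [|c] hx /=.
    by rewrite IH2; congr (_ && _); rewrite /geq; apply/idP/idP => h; case: (x =P p) => [/hx|?]; lia.
  by rewrite IH1 //; lia.
case: (z =P p) => [->|zp] /=; first by rewrite IH1 // leqnn leqnSn.
case: (z =P p.+1) => [->|zp1] /=; first by rewrite IH2 !leqnn.
by rewrite IH1 //; congr (_ && _); rewrite /geq; apply/idP/idP; lia.
Qed.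
(** In a decreasing block all [p.+1] stand before all [p], so the raised letters are the last of the
    [p.+1]. *)
Lemma sorted_scan p c (b : seq nat) : sorted geq (scan p c b) = sorted geq b.
Proof.
case: b => //= z b; case: (z =P p) => [->|zp] /=; first by rewrite path_scan.
case: (z =P p.+1) => [->|zp1] /=; last by rewrite path_scan.
case: c => [|c] /=; last by rewrite path_scan //; lia.
have := @path_scan p (p.+1 :: b) p.+1 0; rewrite /= eqSn eqxx /= leqnn leqnSn /= => -> //; lia.
Qed.
Lemma all_sorted_scanB p c u : all (sorted geq) (scanB p c u) = all (sorted geq) u.
Proof. by elim: u c => //= b u IH c; rewrite sorted_scan IH. Qed.
Lemma all_sorted_EBw v u : all (sorted geq) (EBw v u) = all (sorted geq) u.
Proof. by elim: v u => //= p v IH u; rewrite IH all_sorted_scanB. Qed.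

Lemma all_scan (D : pred nat) p c b : D p = D p.+1 -> all D (scan p c b) = all D b.
Proof.
move=> e; elim: b c => //= x b IH c; case: (x =P p) => [->|_] /=; first by rewrite IH.
case: (x =P p.+1) => [->|_] /=; last by rewrite IH.
by case: c => [|c] /=; rewrite IH // e.
Qed.
Lemma all_scanB (D : pred nat) p c u : D p = D p.+1 -> all (all D) (scanB p c u) = all (all D) u.
Proof. by move=> e; elim: u c => //= b u IH c; rewrite all_scan // IH. Qed.
Lemma all_EBw (D : pred nat) v u : {in v, forall p, D p = D p.+1} ->
  all (all D) (EBw v u) = all (all D) u.
Proof.
elim: v u => //= p v IH u h; rewrite IH ?all_scanB //; first by apply: h; rewrite mem_head.
by move=> q qv; apply: h; rewrite inE qv orbT.
Qed.

Lemma geq_trans' : transitive geq. Proof. by move=> x y z /= h1 h2; exact: leq_trans h2 h1. Qed.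
Lemma geq_anti : antisymmetric geq. Proof. by move=> x y /= h; lia. Qed.
Lemma sorted_count_eq (s t : seq nat) : sorted geq s -> sorted geq t ->
  (forall x, count_mem x s = count_mem x t) -> s = t.
Proof.
move=> ss st h; apply: (sorted_eq geq_trans' geq_anti) => //.
by apply/allP => x _ /=; apply/eqP.
Qed.

Section Fold.
Variables (l K : nat).
Hypothesis l1 : 1 < l.
Let l0 : 0 < l. Proof. lia. Qed.
Notation row := (row l).

Lemma sub_row i k r : row i k r - row i k 0 = r. Proof. by rewrite /Windows.row; lia. Qed.
Definition inw i k x := row i k 0 <= x < row i k.+1 0.
Lemma inw_row i k k' r : r < l -> inw i k (row i k' r) = (k == k').
Proof.
move=> rl; rewrite /inw; case: (ltngtP k k') => [h|h|->].
- by have := leq_row l i h; rewrite /Windows.row; lia.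
- by have := leq_row l i h; have := row_lt l1 i k' rl; rewrite /Windows.row; lia.
- by have := row_lt l1 i k' rl; rewrite /Windows.row; lia.
Qed.
Lemma inwP i k x : inw i k x -> exists2 r, r < l & x = row i k r.
Proof. by rewrite /inw => h; exists (x - row i k 0); move: h; rewrite /Windows.row mulSn; lia. Qed.
Definition resb i k (b : seq nat) := [seq x - row i k 0 | x <- b & inw i k x].
Definition res i k (u : bword) := map (resb i k) u.

Lemma count_resb i k r b : r < l -> count_mem r (resb i k b) = count_mem (row i k r) b.
Proof.
move=> rl; rewrite /resb; elim: b => //= x b IH; case: ifP => hx /=; last first.
  by rewrite IH; case: eqP => // e; rewrite e inw_row ?eqxx in hx.
have [s sl ->] := inwP hx; rewrite IH sub_row; congr (nat_of_bool _ + _).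
by apply/eqP/eqP => [->//|e]; case: (row_inj l1 e sl rl).
Qed.
Lemma resb_lt i k b : all (gtn l) (resb i k b).
Proof.
apply/allP => x /mapP [y]; rewrite mem_filter => /andP[/inwP [r rl ->] _] ->.
by rewrite sub_row.
Qed.
Lemma sorted_resb i k b : sorted geq b -> sorted geq (resb i k b).
Proof.
move=> sb; rewrite /resb sorted_map; apply: (@sub_sorted _ geq); first by move=> x y /=; lia.
exact: sorted_filter geq_trans' _ _ sb.
Qed.

Lemma scan_resb i k p c b : p < l.-1 -> resb i k (scan (row i k p) c b) = scan p c (resb i k b) /\
  cnt (row i k p) c b = cnt p c (resb i k b).
Proof.
move=> pl; have e1 : (row i k p).+1 = row i k p.+1 by rewrite /Windows.row addnS.
have w1 : inw i k (row i k p) by rewrite inw_row ?eqxx //; lia.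
have w2 : inw i k (row i k p.+1) by rewrite inw_row ?eqxx //; lia.
rewrite /resb; elim: b c => //= x b IH c; rewrite e1.
case: (x =P row i k p) => [->|xp].
  by rewrite /= w1 /= sub_row eqxx; case: (IH c.+1) => -> ->.
case: (x =P row i k p.+1) => [->|xp1].
  rewrite w2 /= sub_row eqSn eqxx; case: c => [|c] /=; rewrite ?w1 ?w2 /= ?sub_row.
    by case: (IH 0) => -> ->.
  by case: (IH c) => -> ->.
rewrite /=; case: ifP => hx /=; last by case: (IH c) => -> ->.
have [s sl ex] := inwP hx; rewrite ex sub_row.
have -> : (s == p) = false by apply/eqP => e; apply: xp; rewrite ex e.
have -> : (s == p.+1) = false by apply/eqP => e; apply: xp1; rewrite ex e.
by case: (IH c) => -> ->.
Qed.
Lemma scan_resb_other i k k' p c b : p < l.-1 -> k != k' ->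
  resb i k (scan (row i k' p) c b) = resb i k b.
Proof.
move=> pl kk; have e1 : (row i k' p).+1 = row i k' p.+1 by rewrite /Windows.row addnS.
have w1 : inw i k (row i k' p) = false by rewrite inw_row ?(negPf kk) //; lia.
have w2 : inw i k (row i k' p.+1) = false by rewrite inw_row ?(negPf kk) //; lia.
rewrite /resb; elim: b c => //= x b IH c; rewrite e1.
case: (x =P row i k' p) => [->|xp]; first by rewrite /= w1.
case: (x =P row i k' p.+1) => [->|xp1]; last by rewrite /=; case: ifP => hx /=; rewrite IH.
by case: c => [|c] /=; rewrite ?w1 ?w2.
Qed.
Lemma res_EB i k k' p u : p < l.-1 ->
  res i k (EB (row i k' p) u) = if k == k' then EB p (res i k u) else res i k u.
Proof.
move=> pl; rewrite /res /EB; move: 0 => c; case: (k =P k') => [<-|/eqP kk].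
  by elim: u c => //= b u IH c; have [-> ->] := scan_resb i k c b pl; rewrite IH.
by elim: u c => //= b u IH c; rewrite scan_resb_other // IH.
Qed.
Lemma res_EBw i k v u : (forall r, r \in v -> r < l.-1) -> k < K ->
  res i k (EBw (allw l K i v) u) = EBw v (res i k u).
Proof.
move=> hv kK; rewrite /allw.
have one k' u' : res i k (EBw [seq row i k' r | r <- v] u') =
    if k == k' then EBw v (res i k u') else res i k u'.
  elim: v u' hv => [|p v IH] u' hv /=; first by case: eqP.
  rewrite IH => [|r rv]; last by apply: hv; rewrite inE rv orbT.
  by rewrite res_EB ?hv ?mem_head //; case: eqP.
have : count_mem k (iota 0 K) = 1 by rewrite count_uniq_mem ?iota_uniq // mem_iota /= kK.
elim: (iota 0 K) u => //= k' s IH u; rewrite EBw_cat [k' == k]eq_sym.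
case: (k =P k') => [e|ne] /= cs; last by rewrite IH // one; case: eqP.
have {cs} /count_memPn ks : count_mem k s = 0 by move: cs; rewrite add1n => [] [].
have -> : res i k (EBw (flatten [seq [seq row i k' r | r <- v] | k' <- s]) (EBw [seq row i k' r | r <- v] u))
   = res i k (EBw [seq row i k' r | r <- v] u).
  elim: s ks (EBw _ u) {IH} => //= k2 s IH; rewrite inE negb_or => /andP[h1 h2] u2.
  by rewrite EBw_cat IH // one (negPf h1).
by rewrite one e eqxx.
Qed.

(** Periodicity on copies [x] to [y - 1] only. A shift fetches the last row of each copy from the
    next copy, which costs the last one: [y.-1] in [Ap_rot]. *)
Definition Ap i x y (w u : bword) := all (sorted geq) u /\ forall k, x <= k < y -> res i k u = w.
Lemma Ap_E i x y v w u : (forall r, r \in v -> r < l.-1) -> y <= K ->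
  Ap i x y w u -> Ap i x y (EBw v w) (EBw (allw l K i v) u).
Proof.
move=> hv yK [su h]; split; first by rewrite all_sorted_EBw.
by move=> k hk; rewrite res_EBw ?h //; lia.
Qed.

Definition rotb (b : seq nat) := nseq (count_mem 0 b) l.-1 ++ [seq r.-1 | r <- b & r != 0].
Lemma count_rotb r b : all (gtn l) b -> r < l ->
  count_mem r (rotb b) = count_mem (if r == l.-1 then 0 else r.+1) b.
Proof.
move=> hb rl; rewrite /rotb count_cat count_nseq /= [l.-1 == r]eq_sym count_map count_filter.
have e : count (predI (preim predn (pred1 r)) (fun x => x != 0)) b = if r == l.-1 then 0 else count_mem r.+1 b.
  case: ifP => h.
    apply/eqP; rewrite -leqn0 leqNgt -has_count; apply/hasP => [] [x xb /= /andP[]].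
    by have := allP hb x xb; move=> /= h1 h2 h3; lia.
  by apply: eq_count => x /=; apply/andP/eqP; lia.
by rewrite e; case: ifP => _; rewrite ?mul1n ?mul0n ?addn0.
Qed.
Lemma size_rotb b : size (rotb b) = size b.
Proof.
rewrite /rotb size_cat size_nseq size_map size_filter.
by rewrite -(count_predC (pred1 0) b).
Qed.
Lemma rotb_lt b : all (gtn l) b -> all (gtn l) (rotb b).
Proof.
move=> hb; rewrite /rotb all_cat; apply/andP; split.
  by apply/allP => x /nseqP [-> _] /=; lia.
apply/allP => x /mapP [y]; rewrite mem_filter => /andP[y0 /(allP hb) /= yl] -> /=; lia.
Qed.
Lemma sorted_rotb b : sorted geq b -> all (gtn l) b -> sorted geq (rotb b).
Proof.
move=> sb hb; rewrite /rotb; set t := map _ _.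
have st : sorted geq t.
  rewrite sorted_map; apply: (@sub_sorted _ geq); first by move=> x y /=; lia.
  exact: sorted_filter geq_trans' _ _ sb.
have bt : all (geq l.-1) t.
  apply/allP => x /mapP [y]; rewrite mem_filter => /andP[y0 /(allP hb) /= yl] -> /=; lia.
elim: (count_mem 0 b) => //= c IH; rewrite path_min_sorted //.
by rewrite all_cat bt andbT; apply/allP => x /nseqP [-> _] /=.
Qed.
Lemma resb_rotb i k b B : sorted geq b -> resb i k b = B -> resb i k.+1 b = B ->
  resb i.+1 k b = rotb B.
Proof.
move=> sb e1 e2; have BL : all (gtn l) B by rewrite -e1 resb_lt.
have sB : sorted geq B by rewrite -e1 sorted_resb.
apply: sorted_count_eq; rewrite ?sorted_resb ?sorted_rotb // => r.
have [rl|rl] := ltnP r l; last first.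
  have z (s : seq nat) : all (gtn l) s -> count_mem r s = 0.
    by move=> hs; apply/count_memPn/negP => /(allP hs) /=; lia.
  by rewrite !z ?resb_lt ?rotb_lt.
rewrite count_resb // count_rotb //; case: (r =P l.-1) => [->|rn].
  by rewrite -[in RHS]e2 count_resb //; congr (count_mem _ _); rewrite /Windows.row mulSn; lia.
by rewrite -[in RHS]e1 count_resb; [congr (count_mem _ _); rewrite /Windows.row; lia|lia].
Qed.
Lemma Ap_rot i x y w u : Ap i x y w u -> Ap i.+1 x y.-1 (map rotb w) u.
Proof.
move=> [su h]; split=> // k hk.
have e1 := h k; have e2 := h k.+1.
have {}e1 : res i k u = w by apply: e1; lia.
have {}e2 : res i k.+1 u = w by apply: e2; lia.
elim: u w su e1 e2 {h} => [|b u IH] w; first by move=> _ <-.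
case: w => // B w /= /andP[sb su] [e1 f1] [e2 f2].
by rewrite (resb_rotb sb e1 e2) (IH w).
Qed.

(** The test [NP] for one period, where the shift has to be carried out by [rotb]. *)
Fixpoint S (ns ms : seq nat) (w : bword) : bool := match ms, w with
  | m :: ms', B :: w' => (B == nseq m 0) && S (behead ns) ms' (EBw (Wn l (head 0 ns)) (map rotb w'))
  | [::], [::] => true
  | _, _ => false end.

Section Bridge.
Variables (M b : nat).

Lemma sorted_topw i m : sorted geq (topw l M b i m).
Proof.
rewrite /topw; set ks := rev _.
have : sorted gtn ks by rewrite rev_sorted; apply: iota_ltn_sorted.
elim: ks => //= k ks IH sk.
have gk : all (fun k' => k' < k) ks by move: sk => /=; apply: order_path_min => x y z /=; lia.
have {}IH := IH (path_sorted sk).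
have hall : all (geq (row i k 0)) (flatten [seq nseq m (row i k 0) | k <- ks]).
  apply/allP => x /flattenP [t /mapP [k' /(allP gk) h ->]] /nseqP [-> _] /=.
  by apply: leq_row; exact: ltnW.
move: hall IH; move: (flatten _) => F hall sF; elim: {1}m => //= c IH; rewrite path_min_sorted ?IH //.
by rewrite all_cat hall andbT; apply/allP => x /nseqP [-> _] /=.
Qed.
Lemma count_topw i m k r : M - i <= k < b -> r < l ->
  count_mem (row i k r) (topw l M b i m) = if r == 0 then m else 0.
Proof.
move=> hk rl; rewrite /topw count_tops ?rev_uniq ?iota_uniq //; last first.
  by move=> x y _ _ e; case: (row_inj l1 e l0 l0).
rewrite has_rev; case: hasP => [[k' _ /eqP e]|nh]; first by case: (row_inj l1 e rl l0) => _ ->.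
case: eqP => // r0; case: nh; exists k; first by rewrite mem_iota; lia.
by rewrite r0.
Qed.
Lemma actvP i x : actv l M b i x -> exists k r, [/\ M - i <= k < b, r < l & x = row i k r].
Proof.
rewrite /actv => /andP[h1 h2]; exists ((x - i) %/ l), ((x - i) %% l).
have e : x = row i ((x - i) %/ l) ((x - i) %% l).
  by rewrite /Windows.row -addnA -divn_eq; move: h1; rewrite /Windows.row; lia.
have rl : (x - i) %% l < l by rewrite ltn_mod.
split=> //; apply/andP; split; rewrite leqNgt; apply/negP => h.
  by have := leq_row l i h; have := row_lt l1 i ((x - i) %/ l) rl; rewrite -e; lia.
by have := leq_row l i h; rewrite e in h2; move: h2; rewrite /Windows.row; lia.
Qed.
Lemma actv_row i k r : M - i <= k < b -> r < l -> actv l M b i (row i k r).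
Proof.
move=> /andP[h1 h2] rl; rewrite /actv; have := leq_row l i h1; have := leq_row l i h2.
by have := row_lt l1 i k rl; rewrite /Windows.row; lia.
Qed.
Lemma topP i m bb : sorted geq bb ->
  filter (actv l M b i) bb = topw l M b i m <->
  forall k r, M - i <= k < b -> r < l -> count_mem (row i k r) bb = if r == 0 then m else 0.
Proof.
move=> sb; split=> [e k r hk rl|h].
  rewrite -(count_topw m hk rl) -e count_filter; apply: eq_count => x /=.
  by case: eqP => // ->; rewrite actv_row.
apply: sorted_count_eq; [exact: sorted_filter geq_trans' _ _ sb|exact: sorted_topw|].
move=> x; rewrite count_filter; case ax : (actv l M b i x).
  have [k [r [hk rl ex]]] := actvP ax; subst x.
  rewrite count_topw // -(h k r) //; apply: eq_count => x /=.
  by case: eqP => // ->; rewrite ax.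
rewrite (_ : count _ bb = 0); last first.
  apply/eqP; rewrite -leqn0 leqNgt -has_count; apply/hasP => [] [y _ /= /andP[/eqP ->]].
  by rewrite ax.
apply/esym/count_memPn/negP => /flattenP [s /mapP [k + ->]] /nseqP [ex _].
rewrite mem_rev mem_iota => hk; move: ax; rewrite ex actv_row //; lia.
Qed.

(** The last two inequalities are margins: per remaining block, the controlled range grows by one
    copy downwards and the periodic range shrinks by one copy at its upper end. *)
Lemma bridge x y i ns ms w u : Ap i x y w u -> all (sorted geq) w -> all (all (gtn l)) w ->
  shape w = ms -> y <= K -> i + size ms <= M -> M < b ->
  x <= M - (i + size ms) -> b + size ms <= y ->
  NP l K M b i ns ms u <-> S ns ms w.
Proof.
elim: ms ns i y w u => [|m ms IH] ns i y w u [su ap] sw lw sh yK iM Mb xM by_.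
  have e0 : res i M u = w by apply: ap; move: by_ xM => /=; lia.
  by case: w sh e0 {sw lw ap} => // _; case: u su.
case: w sw lw sh ap => // B w /= /andP[sB sw] /andP[lB lw] [szB sh] ap.
have e0 : res i M u = B :: w by apply: ap; move: by_ xM => /=; lia.
case: u su ap e0 => // bb u /= /andP[sb su] ap _.
have apB k : x <= k < y -> resb i k bb = B by move=> /ap [].
have apu : Ap i x y w u by split=> // k /ap [].
have cnd : filter (actv l M b i) bb = topw l M b i m <-> B == nseq m 0.
  rewrite topP //; split=> [h|/eqP eB k r hk rl].
    rewrite -szB; apply/eqP/all_pred1P/allP => r rB; have rl := allP lB _ rB.
    have hM : M - i <= M < b by move: iM => /=; lia.
    have := h M r hM rl; rewrite -count_resb // apB; last by move: xM by_ => /=; lia.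
    by case: eqP => [-> //|_] /= /count_memPn; rewrite rB.
  rewrite -count_resb // apB; last by move: xM by_ => /=; lia.
  by rewrite eB count_nseq /= eq_sym; case: eqP; rewrite ?mul1n.
have ap2 : Ap i.+1 x y.-1 (EBw (Wn l (head 0 ns)) (map rotb w)) (EBw (allw l K i.+1 (Wn l (head 0 ns))) u).
  by apply: Ap_E; [move=> r; exact: (mem_Wn l1)|lia|exact: Ap_rot].
rewrite cnd (IH _ _ _ _ _ ap2).
- by split=> [[-> ->]|/andP[-> ->]].
- rewrite all_sorted_EBw all_map; apply/allP => c cw /=.
  by apply: sorted_rotb; [exact: (allP sw)|exact: (allP lw)].
- rewrite all_EBw ?all_map; first by apply: sub_all lw => c; exact: rotb_lt.
  by move=> p /(mem_Wn l1) /= h; lia.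
- rewrite shape_EBw -sh /shape -map_comp; apply: eq_map => c /=; exact: size_rotb.
- lia.
- by move: iM => /=; lia.
- by [].
- by move: xM => /=; lia.
- by move: by_ => /=; lia.
Qed.
End Bridge.

Lemma NP_mono M b M' b' i ns ms u : M <= M' -> b' <= b -> all (sorted geq) u ->
  NP l K M b i ns ms u -> NP l K M' b' i ns ms u.
Proof.
move=> h1 h2; elim: ms ns i u => [|m ms IH] ns i [|bb u] //= /andP[sb su] [/(topP _ _ _ _ sb) h3 h4]; split.
  by apply/topP => // k r hk rl; apply: h3 => //; lia.
by apply: IH => //; rewrite all_sorted_EBw.
Qed.

Definition unrb i (g : nat -> seq nat) := sort geq (flatten [seq [seq row i k r | r <- g k] | k <- iota 0 K]).
Definition unr i (f : nat -> bword) m := mkseq (fun j => unrb i (fun k => nth [::] (f k) j)) m.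
Definition inr i x := i <= x < row i K 0.

Lemma count_unrb i g k r : (forall k, all (gtn l) (g k)) -> k < K -> r < l ->
  count_mem (row i k r) (unrb i g) = count_mem r (g k).
Proof.
move=> hg kK rl; rewrite /unrb count_sort count_flatten -map_comp.
have e k' : count_mem (row i k r) [seq row i k' r | r <- g k'] = if k' == k then count_mem r (g k') else 0.
  rewrite count_map; case: eqP => [->|ne].
    by apply: eq_count => x /=; apply/eqP/eqP => [|->//]; rewrite /Windows.row; lia.
  apply/eqP; rewrite -leqn0 leqNgt -has_count; apply/hasP => [] [x xg /= /eqP e].
  by case: (row_inj l1 e (allP (hg k') _ xg) rl).
rewrite (eq_map e); have : count_mem k (iota 0 K) = 1 by rewrite count_uniq_mem ?iota_uniq // mem_iota /= kK.
elim: (iota 0 K) => //= k' s IH; case: eqP => [->|ne] /=; last by rewrite !add0n.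
rewrite add1n => [] [] /count_memPn ks; rewrite (_ : sumn _ = 0) ?addn0 //.
elim: s ks {IH} => //= k2 s IH; rewrite inE negb_or eq_sym => /andP[/negPf -> h2].
by rewrite IH.
Qed.
Lemma sorted_unrb i g : sorted geq (unrb i g).
Proof. by apply: sort_sorted => x y /=; lia. Qed.
Lemma resb_unrb i g k : (forall k, all (gtn l) (g k)) -> sorted geq (g k) -> k < K ->
  resb i k (unrb i g) = g k.
Proof.
move=> hg sg kK; apply: sorted_count_eq => //; first exact: sorted_resb (sorted_unrb _ _).
move=> r; have [rl|rl] := ltnP r l; first by rewrite count_resb // count_unrb.
have z (s : seq nat) : all (gtn l) s -> count_mem r s = 0.
  by move=> hs; apply/count_memPn/negP => /(allP hs) /=; lia.
by rewrite !z ?resb_lt.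
Qed.
Lemma inrP i x : inr i x -> exists k r, [/\ k < K, r < l & x = row i k r].
Proof.
move=> h; have : actv l i K i x by move: h; rewrite /inr /actv subnn /Windows.row mul0n !addn0.
by case/actvP => k [r [hk rl ->]]; exists k, r; split=> //; lia.
Qed.
Lemma inr_row i k r : k < K -> r < l -> inr i (row i k r).
Proof.
move=> kK rl; rewrite /inr; have := leq_row l i kK; have := row_lt l1 i k rl.
by rewrite /Windows.row; lia.
Qed.
Lemma inr_unrb i g : (forall k, all (gtn l) (g k)) -> all (inr i) (unrb i g).
Proof.
move=> hg; rewrite /unrb all_sort; apply/allP => x /flattenP [s /mapP [k + ->]] /mapP [r rg ->].
rewrite mem_iota => hk; apply: inr_row; first by lia.
exact: (allP (hg k)).
Qed.

Section Unr.
Variables (i m : nat) (f : nat -> bword).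
Hypotheses (hf : forall k, [/\ size (f k) = m, all (sorted geq) (f k) & all (all (gtn l)) (f k)]).
Let hl j k : all (gtn l) (nth [::] (f k) j).
Proof.
have [h1 _ h3] := hf k; have [jm|jm] := ltnP j m; last by rewrite nth_default ?h1.
by apply: (allP h3); rewrite mem_nth ?h1.
Qed.
Let hs j k : sorted geq (nth [::] (f k) j).
Proof.
have [h1 h2 _] := hf k; have [jm|jm] := ltnP j m; last by rewrite nth_default ?h1.
by apply: (allP h2); rewrite mem_nth ?h1.
Qed.
Lemma sorted_unr : all (sorted geq) (unr i f m).
Proof. by apply/allP => b /mapP [j _ ->]; exact: sorted_unrb. Qed.
Lemma inr_unr : all (all (inr i)) (unr i f m).
Proof. by apply/allP => b /mapP [j _ ->]; exact: inr_unrb. Qed.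
Lemma res_unr k : k < K -> res i k (unr i f m) = f k.
Proof.
move=> kK; have [h1 _ _] := hf k; apply: (@eq_from_nth _ [::]).
  by rewrite size_map size_mkseq h1.
move=> j; rewrite size_map size_mkseq => jm.
by rewrite (nth_map [::]) ?size_mkseq // nth_mkseq // resb_unrb.
Qed.
End Unr.

Lemma eqU i u u' : all (sorted geq) u -> all (sorted geq) u' ->
  all (all (inr i)) u -> all (all (inr i)) u' -> size u = size u' ->
  (forall k, k < K -> res i k u = res i k u') -> u = u'.
Proof.
elim: u u' => [|b u IH] [|b' u'] //= /andP[sb su] /andP[sb' su'] /andP[ib iu] /andP[ib' iu'] [sz] h.
rewrite (IH u') // => [|k /h [] //]; congr (_ :: _).
apply: sorted_count_eq => // x; case ix : (inr i x).
  have [k [r [kK rl ->]]] := inrP ix; rewrite -!count_resb //.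
  by case: (h k kK) => ->.
have z (s : seq nat) : all (inr i) s -> count_mem x s = 0.
  by move=> as_; apply/count_memPn/negP => /(allP as_); rewrite ix.
by rewrite !z.
Qed.
End Fold.

Lemma size_scanB p c u : size (scanB p c u) = size u.
Proof. by rewrite -(size_map size) -/(shape _) shape_scanB size_map. Qed.
Lemma eq_flat (u u' : bword) : shape u = shape u' -> flatten u = flatten u' -> u = u'.
Proof. by move=> h1 h2; rewrite -[u]flattenK h1 h2 flattenK. Qed.

Definition Sw l ns ms : wset := fun x => exists u,
  [/\ shape u = ms, x = flatten u, all (sorted geq) u, all (all (gtn l)) u & S l ns ms u].

Section FGS.
Variables (l : nat) (ns ms : seq nat).
Hypotheses (l1 : 1 < l) (sms : sorted geq ms).
Let m := size ms.
(** The numbers come from the margins of [bridge] for [m] blocks from stage 1 on. A fully periodic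
    word on [K] copies needs [1 + m <= M] and [b + m <= K]. The replaced copies [M] to [b - 1] must
    themselves be a periodic range with both margins, which forces [b] to be about [3 * m]. *)
Let M := m.+1.
Let b := 3 * m + 3.
Let K := 4 * m + 3.
Let Nin q := Nact l M b 1 q && (q \in allw l K 1 (iota 0 l.-1)).

(** The prefix demanded by [FG_NP] is [H0], neutral for the nodes inside copies, and is
    cancelled. *)
Lemma FG_Nin sg : FG Nin (NPw l K M b 1 ns ms sg).
Proof.
have hl r : r \in iota 0 l.-1 -> r < l.-1 by rewrite mem_iota.
have nu : neutral Nin (H0 l M b 1 (head 0 ms)).
  move=> p /andP[_ h]; exact: (@H0_neutral l K M b l1 1 (head 0 ms) (iota 0 l.-1) (ltn0Sn 0) hl).
apply: (FG_neutral _ nu).1; apply: (@FG_sub (Nact l M b 1)); first by move=> p /andP[].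
have gM k : M - 1 < k -> row l 1 (M - 1) 0 <= (row l 1 k 0).-1.
  by move=> hk; have := leq_row l 1 hk; have := @row_lt l l1 1 (M - 1) 0; lia.
apply: FG_NP => //; rewrite ?/M ?/b; try lia.
- by move=> p /andP[ap _]; case: (@H0E l m.+1 (3 * m + 3) l1 1 (head 0 ms) p ap (ltn0Sn 0)).
- move=> k hk; have [|//|_ ->] := @H0E l M b l1 1 (head 0 ms) (row l 1 k 0).-1.
    by apply: gM; rewrite /M; lia.
  by case: hasP => // [] []; exists k => //; rewrite mem_iota /M /b; lia.
Qed.

Lemma FG_Nin_w v sg : all (gtn l.-1) v -> FG Nin (Fw (allw l K 1 v) (NPw l K M b 1 ns ms sg)).
Proof.
move=> /allP hv; move: (@FG_Nin sg); apply: FG_mixed => p pv.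
case: (@allw_mixed l K M b l1 1 v p hv pv) => h; last by right=> q /andP[/h].
left; rewrite /Nin h /=; have [k [r [kK rv ->]]] := allw_mem pv.
apply/flattenP; exists [seq row l 1 k r | r <- iota 0 l.-1].
  by apply: map_f; rewrite mem_iota.
by apply: map_f; rewrite mem_iota; exact: hv.
Qed.

Definition okw w := [/\ shape w = ms, all (sorted geq) w & all (all (gtn l)) w].

Lemma okw_EBw v w : all (gtn l.-1) v -> okw (EBw v w) <-> okw w.
Proof.
move=> /allP hv; rewrite /okw shape_EBw all_sorted_EBw all_EBw // => p /hv /= h; lia.
Qed.

(** Starting from [w] in all copies, [w] is replaced by [w'] one copy at a time. Consecutive words
    lie on one string of the node [row l 1 t p], and the earlier one is not its head because [E p]
    moves [w]; so the string property on the line carries the test along, and [bridge] reads it off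
    for [w']. *)
Lemma S_fibre v p w w' : all (gtn l.-1) v -> p < l.-1 -> okw w -> okw w' ->
  EB p w' = EB p w -> EB p w <> w -> S l ns ms (EBw v w) -> S l ns ms (EBw v w').
Proof.
move=> av pl ok ok' e ne Sw_; have hv := allP av.
pose f t k := if M <= k < t then w' else w.
have hf t k : [/\ size (f t k) = m, all (sorted geq) (f t k) & all (all (gtn l)) (f t k)].
  have sz x : okw x -> size x = m by move=> [h _ _]; rewrite /m -h size_map.
  by rewrite /f; case: ifP => _; [have [h1 h2 h3] := ok'|have [h1 h2 h3] := ok]; split=> //; exact: sz.
pose U t := unr l K 1 (f t) m.
have rU t k : k < K -> res l 1 k (U t) = f t k by move=> kK; apply: res_unr.
have sU t : all (sorted geq) (U t) by apply: sorted_unr.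
have Z t : M <= t <= b -> NP l K M b 1 ns ms (EBw (allw l K 1 v) (U t)).
  elim: t => [|t IH] ht; first by move: ht; rewrite /M; lia.
  have [Mt|Mt] := ltnP t M.
    have et : t.+1 = M by move: ht; lia.
    have Ap0 : Ap l 1 0 K w (U t.+1).
      split=> // k hk; rewrite rU ?/f //; case: ifP => //; move: et; lia.
    apply/(bridge l1 ns (Ap_E l1 hv (leqnn K) Ap0)) => //; rewrite ?/M ?/b ?/K -/m; try lia.
    - by rewrite all_sorted_EBw; case: ok.
    - by have [_ _] := (okw_EBw w av).2 ok.
    - by rewrite shape_EBw; case: ok.
  have tK : t < K by move: ht; rewrite /b /K; lia.
  pose q := row l 1 t p.
  have iq : inr l K 1 q = inr l K 1 q.+1.
    have eq1 : q.+1 = row l 1 t p.+1 by rewrite /q /row addnS.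
    by rewrite eq1 /q !inr_row //; lia.
  have iU x : all (all (inr l K 1)) (U x) by apply: inr_unr.
  have eU : EB q (U t.+1) = EB q (U t).
    apply: (@eqU l K l1 1); rewrite ?all_sorted_scanB ?all_scanB //.
      by rewrite /EB !size_scanB /U /unr !size_mkseq.
    move=> k kK; rewrite !res_EB // !rU //; case: (k =P t) => [->|/eqP kt]; last first.
      by rewrite /f; congr (if _ then _ else _); lia.
    rewrite /f ltnS leqnn ltnn andbF andbT; case: ifP => // _; exact: e.
  have nU : EB q (U t) <> U t.
    move/(congr1 (res l 1 t)); rewrite res_EB // eqxx rU // /f ltnn andbF; exact: ne.
  have shU : shape (U t.+1) = shape (U t).
    by rewrite -(shape_scanB q 0 (U t.+1)) -/(EB q _) eU shape_scanB.
  have Nq : Nin q.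
    rewrite /Nin; apply/andP; split.
      have tb : t.+1 <= b by lia.
      have Mt' : M - 1 <= t by lia.
      rewrite /Nact; have := leq_row l 1 tb; have := leq_row l 1 Mt'.
      by have := @row_lt l l1 1 t p.+1; rewrite /q /row; lia.
    apply/flattenP; exists [seq row l 1 t r | r <- iota 0 l.-1].
      by apply: map_f; rewrite mem_iota.
    by apply: map_f; rewrite mem_iota.
  have fZ := @FG_Nin_w v (shape (U t)) av.
  have [|_ h] := fZ [::] q erefl Nq (flatten (U t)).
    rewrite /Fw /= -flatten_EBw; exists (EBw (allw l K 1 v) (U t)); split=> //; first by rewrite shape_EBw.
    by apply: IH; lia.
  have [||u [h1 h2 h3]] := h _ (flatten (U t.+1)).
  - rewrite /E -flatten_scanB => /eq_flat; rewrite shape_scanB => /(_ erefl); exact: nU.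
  - by rewrite /E -!flatten_scanB -!/(EB _ _) eU.
  - rewrite /= -flatten_EBw in h2; rewrite (eq_flat _ h2) //.
    by rewrite shape_EBw h1 shU.
(* The middle of the replaced copies, with exactly the margins [m.+1] below and [m] above that
   [bridge] asks for. *)
pose M2 := 2 * m + 2; pose b2 := 2 * m + 3.
have Zb : NP l K M2 b2 1 ns ms (EBw (allw l K 1 v) (U b)).
  apply: (@NP_mono l K l1 M b); rewrite ?all_sorted_EBw //; try by rewrite /M /M2 /b /b2; lia.
  by apply: Z; rewrite /M /b; lia.
have Ap1 : Ap l 1 M b w' (U b).
  by split=> // k hk; rewrite rU ?/f ?hk //; move: hk; rewrite /b /K; lia.
have bK : b <= K by rewrite /b /K; lia.
suff [h _] : NP l K M2 b2 1 ns ms (EBw (allw l K 1 v) (U b)) <-> S l ns ms (EBw v w') by exact: h.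
apply: (bridge l1 ns (Ap_E l1 hv bK Ap1)) => //; rewrite ?/M ?/M2 ?/b2 ?/b ?/K -/m; try lia.
- by rewrite all_sorted_EBw; case: ok'.
- by have [_ _] := (okw_EBw w' av).2 ok'.
- by rewrite shape_EBw; case: ok'.
Qed.

Theorem FG_S : FG (gtn l.-1) (Sw l ns ms).
Proof.
move=> v p av Np x.
have SwP y : Fw v (Sw l ns ms) y <-> exists w, [/\ y = flatten w, okw w & S l ns ms (EBw v w)].
  split=> [[u [h1 h2 h3 h4 h5]]|[w [-> ok h]]]; last first.
    have [h1 h2 h3] := (okw_EBw w av).2 ok.
    by exists (EBw v w); split=> //; rewrite flatten_EBw.
  have sy : sumn ms = size y by rewrite -h1 -size_flatten -h2 size_Eword.
  have sr : shape (reshape ms y) = ms by apply: reshapeKl; rewrite sy.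
  have fr : flatten (reshape ms y) = y by apply: reshapeKr; rewrite sy.
  have eu : EBw v (reshape ms y) = u.
    by apply: eq_flat; rewrite ?shape_EBw ?sr // flatten_EBw fr.
  exists (reshape ms y); split=> //; last by rewrite eu.
  by apply/(okw_EBw _ av); rewrite eu.
have fib y : Fw v (Sw l ns ms) x -> E p x <> x -> E p y = E p x -> Fw v (Sw l ns ms) y.
  move=> /SwP [w [-> ok hS]] ne e; apply/SwP.
  have [sh _ _] := ok; have sy : sumn ms = size y.
    by rewrite -(size_scan p 0 y) [scan _ _ _]e size_scan size_flatten sh.
  have sr : shape (reshape ms y) = ms by apply: reshapeKl; rewrite sy.
  have fr : flatten (reshape ms y) = y by apply: reshapeKr; rewrite sy.
  have ew : EB p (reshape ms y) = EB p w.
    by apply: eq_flat; rewrite /EB ?shape_scanB ?flatten_scanB ?sr ?fr.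
  have ap : all (gtn l.-1) [:: p] by apply/andP.
  have ok' : okw (reshape ms y).
    by apply/(@okw_EBw [:: p] _ ap); rewrite /= ew; apply/(@okw_EBw [:: p] _ ap).
  exists (reshape ms y); split=> //; apply: (S_fibre av Np ok ok' ew) => // h.
  by apply: ne; rewrite /E -flatten_scanB -/(EB p w) h.
move=> hx; split; last by move=> ne w' e; apply: fib.
have [e|/eqP ne] := eqVneq (E p x) x; first by rewrite e.
by apply: fib => //; rewrite E_idem.
Qed.
End FGS.
End Folding.

(** * Jacobi-Trudi determinants under Demazure operators *)

Module JacobiTrudi.
From mathcomp Require Import all_boot all_order all_fingroup all_algebra zify ring.
Import Scan FilteredSets Columns KnuthMoves Dominance Windows Folding.
Import GRing.Theory.
Local Open Scope ring_scope.

Section Complete.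
Variable A : comNzRingType.
Implicit Types (xs ys : seq A) (m : nat) (z : int).

Fixpoint hl xs m : A := if xs is y :: xs' then \sum_(j < m.+1) y ^+ j * hl xs' (m - j) else (m == 0%N)%:R.
Definition hZ xs z : A := if z is Posz m then hl xs m else 0.

Lemma hl0 xs : hl xs 0 = 1.
Proof. by elim: xs => //= y xs IH; rewrite big_ord1 expr0 mul1r. Qed.
Lemma hlS y xs m : hl (y :: xs) m.+1 = hl xs m.+1 + y * hl (y :: xs) m.
Proof.
rewrite /= big_ord_recl expr0 mul1r subn0; congr (_ + _).
by rewrite mulr_sumr; apply: eq_bigr => j _; rewrite lift0 subSS mulrA -exprS.
Qed.
Lemma hZ_cons y xs z : hZ (y :: xs) z = hZ xs z + y * hZ (y :: xs) (z - 1).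
Proof.
case: z => [[|m]|m].
- by rewrite sub0r /hZ !hl0 /= mulr0 addr0.
- by have -> : Posz m.+1 - 1 = m by [lia]; rewrite /hZ hlS.
- have -> : Negz m - 1 = Negz m.+1 by lia.
  by rewrite /hZ mulr0 addr0.
Qed.

Lemma hl_swap a y t xs m : hl (a ++ y :: t :: xs) m = hl (a ++ t :: y :: xs) m.
Proof.
elim: a m => [|b a IH] m /=; last by apply: eq_bigr => j _; rewrite IH.
rewrite -[LHS]/(hl (y :: t :: xs) m) -[RHS]/(hl (t :: y :: xs) m).
elim/ltn_ind: m => [] [|m] IH; first by rewrite !hl0.
case: m IH => [|m] IH; first by rewrite !hlS !hl0; ring.
rewrite (hlS y (t :: xs)) (hlS t (y :: xs)) (hlS t xs m.+1) (hlS y xs m.+1).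
have e1 := hlS t (y :: xs) m; have e2 := hlS y (t :: xs) m.
have -> : hl (t :: xs) m.+1 = hl (y :: t :: xs) m.+1 - y * hl (y :: t :: xs) m by rewrite e2; ring.
have -> : hl (y :: xs) m.+1 = hl (t :: y :: xs) m.+1 - t * hl (t :: y :: xs) m by rewrite e1; ring.
by rewrite (IH m.+1) // (IH m) //; ring.
Qed.
Lemma hl_front a y xs m : hl (a ++ y :: xs) m = hl (y :: a ++ xs) m.
Proof.
elim: a m => [|b a IH] m //=.
rewrite -[RHS]/(hl (y :: b :: a ++ xs) m) -[RHS](hl_swap [::] b y (a ++ xs) m) /=.
by apply: eq_bigr => j _; rewrite IH.
Qed.
Lemma hl_perm xs ys m : perm_eq xs ys -> hl xs m = hl ys m.
Proof.
elim: xs ys m => [|h hs IH] ys m; first by rewrite perm_sym => /perm_nilP ->.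
move=> p; have : h \in ys by rewrite -(perm_mem p) inE eqxx.
move=> /splitPr e; case: e p => s1 s2 p.
have p' : perm_eq hs (s1 ++ s2).
  by rewrite -(perm_cons h); apply: perm_trans p _; rewrite perm_catC /= perm_cons perm_catC.
by rewrite hl_front /=; apply: eq_bigr => j _; rewrite (IH _ _ p').
Qed.
Lemma hZ_perm xs ys z : perm_eq xs ys -> hZ xs z = hZ ys z.
Proof. by move=> p; case: z => m //=; apply: hl_perm. Qed.

Lemma hl_divided y t xs m :
  (y - t) * hl (y :: t :: xs) m = y * hl (y :: xs) m - t * hl (t :: xs) m.
Proof.
elim: m => [|m IH]; first by rewrite !hl0; ring.
rewrite (hlS y (t :: xs)) mulrDr mulrCA IH (hlS y xs) (hlS t xs); ring.
Qed.

Lemma hZ_expand y xs z (K : nat) : z < K%:Z -> hZ (y :: xs) z = \sum_(j < K) y ^+ j * hZ xs (z - j%:Z).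
Proof.
case: z => m; last first.
  move=> _; rewrite [LHS]/= big1 // => j _.
  by have -> : Negz m - j%:Z = Negz (m + j) by [lia]; rewrite mulr0.
rewrite ltz_nat => mK; rewrite [LHS]/= -(big_mkord xpredT (fun j => y ^+ j * hl xs (m - j))).
rewrite -(big_mkord xpredT (fun j => y ^+ j * hZ xs (Posz m - Posz j))).
rewrite (@big_cat_nat _ _ _ m.+1 0 K) //= [X in _ = _ + X]big_nat [X in _ = _ + X]big1 ?addr0.
  by apply: eq_big_nat => j jm; rewrite subzn ?(ltnW jm) //; move: jm; lia.
move=> j hj; have -> : Posz m - Posz j = Negz (j - m).-1 by move: hj; lia.
by rewrite /= mulr0.
Qed.

(** The Jacobi-Trudi determinant of an arbitrary integer sequence in the variables [xs]; for
    partitions a Schur function. *)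
Definition sh xs r (al : nat -> int) : A :=
  \det (\matrix_(a < r, b < r) hZ xs (al a - a%:Z + b%:Z)).

Lemma sh_perm xs ys r al : perm_eq xs ys -> sh xs r al = sh ys r al.
Proof. by move=> p; congr (\det _); apply/matrixP => a b; rewrite !mxE (hZ_perm _ p). Qed.
Lemma eq_sh xs r al al' : (forall a, (a < r)%N -> al a = al' a) -> sh xs r al = sh xs r al'.
Proof. by move=> e; congr (\det _); apply/matrixP => a b; rewrite !mxE e. Qed.

Lemma sh0 xs al : sh xs 0 al = 1.
Proof. by rewrite /sh det_mx00. Qed.

(* The column operations C_b - y C_(b-1) turn the complete functions in y, xs
   into those in xs. *)
Lemma sh_cons_det y xs (a0 r : nat) (al : nat -> int) :
  y ^+ a0 * sh xs r al = \det (\matrix_(a < r.+1, b < r.+1)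
     (if a == 0%N :> nat then y ^+ (a0 + b) else hZ (y :: xs) (al a.-1 - a%:Z + b%:Z))).
Proof.
set M := (X in _ = \det X).
pose T : 'M[A]_r.+1 := \matrix_(c, b) ((c == b)%:R - y * ((c.+1 == b :> nat))%:R).
have dT : \det T = 1.
  rewrite -det_tr det_trig; last first.
    apply/is_trig_mxP => i j ij; rewrite !mxE.
    have -> : (j == i) = false by apply/negP => /eqP e; rewrite e ltnn in ij.
    have -> : (j.+1 == i :> nat) = false by apply/eqP; lia.
    by rewrite mulr0 subr0.
  by apply: big1 => i _; rewrite !mxE eqxx gtn_eqF // mulr0 subr0.
pose N := M *m T.
have NE a b : N a b = M a b - y * (if b == 0 :> nat then 0 else M a (inord b.-1)).
  rewrite mxE; under eq_bigr do rewrite [T _ _]mxE mulrBr.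
  rewrite big_split /= sumrN; congr (_ - _).
    rewrite (bigD1 b) //= eqxx mulr1 big1 ?addr0 // => c /negPf cb.
    by rewrite cb mulr0.
  case: (nat_of_ord b =P 0%N) => [b0|b0].
    by rewrite mulr0 big1 // => c _; rewrite b0 mulrA mulr0.
  rewrite (bigD1 (inord b.-1)) //= big1 ?addr0; last first.
    move=> c /negPf cb; have -> : (c.+1 == b :> nat) = false; last by rewrite !mulr0.
    apply/eqP => e; move/negP: cb; apply; apply/eqP/val_inj.
    by rewrite /= inordK -e //=; apply: ltn_ord.
  have -> : (nat_of_ord (inord b.-1 : 'I_r.+1)).+1 == b.
    by rewrite inordK; have := ltn_ord b; lia.
  by rewrite mulr1 mulrC.
have <- : \det N = \det M by rewrite det_mulmx dT mulr1.
rewrite (expand_det_row _ ord0) big_ord_recl big1 ?addr0; last first.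
  move=> b _; rewrite NE !mxE /= inordK; last by have := ltn_ord b; rewrite /bump; lia.
  by rewrite /bump /= add1n /= addnS exprS subrr mul0r.
rewrite NE !mxE /= mulr0 subr0 addn0; congr (_ * _).
rewrite /cofactor /= addn0 expr0 mul1r; congr (\det _); apply/matrixP => a b.
rewrite [LHS]mxE [RHS]mxE [RHS]mxE NE !mxE /= /bump /= !add1n /= inordK; last by have := ltn_ord b; lia.
rewrite (hZ_cons y xs); have -> : al a - a.+1%:Z + b.+1%:Z = al a - a%:Z + b%:Z by lia.
have -> : al a - a.+1%:Z + b%:Z = al a - a%:Z + b%:Z - 1 by lia.
by rewrite addrK.
Qed.

Definition consf (a0 : nat) (al : nat -> int) : nat -> int := fun a => if a is a'.+1 then al a' else a0%:Z.

Lemma sh_cons_row xs (a0 r : nat) al :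
  sh xs r.+1 (consf a0 al) = \det (\matrix_(a < r.+1, b < r.+1)
     (if a == 0%N :> nat then hl xs (a0 + b) else hZ xs (al a.-1 - a%:Z + b%:Z))).
Proof.
congr (\det _); apply/matrixP => a b; rewrite !mxE; case: a => [[|a] ha] //=.
by rewrite addn0.
Qed.

Fixpoint vecs (K r : nat) : seq (seq nat) :=
  if r is r'.+1 then [seq k :: v | k <- iota 0 K, v <- vecs K r'] else [:: [::]].

Lemma prod_vecs K r (F : nat -> nat -> A) :
  \prod_(a < r) \sum_(j < K) F a j = \sum_(v <- vecs K r) \prod_(a < r) F a (nth 0%N v a).
Proof.
elim: r F => [|r IH] F /=; first by rewrite big_ord0 big_seq1 big_ord0.
rewrite big_ord_recl (IH (fun a j => F a.+1 j)) /= big_allpairs_dep /=.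
rewrite -(big_mkord xpredT (F 0%N)) /index_iota subn0 mulr_suml; apply: eq_bigr => k _.
rewrite mulr_sumr; apply: eq_bigr => v _; rewrite big_ord_recl; congr (_ * _).
Qed.
Lemma size_vecs K r v : v \in vecs K r -> size v = r.
Proof.
elim: r v => [|r IH] v /=; first by rewrite inE => /eqP ->.
by case/allpairsPdep => k [v' [_ /IH <- ->]].
Qed.

(** Each row is expanded in powers of [y] and the determinant is multilinear. The bound makes every
    index smaller than [K], beyond which the complete functions vanish. *)
Lemma sh_expand y xs r (al : nat -> int) (K : nat) :
  (forall a, (a < r)%N -> (al a + r%:Z <= K%:Z)%R) ->
  sh (y :: xs) r al = \sum_(v <- vecs K r) y ^+ sumn v * sh xs r (fun a => al a - (nth 0%N v a)%:Z).
Proof.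
move=> hK; rewrite /sh /determinant.
transitivity (\sum_(s : 'S_r) \sum_(v <- vecs K r)
    (-1) ^+ s * (y ^+ sumn v * \prod_(a < r) hZ xs (al a - (nth 0%N v a)%:Z - a%:Z + (s a)%:Z))).
  apply: eq_bigr => s _; rewrite -mulr_sumr; congr (_ * _).
  pose F (a j : nat) := if insub a is Some a' then
     y ^+ j * hZ xs (al a - j%:Z - a%:Z + (s (a' : 'I_r))%:Z) else 0.
  transitivity (\prod_(a < r) \sum_(j < K) F a j).
    apply: eq_bigr => a _; rewrite mxE (hZ_expand _ _ (K := K)).
      apply: eq_bigr => j _; rewrite /F insubT // => la.
      have -> : Sub (nat_of_ord a) la = a by exact: val_inj.
      by congr (_ * hZ _ _); lia.
    by have := hK a (ltn_ord a); have := ltn_ord (s a); lia.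
  rewrite prod_vecs big_seq [RHS]big_seq; apply: eq_bigr => v /size_vecs sv.
  have -> : y ^+ sumn v = \prod_(a < r) y ^+ nth 0%N v a.
    by rewrite -sv -(big_mkord xpredT (fun a => y ^+ nth 0%N v a)) -(big_nth 0%N xpredT (fun k => y ^+ k)) sumnE; elim: (v) => [|k w IHw]; rewrite ?big_nil ?expr0 // !big_cons exprD IHw.
  rewrite -big_split /=; apply: eq_bigr => a _; rewrite /F insubT // => la.
  by have -> : Sub (nat_of_ord a) la = a by exact: val_inj.
rewrite exchange_big /=; apply: eq_bigr => v _.
rewrite mulr_sumr; apply: eq_bigr => s _; rewrite mulrCA; congr (_ * (_ * _)).
by apply: eq_bigr => a _; rewrite mxE.
Qed.
End Complete.

Section Demazure.
Variables (A : idomainType) (l : nat) (x : nat -> A) (s : nat -> {rmorphism A -> A}).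
Hypotheses (sx : forall p r, (p.+1 < l)%N -> (r < l)%N ->
    s p (x r) = x (if r == p then p.+1 else if r == p.+1 then p else r))
  (nz : forall p, (p.+1 < l)%N -> x p != x p.+1).

Definition pirel p (f g : A) := (x p - x p.+1) * g = x p * f - x p.+1 * s p f.
Fixpoint piw (v : seq nat) (f g : A) : Prop :=
  if v is p :: v' then exists2 g', piw v' f g' & pirel p g' g else f = g.

Lemma pirel_uniq p f g g' : (p.+1 < l)%N -> pirel p f g -> pirel p f g' -> g = g'.
Proof. by move=> pl h1 h2; apply: (mulfI (_ : x p - x p.+1 != 0)); rewrite ?subr_eq0 ?nz // h1 h2. Qed.
Lemma piw_uniq v f g g' : all (fun p => p.+1 < l)%N v -> piw v f g -> piw v f g' -> g = g'.
Proof.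
elim: v g g' => [|p v IH] g g' /=; first by move=> _ <- <-.
move=> /andP[pl av] [h h1 h2] [h' h3 h4]; rewrite -(IH h h') // in h4.
exact: pirel_uniq pl h2 h4.
Qed.
Lemma pirel_sum (I : eqType) (r : seq I) (P : pred I) p (f g : I -> A) :
  (forall i, i \in r -> P i -> pirel p (f i) (g i)) -> pirel p (\sum_(i <- r | P i) f i) (\sum_(i <- r | P i) g i).
Proof.
move=> h; rewrite /pirel rmorph_sum !mulr_sumr -sumrB big_seq_cond [RHS]big_seq_cond.
by apply: eq_bigr => i /andP[ir Pi]; exact: h.
Qed.
Lemma pirel_mul p c f g : s p c = c -> pirel p f g -> pirel p (c * f) (c * g).
Proof. by move=> e h; rewrite /pirel rmorphM e mulrCA h mulrBr; congr (_ - _); rewrite mulrCA. Qed.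
Lemma pirel_sym p f : s p f = f -> pirel p f f.
Proof. by rewrite /pirel => ->; rewrite mulrBl. Qed.
Lemma piw_sum (I : eqType) (r : seq I) (P : pred I) v (f g : I -> A) :
  (forall i, i \in r -> P i -> piw v (f i) (g i)) -> piw v (\sum_(i <- r | P i) f i) (\sum_(i <- r | P i) g i).
Proof.
elim: v f g => [|p v IH] f g h /=.
  by rewrite big_seq_cond [RHS]big_seq_cond; apply: eq_bigr => i /andP[ir Pi]; apply: h.
have hc i : exists g', i \in r -> P i -> piw v (f i) g' /\ pirel p g' (g i).
  case ir : (i \in r); last by exists 0.
  case Pi : (P i); last by exists 0.
  by have [g' h1 h2] := h i ir Pi; exists g'.
have [g' hg] : exists g' : I -> A, forall i, i \in r -> P i -> piw v (f i) (g' i) /\ pirel p (g' i) (g i).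
  clear IH h; elim: r hc => [|a r IHr] hc; first by exists (fun=> 0).
  have [|g' hg] := IHr.
    by move=> i; have [gi hi] := hc i; exists gi => ir; apply: hi; rewrite inE ir orbT.
  have [ga ha] := hc a; exists (fun i => if i == a then ga else g' i) => i.
  by rewrite inE; case: eqP => [->|ne] /=; [move=> _; apply: ha; rewrite mem_head|exact: hg].
exists (\sum_(i <- r | P i) g' i); first by apply: IH => i ir Pi; case: (hg i ir Pi).
apply: pirel_sum => i ir Pi.
by case: (hg i ir Pi).
Qed.
Lemma piw_mul v c f g : {in v, forall p, s p c = c} -> piw v f g -> piw v (c * f) (c * g).
Proof.
elim: v g => [|p v IH] g hc /=; first by move=> ->.
move=> [g' h1 h2]; exists (c * g'); first by apply: IH => // q qv; apply: hc; rewrite inE qv orbT.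
by apply: pirel_mul h2; apply: hc; rewrite mem_head.
Qed.
Lemma piw_cat v v' f g h : piw v' f g -> piw v g h -> piw (v ++ v') f h.
Proof. by elim: v h => [|p v IH] h /= h1; [move=> <-|move=> [g' h2 h3]; exists g'; [apply: IH|]]. Qed.
Lemma piw_sym v f : {in v, forall p, s p f = f} -> piw v f f.
Proof.
elim: v => //= p v IH h; exists f; first by apply: IH => q qv; apply: h; rewrite inE qv orbT.
by apply: pirel_sym; apply: h; rewrite mem_head.
Qed.

Definition xs k := [seq x r | r <- iota k (l - k)].

Lemma s_hl p (zs : seq A) m : s p (hl zs m) = hl [seq s p z | z <- zs] m.
Proof.
elim: zs m => [|z zs IH] m /=; first by rewrite rmorph_nat.
by rewrite rmorph_sum; apply: eq_bigr => j _; rewrite rmorphM rmorphXn IH.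
Qed.
Lemma s_hZ p (zs : seq A) z : s p (hZ zs z) = hZ [seq s p z | z <- zs] z.
Proof. by case: z => m /=; [exact: s_hl|rewrite rmorph0]. Qed.
Lemma s_sh p (zs : seq A) r al : s p (sh zs r al) = sh [seq s p z | z <- zs] r al.
Proof.
rewrite /sh -det_map_mx; congr (\det _); apply/matrixP => a b; rewrite !mxE; exact: s_hZ.
Qed.

Lemma perm_xs k p : (k <= p)%N -> (p.+1 < l)%N -> perm_eq [seq s p z | z <- xs k] (xs k).
Proof.
move=> kp pl; rewrite /xs -map_comp.
have -> : iota k (l - k) = iota k (p - k) ++ p :: p.+1 :: iota p.+2 (l - p.+2).
  have -> : (l - k = (p - k) + (l - p.+2).+2)%N by lia.
  by rewrite iotaD /=; have -> : (k + (p - k) = p)%N by lia.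
have e (r1 r2 : nat) : (r1 + r2 <= l)%N -> ((r1 + r2 <= p) || (p.+1 < r1))%N ->
    [seq (s p \o x) r | r <- iota r1 r2] = [seq x r | r <- iota r1 r2].
  move=> h1 h2; apply/eq_in_map => r; rewrite mem_iota => hr /=; rewrite sx //; last by lia.
  by do 2 (case: eqP => ?; first by lia).
rewrite !map_cat e /=; [|lia|lia]; rewrite (e p.+2); [|lia|lia].
rewrite perm_cat2l !sx ?eqxx ?gtn_eqF //; try lia.
by apply/seq.permP => P /=; rewrite addnCA.
Qed.
Lemma s_sh_xs k p r al : (k <= p)%N -> (p.+1 < l)%N -> s p (sh (xs k) r al) = sh (xs k) r al.
Proof. by move=> kp pl; rewrite s_sh; apply: sh_perm; apply: perm_xs. Qed.

(** Each operator adjoins the next variable to a complete function: this is [hl_divided]. *)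
Lemma pi_power k d m : (k + d < l)%N ->
  piw (rev (iota k d)) (x k ^+ m) (hl (rev [seq x r | r <- iota k d.+1]) m).
Proof.
elim: d => [|d IH] kd.
  rewrite /= big_ord_recr /= subnn mulr1 big1 ?add0r // => j _.
  by rewrite subn_eq0 leqNgt ltn_ord mulr0.
have io (c : nat) : iota k c.+1 = rcons (iota k c) (k + c)%N by rewrite -addn1 iotaD cats1.
rewrite [in rev (iota _ _)]io rev_rcons; exists (hl (rev [seq x r | r <- iota k d.+1]) m).
  by apply: IH; lia.
rewrite !io !map_rcons !rev_rcons /pirel s_hl /=.
set Y := rev _; have -> : [seq s (k + d) z | z <- Y] = Y.
  rewrite /Y map_rev -map_comp; congr rev; apply/eq_in_map => r; rewrite mem_iota => hr /=.
  by rewrite sx; [do 2 (case: eqP => ?; first by lia)|lia|lia].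
rewrite sx ?eqxx; try lia.
rewrite addnS -[X in X = _]/((x (k + d) - x (k + d).+1) * hl [:: x (k + d).+1, x (k + d)%N & Y] m).
by rewrite (hl_swap [::]) /= -hl_divided.
Qed.
Lemma xs_cons k : (k < l)%N -> xs k = x k :: xs k.+1.
Proof. by move=> kl; rewrite /xs; have -> : (l - k = (l - k.+1).+1)%N by lia. Qed.

Lemma pi_h k m : (k < l)%N -> piw (rev (iota k (l.-1 - k))) (x k ^+ m) (hl (xs k) m).
Proof.
move=> kl; have := @pi_power k (l.-1 - k) m; rewrite (_ : (l.-1 - k).+1 = (l - k)%N); last by lia.
rewrite -/(xs k) => h; rewrite -(@hl_perm _ (rev (xs k))); first by apply: h; lia.
by rewrite perm_rev.
Qed.

(** By [sh_cons_det] both sides are determinants with the same lower rows, which are symmetric from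
    the variable [k] on. Expanding along the first row, the operators act on powers of [x k] alone
    and give complete functions. *)
Lemma pi_sh k a0 r al : (k < l)%N -> piw (rev (iota k (l.-1 - k)))
  (x k ^+ a0 * sh (xs k.+1) r al) (sh (xs k) r.+1 (consf a0 al)).
Proof.
move=> kl; rewrite sh_cons_det sh_cons_row -xs_cons //.
set M := (X in piw _ (\det X) _); set M' := (X in piw _ _ (\det X)).
rewrite (expand_det_row M ord0) (expand_det_row M' ord0).
have ec b : cofactor M' ord0 b = cofactor M ord0 b.
  rewrite /cofactor; congr (_ * \det _); apply/matrixP => i j; rewrite !mxE //=.
apply: piw_sum => b _ _; rewrite ec !mxE /= ![_ * cofactor _ _ _]mulrC.
apply: piw_mul; last exact: pi_h.
move=> p; rewrite mem_rev mem_iota => hp; rewrite /cofactor rmorphM rmorph_sign -det_map_mx.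
congr (_ * \det _); apply/matrixP => i j; rewrite !mxE /= s_hZ.
by apply: hZ_perm; apply: perm_xs; lia.
Qed.

(* Monomial in the first k variables, Jacobi-Trudi in the other ones. *)
Definition Sg k L (g : nat -> int) : A :=
  (\prod_(j < k) x j ^+ absz (g j)) * sh (xs k) (L - k) (fun a => g (k + a)%N).

Lemma s_mon k p (e : nat -> nat) : (k <= p)%N -> (p.+1 < l)%N -> s p (\prod_(j < k) x j ^+ e j) = \prod_(j < k) x j ^+ e j.
Proof.
move=> kp pl; rewrite rmorph_prod; apply: eq_bigr => j _; rewrite rmorphXn; have := ltn_ord j => jk.
by rewrite sx; [do 2 (case: eqP => ?; first by lia)|lia|lia].
Qed.
Lemma pi_Sg_step k L (g : nat -> int) : (k < l)%N -> (k < L)%N -> (0 <= g k)%R ->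
  piw (rev (iota k (l.-1 - k))) (Sg k.+1 L g) (Sg k L g).
Proof.
move=> kl kL g0; rewrite /Sg big_ord_recr /= -mulrA; apply: piw_mul.
  by move=> p; rewrite mem_rev mem_iota => hp; apply: (s_mon (fun j => absz (g j))); lia.
have := @pi_sh k (absz (g k)) (L - k.+1) (fun a => g (k.+1 + a)%N) kl.
rewrite (_ : (L - k.+1).+1 = (L - k)%N); last by lia.
rewrite (@eq_sh _ (xs k) _ (consf _ _) (fun a => g (k + a)%N)) // => [] [|a] _ /=.
  by rewrite addn0 gez0_abs.
by rewrite addnS.
Qed.
(** The runs of the staircase move one variable after another from the monomial into the
    determinant, down to [lo]; runs meeting a symmetric function do nothing. The exponents still in
    the monomial must be natural numbers, as [Sg] takes absolute values. *)
Lemma pi_Sg m lo k L (g : nat -> int) : (lo + m = l.-1)%N -> (0 < l)%N -> (k <= l)%N -> (k <= L)%N ->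
  (forall j, (j < k)%N -> 0 <= g j) -> piw (w0w m lo) (Sg k L g) (Sg (minn lo k) L g).
Proof.
elim: m lo => [|m IH] lo lm l0 kl kL g0.
  have [h|h] := boolP (k <= lo)%N; first by rewrite /= (minn_idPr h).
  rewrite -ltnNge in h; have ek : k = lo.+1 by lia.
  rewrite (minn_idPl (ltnW h)); have := @pi_Sg_step lo L g; rewrite (_ : (l.-1 - lo)%N = 0%N) /=; last by lia.
  by rewrite -ek; apply; [lia|lia|apply: g0].
rewrite [w0w _ _]/= -[_ :: _]/(iota lo m.+1).
have {}IH : piw (w0w m lo.+1) (Sg k L g) (Sg (minn lo.+1 k) L g) by apply: IH => //; lia.
apply: (piw_cat IH); have [h|h] := boolP (k <= lo)%N.
  rewrite (minn_idPr (leqW h)) (minn_idPr h); apply: piw_sym => p; rewrite mem_rev mem_iota => hp.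
  by rewrite /Sg rmorphM s_sh_xs ?(s_mon (fun j => absz (g j))) //; lia.
rewrite -ltnNge in h; rewrite (minn_idPl (ltnW h)) (minn_idPl h).
have -> : m.+1 = (l.-1 - lo)%N by lia.
by apply: pi_Sg_step; [lia|lia|apply: g0].
Qed.

Section Phi.
Variables (Phi : {rmorphism A -> A}) (q : A).
Hypotheses (Phx : forall r, (r.+1 < l)%N -> Phi (x r) = x r.+1) (Phl : Phi (x l.-1) = q * x 0%N).

Lemma Phi_hl (zs : seq A) m : Phi (hl zs m) = hl [seq Phi z | z <- zs] m.
Proof.
elim: zs m => [|z zs IH] m /=; first by rewrite rmorph_nat.
by rewrite rmorph_sum; apply: eq_bigr => j _; rewrite rmorphM rmorphXn IH.
Qed.
Lemma Phi_sh (zs : seq A) r al : Phi (sh zs r al) = sh [seq Phi z | z <- zs] r al.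
Proof.
rewrite /sh -det_map_mx; congr (\det _); apply/matrixP => a b; rewrite !mxE.
by case: (_ + _) => m /=; [exact: Phi_hl|rewrite rmorph0].
Qed.

Definition addroots m0 k (g : nat -> int) (v : seq nat) : nat -> int :=
  consf (m0 + sumn v) (fun j => g j - (if (j < k)%N then 0%N else nth 0%N v (j - k))%:Z).

(** [Phi] makes the last variable [q * x 0]. Expanding the determinant in it lowers the old parts by
    [v] and raises the new first part by [sumn v], with weight [q ^+ sumn v]: the geometric series
    of one row of roots. *)
Lemma Phi_Sg m0 k L (g : nat -> int) K : (k < l)%N -> (k <= L)%N ->
  (forall j, (j < L)%N -> g j + L%:Z <= K%:Z) ->
  x 0%N ^+ m0 * Phi (Sg k L g) = \sum_(v <- vecs K (L - k)) q ^+ sumn v * Sg k.+1 L.+1 (addroots m0 k g v).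
Proof.
move=> kl kL hK; rewrite /Sg rmorphM rmorph_prod Phi_sh.
have -> : sh [seq Phi z | z <- xs k] (L - k) (fun a => g (k + a)%N) =
    sh (q * x 0%N :: xs k.+1) (L - k) (fun a => g (k + a)%N).
  apply: sh_perm; rewrite /xs -map_comp.
  have -> : (l - k = (l.-1 - k) + 1)%N by lia.
  rewrite iotaD map_cat /= (_ : (k + (l.-1 - k))%N = l.-1); last by lia.
  rewrite Phl perm_catC /= perm_cons.
  have -> : (l - k.+1 = l.-1 - k)%N by lia.
  rewrite -[k.+1]addn1 -[(k + 1)%N]addnC iotaDl -map_comp.
  rewrite (_ : [seq (Phi \o x) i | i <- _] = [seq (x \o addn 1) i | i <- iota k (l.-1 - k)]) //.
  by apply/eq_in_map => r; rewrite mem_iota => hr /=; rewrite Phx ?add1n //; lia.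
rewrite (@sh_expand _ (q * x 0%N) _ _ _ K); last first.
  by move=> a ha; have := hK (k + a)%N; lia.
rewrite !mulr_sumr; apply: eq_bigr => v _.
rewrite big_ord_recl /= subSS.
have -> : (\prod_(i < k) Phi (x i ^+ absz (g i))) = \prod_(i < k) x (lift ord0 i) ^+ absz (addroots m0 k g v (lift ord0 i)).
  by apply: eq_bigr => i _; rewrite rmorphXn lift0 /= ltn_ord subr0 Phx //; have := ltn_ord i; lia.
rewrite (@eq_sh _ (xs k.+1) _ (fun a => g (k + a)%N - (nth 0%N v a)%:Z) (fun a => addroots m0 k g v (k.+1 + a)%N)).
  by rewrite exprMn exprD; ring.
by move=> a _; rewrite addSn /= ltnNge leq_addr addKn.
Qed.
End Phi.
End Demazure.
End JacobiTrudi.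

(** * Characters of sets with the string property *)

Module Characters.
From mathcomp Require Import all_boot all_order all_fingroup all_algebra zify ring.
Import Scan FilteredSets Columns KnuthMoves Dominance Windows Folding JacobiTrudi.
Import GRing.Theory.
Local Open Scope nat_scope.

Lemma mem_vecs K r v : (v \in vecs K r) = (size v == r) && all (gtn K) v.
Proof.
elim: r v => [|r IH] v /=; first by rewrite inE; case: v.
apply/allpairsPdep/idP => [[k [v' [+ + ->]]]|].
  by rewrite mem_iota IH /= eqSS => h /andP[-> ->]; rewrite andbT; lia.
case: v => // k v /=; rewrite eqSS => /and3P[h1 h2 h3]; exists k, v; split=> //.
  by rewrite mem_iota /=; lia.
by rewrite IH h1 h3.
Qed.
Lemma uniq_vecs K r : uniq (vecs K r).
Proof.
elim: r => //= r IH; apply: allpairs_uniq; rewrite ?iota_uniq //.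
by move=> [k v] [k' v'] _ _ /= [-> ->].
Qed.
Lemma perm_vecs_rcons K r : perm_eq (vecs K r.+1) [seq rcons v k | v <- vecs K r, k <- iota 0 K].
Proof.
apply: uniq_perm; rewrite ?uniq_vecs //.
  apply: allpairs_uniq; rewrite ?iota_uniq ?uniq_vecs //.
  by move=> [v k] [v' k'] _ _ /= /rcons_inj [-> ->].
move=> v; rewrite mem_vecs; apply/idP/allpairsPdep.
  case/lastP: v => // v k; rewrite size_rcons all_rcons eqSS => /and3P[h1 h2 h3].
  by exists v, k; rewrite mem_vecs h1 h3 mem_iota /=; split=> //; lia.
move=> [v' [k [+ + ->]]]; rewrite mem_vecs mem_iota size_rcons all_rcons eqSS => /andP[-> ->] /=.
lia.
Qed.

Local Open Scope ring_scope.
Section Char.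
Variables (A : idomainType) (l : nat) (x : nat -> A) (s : nat -> {rmorphism A -> A}).
Hypotheses (sx : forall p r, (p.+1 < l)%N -> (r < l)%N ->
    s p (x r) = x (if r == p then p.+1 else if r == p.+1 then p else r))
  (nz : forall p, (p.+1 < l)%N -> x p != x p.+1).

Definition mw (w : seq nat) : A := \prod_(r <- w) x r.
Lemma mw_rcons w r : mw (rcons w r) = mw w * x r.
Proof. by rewrite /mw -cats1 big_cat big_seq1. Qed.

(** The string of [h] contributes one monomial for each value of the counter. Refining the sum by
    the counter is what makes the induction on the last letter close. *)
Lemma fibre_cnt p h : (p.+1 < l)%N -> E p h = h -> all (gtn l) h ->
  exists R, [/\ s p R = R, mw h = R * x p ^+ cnt p 0 h
  & forall k, \sum_(w <- vecs l (size h) | (E p w == h) && (cnt p 0 w == k)) mw w =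
     if (k <= cnt p 0 h)%N then R * x p ^+ k * x p.+1 ^+ (cnt p 0 h - k) else 0].
Proof.
move=> pl; elim/last_ind: h => [|h y IH] Eh.
  move=> _; exists 1; rewrite rmorph1 /mw !big_nil mulr1; split=> // k.
  rewrite big_cons /= big_nil /mw big_nil eq_sym leqn0; case: eqP => [->|_] //=.
  by rewrite !expr0 !mulr1 addr0.
rewrite all_rcons => /andP[yl hl].
move: Eh; rewrite E_rcons => /rcons_inj [Eh ly].
have [R [sR mR HR]] := IH Eh hl; rewrite size_rcons mw_rcons.
have sumE k : \sum_(w <- vecs l (size h).+1 | (E p w == rcons h y) && (cnt p 0 w == k)) mw w =
   \sum_(w <- vecs l (size h) | E p w == h)
     \sum_(z <- iota 0 l | (lastE p w z == y) && (cnt p 0 (rcons w z) == k)) mw w * x z.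
  rewrite big_mkcond (perm_big _ (perm_vecs_rcons _ _)) /= big_allpairs_dep /= [RHS]big_mkcond /=.
  apply: eq_bigr => w _; rewrite -big_mkcond /=; case: ifP => e.
    by apply: eq_big => [z|z _]; rewrite ?mw_rcons // E_rcons eqseq_rcons e.
  by rewrite big1 // => z; rewrite E_rcons eqseq_rcons e.
have pick (P : pred nat) z (w : seq nat) : (z < l)%N -> (forall z', P z' = (z' == z)) ->
    \sum_(z' <- iota 0 l | P z') mw w * x z' = mw w * x z.
  move=> zl Pz; rewrite (eq_bigl _ _ Pz) -big_filter.
  have -> : [seq i <- iota 0 l | i == z] = [:: z]; last by rewrite big_seq1.
  by apply: filter_pred1_uniq; rewrite ?iota_uniq // mem_iota.
have pick0 (P : pred nat) (w : seq nat) : (forall z', P z' = false) ->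
    \sum_(z' <- iota 0 l | P z') mw w * x z' = 0.
  by move=> Pz; rewrite (eq_bigl _ _ Pz) big_pred0.
have sumC (P : pred nat) (c : A) : \sum_(w <- vecs l (size h) | (E p w == h) && P (cnt p 0 w)) mw w * c =
    \sum_(w <- vecs l (size h) | E p w == h) (if P (cnt p 0 w) then mw w * c else 0).
  by rewrite big_mkcondr.
have [n1 n2] : (p == p.+1) = false /\ (p.+1 == p) = false by rewrite !neqS.
case: (y =P p) => [yp|yp].
  subst y; exists R; split=> //.
    by rewrite mR cnt_rcons eqxx exprSr mulrA.
  move=> k; rewrite sumE cnt_rcons eqxx.
  have inner w : \sum_(z <- iota 0 l | (lastE p w z == p) && (cnt p 0 (rcons w z) == k)) mw w * x z =
     if k is k'.+1 then (if cnt p 0 w == k' then mw w * x p else 0)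
     else (if cnt p 0 w == 0%N then mw w * x p.+1 else 0).
    have le z : (lastE p w z == p) = (z == p) || ((z == p.+1) && (cnt p 0 w == 0%N)).
      rewrite /lastE; case: (z =P p.+1) => [->|zp1] /=; last by rewrite orbF.
      by rewrite n2 /=; case: (cnt p 0 w == 0%N); rewrite ?eqxx ?n2.
    case: k => [|k]; case: eqP => ck; [apply: pick => // z|apply: pick0 => z|apply: pick => [|z]|apply: pick0 => z];
      rewrite ?le ?cnt_rcons; move: (cnt p 0 w) ck => c ck; try (clear -pl; lia);
      case: (z =P p) => e; case: (z =P p.+1) => e' /=; clear -ck e e'; lia.
  under eq_bigr do rewrite inner.
  case: k inner => [|k] _.
    by rewrite -(sumC (fun c => c == 0%N)) -mulr_suml HR /= subn0 subn0 exprSr; ring.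
  rewrite -(sumC (fun c => c == k)) -mulr_suml HR ltnS; case: ifP => // _.
    by rewrite subSS exprSr; ring.
  by rewrite mul0r.
case: (y =P p.+1) => [yp1|yp1].
  subst y; move: ly; rewrite /lastE eqxx /=; case: (cnt p 0 h =P 0%N) => [|c0 _]; first by move=> _ /=; lia.
  have cr : cnt p 0 (rcons h p.+1) = (cnt p 0 h).-1 by rewrite cnt_rcons n2 eqxx.
  exists (R * x p * x p.+1); split.
  - by rewrite !rmorphM sR !sx ?eqxx ?n2 //; [ring|lia].
  - rewrite mR cr -{1}(prednK (_ : 0 < cnt p 0 h)%N) ?lt0n; last by apply/eqP.
    by rewrite exprS; ring.
  move=> k; rewrite sumE cr.
  have inner w : \sum_(z <- iota 0 l | (lastE p w z == p.+1) && (cnt p 0 (rcons w z) == k)) mw w * x z =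
     if cnt p 0 w == k.+1 then mw w * x p.+1 else 0.
    have le z : (lastE p w z == p.+1) = ((z == p.+1) && (cnt p 0 w != 0%N)).
      rewrite /lastE; case: (z =P p.+1) => [->|zp1] /=; last by apply/eqP.
      by case: (cnt p 0 w == 0%N); rewrite ?eqxx ?n1.
    case: eqP => ck; [apply: pick => // z|apply: pick0 => z]; rewrite le cnt_rcons ?ck.
      by case: (z =P p.+1) => [->|_] //=; rewrite n2 eqxx.
    case: (z =P p.+1) => [->|_] //=; rewrite n2; apply/negP => /andP[h1 /eqP h2].
    by apply: ck; rewrite -h2 prednK ?lt0n.
  under eq_bigr do rewrite inner.
  rewrite -(sumC (fun c => c == k.+1)) -mulr_suml HR.
  have -> : (k < cnt p 0 h)%N = (k <= (cnt p 0 h).-1)%N by move/eqP: c0; lia.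
  case: ifP => hk; last by rewrite mul0r.
  have -> : (cnt p 0 h - k.+1 = (cnt p 0 h).-1 - k)%N by move/eqP: c0; lia.
  by rewrite exprSr; ring.
have cr w : cnt p 0 (rcons w y) = cnt p 0 w by rewrite cnt_rcons (introF eqP yp) (introF eqP yp1).
exists (R * x y); split.
- by rewrite rmorphM sR sx // (introF eqP yp) (introF eqP yp1).
- by rewrite mR cr; ring.
move=> k; rewrite sumE cr.
have inner w : \sum_(z <- iota 0 l | (lastE p w z == y) && (cnt p 0 (rcons w z) == k)) mw w * x z =
     if cnt p 0 w == k then mw w * x y else 0.
  have le z : (lastE p w z == y) = (z == y).
    rewrite /lastE; case: (z =P p.+1) => [->|zp1] //=.
    rewrite [in RHS]eq_sym (introF eqP yp1); case: ifP => _; first by rewrite eq_sym (introF eqP yp).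
    by rewrite eq_sym (introF eqP yp1).
  case: eqP => ck; [apply: pick => // z|apply: pick0 => z]; rewrite le.
    by case: eqP => // ->; rewrite cr ck eqxx.
  by case: eqP => // ->; rewrite cr; apply/eqP.
under eq_bigr do rewrite inner.
rewrite -(sumC (fun c => c == k)) -mulr_suml HR; case: ifP => _; last by rewrite mul0r.
by ring.
Qed.

(** Summing [fibre_cnt] over the counters gives [R] times a complete function in [x p] and [x p.+1],
    the Demazure image of [R * x p ^+ cnt p 0 h]. *)
Lemma fibre_sum p h : (p.+1 < l)%N -> E p h = h -> all (gtn l) h ->
  let F := \sum_(w <- vecs l (size h) | E p w == h) mw w in
  pirel x s p (mw h) F /\ s p F = F.
Proof.
move=> pl Eh hl F; have [R [sR mR HR]] := fibre_cnt pl Eh hl.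
have FE : F = R * JacobiTrudi.hl [:: x p; x p.+1] (cnt p 0 h).
  have bnd w : w \in vecs l (size h) -> E p w = h -> (cnt p 0 w < (cnt p 0 h).+1)%N.
    move=> _ e; have [h1 _] := cnt_scan p 0 0 w.
    by move: h1; rewrite add0n addn0 -/(E p w) e.
  rewrite /F /= mulr_sumr.
  transitivity (\sum_(w <- vecs l (size h) | E p w == h) \sum_(k < (cnt p 0 h).+1) (if cnt p 0 w == k :> nat then mw w else 0)).
    rewrite big_seq_cond [RHS]big_seq_cond; apply: eq_bigr => w /andP[wv /eqP e].
    rewrite (bigD1 (Ordinal (bnd w wv e))) //= eqxx big1 ?addr0 // => k /eqP ne.
    by case: eqP => // e2; case: ne; apply: val_inj.
  rewrite exchange_big /=; apply: eq_bigr => k _.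
  rewrite -big_mkcondr /= HR -ltnS ltn_ord -mulrA; congr (_ * (_ * _)).
  rewrite big_ord_recr /= subnn mulr1 big1 ?add0r // => j _.
  by rewrite subn_eq0 leqNgt ltn_ord mulr0.
have h1 (y : A) m : JacobiTrudi.hl [:: y] m = y ^+ m.
  rewrite /= big_ord_recr /= subnn mulr1 big1 ?add0r // => j _.
  by rewrite subn_eq0 leqNgt ltn_ord mulr0.
have n1 : (p == p.+1) = false by rewrite !neqS.
split; last first.
  rewrite FE rmorphM sR s_hl /= !sx ?eqxx //; last by lia.
  rewrite [p.+1 == p]eq_sym n1; congr (_ * _).
  exact: (hl_swap [::] (x p.+1) (x p) [::] _).
rewrite FE mR; apply: pirel_mul => //; rewrite /pirel hl_divided !h1 rmorphXn sx ?eqxx //; lia.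
Qed.

Section Weighted.
Variables (N : nat) (c : seq nat -> A) (D : pred (seq nat)).
Hypotheses (hD : forall p w, (p.+1 < l)%N -> D (E p w) = D w)
 (hc : forall p w, (p.+1 < l)%N -> w \in vecs l N -> D w -> c (E p w) = c w)
 (hs : forall p w, (p.+1 < l)%N -> s p (c w) = c w).
Definition chr (X : pred (seq nat)) := \sum_(w <- vecs l N | X w) c w * mw w.

Lemma vecs_E p w : (p.+1 < l)%N -> (E p w \in vecs l N) = (w \in vecs l N).
Proof. by move=> pl; rewrite !mem_vecs size_scan all_scan //=; lia. Qed.

(** Words are grouped by the heads of their strings. A missing string gives zero, a full one is
    symmetric and hence fixed, and a lone head is completed to its string by [fibre_sum]. *)
Lemma chr_pi p (X : pred (seq nat)) : (p.+1 < l)%N -> (forall w, X w -> D w) -> nice p X ->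
  pirel x s p (chr X) (chr (fun w => X (E p w))).
Proof.
move=> pl XD nX.
have split_sum (Y : pred (seq nat)) : chr Y = \sum_(h <- vecs l N | E p h == h)
     \sum_(w <- vecs l N | Y w && (E p w == h)) c w * mw w.
  rewrite (exchange_big_dep Y) /=; last by move=> h w _ /andP[].
  rewrite /chr big_seq_cond [RHS]big_seq_cond; apply: eq_bigr => w /andP[wv Yw].
  rewrite (eq_bigl (pred1 (E p w))); last first.
    move=> h; rewrite Yw /= [in RHS]/= [h == _]eq_sym; apply/andP/idP => [[]//|/eqP <-].
    by rewrite E_idem !eqxx.
  by rewrite -big_filter (@filter_pred1_uniq _ _ (E p w)) ?uniq_vecs ?vecs_E // big_seq1.
rewrite (split_sum X) (split_sum (fun w => X (E p w))).
apply: pirel_sum => h hv /eqP Eh.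
have [hl hsz] : all (gtn l) h /\ size h = N by move: hv; rewrite mem_vecs => /andP[/eqP].
have [F1 F2] := fibre_sum pl Eh hl; rewrite hsz in F1 F2.
have cE w : w \in vecs l N -> D w -> E p w = h -> c w = c h by move=> wv Dw <-; rewrite hc.
case Xh : (X h); last first.
  rewrite big_pred0; last first.
    by move=> w; apply/negP => /andP[/nX [h1 _] /eqP e]; rewrite e Xh in h1.
  rewrite big_pred0; first by apply: pirel_sym; rewrite rmorph0.
  by move=> w; apply/negP => /andP[h1 /eqP e]; rewrite e Xh in h1.
have Dh := XD _ Xh.
have -> : \sum_(w <- vecs l N | X (E p w) && (E p w == h)) c w * mw w =
    c h * \sum_(w <- vecs l N | E p w == h) mw w.
  rewrite mulr_sumr big_seq_cond [RHS]big_seq_cond; apply: eq_big => w.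
    by congr (_ && _); case: eqP => [->|_]; rewrite ?Xh ?andbF.
  move=> /and3P[wv _ /eqP e]; rewrite cE //.
  by rewrite -(hD w pl) e.
case ex : (has (fun w => [&& X w, E p w == h & w != h]) (vecs l N)).
  have /hasP [w0 _ /and3P[Xw0 /eqP e0 ne0]] := ex.
  have all_in w : E p w = h -> X w.
    move=> e; have [_ h2] := nX w0 Xw0; apply: h2; first by rewrite e0; apply/eqP; rewrite eq_sym.
    by rewrite e e0.
  have -> : \sum_(w <- vecs l N | X w && (E p w == h)) c w * mw w =
      c h * \sum_(w <- vecs l N | E p w == h) mw w.
    rewrite mulr_sumr big_seq_cond [RHS]big_seq_cond; apply: eq_big => w.
      by congr (_ && _); case: eqP => [/all_in ->|_]; rewrite ?andbF.
    by move=> /and3P[wv Xw /eqP e]; rewrite cE // XD.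
  by apply: pirel_mul; [exact: hs|exact: pirel_sym].
have -> : \sum_(w <- vecs l N | X w && (E p w == h)) c w * mw w = c h * mw h.
  rewrite big_seq_cond (eq_bigl (fun w => (w \in vecs l N) && (w == h))); last first.
    move=> w; case wv : (w \in vecs l N) => //=; apply/andP/idP => [[Xw e]|/eqP ->]; last by rewrite Xh Eh.
    by apply: contraFT ex => ne; apply/hasP; exists w; rewrite // Xw e.
  by rewrite -big_seq_cond -big_filter (@filter_pred1_uniq _ _ h) ?uniq_vecs // big_seq1.
by apply: pirel_mul => //; exact: hs.
Qed.

Lemma chr_piw v (X : pred (seq nat)) : all (gtn l.-1) v -> (forall w, X w -> D w) ->
  FG (gtn l.-1) X -> piw x s v (chr X) (chr (fun w => X (Eword v w))).
Proof.
move=> + XD fX; elim: v => [|p v IH] //= /andP[pv av].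
have pl : (p.+1 < l)%N by lia.
exists (chr (fun w => X (Eword v w))); first exact: IH.
apply: (@chr_pi p (fun w => X (Eword v w))) => // [w /XD|]; last exact: (fX v p av pv).
elim: v av {IH} w => //= p' v IH /andP[h1 h2] w /IH; rewrite hD; last by lia.
exact.
Qed.
End Weighted.
End Char.
End Characters.

(** * The recursion for the graded characters *)

Module CharacterRecursion.
From mathcomp Require Import all_boot all_order all_fingroup all_algebra zify ring.
Import Scan FilteredSets Columns KnuthMoves Dominance Windows Folding JacobiTrudi Characters.
Import GRing.Theory.
Local Open Scope nat_scope.

Section Rot.
Variable l : nat.
Hypothesis l0 : 0 < l.
Definition suc r := if r == l.-1 then 0 else r.+1.
Definition unrotb (b : seq nat) := sort geq (map suc b).
Lemma size_unrotb b : size (unrotb b) = size b.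
Proof. by rewrite size_sort size_map. Qed.
Lemma sorted_unrotb b : sorted geq (unrotb b).
Proof. by apply: sort_sorted => x y /=; lia. Qed.
Lemma unrotb_lt b : all (gtn l) b -> all (gtn l) (unrotb b).
Proof.
move=> h; rewrite all_sort; apply/allP => x /mapP [y /(allP h) /= yl ->].
by rewrite /suc; case: eqP => ?; lia.
Qed.
Lemma suc_inj : {in gtn l &, injective suc}.
Proof. by move=> r r'; rewrite !inE /suc /=; do 2 case: eqP => ?; lia. Qed.
Lemma count_unrotb b r : all (gtn l) b -> r < l -> count_mem (suc r) (unrotb b) = count_mem r b.
Proof.
move=> h rl; rewrite count_sort count_map; apply: eq_in_count => x /(allP h) xl /=.
by apply/eqP/eqP => [/suc_inj|->] //; apply.
Qed.
Lemma ltl_count (b c : seq nat) : all (gtn l) b -> all (gtn l) c -> sorted geq b -> sorted geq c ->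
  (forall r, r < l -> count_mem r b = count_mem r c) -> b = c.
Proof.
move=> hb hc sb sc h; apply: sorted_count_eq => // r; have [rl|rl] := ltnP r l; first exact: h.
have z (s : seq nat) : all (gtn l) s -> count_mem r s = 0.
  by move=> hs; apply/count_memPn/negP => /(allP hs) /=; lia.
by rewrite !z.
Qed.
Lemma rotb_unrotb b : 1 < l -> all (gtn l) b -> sorted geq b -> rotb l (unrotb b) = b.
Proof.
move=> l1 hb sb; apply: ltl_count => //; rewrite ?rotb_lt ?sorted_rotb ?unrotb_lt ?sorted_unrotb // => r rl.
by rewrite count_rotb ?unrotb_lt // -[X in count_mem X _]/(suc r) count_unrotb.
Qed.
Lemma unrotb_rotb b : 1 < l -> all (gtn l) b -> sorted geq b -> unrotb (rotb l b) = b.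
Proof.
move=> l1 hb sb; apply: ltl_count => //; rewrite ?unrotb_lt ?rotb_lt ?sorted_unrotb // => r rl.
have [r' r'l <-] : exists2 r', r' < l & suc r' = r.
  exists (if r == 0 then l.-1 else r.-1); first by case: eqP; lia.
  by rewrite /suc; case: (r =P 0) => [->|r0]; rewrite ?eqxx //; case: eqP; lia.
by rewrite count_unrotb ?rotb_lt // count_rotb.
Qed.
End Rot.

Definition Sb l ns ms (w : seq nat) : bool := let u := reshape ms w in
  [&& size w == sumn ms, all (sorted geq) u, all (all (gtn l)) u & S l ns ms u].

Lemma SbP l ns ms w : Sb l ns ms w <-> Sw l ns ms w.
Proof.
split.
  move=> /and4P[/eqP h0 h1 h2 h3]; exists (reshape ms w); split=> //.
    by apply: reshapeKl; rewrite h0.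
  by rewrite reshapeKr // h0.
move=> [u [h1 -> h2 h3 h4]]; apply/and4P; rewrite -h1 flattenK h1; split=> //.
by rewrite size_flatten h1.
Qed.
Definition Dsort ms (w : seq nat) : bool := (size w == sumn ms) && all (sorted geq) (reshape ms w).

Lemma reshape_E ms p w : size w = sumn ms -> reshape ms (E p w) = EB p (reshape ms w).
Proof.
move=> h; have sr : shape (reshape ms w) = ms by apply: reshapeKl; rewrite h.
apply: eq_flat; first by rewrite shape_scanB sr reshapeKl // size_scan h.
by rewrite flatten_scanB !reshapeKr ?size_scan ?h.
Qed.
Lemma reshape_Ew ms v w : size w = sumn ms -> reshape ms (Eword v w) = EBw v (reshape ms w).
Proof.
elim: v w => //= p v IH w h; rewrite IH ?reshape_E //.
by rewrite size_scan.
Qed.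
Lemma Dsort_E ms p w : Dsort ms (E p w) = Dsort ms w.
Proof.
rewrite /Dsort size_scan; case: eqP => //= h.
by rewrite reshape_E // all_sorted_scanB.
Qed.

Local Open Scope ring_scope.
Section Recursion.
Variables (A : idomainType) (l : nat) (x : nat -> A) (s : nat -> {rmorphism A -> A}).
Hypothesis l1 : (1 < l)%N.
Hypotheses (sx : forall p r, (p.+1 < l)%N -> (r < l)%N ->
    s p (x r) = x (if r == p then p.+1 else if r == p.+1 then p else r))
  (nz : forall p, (p.+1 < l)%N -> x p != x p.+1).
Variables (Phi : {rmorphism A -> A}) (q : A).
Hypotheses (Phx : forall r, (r.+1 < l)%N -> Phi (x r) = x r.+1) (Phl : Phi (x l.-1) = q * x 0%N)
  (Phq : Phi q = q) (sq : forall p, (p.+1 < l)%N -> s p q = q).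
(** The place of charge: invariance along strings ([g1]), the rotation rule ([g2]) and the empty
    value ([g3]) determine the recursion for the graded character. *)
Variable g : bword -> nat.
Definition okb (u : bword) := [/\ sorted geq (shape u), all (sorted geq) u & all (all (gtn l)) u].
Hypotheses (g3 : g [::] = 0%N) (g1 : forall p u, (p.+1 < l)%N -> okb u -> g (EB p u) = g u)
  (g2 : forall m u, okb (nseq m 0%N :: u) ->
     g (nseq m 0%N :: u) = (count_mem 0%N (flatten u) + g (map (rotb l) u))%N).

Definition wt ms w := q ^+ g (reshape ms w).
Definition G ns ms := chr l x (sumn ms) (wt ms) (Sb l ns ms).

Lemma G_pi v ns ms : sorted geq ms -> all (gtn l.-1) v ->
  piw x s v (G ns ms) (chr l x (sumn ms) (wt ms) (fun w => Sb l ns ms (Eword v w))).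
Proof.
move=> sms av; apply: (@chr_piw _ _ _ _ sx _ _ (Dsort ms)) => //.
- by move=> p w pl; rewrite Dsort_E.
- move=> p w pl; rewrite mem_vecs => /andP[/eqP sz lw] /andP[_ Dw].
  rewrite /wt reshape_E // g1 //; split=> //; first by rewrite reshapeKl // sz.
  apply/allP => b bu; apply/allP => r rb; apply: (allP lw).
  by rewrite -(reshapeKr (s := w) (sh := ms)) ?sz //; apply/flattenP; exists b.
- by move=> p w pl; rewrite /wt rmorphXn sq.
- by move=> w /and4P[h1 h2 _ _]; rewrite /Dsort h1 h2.
- have f : FG (gtn l.-1) (Sw l ns ms) := FG_S l1 sms.
  by apply: FG_ext f => w; exact: iff_sym (SbP l ns ms w).
Qed.

Definition inv m ms (w : seq nat) := nseq m 0%N ++ flatten (map (unrotb l) (reshape ms w)).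

(** The words of the set are [0 ^ m] followed by an unrotated word of the preimage, by the bijection
    [inv]. [Phi] moves variables as [unrotb] moves rows, and its factor [q] counts the letters
    coming from the last row back to row 0, which is the increment in [g2]. *)
Lemma G_cons ns m ms : sorted geq (m :: ms) ->
  G ns (m :: ms) = x 0%N ^+ m * Phi (chr l x (sumn ms) (wt ms)
    (fun w => Sb l (behead ns) ms (Eword (Wn l (head 0%N ns)) w))).
Proof.
move=> sms; have l0 : (0 < l)%N by lia.
set W := Wn l (head 0%N ns).
set X := (fun w => Sb l (behead ns) ms (Eword W w)).
have sz_map (f : seq nat -> seq nat) u : (forall b, size (f b) = size b) -> shape (map f u) = shape u.
  by move=> h; rewrite /shape -map_comp; apply: eq_map => b /=.
have Wl p : p \in W -> (p.+1 < l)%N by move/(mem_Wn l1); lia.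
have XE w : size w = sumn ms -> X w = [&& all (sorted geq) (reshape ms w), all (all (gtn l)) (reshape ms w)
   & S l (behead ns) ms (EBw W (reshape ms w))].
  move=> sw; rewrite /X /Sb size_Eword sw eqxx reshape_Ew // all_sorted_EBw all_EBw //.
  by move=> p /Wl /=; lia.
have invE w : size w = sumn ms -> reshape (m :: ms) (inv m ms w) = nseq m 0%N :: map (unrotb l) (reshape ms w).
  move=> sw; have h : shape (nseq m 0%N :: map (unrotb l) (reshape ms w)) = m :: ms.
    by rewrite /= size_nseq -/(shape _) sz_map ?reshapeKl ?sw // => b; exact: size_unrotb.
  by rewrite -{1}h -[inv _ _ _]/(flatten (nseq m 0%N :: map (unrotb l) (reshape ms w))) flattenK.
have szinv w : size w = sumn ms -> size (inv m ms w) = sumn (m :: ms).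
  move=> sw; rewrite size_cat size_nseq size_flatten sz_map ?reshapeKl ?sw //.
  by move=> b; exact: size_unrotb.
have ltr w : w \in vecs l (sumn ms) -> all (all (gtn l)) (reshape ms w).
  rewrite mem_vecs => /andP[/eqP sz lw]; apply/allP => b bu; apply/allP => r rb; apply: (allP lw).
  by rewrite -(reshapeKr (s := w) (sh := ms)) ?sz //; apply/flattenP; exists b.
have rK w : size w = sumn ms -> all (sorted geq) (reshape ms w) -> all (all (gtn l)) (reshape ms w) ->
    map (rotb l) (map (unrotb l) (reshape ms w)) = reshape ms w.
  move=> sw h1 h2; rewrite -map_comp map_id_in // => b bu /=.
  by rewrite rotb_unrotb //; [exact: (allP h2)|exact: (allP h1)].
have pe : perm_eq [seq w <- vecs l (sumn (m :: ms)) | Sb l ns (m :: ms) w]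
    [seq inv m ms w | w <- vecs l (sumn ms) & X w].
  apply: uniq_perm; first by rewrite filter_uniq ?uniq_vecs.
    rewrite map_inj_in_uniq ?filter_uniq ?uniq_vecs // => w w'.
    rewrite !mem_filter => /andP[Xw wv] /andP[Xw' wv'] e.
    have [sw sw'] : size w = sumn ms /\ size w' = sumn ms.
      by move: wv wv'; rewrite !mem_vecs => /andP[/eqP -> _] /andP[/eqP -> _].
    have := congr1 (reshape (m :: ms)) e; rewrite !invE // => [] [].
    move/(congr1 (map (rotb l))); rewrite XE // in Xw; rewrite XE // in Xw'.
    case/and3P: Xw => h1 h2 _; case/and3P: Xw' => h1' h2' _.
    by rewrite !rK // => /(congr1 flatten); rewrite !reshapeKr ?sw ?sw'.
  move=> w; rewrite mem_filter; apply/andP/mapP.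
    move=> [/and4P[/eqP sw h1 h2]]; rewrite mem_vecs => hS /andP[_ lw].
    have e : w = take m w ++ drop m w by rewrite cat_take_drop.
    move: h1 h2 hS; rewrite /= => /andP[st h1] /andP[lt h2] /andP[/eqP et hS].
    set u := reshape ms (drop m w) in h1 h2 hS.
    have su : shape u = ms by apply: reshapeKl; rewrite size_drop sw /= addKn.
    have fu : flatten u = drop m w by apply: reshapeKr; rewrite size_drop sw /= addKn.
    pose w'' := flatten (map (rotb l) u).
    have sh'' : shape (map (rotb l) u) = ms by rewrite sz_map // => b; exact: size_rotb.
    have sw'' : size w'' = sumn ms by rewrite size_flatten sh''.
    have r'' : reshape ms w'' = map (rotb l) u by rewrite -sh'' flattenK.
    have a1 : all (sorted geq) (map (rotb l) u).
      by rewrite all_map; apply/allP => b bu /=; apply: sorted_rotb => //; [exact: (allP h1)|exact: (allP h2)].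
    have a2 : all (all (gtn l)) (map (rotb l) u).
      by rewrite all_map; apply: sub_all h2 => b; exact: rotb_lt.
    exists w''; last first.
      rewrite {1}e et /inv r''; congr (_ ++ _); rewrite -fu -map_comp map_id_in // => b bu /=.
      by rewrite unrotb_rotb //; [exact: (allP h2)|exact: (allP h1)].
    rewrite mem_filter XE // r'' a1 a2 hS mem_vecs sw'' eqxx /=.
    by apply/allP => r /flattenP [b bu rb]; apply: (allP (allP a2 b bu)).
  move=> [w'' + ->]; rewrite mem_filter mem_vecs => /andP[Xw /andP[/eqP sw lw]].
  move: Xw; rewrite XE // => /and3P[h1 h2 h3].
  have a2 : all (all (gtn l)) (map (unrotb l) (reshape ms w'')).
    by rewrite all_map; apply: sub_all h2 => b; exact: unrotb_lt.
  have a3 : all (gtn l) (nseq m 0%N) by apply/allP => r /nseqP [-> _] /=.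
  split.
    rewrite /Sb szinv // eqxx invE //= rK // eqxx h3 a2 a3 /= andbT all_map.
    apply/andP; split; first by elim: (m) => //= k IH; rewrite path_min_sorted //; apply/allP => r /nseqP [-> _].
    by apply/allP => b _ /=; exact: sorted_unrotb.
  rewrite mem_vecs szinv // eqxx /= all_cat a3 /=.
  by apply/allP => r /flattenP [b bu rb]; apply: (allP (allP a2 b bu)).
rewrite /G /chr -[LHS]big_filter (perm_big _ pe) big_map big_filter rmorph_sum mulr_sumr.
rewrite big_seq_cond [RHS]big_seq_cond; apply: eq_bigr => w /andP[wv Xw].
have sw : size w = sumn ms by move: wv; rewrite mem_vecs => /andP[/eqP].
have lw : all (gtn l) w by move: wv; rewrite mem_vecs => /andP[].
move: Xw; rewrite XE // => /and3P[h1 h2 h3].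
rewrite /wt invE // g2; last first.
  split.
  - by rewrite /= -/(shape _) size_nseq sz_map ?reshapeKl ?sw // => b; exact: size_unrotb.
  - rewrite /= all_map; apply/andP; split; first by elim: (m) => //= k IH; rewrite path_min_sorted //; apply/allP => r /nseqP [-> _].
    by apply/allP => b _ /=; exact: sorted_unrotb.
  - rewrite /= all_map; apply/andP; split; first by apply/allP => r /nseqP [-> _] /=.
    by apply: sub_all h2 => b; exact: unrotb_lt.
rewrite rK // rmorphM rmorphXn Phq /mw /inv big_cat /= big_nseq.
have -> : iter m ( *%R (x 0%N)) 1 = x 0%N ^+ m by elim: (m) => //= k ->; rewrite exprS.
have pm : perm_eq (flatten (map (unrotb l) (reshape ms w))) (map (suc l) w).
  rewrite -{2}(reshapeKr (s := w) (sh := ms)) ?sw // map_flatten.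
  elim: (reshape ms w) => //= b u IH; apply: perm_cat => //.
  by rewrite perm_sort.
rewrite (perm_big _ pm) big_map rmorph_prod exprD.
have -> : count_mem 0%N (flatten (map (unrotb l) (reshape ms w))) = count_mem l.-1 w.
  rewrite (seq.permP pm) count_map; apply: eq_in_count => r /(allP lw) /= rl.
  by rewrite /suc; case: (r == l.-1).
have -> : \prod_(i <- w) Phi (x i) = q ^+ count_mem l.-1 w * \prod_(j <- w) x (suc l j).
  elim: w lw {sw wv h1 h2 h3 pm} => [|r w IH] /=; first by rewrite !big_nil mulr1.
  move=> /andP[rl lw]; rewrite !big_cons IH // /suc; case: (r =P l.-1) => [->|rn] /=.
    by rewrite Phl exprS; ring.
  by rewrite Phx ?add0n; [ring|lia].
by ring.
Qed.

Definition addr m k (ga : seq int) (v : seq nat) : seq int :=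
  (m + sumn v)%:Z :: mkseq (fun j => nth 0 ga j - (if (j < k)%N then 0%N else nth 0%N v (j - k))%:Z) (size ga).

(* Exponent sequences, with the power of q, of the expansion of G. *)
Fixpoint Lst (Kf : nat -> nat) (ns ms : seq nat) : seq (nat * seq int) := match ms with
  | [::] => [::]
  | m :: ms' => if ms' is [::] then [:: (0%N, [:: m%:Z])] else
      [seq ((eg.1 + sumn v)%N, addr m (head 0%N ns).-1 eg.2 v)
      | eg <- Lst Kf (behead ns) ms', v <- vecs (Kf (size ms')) (size ms' - (head 0%N ns).-1)] end.

(** The number of exponents kept in the monomial part of [Sg] after [L] rows. *)
Definition kk (ns : seq nat) (L : nat) := if L == 1%N then 1%N else head 0%N ns.
(** What is required of [nr Psi]. The bound by [(kk _ _).+1] is the ideal property between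
    consecutive rows; through it the operator [Wn] leaves exactly [(head 0 ns).-1] monomial
    variables. *)
Fixpoint okns (ns : seq nat) (L : nat) : bool := match L with
  | L'.+1 => (L' == 0%N) || [&& 0 < head 0 ns, head 0 ns <= L, head 0 ns <= (kk (behead ns) L').+1 & okns (behead ns) L']%N
  | 0%N => false end.

(** [bd] bounds the exponents after [L] rows and [Kfun] the root multiplicities. The summand [L]
    serves the bound of [sh_expand]; the summand [D] makes the range contain every multiplicity that
    can occur in a degree below [D]. *)
Fixpoint bd (MU D L : nat) := if L is L'.+1 then (MU + L' * (bd MU D L' + L' + D) + bd MU D L')%N else 0%N.
Definition Kfun MU D L := (bd MU D L + L + D)%N.

Lemma sumn_vecs K r v : v \in vecs K r -> (sumn v <= r * K)%N.
Proof.
rewrite mem_vecs => /andP[/eqP <-]; elim: v => //= k v IH /andP[h1 /IH]; rewrite mulSn; lia.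
Qed.
Lemma eq_Sg k L (ga ga' : nat -> int) : (k <= L)%N -> (forall j, (j < L)%N -> ga j = ga' j) -> Sg l x k L ga = Sg l x k L ga'.
Proof.
move=> kL e; rewrite /Sg; congr (_ * _).
  by apply: eq_bigr => j _; rewrite e //; have := ltn_ord j; lia.
by apply: eq_sh => a ha; apply: e; lia.
Qed.

Lemma Lst_ok MU D ns ms : okns ns (size ms) -> all (geq MU) ms ->
  forall eg, eg \in Lst (Kfun MU D) ns ms ->
  [/\ size eg.2 = size ms, (forall j, (j < size ms)%N -> nth 0 eg.2 j <= (bd MU D (size ms))%:Z)%R
  & forall j, (j < kk ns (size ms))%N -> (0 <= nth 0 eg.2 j)%R].
Proof.
elim: ms ns => [//|m ms IH] ns okn /andP[mM aM] eg.
case: ms IH okn aM => [|m' ms'] IH okn aM.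
  by rewrite inE => /eqP -> /=; split=> // [] [|j] //= _; move: mM => /=; clear; lia.
set ms := m' :: ms' in IH okn aM *.
have {}okn : [&& 0 < head 0 ns, head 0 ns <= (size ms).+1, head 0 ns <= (kk (behead ns) (size ms)).+1
   & okns (behead ns) (size ms)]%N by move: okn => /=.
case/and4P: okn => n0 nL nk okn.
have -> : Lst (Kfun MU D) ns (m :: ms) = [seq ((eg.1 + sumn v)%N, addr m (head 0%N ns).-1 eg.2 v)
      | eg <- Lst (Kfun MU D) (behead ns) ms, v <- vecs (Kfun MU D (size ms)) (size ms - (head 0%N ns).-1)] by [].
have -> : bd MU D (size (m :: ms)) = (MU + size ms * Kfun MU D (size ms) + bd MU D (size ms))%N by [].
have -> : size (m :: ms) = (size ms).+1 by [].
move=> /allpairsPdep [[e ga] [v [/(IH _ okn aM) [h1 h2 h3] vv ->]]].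
rewrite [(_, _).2]/= in h1 h2 h3 *.
have sv : (sumn v <= size ms * Kfun MU D (size ms))%N.
  by apply: leq_trans (sumn_vecs vv) _; rewrite leq_mul2r leq_subr orbT.
split; first by rewrite [LHS]/= size_mkseq h1.
  move: sv; set T := (size ms * _)%N => sv.
  move=> [|j] jl; rewrite [nth _ _ _]/=; first by clear -sv mM; move: mM => /=; lia.
  rewrite nth_mkseq ?h1 //; have := h2 j jl; move: (nth 0 ga j : int) (bd _ _ _) T {sv h2 h3} => z B T.
  by move: (if _ then _ else _) => k; clear; lia.
move=> [|j]; first by [].
rewrite /kk [(size ms).+1 == 1%N]eqSS [size ms == 0%N]/= => jn; rewrite [nth _ _ _]/=.
rewrite /= in jn; rewrite nth_mkseq; last by rewrite h1 -ltnS (leq_trans jn nL).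
have -> : (j < (head 0 ns).-1)%N by lia.
by rewrite subr0; apply: h3; lia.
Qed.

Lemma le_addz (z : int) (B L D : nat) : (z <= B%:Z -> z + L%:Z <= (B + L + D)%N%:Z)%R.
Proof. lia. Qed.

(** One row of [Lst] is one application of [G_cons]: [pi_Sg] evaluates the insertion operator and
    [Phi_Sg] the shift. *)
Lemma G_Lst MU D ns ms : sorted geq ms -> okns ns (size ms) -> (size ms <= l)%N -> all (geq MU) ms ->
  G ns ms = \sum_(eg <- Lst (Kfun MU D) ns ms) q ^+ eg.1 * Sg l x (kk ns (size ms)) (size ms) (nth 0 eg.2).
Proof.
elim: ms ns => [|m ms IH] ns sms okn sl aM //; have aM' := aM; case/andP: aM' => mM aM'.
rewrite G_cons //; case: ms IH sms okn sl aM aM' => [|m' ms'] IH sms okn sl aM aM'.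
  rewrite /= big_seq1 /kk /= /Sg big_ord1 /= subnn sh0 mulr1 expr0 mul1r.
  rewrite (_ : chr _ _ _ _ _ = 1) ?rmorph1 ?mulr1 //.
  rewrite /chr /= big_cons big_nil /=; have -> : Eword (Wn l (head 0%N ns)) [::] = [::].
    by apply: size0nil; rewrite size_Eword.
  by rewrite /Sb /= /wt g3 expr0 /mw big_nil mul1r addr0.
set ms := m' :: ms' in IH sms okn sl aM aM' *.
have {}okn : [&& 0 < head 0 ns, head 0 ns <= (size ms).+1, head 0 ns <= (kk (behead ns) (size ms)).+1
   & okns (behead ns) (size ms)]%N by move: okn => /=.
case/and4P: okn => n0 nL nk okn; have sms' : sorted geq ms by exact: path_sorted sms.
set n := head 0%N ns in n0 nL nk *.
have Wl : all (gtn l.-1) (Wn l n) by apply/allP => p /(mem_Wn l1).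
have e1 := @G_pi (Wn l n) (behead ns) ms sms' Wl.
rewrite (IH _ sms' okn (ltnW sl) aM') in e1.
have kL : (kk (behead ns) (size ms) <= size ms)%N.
  by move: okn; rewrite /kk; case: (size ms) => [|[|L'']] //= /and4P[].
have e2 : piw x s (Wn l n)
   (\sum_(eg <- Lst (Kfun MU D) (behead ns) ms) q ^+ eg.1 * Sg l x (kk (behead ns) (size ms)) (size ms) (nth 0 eg.2))
   (\sum_(eg <- Lst (Kfun MU D) (behead ns) ms) q ^+ eg.1 * Sg l x n.-1 (size ms) (nth 0 eg.2)).
  apply: piw_sum => eg hin _; have [h1 h2 h3] := Lst_ok okn aM' hin.
  apply: piw_mul; first by move=> p /(mem_Wn l1) pl; rewrite rmorphXn sq //; lia.
  have -> : n.-1 = minn n.-1 (kk (behead ns) (size ms)) by rewrite (minn_idPl _) //; lia.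
  have sl' : ((size ms).+1 <= l)%N := sl.
  by apply: (pi_Sg sx) => //; move: (kk _ _) nk kL => k nk kL; clear -nk sl' l1 n0 nL kL; lia.
have -> := piw_uniq nz _ e1 e2; last by apply: sub_all Wl => p /=; lia.
have -> : Lst (Kfun MU D) ns (m :: ms) = [seq ((eg.1 + sumn v)%N, addr m (head 0%N ns).-1 eg.2 v)
      | eg <- Lst (Kfun MU D) (behead ns) ms, v <- vecs (Kfun MU D (size ms)) (size ms - (head 0%N ns).-1)] by [].
have -> : size (m :: ms) = (size ms).+1 by [].
rewrite rmorph_sum mulr_sumr [RHS]big_allpairs_dep big_seq [RHS]big_seq; apply: eq_bigr => eg hin.
have [h1 h2 h3] := Lst_ok okn aM' hin; have sl' : ((size ms).+1 <= l)%N := sl.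
rewrite rmorphM rmorphXn Phq mulrCA (@Phi_Sg A l x Phi q Phx Phl m n.-1 (size ms) (nth 0 eg.2) (Kfun MU D (size ms))).
- rewrite mulr_sumr; apply: eq_bigr => v _; rewrite [(_, _).1]/= [(_, _).2]/= exprD mulrA; congr (_ * _).
  rewrite /kk [(size ms).+1 == 1%N]eqSS [size ms == 0%N]/= -/n prednK //.
  apply: eq_Sg => // [] [|j] jl //; rewrite [addr _ _ _ _]/addr [RHS]/= nth_mkseq ?h1 //.
- by clear -sl' nL n0; lia.
- by clear -nL n0; lia.
- by move=> j jl; exact: le_addz (h2 j jl).
Qed.
End Recursion.
End CharacterRecursion.

(** * Tabloids as block words; invariance of the highest weight word under Knuth moves *)

Module TabloidWords.
From mathcomp Require Import all_boot zify.
Import Defs Scan FilteredSets Columns KnuthMoves Dominance Windows Folding.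

Lemma heq_rev a b : heq a b -> heq (rev a) (rev b).
Proof.
elim=> {a b} [u a b v r|w|a b _ IH|a b c _ IH _ IH'].
- rewrite !rev_cat -!catA; apply: heq_cat; case: r => [i|i j ij|i]; rewrite /rev /=.
  + exact: hrel_heq (Hidem i).
  + exact: Hsym (hrel_heq (Hcomm ij)).
  + exact: hrel_heq (Hbraid i).
- exact: Hrefl.
- exact: Hsym.
- exact: Htrans IH IH'.
Qed.
Lemma heq_comm_seq p s : all (fun q => (p.+1 < q) || (q.+1 < p)) s -> heq (p :: s) (s ++ [:: p]).
Proof.
elim: s => [|q s IH] /=; first by move=> _; exact: Hrefl.
case/andP=> h /IH {}IH; apply: Htrans (heq_cons q IH).
have : heq [:: p; q] [:: q; p].
  by case/orP: h => h; [|apply: Hsym]; exact: hrel_heq (Hcomm h).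
exact: (@heq_catr [:: p; q] [:: q; p] s).
Qed.

(** The top generator is absorbed by idempotency. A lower [p] crosses the first run by a braid
    relation, comes out as [p.+1], and is absorbed by the shorter staircase. *)
Lemma w0w_absl m lo p : lo <= p < lo + m -> heq (p :: w0w m lo) (w0w m lo).
Proof.
elim: m lo p => [|m IH] lo p hp; first by lia.
have -> : w0w m.+1 lo = rev (iota lo m.+1) ++ w0w m lo.+1 by [].
have [e|ne] := eqVneq p (lo + m).
  have -> : rev (iota lo m.+1) = p :: rev (iota lo m) by rewrite -addn1 iotaD rev_cat e.
  exact: (@heq_catr [:: p; p] [:: p] _ (hrel_heq (Hidem p))).
have hp' : p < lo + m by lia.
set hi := rev (iota p.+2 (lo + m - p.+1)); set lw := rev (iota lo (p - lo)).
have -> : rev (iota lo m.+1) = hi ++ [:: p.+1; p] ++ lw.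
  have -> : m.+1 = (p - lo) + (2 + (lo + m - p.+1)) by lia.
  rewrite !iotaD !rev_cat -catA /hi /lw; have -> : lo + (p - lo) = p by lia.
  by rewrite addn2.
have c1 : heq (p :: hi) (hi ++ [:: p]).
  by apply: heq_comm_seq; apply/allP => q; rewrite mem_rev mem_iota; lia.
have c2 : heq (p.+1 :: lw) (lw ++ [:: p.+1]).
  by apply: heq_comm_seq; apply/allP => q; rewrite mem_rev mem_iota; lia.
rewrite -!catA -cat_cons; apply: Htrans (heq_catr _ c1) _; rewrite -catA.
apply: heq_catl; rewrite [[:: p] ++ _]/=.
have b := hrel_heq (Hbraid p).
apply: Htrans (@heq_catr [:: p; p.+1; p] _ (lw ++ w0w m lo.+1) b) _.
rewrite -[X in heq X _]/([:: p.+1; p] ++ ((p.+1 :: lw) ++ w0w m lo.+1)).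
rewrite -[X in heq _ X]/([:: p.+1; p] ++ (lw ++ w0w m lo.+1)).
apply: heq_catl; apply: Htrans (heq_catr _ c2) _; rewrite -catA; apply: heq_catl.
by apply: IH; lia.
Qed.
Lemma w0w_absl_seq m lo s : all (fun p => lo <= p < lo + m) s -> heq (s ++ w0w m lo) (w0w m lo).
Proof.
elim: s => [|p s IH] /=; first by move=> _; exact: Hrefl.
by case/andP=> h /IH {}IH; apply: Htrans (heq_cons p IH) (w0w_absl h).
Qed.
(* The reversed word absorbs on the right, so both agree with their product. *)
Lemma w0w_rev m lo : heq (w0w m lo) (rev (w0w m lo)).
Proof.
have a : all (fun p => lo <= p < lo + m) (w0w m lo) by apply/allP => p /mem_w0w.
have a' : all (fun p => lo <= p < lo + m) (rev (w0w m lo)) by rewrite all_rev.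
apply: Htrans (Hsym (w0w_absl_seq a')) _.
by have := heq_rev (w0w_absl_seq a'); rewrite rev_cat revK.
Qed.
Lemma w0w_absr m lo p : lo <= p < lo + m -> heq (w0w m lo ++ [:: p]) (w0w m lo).
Proof.
move=> hp; apply: Htrans (heq_catr _ (w0w_rev m lo)) _.
have := heq_rev (w0w_absl hp); rewrite rev_cons -cats1 => h.
by apply: Htrans h (Hsym (w0w_rev m lo)).
Qed.

Lemma EBw_heq v v' u : heq v v' -> EBw v u = EBw v' u.
Proof. by move=> h; apply: eq_flat; rewrite ?shape_EBw // !flatten_EBw (Eword_heq _ h). Qed.
Lemma EBw_nil v : EBw v [::] = [::]. Proof. by elim: v. Qed.

(** The highest weight word of the component of [u], for [N] rows. *)
Definition cl N (u : bword) := EBw (w0w N.-1 0) u.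
Lemma cl_E N p u : p.+1 < N -> cl N (EB p u) = cl N u.
Proof. by move=> h; apply: (EBw_heq u (@w0w_absl N.-1 0 p _)); lia. Qed.
Lemma cl_Ew N v u : all (fun p => p.+1 < N) v -> cl N (EBw v u) = cl N u.
Proof. by elim: v u => //= p v IH u /andP[h av]; rewrite IH // cl_E. Qed.
Lemma cl_fix N p u : p.+1 < N -> EB p (cl N u) = cl N u.
Proof.
move=> h; have := EBw_heq u (@w0w_absr N.-1 0 p _); rewrite EBw_cat; apply; lia.
Qed.
Lemma EBw_fix v u : (forall p, p \in v -> EB p u = u) -> EBw v u = u.
Proof.
elim: v => //= p v IH h; rewrite h ?mem_head // IH // => q qv.
by apply: h; rewrite inE qv orbT.
Qed.
Lemma cl_hw N u : (forall p, p.+1 < N -> EB p u = u) -> cl N u = u.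
Proof. by move=> h; apply: EBw_fix => p /mem_w0w hp; apply: h; lia. Qed.

Lemma EB_notin p u : all (fun b => (p.+1 \notin b)) u -> EB p u = u.
Proof.
rewrite /EB; move: 0 => c; elim: u c => //= b u IH c /andP[h /IH ->]; congr (_ :: _).
elim: b c h => //= x b IHb c; rewrite inE negb_or eq_sym => /andP[/negPf h1 h2].
by rewrite h1; case: ifP => _; rewrite IHb.
Qed.
Lemma all_lt_EBw n v u : (forall p, p \in v -> p.+1 < n) -> all (all (gtn n)) u -> all (all (gtn n)) (EBw v u).
Proof. by move=> h a; rewrite all_EBw // => p /h /=; lia. Qed.
(** Letters only move to smaller rows, so further nodes find nothing to raise. Proofs may thus use
    as many auxiliary rows as they like. *)
Lemma cl_indep n N u : 0 < n <= N -> all (all (gtn n)) u -> cl N u = cl n u.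
Proof.
move=> nN a; have -> : cl N u = cl N (cl n u).
  by rewrite cl_Ew //; apply/allP => p /mem_w0w; lia.
apply: cl_hw => p pN; have [h|h] := ltnP p.+1 n; first exact: cl_fix.
apply: EB_notin; have : all (all (gtn n)) (cl n u) by apply: all_lt_EBw => // q /mem_w0w; lia.
by apply: sub_all => b /allP hb; apply/negP => /hb /=; lia.
Qed.

Section Tabloids.
Variable L : nat.
Implicit Types (Rs : seq (seq nat)).

(** The biword of a tabloid sorted by letters instead of rows. This exchange, the symmetry of the
    Robinson-Schensted correspondence, turns insertion into raising operators. *)
Definition blk s Rs := flatten [seq nseq (count_mem s (nth [::] Rs r)) r | r <- rev (iota 0 (size Rs))].
Definition bw Rs : bword := [seq blk s Rs | s <- iota 1 L].

Lemma count_blk r s Rs : count_mem r (blk s Rs) = count_mem s (nth [::] Rs r).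
Proof.
rewrite /blk count_flatten -map_comp map_rev sumn_rev.
have e k : (([eta count_mem r] \o (fun r0 => nseq (count_mem s (nth [::] Rs r0)) r0)) k) =
   (if k == r then count_mem s (nth [::] Rs r) else 0).
  by rewrite /= count_nseq /=; case: eqP => [->|_]; rewrite ?mul1n ?mul0n.
rewrite (eq_map e); have [h|h] := ltnP r (size Rs); last first.
  by rewrite nth_default // sumnE big_map big1 // => k _; case: eqP.
have : count_mem r (iota 0 (size Rs)) = 1 by rewrite count_uniq_mem ?iota_uniq // mem_iota /= add0n h.
elim: (iota 0 (size Rs)) => //= k t IH; case: (k =P r) => [_|_] /=; last by rewrite !add0n.
rewrite add1n => [] [] /count_memPn rt; rewrite (_ : sumn _ = 0) ?addn0 //.
elim: t rt {IH} => //= k2 t IH; rewrite inE negb_or eq_sym => /andP[/negPf -> h2].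
by rewrite IH.
Qed.
Lemma sorted_blk s Rs : sorted geq (blk s Rs).
Proof.
rewrite /blk; set ks := rev _.
have : sorted gtn ks by rewrite rev_sorted; apply: iota_ltn_sorted.
elim: ks => //= k ks IH sk.
have gk : all (fun k' => k' < k) ks by move: sk => /=; apply: order_path_min => x y z /=; lia.
have {}IH := IH (path_sorted sk).
have hall : all (geq k) (flatten [seq nseq (count_mem s (nth [::] Rs r)) r | r <- ks]).
  by apply/allP => x /flattenP [t /mapP [k' /(allP gk) h ->]] /nseqP [-> _] /=; exact: ltnW.
move: hall IH; move: (flatten _) => F hall sF; elim: (count_mem _ _) => //= c IH; rewrite path_min_sorted ?IH //.
by rewrite all_cat hall andbT; apply/allP => x /nseqP [-> _] /=.
Qed.
Lemma blk_lt s Rs : all (gtn (size Rs)) (blk s Rs).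
Proof.
apply/allP => x /flattenP [t /mapP [k + ->]] /nseqP [-> _]; rewrite mem_rev mem_iota /=; lia.
Qed.
Lemma eq_blk s Rs (b : seq nat) : sorted geq b -> (forall r, count_mem r b = count_mem s (nth [::] Rs r)) ->
  b = blk s Rs.
Proof. by move=> sb h; apply: sorted_count_eq => // [|r]; rewrite ?sorted_blk // count_blk h. Qed.
Lemma sorted_bw Rs : all (sorted geq) (bw Rs).
Proof. by apply/allP => b /mapP [s _ ->]; exact: sorted_blk. Qed.
Lemma bw_lt Rs : all (all (gtn (size Rs))) (bw Rs).
Proof. by apply/allP => b /mapP [s _ ->]; exact: blk_lt. Qed.
Lemma eq_bw Rs Rs' : (forall r, nth [::] Rs r = nth [::] Rs' r) -> bw Rs = bw Rs'.
Proof.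
move=> e; apply: eq_map => s; apply: eq_blk; first exact: sorted_blk.
by move=> r; rewrite count_blk e.
Qed.
Lemma bw_rcons0 Rs : bw (rcons Rs [::]) = bw Rs.
Proof.
apply: eq_bw => r; rewrite nth_rcons; case: ltnP => // h; rewrite (nth_default _ h).
by case: ifP.
Qed.

(* a is the lower row: it is read first. *)
Lemma EB_merge A (a b : seq nat) B : sorted leq (a ++ b) ->
  EB (size A) (bw (A ++ [:: b; a] ++ B)) = bw (A ++ [:: a ++ b; [::]] ++ B).
Proof.
move=> sab; set Rs := A ++ _; set Rs' := A ++ _; set p := size A.
have nR r : nth [::] Rs r = if r == p then b else if r == p.+1 then a else nth [::] Rs' r.
  rewrite /Rs /Rs' /p !nth_cat; case: (ltngtP r (size A)) => [h|h|->]; last by rewrite subnn.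
    by case: (r =P (size A).+1) => // e; lia.
  case: (r =P (size A).+1) => [->|h2]; first by rewrite subSnn.
  by have -> : r - size A = (r - (size A).+2).+2 by lia.
have nR' r : nth [::] Rs' r = if r == p then a ++ b else if r == p.+1 then [::] else nth [::] Rs r.
  rewrite /Rs /Rs' /p !nth_cat; case: (ltngtP r (size A)) => [h|h|->]; last by rewrite subnn.
    by case: (r =P (size A).+1) => // e; lia.
  case: (r =P (size A).+1) => [->|h2]; first by rewrite subSnn.
  by have -> : r - size A = (r - (size A).+2).+2 by lia.
(* Invariant along the blocks: an open bracket remains only once all letters of [a] have been
   passed, so every letter of [a] is raised. *)
suff H n s c : (c = 0 \/ all (gtn s) a) ->
    scanB p c [seq blk s Rs | s <- iota s n] = [seq blk s Rs' | s <- iota s n].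
  by apply: H; left.
elim: n s c => //= n IH s c hc.
have pp : (p == p.+1) = false by rewrite neqS.
have key : scan p c (blk s Rs) = blk s Rs' /\ (cnt p c (blk s Rs) = 0 \/ all (gtn s.+1) a).
  have cp : count_mem p (blk s Rs) = count_mem s b by rewrite count_blk nR eqxx.
  have cp1 : count_mem p.+1 (blk s Rs) = count_mem s a by rewrite count_blk nR eqSn eqxx.
  have srt := sorted_blk s Rs.
  have hca : c = 0 \/ count_mem s a = 0.
    case: hc => [->|/allP h]; first by left.
    by right; apply/count_memPn/negP => /h /=; lia.
  have E1 (w : seq nat) c0 : sorted geq w -> (c0 = 0 \/ count_mem p.+1 w = 0) ->
      scan p c0 w = [seq if x == p.+1 then p else x | x <- w] /\
      cnt p c0 w = count_mem p w + c0.
    clear; elim: w c0 => [|y w IH] c0 //= sw h.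
    have sw' : sorted geq w := path_sorted sw.
    have le : all (geq y) w by apply: order_path_min sw => x1 x2 x3 /=; lia.
    case: (y =P p) => [ey|yp] /=.
      have z : count_mem p.+1 w = 0.
        by apply/count_memPn/negP => /(allP le) /=; rewrite ey; lia.
      rewrite ey eqnS; have [|-> ->] := IH c0.+1 sw'; first by right.
      by split=> //; rewrite addnS add1n addSn.
    case: (y =P p.+1) h => [->|yp1] h /=.
      have c00 : c0 = 0 by case: h => //; rewrite add1n.
      by subst c0; have [|-> ->] := IH 0 sw'; [left|].
    by have [|-> ->] := IH c0 sw'; first by case: h => h; [left|right].
  have [|-> ->] := E1 _ c srt; first by rewrite cp1.
  split.
    apply: eq_blk => [|r].
      have <- : scan p c (blk s Rs) = [seq if x == p.+1 then p else x | x <- blk s Rs].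
        by have [|] := E1 _ c srt; rewrite ?cp1.
      by rewrite sorted_scan.
    rewrite count_map nR'; case: (r =P p) => [->|rp].
      rewrite count_cat -cp1 -cp addnC -count_predUI [X in _ = _ + X](_ : _ = 0).
        by rewrite addn0; apply: eq_count => x /=; case: (x =P p.+1) => [->|_]; rewrite ?eqxx ?eqSn ?orbT ?orbF.
      apply/eqP; rewrite -leqn0 leqNgt -has_count; apply/hasP => [] [x _ /= /andP[/eqP -> /eqP]]; lia.
    case: (r =P p.+1) => [->|rp1].
      apply/eqP; rewrite -leqn0 leqNgt -has_count; apply/hasP => [] [x _ /=].
      by case: (x =P p.+1) => [_|h /eqP //]; rewrite pp.
    rewrite -count_blk; apply: eq_count => x /=; case: (x =P p.+1) => [->|_] //.
    by rewrite eq_sym (introF eqP rp) [RHS]eq_sym (introF eqP rp1).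
  rewrite cp; case: hc => [c0|h]; last by right; apply: sub_all h => y /=; lia.
  rewrite c0 addn0; have [z|z] := posnP (count_mem s b); first by left.
  right; move: z; rewrite -has_count => /hasP [y yb /eqP ys]; subst y.
  move: sab; rewrite (sorted_pairwise leq_trans) pairwise_cat => /and3P[/allrelP h _ _].
  by apply/allP => x xa /=; rewrite ltnS; exact: h.
case: key => -> hk; congr (_ :: _); exact: IH.
Qed.

Definition clR N Rs := cl N (bw Rs).
Lemma clR_merge N A (a b : seq nat) B : sorted leq (a ++ b) -> (size A).+1 < N ->
  clR N (A ++ [:: b; a] ++ B) = clR N (A ++ [:: a ++ b; [::]] ++ B).
Proof. by move=> sab h; rewrite /clR -(cl_E _ h) EB_merge. Qed.
Lemma clR_nil N A B : all (sorted leq) B -> (size A + size B).+1 <= N ->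
  clR N (A ++ [::] :: B) = clR N (A ++ B).
Proof.
elim: B A => [|R B IH] A.
  by rewrite cats1 cats0 => _ _; rewrite /clR bw_rcons0.
move=> /= /andP[sR sB] h; rewrite -[_ :: _ :: B]/([:: [::]; R] ++ B) clR_merge ?cats0 //; last by lia.
rewrite -[[:: _; _] ++ B]/([:: R] ++ [::] :: B) catA IH //; first by rewrite -catA.
by rewrite size_cat /=; lia.
Qed.
Lemma clR_merge' N A (a b : seq nat) B : sorted leq (a ++ b) -> all (sorted leq) B ->
  (size A + size B).+2 <= N ->
  clR N (A ++ [:: b; a] ++ B) = clR N (A ++ [:: a ++ b] ++ B).
Proof.
move=> sab sB h; rewrite clR_merge //; last by lia.
rewrite -[[:: _; _] ++ B]/([:: a ++ b] ++ [::] :: B) catA clR_nil -?catA // size_cat /=; lia.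
Qed.

Definition sing (w : seq nat) : seq (seq nat) := [seq [:: x] | x <- rev w].
Lemma sing_cat u v : sing (u ++ v) = sing v ++ sing u.
Proof. by rewrite /sing rev_cat map_cat. Qed.
Lemma size_sing w : size (sing w) = size w.
Proof. by rewrite size_map size_rev. Qed.
Lemma sorted_sing w : all (sorted leq) (sing w).
Proof. by apply/allP => R /mapP [x _ ->]. Qed.

Lemma clR_sing_row N A (R : seq nat) B : sorted leq R -> all (sorted leq) B ->
  (size A + size R + size B).+1 <= N ->
  clR N (A ++ sing R ++ B) = clR N (A ++ R :: B).
Proof.
elim: R B => [|a R IH] B sR sB h; first by rewrite clR_nil //; move: h => /=; lia.
rewrite -cat1s sing_cat -catA IH /=.
- by rewrite -[R :: [:: a] :: B]/([:: R; [:: a]] ++ B) clR_merge' //; move: h => /=; lia.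
- exact: path_sorted sR.
- by [].
- by move: h => /=; lia.
Qed.
(** Rows are cut into singletons by reading [clR_merge] backwards. Hence the highest weight word
    depends on the reading word only, provided [N] leaves room for one row per letter. *)
Lemma clR_read N A Rs : all (sorted leq) Rs -> (size A + size (flatten Rs) + size Rs).+1 <= N ->
  clR N (A ++ sing (flatten (rev Rs))) = clR N (A ++ Rs).
Proof.
elim: Rs A => [|R Rs IH] A //=; rewrite size_cat => /andP[sR sRs] h.
rewrite rev_cons -cats1 flatten_cat /= cats0 sing_cat clR_sing_row ?sorted_sing //; last first.
  rewrite size_sing (_ : size (flatten (rev Rs)) = size (flatten Rs)); first by lia.
  by rewrite !size_flatten /shape map_rev sumn_rev.
by rewrite -cat1s catA IH -?catA // size_cat /=; lia.
Qed.

(* Letters of three rows woven into a fixed word of inert letters. *)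
Fixpoint weave (m : seq (option nat)) (f : seq nat) : seq nat := match m with
  | Some q :: m' => q :: weave m' f
  | None :: m' => if f is a :: f' then a :: weave m' f' else weave m' [::]
  | [::] => [::] end.
Lemma weave_scan p c m f : all (fun o => if o is Some q then (q != p) && (q != p.+1) else true) m ->
  scan p c (weave m f) = weave m (scan p c f).
Proof.
elim: m f c => [|[q|] m IH] f c //= ; first by case/andP=> /andP[/negPf -> /negPf ->] h; rewrite IH.
move=> h; case: f => [|a f] /=; first exact: (IH [::]).
case: ifP => _; first by rewrite IH.
by case: ifP => _; [case: c => [|c]; rewrite IH|rewrite IH].
Qed.
Lemma weave_Eword v m f : (forall p, p \in v -> all (fun o => if o is Some q then (q != p) && (q != p.+1) else true) m) ->
  Eword v (weave m f) = weave m (Eword v f).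
Proof.
elim: v f => //= p v IH f h; rewrite /E weave_scan ?IH //; last by apply: h; rewrite mem_head.
by move=> q qv; apply: h; rewrite inE qv orbT.
Qed.

Lemma blk_cat s A B : blk s (A ++ B) = map (addn (size A)) (blk s B) ++ blk s A.
Proof.
rewrite /blk size_cat iotaD rev_cat map_cat flatten_cat map_flatten; congr (_ ++ _); last first.
  congr flatten; apply/eq_in_map => r; rewrite mem_rev mem_iota /= => h.
  by rewrite nth_cat add0n in h *; rewrite h.
congr flatten; rewrite add0n -{1}[size A]addn0 iotaDl -map_rev -!map_comp; apply: eq_map => r /=.
by rewrite map_nseq nth_cat ltnNge leq_addr addKn.
Qed.

Section Three.
Variables (A B : seq (seq nat)).
Let r := size A.
Definition mid (c1 c2 c3 s : nat) := nseq (c1 == s) r.+2 ++ nseq (c2 == s) r.+1 ++ nseq (c3 == s) r.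
Definition midw c1 c2 c3 n := flatten [seq mid c1 c2 c3 s | s <- iota 1 n].
Definition mask3 (c1 c2 c3 n : nat) := flatten [seq
   [seq Some (x + r.+3) | x <- blk s B] ++ nseq ((c1 == s) + (c2 == s) + (c3 == s)) None ++ [seq Some x | x <- blk s A]
   | s <- iota 1 n].

Lemma weave_Some m f (t : seq nat) : weave (map Some t ++ m) f = t ++ weave m f.
Proof. by elim: t => //= q t ->. Qed.
Lemma weave_None k m f f' : size f = k -> weave (nseq k None ++ m) (f ++ f') = f ++ weave m f'.
Proof. by elim: k f => [|k IH] [|a f] //= [] /IH ->. Qed.

Lemma bw_weave c1 c2 c3 : flatten (bw (A ++ [:: [:: c3]; [:: c2]; [:: c1]] ++ B)) =
  weave (mask3 c1 c2 c3 L) (midw c1 c2 c3 L).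
Proof.
rewrite /bw /mask3 /midw; have fl (T : Type) (c : seq T) d : flatten (c :: d) = c ++ flatten d by [].
elim: (iota 1 L) => [//|s t IH].
have em : map (addn (size A)) (blk s [:: [:: c3]; [:: c2]; [:: c1]]) = mid c1 c2 c3 s.
  rewrite /blk /= /rev /= /mid !cats0 !addn0 !map_cat !map_nseq -/r.
  by rewrite addn2 addn1 addn0.
have sm : size (mid c1 c2 c3 s) = (c1 == s) + (c2 == s) + (c3 == s).
  by rewrite /mid !size_cat !size_nseq addnA.
rewrite !map_cons !fl IH; move: (mid c1 c2 c3 s) em sm => md em sm; rewrite !blk_cat -!catA.
have -> : [seq Some (x + r.+3) | x <- blk s B] = [seq Some x | x <- [seq x + r.+3 | x <- blk s B]].
  by rewrite -map_comp.
rewrite weave_Some map_cat -catA; congr (_ ++ _).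
  by rewrite -map_comp; apply: eq_map => x /=; rewrite -/r; lia.
by rewrite em weave_None ?weave_Some.
Qed.
Lemma mask3_inert c1 c2 c3 p : r <= p <= r.+1 ->
  all (fun o => if o is Some q then (q != p) && (q != p.+1) else true) (mask3 c1 c2 c3 L).
Proof.
move=> hp; apply/allP => o /flattenP [t /mapP [s _ ->]]; rewrite !mem_cat => /or3P[].
- by move=> /mapP [x _ ->]; lia.
- by move=> /nseqP [-> _].
- by move=> /mapP [x /(allP (blk_lt s A)) /=] + ->; rewrite -/r; lia.
Qed.
(** The word [r, r.+1, r] is absorbed by the longest element and moves only the three singleton
    rows; all other letters are inert for it. So it suffices to compare its effect on three
    letters. *)
Lemma clR_three N c1 c2 c3 d1 d2 d3 : r.+2 < N ->
  (forall s, (c1 == s) + (c2 == s) + (c3 == s) = (d1 == s) + (d2 == s) + (d3 == s)) ->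
  Eword [:: r; r.+1; r] (midw c1 c2 c3 L) = Eword [:: r; r.+1; r] (midw d1 d2 d3 L) ->
  clR N (A ++ [:: [:: c3]; [:: c2]; [:: c1]] ++ B) = clR N (A ++ [:: [:: d3]; [:: d2]; [:: d1]] ++ B).
Proof.
move=> rN hm he; rewrite /clR.
have av : all (fun p => p.+1 < N) [:: r; r.+1; r] by rewrite /= rN !(ltn_trans _ rN).
rewrite -(cl_Ew _ av) -[RHS](cl_Ew _ av); congr cl; apply: eq_flat.
  rewrite !shape_EBw /shape /bw -!map_comp; apply: eq_map => s.
  change (size (blk s (A ++ [:: [:: c3]; [:: c2]; [:: c1]] ++ B)) = size (blk s (A ++ [:: [:: d3]; [:: d2]; [:: d1]] ++ B))).
  rewrite !blk_cat !size_cat !size_map !size_cat !size_map.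
  by have := hm s; rewrite !size_nseq /= !addn0 => e; congr (_ + _ + _); move: e; clear; lia.
rewrite !flatten_EBw !bw_weave.
have -> : mask3 d1 d2 d3 L = mask3 c1 c2 c3 L.
  by rewrite /mask3; congr flatten; apply: eq_map => s; rewrite hm.
rewrite !weave_Eword ?he // => p hp; apply: mask3_inert; move: hp; rewrite !inE; lia.
Qed.

Definition opt (b : bool) (k : nat) := if b then [:: k] else [::].
Lemma midwS c1 c2 c3 n : midw c1 c2 c3 n.+1 = midw c1 c2 c3 n ++ mid c1 c2 c3 n.+1.
Proof. by rewrite /midw iota_rcons map_cat flatten_cat /= cats0 add1n. Qed.

Ltac midtac x y z n IH := rewrite midwS IH /mid /opt -!(ltnS _ n);
  case: (ltngtP x n.+1) => hx; case: (ltngtP y n.+1) => hy; case: (ltngtP z n.+1) => hz //=; exfalso; lia.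

Lemma midw_xzy x y z n : 0 < x <= y -> y < z ->
  midw x z y n = opt (x <= n) r.+2 ++ opt (y <= n) r ++ opt (z <= n) r.+1.
Proof.
move=> h1 h2; elim: n => [|n IH]; last by midtac x y z n IH.
by rewrite /midw /= !leqn0; do !case: eqP => ? //=; lia.
Qed.
Lemma midw_zxy x y z n : 0 < x <= y -> y < z ->
  midw z x y n = opt (x <= n) r.+1 ++ opt (y <= n) r ++ opt (z <= n) r.+2.
Proof.
move=> h1 h2; elim: n => [|n IH]; last by midtac x y z n IH.
by rewrite /midw /= !leqn0; do !case: eqP => ? //=; lia.
Qed.
Lemma midw_yxz x y z n : 0 < x < y -> y <= z ->
  midw y x z n = opt (x <= n) r.+1 ++ opt (y <= n) r.+2 ++ opt (z <= n) r.
Proof.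
move=> h1 h2; elim: n => [|n IH]; last by midtac x y z n IH.
by rewrite /midw /= !leqn0; do !case: eqP => ? //=; lia.
Qed.
Lemma midw_yzx x y z n : 0 < x < y -> y <= z ->
  midw y z x n = opt (x <= n) r ++ opt (y <= n) r.+2 ++ opt (z <= n) r.+1.
Proof.
move=> h1 h2; elim: n => [|n IH]; last by midtac x y z n IH.
by rewrite /midw /= !leqn0; do !case: eqP => ? //=; lia.
Qed.
End Three.

Definition okl (x : nat) := 0 < x <= L.
Lemma clR_knuth_rel N u a b v : knuth_rel a b -> all okl (u ++ a ++ v) -> size (u ++ a ++ v) <= N ->
  clR N (sing (u ++ a ++ v)) = clR N (sing (u ++ b ++ v)).
Proof.
move=> rab; rewrite !all_cat !size_cat => /and3P[_ oa _] sz; rewrite !sing_cat -!catA.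
have n1 k : (k == k.+1) = false by rewrite neqS.
have n2 k : (k.+1 == k) = false by rewrite neqS.
have n3 k : (k.+2 == k) = false by rewrite neqS.
have n4 k : (k == k.+2) = false by rewrite neqS.
case: rab oa sz => [x y z h|x y z h] /= /and4P[ox oy oz _] sz.
  apply: (@clR_three (sing v) (sing u) N x z y z x y); [by rewrite size_sing; move: sz => /=; lia|by move=> s; lia|].
  rewrite midw_xzy ?midw_zxy //; try by move: ox; rewrite /okl; lia.
  have [-> [-> ->]] : (x <= L) /\ (y <= L) /\ (z <= L) by move: ox oy oz; rewrite /okl; lia.
  by rewrite /= /E /= ?(eqxx, n1, n2, n3, n4) /= ?(eqxx, n1, n2, n3, n4) /= ?(eqxx, n1, n2, n3, n4).
apply: (@clR_three (sing v) (sing u) N y x z y z x); [by rewrite size_sing; move: sz => /=; lia|by move=> s; lia|].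
rewrite midw_yxz ?midw_yzx //; try by move: oy; rewrite /okl; lia.
have [-> [-> ->]] : (x <= L) /\ (y <= L) /\ (z <= L) by move: ox oy oz; rewrite /okl; lia.
by rewrite /= /E /= ?(eqxx, n1, n2, n3, n4) /= ?(eqxx, n1, n2, n3, n4) /= ?(eqxx, n1, n2, n3, n4).
Qed.
Lemma knuth_perm v w : knuth_eq v w -> perm_eq v w.
Proof.
elim=> {v w} [u a b v r|w|v w _|u v w _ h1 _ h2]; [|by []|by rewrite perm_sym|exact: perm_trans h1 h2].
rewrite perm_cat2l perm_cat2r; case: r => x y z _; apply/seq.permP => P /=; lia.
Qed.
Lemma clR_knuth N v w : knuth_eq v w -> all okl v -> size v <= N -> clR N (sing v) = clR N (sing w).
Proof.
elim=> {v w} [u a b v r|w|v w k IH|u v w k1 h1 k2 h2] //.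
- exact: clR_knuth_rel.
- by move=> a s; rewrite IH // ?(perm_all _ (knuth_perm k)) ?(perm_size (knuth_perm k)).
- move=> a s; rewrite h1 // h2 //.
    by rewrite -(perm_all _ (knuth_perm k1)).
  by rewrite -(perm_size (knuth_perm k1)).
Qed.
End Tabloids.
End TabloidWords.

(** * Column insertion yields a tableau in the same Knuth class *)

Module ColumnInsertion.
From mathcomp Require Import all_boot zify.
Import Defs Scan FilteredSets Columns KnuthMoves Dominance Windows Folding TabloidWords.

Lemma knuth_ctx u v w x : knuth_eq v w -> knuth_eq (u ++ v ++ x) (u ++ w ++ x).
Proof.
elim=> {v w} [u' a b v' r|w|a b _ IH|a b c _ IH _ IH'].
- by rewrite -!catA !(catA u); apply: KnuthStep.
- exact: KnuthRefl.
- exact: KnuthSym.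
- exact: KnuthTrans IH IH'.
Qed.
Lemma knuth_catl u v w : knuth_eq v w -> knuth_eq (u ++ v) (u ++ w).
Proof. by move/(knuth_ctx u [::]); rewrite !cats0. Qed.
Lemma knuth_catr v w x : knuth_eq v w -> knuth_eq (v ++ x) (w ++ x).
Proof. exact: (knuth_ctx [::] x). Qed.

(* A column is read from the bottom. *)
Definition cread (C : seq (seq nat)) := flatten [seq rev c | c <- C].

Lemma knuth_swap1 x y z : x <= y < z -> knuth_eq [:: x; z; y] [:: z; x; y].
Proof. by move=> h; have := KnuthStep [::] [::] (Knuth1 h). Qed.
Lemma knuth_swap2 x y z : x < y <= z -> knuth_eq [:: y; x; z] [:: y; z; x].
Proof. by move=> h; have := KnuthStep [::] [::] (Knuth2 h). Qed.

(* x z1 .. zk y with x <= y < z_i, z decreasing: x moves right. *)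
Lemma knuth_move_right x y (s : seq nat) : all (ltn y) s -> sorted gtn s -> x <= y ->
  knuth_eq (x :: s ++ [:: y]) (s ++ [:: x; y]).
Proof.
elim: s => [|z s IH] /= ; first by move=> _ _ _; exact: KnuthRefl.
case/andP=> yz ys sz xy.
have sz' := path_sorted sz; apply: KnuthTrans (knuth_catl [:: z] (IH ys sz' xy)).
case: s {IH} ys sz sz' => [|z' s] /= ys sz sz'; first by apply: knuth_swap1; rewrite xy.
have h : x <= z' < z by case/andP: ys => h _; case/andP: sz => h2 _; move: h h2 xy => /=; lia.
exact: (knuth_catr (s ++ [:: y]) (knuth_swap1 h)).
Qed.
Lemma knuth_move_right2 x y (s : seq nat) : all (gtn x) s -> sorted gtn s -> x <= y ->
  knuth_eq (x :: y :: s) (x :: s ++ [:: y]).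
Proof.
elim: s x => [|z s IH] x; first by move=> _ _ _; exact: KnuthRefl.
move=> /= /andP[zx xs] sz xy.
have h : z < x <= y by rewrite zx.
apply: KnuthTrans (knuth_catr s (KnuthSym (knuth_swap2 h))) _.
apply: (knuth_catl [:: x]); apply: IH; [|exact: path_sorted sz|by lia].
by apply: order_path_min sz => a b c /=; lia.
Qed.

Lemma col_insert1 x (c : seq nat) : sorted ltn c -> let k := find (leq x) c in
  if k < size c then knuth_eq (x :: rev c) (rev (set_nth 0 c k x) ++ [:: nth 0 c k])
  else x :: rev c = rev (rcons c x).
Proof.
move=> sc; set k := find _ c => /=; case: ltnP => kc; last by rewrite rev_rcons.
have kh : has (leq x) c by rewrite has_find.
have xk : x <= nth 0 c k by apply: nth_find.
have ec : c = take k c ++ nth 0 c k :: drop k.+1 c by rewrite -drop_nth // cat_take_drop.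
have es : set_nth 0 c k x = take k c ++ x :: drop k.+1 c.
  by rewrite set_nthE kc.
set y := nth 0 c k in ec xk *; set a := take k c in ec es *; set d := drop k.+1 c in ec es *.
have la : all (gtn x) a.
  apply/allP => z za; rewrite /= ltnNge; apply/negP => xz.
  have /(nthP 0) [j ja ej] := za; have jk : j < k by move: ja; rewrite size_take kc.
  by have := before_find 0 jk; rewrite -(nth_take _ jk) -/a ej xz.
have : sorted ltn (a ++ y :: d) by rewrite -ec.
rewrite (sorted_pairwise ltn_trans) pairwise_cat /= => /and3P[/allrelP ad pa /andP[yd pd]].
rewrite es {1}ec !rev_cat !rev_cons -!cats1 -!catA /=.
have sd : sorted ltn d by rewrite (sorted_pairwise ltn_trans).
have h1 : knuth_eq (x :: rev d ++ [:: y]) (rev d ++ [:: x; y]).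
  by apply: knuth_move_right; rewrite ?all_rev ?rev_sorted.
have h2 : knuth_eq (x :: y :: rev a) (x :: rev a ++ [:: y]).
  by apply: knuth_move_right2; rewrite ?all_rev ?rev_sorted // (sorted_pairwise ltn_trans).
have := KnuthTrans (knuth_catr (rev a) h1) _; rewrite /= -!catA /=; apply.
exact: knuth_catl.
Qed.

Lemma cread_insert x C : all (sorted ltn) C -> knuth_eq (x :: cread C) (cread (col_insert x C)).
Proof.
elim: C x => [|c C IH] x /=; first by move=> _; exact: KnuthRefl.
case/andP=> sc sC; have := col_insert1 x sc => /=; case: ifP => _ h.
  rewrite /cread /= -cat_cons; apply: KnuthTrans (knuth_catr _ h) _.
  by rewrite -catA; apply: knuth_catl; apply: IH.
by rewrite /cread /= -h; exact: KnuthRefl.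
Qed.

Definition ent (X : seq (seq nat)) i j := nth 0 (nth [::] X i) j.
Definition inT (X : seq (seq nat)) i j := j < size (nth [::] X i).
(* Row tableaux are isT leq ltn, column tableaux isT ltn leq. *)
Definition isT (e1 e2 : rel nat) (X : seq (seq nat)) :=
  (forall i j, inT X i j.+1 -> e1 (ent X i j) (ent X i j.+1)) /\
  (forall i j, inT X i.+1 j -> inT X i j /\ e2 (ent X i j) (ent X i.+1 j)).
Lemma inT_le X i j j' : inT X i j -> j' <= j -> inT X i j'.
Proof. rewrite /inT; lia. Qed.
Lemma isT_in e1 e2 X i i' j : isT e1 e2 X -> inT X i j -> i' <= i -> inT X i' j.
Proof.
move=> [_ h]; elim: i => [|i IH]; first by case: i'.
move=> hi; rewrite leq_eqVlt => /orP[/eqP -> //|]; rewrite ltnS; apply: IH.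
by case: (h _ _ hi).
Qed.
Lemma isT_sorted e1 e2 X : isT e1 e2 X -> all (sorted e1) X.
Proof.
move=> [h _]; apply/(all_nthP [::]) => i iX; apply/(sortedP 0) => j hj; exact: h.
Qed.

Section Transpose.
Variables (e1 e2 : rel nat) (X : seq (seq nat)).
Hypothesis hX : isT e1 e2 X.
Lemma isT_shape : sorted geq (shape X).
Proof.
apply/(sortedP 0) => i; rewrite size_map => hi; rewrite !(nth_map [::]) //; last by lia.
case e : (size (nth [::] X i.+1)) => [|k] //=.
by have [_ /(_ i k)] := hX; rewrite /inT e => /(_ (ltnSn _)) [].
Qed.
Lemma width_transpose : foldr maxn 0 (shape X) = size (nth [::] X 0).
Proof.
case: X isT_shape => //= r Y /(order_path_min geq_trans') h; apply/maxn_idPl.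
by elim: (shape Y) h => //= k s IH /andP[h1 /IH h2]; rewrite geq_max h1 h2.
Qed.
Lemma size_transpose : size (transpose X) = size (nth [::] X 0).
Proof. by rewrite size_map size_iota width_transpose. Qed.
Lemma nth_transpose j : j < size (nth [::] X 0) ->
  nth [::] (transpose X) j = [seq nth 0 r j | r <- X & j < size r].
Proof. by move=> h; rewrite (nth_map 0) ?size_iota ?width_transpose // nth_iota ?width_transpose. Qed.
Lemma filter_prefix j : forall i, i < size [seq r <- X | j < size r] ->
  nth [::] [seq r <- X | j < size r] i = nth [::] X i.
Proof.
have := isT_shape; elim: (X) => //= r Y IH sY i; case: ifP => h; first by case: i => //= i; apply: IH; exact: path_sorted sY.
have -> // : [seq r0 <- Y | j < size r0] = [::].
apply/eqP; rewrite -size_eq0 size_filter -leqn0 leqNgt -has_count; apply/hasP => [] [r' rY].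
by have /allP /(_ (size r') (map_f size rY)) /= := order_path_min geq_trans' sY; lia.
Qed.
Lemma size_filter_prefix j i : (i < size [seq r <- X | j < size r]) = inT X i j.
Proof.
rewrite /inT; have := isT_shape; elim: (X) i => [|r Y IH] i sY /=; first by rewrite nth_nil.
case: ifP => h; first by case: i => [|i] //=; rewrite ltnS IH // ; exact: path_sorted sY.
have -> : [seq r0 <- Y | j < size r0] = [::].
  apply/eqP; rewrite -size_eq0 size_filter -leqn0 leqNgt -has_count; apply/hasP => [] [r' rY].
  by have /allP /(_ (size r') (map_f size rY)) /= := order_path_min geq_trans' sY; lia.
case: i => [|i] /=; first by rewrite h.
have [iY|iY] := ltnP i (size Y); last by rewrite nth_default.
have := allP (order_path_min geq_trans' sY) (size (nth [::] Y i)) (map_f size (mem_nth _ iY)).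
by move=> /=; lia.
Qed.
Lemma inT_transpose j i : inT (transpose X) j i = inT X i j.
Proof.
have [h|h] := ltnP j (size (nth [::] X 0)).
  by rewrite {1}/inT nth_transpose // size_map size_filter_prefix.
rewrite {1}/inT nth_default ?size_transpose //; apply/esym/negP => /(isT_in hX) /(_ (leq0n i)).
by rewrite /inT; lia.
Qed.
Lemma ent_transpose j i : inT X i j -> ent (transpose X) j i = ent X i j.
Proof.
move=> hi; have h := isT_in hX hi (leq0n i).
rewrite /ent nth_transpose // (nth_map [::]) ?size_filter_prefix // filter_prefix //.
by rewrite size_filter_prefix.
Qed.
Lemma isT_transpose : isT e2 e1 (transpose X).
Proof.
have [h1 h2] := hX; split=> i j; rewrite !inT_transpose => h.
  by have [h3 h4] := h2 _ _ h; rewrite !ent_transpose.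
have h3 : inT X j i by apply: inT_le h _.
by split=> //; rewrite !ent_transpose //; apply: h1.
Qed.
Lemma transpose_nonempty : all (fun c => c != [::]) (transpose X).
Proof.
apply/(all_nthP [::]) => j hj; rewrite -size_eq0 -lt0n -/(inT (transpose X) j 0) inT_transpose.
by rewrite /inT -size_transpose.
Qed.
End Transpose.

Lemma eq_ent X Y : all (fun c => c != [::]) X -> all (fun c => c != [::]) Y ->
  (forall i j, inT X i j = inT Y i j) -> (forall i j, inT X i j -> ent X i j = ent Y i j) -> X = Y.
Proof.
move=> nX nY hi he.
have sz (Z : seq (seq nat)) : all (fun c => c != [::]) Z -> forall i, (i < size Z) = inT Z i 0.
  move=> nZ i; rewrite /inT; have [h|h] := ltnP i (size Z); last by rewrite nth_default.
  by have := all_nthP [::] nZ i h; rewrite -size_eq0 lt0n.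
have ltE (a b : nat) : (forall i, (i < a) = (i < b)) -> a = b.
  by move=> h; have := h a; have := h b; rewrite !ltnn; lia.
have s : size X = size Y by apply: ltE => i; rewrite (sz X) // hi -(sz Y).
apply: (@eq_from_nth _ [::]) => // i iX.
have s2 : size (nth [::] X i) = size (nth [::] Y i).
  by apply: ltE => j; exact: hi.
by apply: (@eq_from_nth _ 0) => // j jX; apply: he.
Qed.
Lemma transposeK e1 e2 X : isT e1 e2 X -> all (fun c => c != [::]) X -> transpose (transpose X) = X.
Proof.
move=> hX nX; have hX' := isT_transpose hX; apply: eq_ent => //; first exact: transpose_nonempty hX'.
  by move=> i j; rewrite (inT_transpose hX') (inT_transpose hX).
move=> i j; rewrite (inT_transpose hX') => h; rewrite (ent_transpose hX') //.
by rewrite (ent_transpose hX) // -(inT_transpose hX).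
Qed.

Lemma knuth_peel1 y (t s : seq nat) : sorted leq t -> all (leq y) t -> path gtn y s ->
  knuth_eq (y :: t ++ s) (y :: s ++ t).
Proof.
elim: s y => [|x s IH] y st yt /=; first by rewrite cats0 => _; exact: KnuthRefl.
case/andP=> xy sx.
have xt : all (leq x) t by apply: sub_all yt => z /=; move: xy => /=; lia.
apply: (@KnuthTrans _ (y :: x :: t ++ s)); last exact: (knuth_catl [:: y] (IH x st xt sx)).
rewrite -cat_rcons -[X in knuth_eq X]/((y :: rcons t x) ++ s) -[X in knuth_eq _ X]/((y :: x :: t) ++ s).
apply: knuth_catr.
elim: t y st yt xy {IH xt} => [|z t IHt] y st yt xy /=; first exact: KnuthRefl.
have /andP[yz yt'] := yt.
have zt : all (leq z) t by apply: order_path_min st; exact: leq_trans.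
have h : x < y <= z by move: xy => /=; lia.
apply: KnuthTrans (knuth_catr t (KnuthSym (knuth_swap2 h))).
apply: (knuth_catl [:: y]); apply: IHt => //; first exact: path_sorted st.
by move: xy yz => /=; lia.
Qed.
(** Brings the first column to the front of the row reading; its iteration turns row reading into
    column reading. *)
Lemma knuth_peel T : isT leq ltn T -> all (fun c => c != [::]) T ->
  knuth_eq (flatten (rev T)) (rev [seq head 0 r | r <- T] ++ flatten (rev [seq behead r | r <- T])).
Proof.
elim/last_ind: T => [|T r IH] hT; first by move=> _; exact: KnuthRefl.
rewrite all_rcons => /andP[r0 nT].
have nthr i : i < size T -> nth [::] (rcons T r) i = nth [::] T i by move=> h; rewrite nth_rcons h.
have hT' : isT leq ltn T.
  have [h1 h2] := hT; split=> i j; rewrite /inT /ent => h.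
    have hi : i < size T by rewrite ltnNge; apply/negP => hi; rewrite nth_default in h.
    by have := h1 i j; rewrite /inT /ent nthr //; apply.
  have hi : i.+1 < size T by rewrite ltnNge; apply/negP => hi; rewrite nth_default in h.
  by have := h2 i j; rewrite /inT /ent !nthr //; [apply|lia].
rewrite rev_rcons !map_rcons !rev_rcons /=; case: r r0 hT {nthr} => // c t _ hT /=.
apply: KnuthTrans (knuth_catl (c :: t) (IH hT' nT)) _.
rewrite catA [X in knuth_eq _ (_ :: X)]catA -cat_cons; apply: knuth_catr.
have st : sorted leq (c :: t).
  by have := isT_sorted hT; rewrite all_rcons => /andP[].
apply: knuth_peel1; first exact: path_sorted st.
  by apply: order_path_min st; exact: leq_trans.
have [_ h2] := hT.
have : sorted gtn (rev [seq head 0 r | r <- rcons T (c :: t)]).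
  rewrite rev_sorted; apply/(sortedP 0) => i; rewrite size_map => hi.
  rewrite !(nth_map [::]) ?(ltnW hi) //.
  have nn : inT (rcons T (c :: t)) i.+1 0.
    have nT' : all (fun c => c != [::]) (rcons T (c :: t)) by rewrite all_rcons.
    by have := all_nthP [::] nT' _ hi; rewrite -size_eq0 -lt0n.
  by have [_] := h2 i 0 nn; rewrite /ent !nth0.
by rewrite map_rcons rev_rcons.
Qed.

Lemma cread_transpose T : isT leq ltn T -> knuth_eq (flatten (rev T)) (cread (transpose T)).
Proof.
have [m] := ubnP (size (nth [::] T 0)); elim: m T => // m IH T sm hT.
pose T1 := [seq r <- T | 0 < size r].
have nth1 i : nth [::] T1 i = nth [::] T i.
  have [h|h] := ltnP i (size T1); first by rewrite (filter_prefix hT).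
  rewrite nth_default // ; have : ~~ inT T i 0 by rewrite -(size_filter_prefix hT) -leqNgt.
  by rewrite /inT -leqNgt leqn0 => /eqP /size0nil ->.
have hT1 : isT leq ltn T1.
  by have [h1 h2] := hT; split=> i j; rewrite /inT /ent !nth1; [exact: h1|exact: h2].
have n1 : all (fun c => c != [::]) T1.
  by apply/allP => r; rewrite mem_filter -size_eq0 -lt0n => /andP[].
have fl : flatten (rev T) = flatten (rev T1).
  rewrite /T1; elim: (T) => //= r Y IHY; rewrite rev_cons -cats1 flatten_cat /= cats0 IHY.
  by case: ifP => h; [rewrite rev_cons -cats1 flatten_cat /= cats0|case: r h => //; rewrite cats0].
pose T2 := [seq behead r | r <- T1].
have nth2 i : nth [::] T2 i = behead (nth [::] T i).
  have [h|h] := ltnP i (size T1); first by rewrite (nth_map [::]) // nth1.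
  by rewrite nth_default ?size_map // -nth1 nth_default.
have hT2 : isT leq ltn T2.
  have [h1 h2] := hT; split=> i j; rewrite /inT /ent !nth2 !nth_behead size_behead => h.
    by apply: h1; rewrite /inT; lia.
  by rewrite size_behead; have [] := h2 i j.+1; rewrite /inT; [lia|move=> ? ?; split=> //; lia].
rewrite fl; apply: KnuthTrans (knuth_peel hT1 n1) _.
case e0 : (size (nth [::] T 0)) => [|k].
  have e1 : T1 = [::].
    apply: size0nil; apply/eqP; rewrite -leqn0 leqNgt (size_filter_prefix hT) /inT e0.
    by [].
  have -> : transpose T = [::] by apply: size0nil; rewrite (size_transpose hT).
  by rewrite e1; exact: KnuthRefl.
have -> : transpose T = [seq head 0 r | r <- T1] :: transpose T2.
  apply: eq_ent; first exact: transpose_nonempty hT.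
  - rewrite /= (transpose_nonempty hT2) andbT -size_eq0 size_map -lt0n (size_filter_prefix hT).
    by rewrite /inT e0.
  - move=> i j; rewrite (inT_transpose hT); case: i => [|i].
      by rewrite [RHS]/inT /= size_map /T1 (size_filter_prefix hT).
    by rewrite {2}/inT /= -/(inT _ i j) (inT_transpose hT2) /inT nth2 size_behead; lia.
  - move=> i j; rewrite (inT_transpose hT) => h; rewrite (ent_transpose hT) //.
    case: i h => [|i] h.
      by rewrite /ent /= (nth_map [::]) ?nth1 ?nth0 // (size_filter_prefix hT).
    rewrite {2}/ent /= -/(ent _ i j) (ent_transpose hT2) /ent ?nth2 ?nth_behead //.
    by move: h; rewrite /inT nth2 size_behead; lia.
apply: knuth_catl; apply: IH => //; rewrite nth2 size_behead e0 /=; lia.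
Qed.

Lemma isT_cons c C : isT ltn leq (c :: C) <-> [/\ sorted ltn c, isT ltn leq C, size (nth [::] C 0) <= size c
  & forall j, j < size (nth [::] C 0) -> nth 0 c j <= nth 0 (nth [::] C 0) j].
Proof.
split.
  move=> [h1 h2]; split.
  - by apply/(sortedP 0) => j hj; exact: (h1 0 j).
  - by split=> i j; [exact: (h1 i.+1 j)|exact: (h2 i.+1 j)].
  - case e : (size (nth [::] C 0)) => [|k] //.
    by have [|] := h2 0 k; rewrite /inT /= ?e.
  - by move=> j hj; have [|] := h2 0 j.
move=> [h1 [h2 h3] h4 h5]; split=> [] [|i] j.
- by move=> hj; exact: (sortedP 0 h1).
- exact: h2.
- by move=> hj; split; [exact: leq_trans hj h4|exact: h5].
- exact: h3.
Qed.

Lemma col_insert_isT x C : isT ltn leq C -> all (fun c => c != [::]) C ->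
  isT ltn leq (col_insert x C) /\ all (fun c => c != [::]) (col_insert x C).
Proof.
(* Strengthened by the explicit new first column: the induction has to compare it with the column on
   its left, using that the bumped entry lands weakly higher. *)
suff H : isT ltn leq C -> all (fun c => c != [::]) C ->
  [/\ isT ltn leq (col_insert x C), all (fun c => c != [::]) (col_insert x C) &
   let c := nth [::] C 0 in let k := find (leq x) c in
   nth [::] (col_insert x C) 0 = if k < size c then set_nth 0 c k x else rcons c x].
  by move=> h1 h2; have [] := H h1 h2.
elim: C x => [|c C IH] x.
  by move=> _ _; split=> //; split=> [] [|i] j //; rewrite /inT /= ?nth_nil.
move=> /isT_cons [sc hC szc le] /= /andP[c0 nC].
set k := find (leq x) c; case: ltnP => kc; last first.
  split=> //=; last by rewrite -size_eq0 size_rcons.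
  apply/isT_cons; split=> //.
  - rewrite -cats1 (sorted_pairwise ltn_trans) pairwise_cat /= andbT -(sorted_pairwise ltn_trans) sc andbT.
    apply/allrelP => z w zc; rewrite inE => /eqP ->; rewrite ltnNge; apply/negP => xz.
    by move: kc; rewrite leqNgt -has_find => /negP; apply; apply/hasP; exists z.
  - by rewrite size_rcons; exact: leqW.
  - by move=> j hj; rewrite nth_rcons (leq_trans hj szc); exact: le.
set y := nth 0 c k.
have xy : x <= y by apply: nth_find; rewrite has_find.
have [h1 h2 h3] := IH y hC nC.
have bf j : j < k -> nth 0 c j < x by move=> jk; have := before_find 0 jk; lia.
have snth j : nth 0 (set_nth 0 c k x) j = if j == k then x else nth 0 c j by rewrite nth_set_nth.
have ssz : size (set_nth 0 c k x) = size c by rewrite size_set_nth; apply/maxn_idPr.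
have cs i j : i < j -> j < size c -> nth 0 c i < nth 0 c j.
  by move=> ij jc; apply: (sorted_ltn_nth ltn_trans) => //; rewrite inE //; lia.
have snew : sorted ltn (set_nth 0 c k x).
  apply/(sortedP 0) => j; rewrite ssz => hj; rewrite !snth.
  case: (j =P k) => [ej|nj]; case: (j.+1 =P k) => [ej1|nj1]; try lia.
  - by apply: leq_ltn_trans xy _; rewrite /y -ej; apply: cs.
  - by apply: bf; lia.
  - by apply: cs.
set c1 := nth [::] C 0 in h3 szc le; set k' := find (leq y) c1 in h3.
have k'k : k' <= k.
  rewrite leqNgt; apply/negP => h; have := before_find 0 h.
  have kc1 : k < size c1 by apply: leq_trans h (find_size _ _).
  by rewrite (le k kc1).
have lex j : j <= k -> nth 0 (set_nth 0 c k x) j <= x.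
  by move=> jk; rewrite snth; case: eqP => // nj; apply: ltnW; apply: bf; lia.
have lec j : nth 0 (set_nth 0 c k x) j <= nth 0 c j.
  by rewrite snth; case: eqP => // ->.
have fs : k' <= size c1 by exact: find_size.
rewrite /= in h3.
split=> //=; last by rewrite h2 andbT -size_eq0 ssz size_eq0.
apply/isT_cons; split=> //; rewrite h3 ?ssz.
  case: ifP => h; last by rewrite size_rcons; move/negbT: h; rewrite -leqNgt => h; lia.
  by rewrite size_set_nth geq_max szc andbT; lia.
move=> j; case: ifP => h.
  rewrite size_set_nth (maxn_idPr h) => hj; rewrite [X in _ <= X]nth_set_nth [X in _ <= X]/= -/k'.
  case: (j =P k') => [->|_].
    by apply: leq_trans xy; exact: lex.
  by apply: leq_trans (lec j) _; exact: le.
rewrite size_rcons nth_rcons => hj; case: (ltngtP j (size c1)) => hj'.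
- by apply: leq_trans (lec j) _; exact: le.
- by lia.
- by apply: leq_trans xy; apply: lex; move/negbT: h; rewrite -leqNgt => h; lia.
Qed.

Lemma col_insert_row_ok (r : seq nat) T : isT leq ltn T -> 
  let R := col_insert_row r T in
  [/\ isT leq ltn R, all (fun c => c != [::]) R & knuth_eq (r ++ flatten (rev T)) (flatten (rev R))].
Proof.
move=> hT R; have hC := isT_transpose hT; have nC := transpose_nonempty hT.
have [h1 h2 h3] : [/\ isT ltn leq (foldr col_insert (transpose T) r),
   all (fun c => c != [::]) (foldr col_insert (transpose T) r)
   & knuth_eq (r ++ flatten (rev T)) (cread (foldr col_insert (transpose T) r))].
  elim: r {R} => [|x r [h1 h2 h3]] /=; first by split=> //; exact: cread_transpose.
  have [h4 h5] := col_insert_isT x h1 h2; split=> //.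
  apply: KnuthTrans (knuth_catl [:: x] h3) _; apply: cread_insert; exact: isT_sorted h1.
have hR : isT leq ltn R := isT_transpose h1.
split=> //; first exact: transpose_nonempty h1.
apply: KnuthTrans h3 _; apply: KnuthSym; rewrite -[X in cread X](transposeK h1 h2).
exact: cread_transpose.
Qed.
End ColumnInsertion.

(** * Tableaux are the highest weight block words *)

Module TableauWords.
From mathcomp Require Import all_boot zify.
Import Defs Scan FilteredSets Columns KnuthMoves Dominance Windows Folding TabloidWords ColumnInsertion.

Definition rread (T : seq (seq nat)) := flatten (rev T).

Section T2.
Variable L : nat.
Notation bw := (bw L).

Lemma count_le_sorted (r : seq nat) j s : sorted leq r -> (j < count (leq^~ s) r) = (j < size r) && (nth 0 r j <= s).
Proof.
elim: r j => [|x r IH] j //= sr.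
have sr' := path_sorted sr; have /allP xr : all (leq x) r by apply: order_path_min sr; exact: leq_trans.
case: (leqP x s) => xs; first by case: j => [|j] //=; rewrite ?xs // add1n !ltnS IH.
rewrite add0n (_ : count _ r = 0); last first.
  by apply/eqP; rewrite -leqn0 leqNgt -has_count; apply/hasP => [] [y /xr h1 /= h2]; lia.
rewrite ltn0; case: j => [|j] /=; first by rewrite leqNgt xs.
rewrite ltnS; case: ltnP => //= h; have h2 := xr _ (mem_nth 0 h).
by apply/esym/negbTE; rewrite -ltnNge; exact: leq_trans xs h2.
Qed.

Lemma scan_sorted p c (w : seq nat) : sorted geq w ->
  (scan p c w = w <-> count_mem p.+1 w <= c) /\
  (count_mem p.+1 w <= c -> cnt p c w = c - count_mem p.+1 w + count_mem p w).
Proof.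
elim: w c => [|y w IH] c; first by rewrite /= subn0 addn0.
move=> sw; have sw' : sorted geq w := path_sorted sw.
have le : all (geq y) w by apply: order_path_min sw => x1 x2 x3 /=; lia.
rewrite [scan _ _ _]/= [cnt _ _ _]/= [count_mem p.+1 _]/= [count_mem p _]/=.
case: (y =P p) => [ey|yp].
  have z : count_mem p.+1 w = 0.
    by apply/count_memPn/negP => /(allP le) /=; rewrite ey; lia.
  have [h1 h2] := IH c.+1 sw'; rewrite z in h1 h2 *; rewrite ey eqnS !add0n leq0n.
  split; first by split=> // _; congr (_ :: _); apply/h1.
  by move=> _; rewrite h2 // !subn0 addSnnS.
case: (y =P p.+1) => [ey|yp1].
  rewrite ey; case: c => [|c].
    by rewrite add1n; split=> //; split=> // [[]] /n_Sn.
  have [h1 h2] := IH c sw'; split.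
    by rewrite add1n ltnS -h1; split=> [[->]//|->].
  by rewrite add1n ltnS [c.+1.-1]/= => /h2 ->; rewrite subSS.
have [h1 h2] := IH c sw'; rewrite !add0n; split=> //.
by rewrite -h1; split=> [[->]//|->].
Qed.

(* Before the block of the letter s, the counter of node p is the number of
   smaller letters in row p minus their number in row p + 1. *)
Lemma EB_fixP Rs p : all (sorted leq) Rs -> all (all (fun x => 0 < x <= L)) Rs ->
  EB p (bw Rs) = bw Rs <->
  forall j, inT Rs p.+1 j -> inT Rs p j /\ ent Rs p j < ent Rs p.+1 j.
Proof.
move=> sRs okR; set a := nth [::] Rs p.+1; set b := nth [::] Rs p.
have nthok (P : pred (seq nat)) i : P [::] -> all P Rs -> P (nth [::] Rs i).
  by move=> P0 /allP h; have [hi|hi] := ltnP i (size Rs); [apply: h; exact: mem_nth|rewrite nth_default].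
have sa : sorted leq a by apply: (nthok (sorted leq)).
have sb : sorted leq b by apply: (nthok (sorted leq)).
have oa : all (fun x => 0 < x <= L) a by apply: (nthok (all (fun x => 0 < x <= L))).
have ob : all (fun x => 0 < x <= L) b by apply: (nthok (all (fun x => 0 < x <= L))).
have step c s : (scan p c (blk s Rs) = blk s Rs <-> count_mem s a <= c) /\
    (count_mem s a <= c -> cnt p c (blk s Rs) = c - count_mem s a + count_mem s b).
  have ca : count_mem p.+1 (blk s Rs) = count_mem s a by rewrite count_blk.
  have cb : count_mem p (blk s Rs) = count_mem s b by rewrite count_blk.
  by rewrite -ca -cb; apply: scan_sorted; exact: sorted_blk.
have main n s c : (scanB p c [seq blk t Rs | t <- iota s n] = [seq blk t Rs | t <- iota s n]) <->
   (forall k, k < n -> count (fun x => s <= x <= s + k) a <= c + count (fun x => s <= x < s + k) b).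
  elim: n s c => [|n IH] s c; first by split.
  have [st1 st2] := step c s; rewrite /=; split.
    case=> /st1 h; rewrite (st2 h) => /IH h3 [|k] kn.
      rewrite addn0 (@eq_count _ _ (pred1 s)); last by move=> x /=; lia.
      by apply: leq_trans h _; exact: leq_addr.
    have := h3 k kn.
    have e1 (r : seq nat) : count (fun x => s <= x <= s + k.+1) r = count_mem s r + count (fun x => s.+1 <= x <= s.+1 + k) r.
      by elim: r => //= x r ->; case: (ltngtP s x) => h4; lia.
    have e2 (r : seq nat) : count (fun x => s <= x < s + k.+1) r = count_mem s r + count (fun x => s.+1 <= x < s.+1 + k) r.
      by elim: r => //= x r ->; case: (ltngtP s x) => h4; lia.
    by rewrite e1 e2; lia.
  move=> h; have h0 : count_mem s a <= c.
    have := h 0 (ltn0Sn n); rewrite addn0 (@eq_count _ _ (pred1 s)); last by move=> x /=; lia.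
    by rewrite [X in _ <= _ + X](@eq_count _ _ pred0) ?count_pred0 ?addn0 // => x /=; lia.
  congr (_ :: _); first exact/st1.
  rewrite (st2 h0); apply/IH => k kn; have := h k.+1 kn.
  have e1 (r : seq nat) : count (fun x => s <= x <= s + k.+1) r = count_mem s r + count (fun x => s.+1 <= x <= s.+1 + k) r.
    by elim: r => //= x r ->; case: (ltngtP s x) => h4; lia.
  have e2 (r : seq nat) : count (fun x => s <= x < s + k.+1) r = count_mem s r + count (fun x => s.+1 <= x < s.+1 + k) r.
    by elim: r => //= x r ->; case: (ltngtP s x) => h4; lia.
  by rewrite e1 e2; lia.
rewrite /EB main.
have ea k : k < L -> count (fun x => 1 <= x <= 1 + k) a = count (leq^~ k.+1) a.
  by move=> kL; apply: eq_in_count => x /(allP oa) h /=; lia.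
have eb k : k < L -> count (fun x => 1 <= x < 1 + k) b = count (leq^~ k) b.
  by move=> kL; apply: eq_in_count => x /(allP ob) h /=; lia.
split.
  move=> h j; rewrite /inT /ent -/a -/b => ja; set s := nth 0 a j.
  have /andP[s0 sL] : 0 < s <= L by apply: (allP oa); exact: mem_nth.
  have sL' : s.-1 < L by lia.
  have := h s.-1 sL'; rewrite ea // eb // add0n prednK // => hh.
  have : j < count (leq^~ s) a by rewrite count_le_sorted // ja leqnn.
  by move=> /leq_trans /(_ hh); rewrite count_le_sorted // => /andP[-> ]; lia.
move=> h k kL; rewrite add0n ea // eb //.
case e : (count (leq^~ k.+1) a) => [|j] //.
have : j < count (leq^~ k.+1) a by rewrite e.
rewrite count_le_sorted // => /andP[ja hj]; have [h1 h2] := h j ja.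
by rewrite count_le_sorted // [_ < size b]h1 /=; move: h2; rewrite /ent -/a -/b; lia.
Qed.

Definition okT (Rs : seq (seq nat)) := all (sorted leq) Rs && all (all (fun x => 0 < x <= L)) Rs.
Lemma hw_isT Rs : okT Rs -> (forall p, EB p (bw Rs) = bw Rs) <-> isT leq ltn Rs.
Proof.
case/andP=> sRs okR; split.
  move=> h; split=> i j.
    rewrite /inT => hj; have iR : i < size Rs by rewrite ltnNge; apply/negP => hi; rewrite nth_default in hj.
    by apply: (sortedP 0) hj; apply: (allP sRs); exact: mem_nth.
  by move/(EB_fixP i sRs okR): (h i); apply.
by move=> [_ h] p; apply/(EB_fixP p sRs okR) => j; exact: h.
Qed.

Lemma eq_rows (a b : seq nat) : sorted leq a -> sorted leq b -> (forall s, count_mem s a = count_mem s b) -> a = b.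
Proof.
move=> sa sb h; apply: (sorted_eq leq_trans anti_leq) => //.
by apply/allP => x _ /=; apply/eqP.
Qed.
Lemma bw_inj Rs Rs' : okT Rs -> okT Rs' -> size Rs = size Rs' -> bw Rs = bw Rs' -> Rs = Rs'.
Proof.
move=> /andP[s1 o1] /andP[s2 o2] sz e; apply: (@eq_from_nth _ [::]) => // r hr.
have hr' : r < size Rs' by rewrite -sz.
apply: eq_rows; [exact: (allP s1 _ (mem_nth _ hr))|exact: (allP s2 _ (mem_nth _ hr'))|] => s.
have z (X : seq (seq nat)) : r < size X -> all (all (fun x => 0 < x <= L)) X -> ~~ (0 < s <= L) -> count_mem s (nth [::] X r) = 0.
  by move=> hX oX ns; apply/count_memPn; apply: contra ns => /(allP (allP oX _ (mem_nth _ hX))).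
case os : (0 < s <= L); last by rewrite !z ?os.
rewrite -!count_blk; congr (count_mem r _).
have := congr1 (fun u => nth [::] u s.-1) e.
rewrite !(nth_map 0) ?size_iota; try by lia.
have -> // : nth 0 (iota 1 L) s.-1 = s.
by case/andP: os => h1 h2; rewrite nth_iota ?add1n ?prednK.
Qed.

Definition rowt r (u : bword) : seq nat := flatten [seq nseq (count_mem r (nth [::] u s)) s.+1 | s <- iota 0 (size u)].
Definition tab l (u : bword) := mkseq (fun r => rowt r u) l.
Lemma count_rowt r s u : count_mem s (rowt r u) = if 0 < s then count_mem r (nth [::] u s.-1) else 0.
Proof.
rewrite /rowt count_flatten -map_comp.
have e k : (([eta count_mem s] \o (fun s0 => nseq (count_mem r (nth [::] u s0)) s0.+1)) k) =
   (if k.+1 == s then count_mem r (nth [::] u s.-1) else 0).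
  by rewrite /= count_nseq /=; case: eqP => [<-|_]; rewrite ?mul1n ?mul0n.
rewrite (eq_map e); case: s {e} => [|s] /=; first by elim: (iota _ _).
have [h|h] := ltnP s (size u); last first.
  by rewrite nth_default // sumnE big_map big1 // => k _; case: ifP.
have : count_mem s (iota 0 (size u)) = 1 by rewrite count_uniq_mem ?iota_uniq // mem_iota /= add0n h.
elim: (iota 0 (size u)) => //= k t IH; rewrite eqSS; case: (k =P s) => [_|_] /=; last by rewrite !add0n.
rewrite add1n => [] [] /count_memPn rt; rewrite (_ : sumn _ = 0) ?addn0 //.
elim: t rt {IH} => //= k2 t IH; rewrite inE negb_or eq_sym eqSS => /andP[/negPf -> h2].
by rewrite IH.
Qed.
Lemma sorted_rowt r u : sorted leq (rowt r u).
Proof.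
rewrite /rowt; have : sorted ltn (iota 0 (size u)) := iota_ltn_sorted _ _.
elim: (iota 0 (size u)) => //= k ks IH sk.
have gk : all (ltn k) ks by apply: order_path_min sk; exact: ltn_trans.
have {}IH := IH (path_sorted sk).
have hall : all (leq k.+1) (flatten [seq nseq (count_mem r (nth [::] u s)) s.+1 | s <- ks]).
  by apply/allP => x /flattenP [t /mapP [k' /(allP gk) h ->]] /nseqP [-> _] /=; exact: ltnW.
move: hall IH; move: (flatten _) => F hall sF; elim: (count_mem _ _) => //= c IH; rewrite path_min_sorted ?IH //.
by rewrite all_cat hall andbT; apply/allP => x /nseqP [-> _] /=.
Qed.
Lemma okT_tab l u : size u = L -> okT (tab l u).
Proof.
move=> sz; apply/andP; split; apply/allP => R /mapP [r _ ->]; first exact: sorted_rowt.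
apply/allP => x /flattenP [t /mapP [s + ->]] /nseqP [-> _]; rewrite mem_iota sz; lia.
Qed.
Lemma bw_tab l u : size u = L -> all (sorted geq) u -> all (all (gtn l)) u -> bw (tab l u) = u.
Proof.
move=> sz su lu; apply: (@eq_from_nth _ [::]); first by rewrite size_map size_iota.
move=> s; rewrite size_map size_iota => sL; rewrite (nth_map 0) ?size_iota // nth_iota // add1n.
have su' : s < size u by rewrite sz.
apply/esym/eq_blk => [|r]; first exact: (allP su _ (mem_nth _ su')).
have [rl|rl] := ltnP r l; first by rewrite nth_mkseq // count_rowt.
rewrite [nth [::] (tab _ _) _]nth_default ?size_mkseq // [RHS]/=; apply/count_memPn/negP => /(allP (allP lu _ (mem_nth _ su'))) /=; lia.
Qed.
Lemma tab_bw Rs : okT Rs -> tab (size Rs) (bw Rs) = Rs.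
Proof.
move=> oR; apply: bw_inj => //; rewrite ?size_mkseq //.
  by apply: okT_tab; rewrite size_map size_iota.
by apply: bw_tab; rewrite ?size_map ?size_iota ?sorted_bw ?bw_lt.
Qed.

Lemma rread_ok Rs : okT Rs -> all (okl L) (rread Rs).
Proof.
case/andP=> _ /allP h; apply/allP => x /flattenP [R]; rewrite mem_rev => RR xR.
exact: (allP (h R RR)).
Qed.
Lemma size_rread Rs : size (rread Rs) = size (flatten Rs).
Proof. by rewrite /rread !size_flatten /shape map_rev sumn_rev. Qed.

Lemma knuth_cl n Rs Rs' : okT Rs -> okT Rs' -> 0 < n -> size Rs <= n -> size Rs' <= n ->
  knuth_eq (rread Rs) (rread Rs') -> cl n (bw Rs) = cl n (bw Rs').
Proof.
move=> o1 o2 n0 s1 s2 k.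
(* Room for both tabloids cut into single cells; [cl_indep] returns to [n] rows. *)
pose N := (n + size (flatten Rs) + size Rs + size Rs').+1.
have sz : size (flatten Rs') = size (flatten Rs).
  by have := perm_size (knuth_perm k); rewrite (size_rread Rs) (size_rread Rs').
have lt (Z : seq (seq nat)) : size Z <= n -> all (all (gtn n)) (bw Z).
  by move=> h; apply: sub_all (bw_lt L Z) => b; apply: sub_all => x /=; lia.
rewrite -!(@cl_indep n N) ?lt //; try by rewrite /N; lia.
have [a1 _] := andP o1; have [a2 _] := andP o2.
rewrite -!/(clR L N _) -[Rs]cat0s -[Rs']cat0s -(@clR_read L N [::] Rs) ?add0n //; last by rewrite /N; lia.
rewrite -(@clR_read L N [::] Rs') ?add0n ?sz //; last by rewrite /N; lia.
rewrite !cat0s; apply: clR_knuth => //; first exact: rread_ok.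
by rewrite size_rread /N; lia.
Qed.


(** [R] is a tableau Knuth equivalent to [S], so its block word is of highest weight and equals the
    closure of that of [S]. The closure stays in rows below [size S] and [R] has no empty row, which
    bounds its size. *)
Lemma insert_cl (S : seq (seq nat)) : okT S -> 0 < size S -> isT leq ltn (take (size S).-1 S) ->
  let R := col_insert_row (last [::] S) (take (size S).-1 S) in
  [/\ size R <= size S, isT leq ltn R, okT R, knuth_eq (rread S) (rread R)
    & bw R = cl (size S) (bw S)].
Proof.
move=> oS S0 hT R; set n := size S in S0 hT R *.
have [hR nR kR] := col_insert_row_ok (last [::] S) hT; rewrite -/R in hR nR kR.
have eS : S = rcons (take n.-1 S) (last [::] S).
  have aux (X : seq (seq nat)) : 0 < size X -> X = rcons (take (size X).-1 X) (last [::] X).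
    by case/lastP: X => // s x _; rewrite size_rcons last_rcons /= -{2}cats1 take_size_cat.
  exact: aux.
have {}kR : knuth_eq (rread S) (rread R) by rewrite {1}eS /rread rev_rcons.
have oR : okT R.
  apply/andP; split; first exact: isT_sorted hR.
  apply/allP => r rR; apply/allP => x xr.
  have : x \in rread R by apply/flattenP; exists r; rewrite ?mem_rev.
  by rewrite -(perm_mem (knuth_perm kR)) => /(allP (rread_ok oS)).
pose N := (n + size R).+1.
have e : bw R = cl n (bw S).
  have <- : cl N (bw R) = bw R by apply: cl_hw => p _; apply: (hw_isT oR).2.
  rewrite -(@knuth_cl N S R) //; try by rewrite /N -/n; lia.
  by apply: cl_indep; [rewrite /N; lia|exact: bw_lt].
split=> //; rewrite leqNgt; apply/negP => h.
have r0 : nth [::] R n != [::] by apply: (allP nR); exact: mem_nth.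
have [x xr] : exists x, x \in nth [::] R n by case: (nth [::] R n) r0 => // x r _; exists x; rewrite mem_head.
have ox : 0 < x <= L by have [_ /allP o2] := andP oR; exact: allP (o2 _ (mem_nth [::] h)) _ xr.
have lt : all (all (gtn n)) (cl n (bw S)) by apply: all_lt_EBw (bw_lt L S) => p /mem_w0w; lia.
rewrite -e in lt.
have bx : blk x R \in bw R by apply: map_f; rewrite mem_iota; lia.
have : n \in blk x R by rewrite -has_pred1 has_count count_blk -has_count has_pred1.
by move=> /(allP (allP lt _ bx)) /=; rewrite ltnn.
Qed.
End T2.
End TableauWords.

(** * Insertion, [kat] and the katabolism test on block words *)

Module Katabolism.
From mathcomp Require Import all_boot zify.
Import Defs Scan FilteredSets Columns KnuthMoves Dominance Windows Folding TabloidWords ColumnInsertion TableauWords.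

(** The block word of a tabloid whose first [k] rows have block word [v] and whose other rows have
    [u] ([bw_cat]). *)
Definition joinb k (u v : bword) : bword := [seq map (addn k) b.1 ++ b.2 | b <- zip u v].

Lemma scan_join k p c (b a : seq nat) : all (gtn k) a ->
  scan (k + p) c (map (addn k) b ++ a) = map (addn k) (scan p c b) ++ a /\
  cnt (k + p) c (map (addn k) b ++ a) = cnt p c b.
Proof.
move=> ha; elim: b c => [|x b IH] c /=.
  elim: a c ha => //= x a IH c /andP[h1 h2].
  have -> : (x == k + p) = false by apply/negbTE; lia.
  have -> : (x == (k + p).+1) = false by apply/negbTE; lia.
  by have [-> ->] := IH c h2.
rewrite -addnS !eqn_add2l; have [e1 e2] := IH c; have [e3 e4] := IH c.+1; have [e5 e6] := IH c.-1; rewrite -?addnS in e1 e2 e3 e4 e5 e6.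
by case: (x == p); case: (x == p.+1); case: c {IH} e1 e2 e3 e4 e5 e6 => [|c] /= e1 e2 e3 e4 e5 e6; rewrite ?e1 ?e2 ?e3 ?e4 ?e5 ?e6.
Qed.
Lemma EB_join k p u v : size u = size v -> all (all (gtn k)) v ->
  EB (k + p) (joinb k u v) = joinb k (EB p u) v.
Proof.
rewrite /EB /joinb; elim: u v 0 => [|b u IH] [|a v] c //= [sz] /andP[h1 h2].
by have [-> ->] := scan_join p c b h1; rewrite IH.
Qed.
Lemma EBw_join k w u v : size u = size v -> all (all (gtn k)) v ->
  EBw (map (addn k) w) (joinb k u v) = joinb k (EBw w u) v.
Proof.
move=> + h; elim: w u => //= p w IH u sz; rewrite -/(EBw _ _) EB_join // IH //.
by rewrite /EB size_scanB.
Qed.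
Lemma w0w_shift k m lo : w0w m (k + lo) = map (addn k) (w0w m lo).
Proof.
elim: m lo => // m IH lo.
have e a : w0w m.+1 a = rev (iota a m.+1) ++ w0w m a.+1 by [].
by rewrite !e map_cat map_rev -iotaDl -addnS IH.
Qed.

Section T4.
Variable L : nat.
Implicit Types T A B : seq (seq nat).

Lemma blk_cat s A B : blk s (A ++ B) = map (addn (size A)) (blk s B) ++ blk s A.
Proof.
rewrite /blk size_cat iotaD rev_cat map_cat flatten_cat; congr (_ ++ _).
  rewrite map_flatten -map_comp -[0 + size A]addn0 iotaDl -map_rev -map_comp; congr flatten.
  by apply: eq_map => r /=; rewrite map_nseq nth_cat ltnNge leq_addr addKn.
congr flatten; apply/eq_in_map => r; rewrite mem_rev mem_iota add0n /= => h.
by rewrite nth_cat h.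
Qed.
Lemma bw_cat A B : bw L (A ++ B) = joinb (size A) (bw L B) (bw L A).
Proof.
by rewrite /bw /joinb; elim: (iota 1 L) => //= s t ->; rewrite blk_cat.
Qed.
Lemma size_bw T : size (bw L T) = L. Proof. by rewrite size_map size_iota. Qed.

Lemma size_blk s T : size (blk s T) = count_mem s (flatten T).
Proof.
rewrite /blk size_flatten /shape -map_comp map_rev sumn_rev.
have -> : count_mem s (flatten T) = sumn [seq count_mem s (nth [::] T r) | r <- iota 0 (size T)].
  by rewrite count_flatten -[in LHS](mkseq_nth [::] T) /mkseq -map_comp.
congr sumn.
by apply: eq_map => r /=; rewrite size_nseq.
Qed.

Lemma okT_cat A B : okT L (A ++ B) = okT L A && okT L B.
Proof. by rewrite /okT !all_cat; do 4 case: (all _ _). Qed.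
Lemma okT_nseq k : okT L (nseq k [::]).
Proof. by apply/andP; split; apply/allP => x /nseqP [-> _]. Qed.

Lemma isT_pad R k : isT leq ltn R -> isT leq ltn (R ++ nseq k [::]).
Proof.
have e i : nth [::] (R ++ nseq k [::]) i = nth [::] R i :> seq nat.
  rewrite nth_cat; case: ltnP => // h; rewrite nth_nseq [RHS]nth_default //.
  by case: ifP.
by case=> h1 h2; split=> i j; rewrite /inT /ent !e; [exact: h1|exact: h2].
Qed.

Lemma Pins_bw l m T : size T = l -> 0 < m <= l -> okT L T ->
  isT leq ltn (take (l - m) (drop m.-1 T)) ->
  [/\ size (Pins m T) = l, okT L (Pins m T), isT leq ltn (drop m.-1 (Pins m T))
    & bw L (Pins m T) = EBw (Wn l m) (bw L T)].
Proof.
move=> sT hm oT; set k := m.-1; set S := drop k T.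
have sS : size S = l - k by rewrite size_drop sT.
have -> : l - m = (size S).-1 by rewrite sS /k; lia.
have okS : okT L S by move: oT; rewrite -{1}(cat_take_drop k T) okT_cat => /andP[].
have okk : okT L (take k T) by move: oT; rewrite -{1}(cat_take_drop k T) okT_cat => /andP[].
have S0 : 0 < size S by rewrite sS /k; lia.
move=> hS; have [sR tR oR kR eR] := insert_cl okS S0 hS.
rewrite /Pins -/k -/S; move: (col_insert_row _ _) sR tR oR kR eR => R sR tR oR _ eR.
have sk : size (take k T) = k by rewrite size_take sT /k; case: ltnP; lia.
set R' := R ++ _; have sR' : size R' = size S by rewrite size_cat size_nseq; lia.
have eR' : bw L R' = bw L R.
  apply: eq_bw => r; rewrite nth_cat; case: ltnP => // h; rewrite nth_nseq [RHS]nth_default //.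
  by case: ifP.
split.
- by rewrite size_cat sR' sk sS /k; lia.
- by rewrite !okT_cat okk oR okT_nseq.
- by rewrite drop_size_cat //; exact: isT_pad.
rewrite bw_cat sk eR' eR -{2}(cat_take_drop k T) bw_cat sk -/S.
have -> : Wn l m = map (addn k) (w0w (size S).-1 0).
  by rewrite -w0w_shift addn0 /Wn -/k sS; congr (w0w _ _); rewrite /k; lia.
rewrite EBw_join ?size_bw //.
by have := bw_lt L (take k T); rewrite sk.
Qed.

Lemma okT_nth T r : okT L T -> sorted leq (nth [::] T r) /\ all (fun x => 0 < x <= L) (nth [::] T r).
Proof.
case/andP=> /allP h1 /allP h2; have [h|h] := ltnP r (size T); last by rewrite nth_default.
by split; [apply: h1|apply: h2]; exact: mem_nth.
Qed.
End T4.

Definition krow (r : seq nat) := [seq x.-1 | x <- r & x != 1].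
Lemma size_kat T : size (kat T) = size T. Proof. by rewrite size_rot size_map. Qed.
Lemma nth_kat T r : r < size T -> nth [::] (kat T) r = krow (nth [::] T (if r == (size T).-1 then 0 else r.+1)).
Proof.
case: T => // R T; rewrite /kat rot1_cons nth_rcons size_map [size _]/= => h.
have [e|ne] := eqVneq r (size T); first by rewrite e ltnn.
have hr : r < size T by lia.
by rewrite hr /= (nth_map [::]).
Qed.
Lemma count_krow s r : 0 < s -> count_mem s (krow r) = count_mem s.+1 r.
Proof.
move=> s0; rewrite /krow count_map count_filter; apply: eq_count => x /=.
by case: x => [|[|x]] /=; lia.
Qed.
Lemma sorted_krow r : sorted leq r -> sorted leq (krow r).
Proof.
move=> sr; rewrite /krow sorted_map; apply: (@sub_sorted _ leq); first by move=> x y /=; lia.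
exact: sorted_filter leq_trans _ _ sr.
Qed.
Lemma okT_kat L T : okT L.+1 T -> okT L (kat T).
Proof.
move=> oT; apply/andP; split; apply/allP => R; rewrite mem_rot => /mapP [r rT ->].
  by apply: sorted_krow; case/andP: oT => /allP h _; exact: h.
apply/allP => x /mapP [y]; rewrite mem_filter => /andP[y1 yr] ->.
by case/andP: oT => _ /allP /(_ _ rT) /allP /(_ _ yr); lia.
Qed.
Lemma bw_kat l L T : 1 < l -> size T = l -> bw L (kat T) = map (rotb l) (behead (bw L.+1 T)).
Proof.
move=> l1 sT; rewrite /bw [iota 1 L.+1]/= [behead _]/= -map_comp.
rewrite -[iota 2 L]/(iota (1 + 1) L) iotaDl -map_comp; apply/eq_in_map => s; rewrite mem_iota => hs /=.
have lt := blk_lt (1 + s) T; rewrite sT in lt.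
apply/esym/eq_blk; first by apply: sorted_rotb => //; exact: sorted_blk.
move=> r; have [rl|rl] := ltnP r l.
  rewrite count_rotb // nth_kat sT // count_krow; last by lia.
  by rewrite count_blk add1n.
rewrite [nth _ (kat T) r]nth_default ?size_kat ?sT //.
by apply/count_memPn/negP => /(allP (rotb_lt l1 lt)) /=; lia.
Qed.

Lemma ones_blk T : ones_in_first_row T = (blk 1 T == nseq (size (blk 1 T)) 0).
Proof.
have -> : (blk 1 T == nseq (size (blk 1 T)) 0) = all (pred1 0) (blk 1 T).
  by rewrite eq_sym; apply/eqP/all_pred1P => ->//; rewrite size_nseq.
rewrite /ones_in_first_row; apply/negP/allP => [h x xb|h /flattenP [r rT xr]].
  rewrite /=; apply/negPn/negP => x0; case: h.
  move: xb; rewrite -has_pred1 has_count count_blk -has_count has_pred1 => h1.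
  have xT : x < size T by rewrite ltnNge; apply/negP => hx; rewrite nth_default in h1.
  apply/flattenP; exists (nth [::] T x) => //.
  have -> : nth [::] T x = nth [::] (behead T) x.-1 by rewrite nth_behead prednK //; lia.
  by apply: mem_nth; rewrite size_behead; move: (size T) xT x0 => z; clear; case: x => // x; case: z.
have i := index_mem r (behead T); rewrite rT in i.
have : (index r (behead T)).+1 \in blk 1 T.
  by rewrite -has_pred1 has_count count_blk -nth_behead nth_index // -has_count has_pred1.
by move/h.
Qed.

(** With the 1's confined to the first row, [kat] merely moves the lower rows up and subtracts 1, so
    the rows before the last still form a tableau from [m] on. *)
Lemma isT_kat l m T : size T = l -> 0 < m <= l -> ones_in_first_row T -> isT leq ltn (drop m T) ->
  all (all (leq 1)) T -> isT leq ltn (take (l - m) (drop m.-1 (kat T))).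
Proof.
move=> sT hm one [h1 h2] pos.
have sz : size (drop m T) = l - m by rewrite size_drop sT.
have e r : nth [::] (take (l - m) (drop m.-1 (kat T))) r = [seq x.-1 | x <- nth [::] (drop m T) r].
  have [h|h] := ltnP r (l - m); last first.
    by rewrite !nth_default ?sz // size_take_min; lia.
  rewrite nth_take // !nth_drop nth_kat ?sT; last by lia.
  rewrite (_ : (_ == _) = false); last by lia.
  have -> : (m.-1 + r).+1 = m + r by lia.
  rewrite /krow; congr map; apply/all_filterP/allP => x xT.
  have hT : m + r < size T by lia.
  apply/negP => /eqP x1; subst x; move: one; rewrite /ones_in_first_row => /negP; apply.
  apply/flattenP; exists (nth [::] T (m + r)) => //.
  have -> : nth [::] T (m + r) = nth [::] (behead T) (m + r).-1 by rewrite nth_behead prednK //; lia.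
  by apply: mem_nth; rewrite size_behead; move: (size T) hT hm => z; clear; lia.
have pos' i j : inT (drop m T) i j -> 0 < ent (drop m T) i j.
  rewrite /inT /ent nth_drop => h.
  have hT : m + i < size T by rewrite ltnNge; apply/negP => hx; rewrite nth_default in h.
  exact: (allP (allP pos _ (mem_nth [::] hT)) _ (mem_nth 0 h)).
split=> i j; rewrite /inT /ent !e !size_map => h.
  rewrite !(nth_map 0) //; last by exact: ltnW.
  by have := h1 i j h; rewrite /ent /=; lia.
have [h3 h4] := h2 i j h; split=> //; rewrite !(nth_map 0) //.
by have := pos' i j h3; move: h4; rewrite /ent /=; lia.
Qed.

(** After an insertion at [m] the rows from index [m.-1] on form a tableau; since [kat] moves rows
    up by one, the next insertion at [m'] finds a tableau when [m.-1 <= m']. *)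
Fixpoint okchain l m (ns : seq nat) : bool :=
  if ns is m' :: ns' then [&& 0 < m', m' <= l, m.-1 <= m' & okchain l m' ns'] else true.

Lemma kat_S l ns ms T m : 1 < l -> size ms = (size ns).+1 -> size T = l -> okT (size ms) T ->
  shape (bw (size ms) T) = ms -> okchain l m ns -> 0 < m <= l -> isT leq ltn (drop m.-1 T) ->
  ones_in_first_row T && all ones_in_first_row (scanl (fun T m => Pins m (kat T)) T ns)
  = S l ns ms (bw (size ms) T).
Proof.
move=> l1; elim: ns ms T m => [|m' ns IH] [|a ms] T m //= [sz] sT oT shT.
  case: ms sz oT shT => //= _ oT [sh1] _ _ _; rewrite EBw_nil ones_blk sh1 /=.
  by rewrite !andbT.
case/and4P=> m0 ml mm oc hm hT.
have e : bw (size ms).+1 T = blk 1 T :: behead (bw (size ms).+1 T) by [].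
have sh1 : size (blk 1 T) = a by case: shT.
rewrite {1}ones_blk sh1; case one : (blk 1 T == nseq a 0); last by [].
have one' : ones_in_first_row T by rewrite ones_blk sh1.
have pos : all (all (leq 1)) T.
  by case/andP: oT => _; apply: sub_all => r; apply: sub_all => x /andP[].
have tk : isT leq ltn (take (l - m') (drop m'.-1 (kat T))).
  apply: isT_kat => //; first by lia.
  case: hT => h1 h2; have -> : drop m' T = drop (m' - m.-1) (drop m.-1 T) by rewrite drop_drop; congr drop; lia.
  move: (drop m.-1 T) h1 h2 => D h1 h2.
  by split=> i j; rewrite /inT /ent !nth_drop ?addnS; [exact: h1|exact: h2].
have okk := okT_kat oT.
have sk : size (kat T) = l by rewrite size_kat.
have m'l : 0 < m' <= l by rewrite m0.
have [p1 p2 p3 p4] := Pins_bw sk m'l okk tk.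
rewrite !andTb (IH ms _ m') //.
  by rewrite p4 (bw_kat _ l1 sT).
rewrite p4 shape_EBw (bw_kat _ l1 sT) /shape -map_comp.
case: shT => _ e2; rewrite -[RHS]e2 /bw [iota 1 _]/= [behead _]/= /shape -!map_comp; apply: eq_map => s /=.
by rewrite size_rotb.
Qed.

Lemma col_ltP T : isT leq ltn T <-> [/\ all (sorted leq) T, sorted geq (shape T) & sorted col_lt T].
Proof.
split=> [hT|[h1 h2 h3]].
  split; first exact: isT_sorted hT.
    case: hT => _ h2; apply/(sortedP 0) => i; rewrite size_map => hi.
    rewrite !(nth_map [::]) //; last by exact: ltnW.
    rewrite /=; case e: (size (nth [::] T i.+1)) => [|j] //.
    by have [] := h2 i j; rewrite /inT ?e.
  case: hT => _ h2; apply/(sortedP [::]) => i hi; apply/allP => j; rewrite mem_iota add0n /= => hj.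
  by have [_] := h2 i j hj.
split=> i j; rewrite /inT => hj.
  have iR : i < size T by rewrite ltnNge; apply/negP => hi; rewrite nth_default in hj.
  by apply: (sortedP 0) hj; apply: (allP h1); exact: mem_nth.
have iR : i.+1 < size T by rewrite ltnNge; apply/negP => hi; rewrite nth_default in hj.
split.
  have : i.+1 < size (shape T) by rewrite size_map.
  move/(sortedP 0 h2); rewrite !(nth_map [::]) //; last by exact: ltnW.
  by move=> /=; exact: leq_trans.
by have /allP := sortedP [::] h3 i iR; apply; rewrite mem_iota.
Qed.

Lemma is_ssytP l (mu : l.-tuple nat) U :
  is_ssyt mu U <-> [/\ size U = l, okT l U, isT leq ltn U & shape (bw l U) = mu].
Proof.
have shE : shape (bw l U) = [seq count_mem s (flatten U) | s <- iota 1 l].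
  by rewrite /bw /shape -map_comp; apply: eq_map => s /=; rewrite size_blk.
have e : (shape (bw l U) = mu) <-> forall i : 'I_l, count_mem i.+1 (flatten U) = tnth mu i.
  rewrite shE; split=> [h i|h].
    by rewrite (tnth_nth 0) -h (nth_map 0) ?size_iota // nth_iota // add1n.
  apply: (@eq_from_nth _ 0); first by rewrite size_map size_iota size_tuple.
  move=> i; rewrite size_map size_iota => il; rewrite (nth_map 0) ?size_iota // nth_iota // add1n.
  by rewrite (h (Ordinal il)) (tnth_nth 0).
have af (P : pred nat) : all P (flatten U) = all (all P) U.
  by elim: (U) => //= r t <-; rewrite all_cat.
rewrite /is_ssyt /is_tabloid /has_content af; split.
  case/and4P=> /and3P[/eqP h1 h2 _] /andP[h4 /forallP h5] h6 h7; split=> //.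
  - by rewrite /okT h2.
  - by apply/col_ltP.
  by apply/e => i; apply/eqP.
case=> h1 /andP[h2 h3] /col_ltP [_ h4 h5] /e h6.
rewrite h1 eqxx h2 h3 h4 h5 /= !andbT; apply/andP; split; last by apply/forallP => i; apply/eqP.
by apply: sub_all h3 => r; apply: sub_all => x /andP[].
Qed.
End Katabolism.

(** * Existence of charge *)

Module ChargeExistence.
From mathcomp Require Import all_boot zify.
Import Defs Scan FilteredSets Columns KnuthMoves Dominance Windows Folding TabloidWords ColumnInsertion TableauWords Katabolism.

Lemma knuth_cons x v w : knuth_eq v w -> knuth_eq (x :: v) (x :: w).
Proof. exact: (@knuth_catl [:: x]). Qed.

Lemma knuth_row_insert (P Q : seq nat) x y : sorted leq (P ++ y :: Q) -> all (geq x) P -> x < y ->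
  knuth_eq ((P ++ y :: Q) ++ [:: x]) (y :: P ++ x :: Q).
Proof.
move=> sPQ Px xy.
have sQ : path leq y Q by move: sPQ; rewrite sorted_cat_cons => /andP[].
have sP : sorted leq P by move: sPQ; rewrite -cat_rcons => /(subseq_sorted leq_trans (prefix_subseq _ _)); rewrite -cats1 => /(subseq_sorted leq_trans (prefix_subseq _ _)).
rewrite -catA cat_cons; apply: KnuthTrans (_ : knuth_eq _ (P ++ y :: x :: Q)) _.
  apply: knuth_catl; elim: Q y xy sQ {sPQ} => [|q Q IH] y xy /=; first by move=> _; exact: KnuthRefl.
  case/andP=> yq sQ; apply: KnuthTrans (knuth_cons y (IH q _ sQ)) _; first by lia.
  apply: KnuthSym; apply: (@knuth_catr [:: y; x; q] [:: y; q; x] Q); apply: knuth_swap2; lia.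
rewrite -[y :: x :: Q]/([:: y; x] ++ Q) -[x :: Q]/([:: x] ++ Q) -cat_cons !catA; apply: knuth_catr.
elim: P Px sP {sPQ} => [|p P IH]; first by move=> *; exact: KnuthRefl.
move=> /= /andP[px Px] sP; apply: KnuthTrans (knuth_cons p (IH Px (path_sorted sP))) _.
case: P Px sP {IH} => [|p' P] /=.
  by move=> _ _; apply: knuth_swap1; lia.
case/andP=> p'x _ /andP[pp' _]; apply: (@knuth_catr [:: p; y; p'] [:: y; p; p'] (P ++ [:: x])).
by apply: knuth_swap1; lia.
Qed.

Lemma knuth_predn v w : all (ltn 0) v -> knuth_eq v w -> knuth_eq (map predn v) (map predn w).
Proof.
move=> + k; elim: k => {v w} [u a b v r|w|a b k IH|a b c k1 IH k2 IH'] h.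
- rewrite !map_cat; apply: KnuthStep; move: h; rewrite !all_cat => /and3P[_ + _].
  by case: r => x y z h /= /and4P[h1 h2 h3 _]; [apply: Knuth1|apply: Knuth2]; clear -h h1 h2 h3; lia.
- exact: KnuthRefl.
- by apply: KnuthSym; apply: IH; rewrite (perm_all _ (knuth_perm k)).
by apply: KnuthTrans (IH h) (IH' _); rewrite -(perm_all _ (knuth_perm k1)).
Qed.

Definition Pt (w : seq nat) := foldr (fun x T => col_insert_row [:: x] T) [::] w.
Lemma Pt_ok w : [/\ isT leq ltn (Pt w), all (fun c => c != [::]) (Pt w) & knuth_eq w (rread (Pt w))].
Proof.
elim: w => [|x w [h1 h2 h3]]; first by split=> //; [split=> i j; rewrite /inT nth_nil|exact: KnuthRefl].
have [g1 g2 g3] := col_insert_row_ok [:: x] h1; split=> //.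
by apply: KnuthTrans (knuth_cons x h3) g3.
Qed.
Lemma okT_knuth L T w : all (sorted leq) T -> all (okl L) w -> knuth_eq w (rread T) -> okT L T.
Proof.
move=> sT aw k; apply/andP; split=> //; apply/allP => R RT; apply/allP => x xR.
apply: (allP aw); rewrite (perm_mem (knuth_perm k)); apply/flattenP; exists R => //.
by rewrite mem_rev.
Qed.
Lemma okl_exists w : 0 \notin w -> exists L, all (okl L) w.
Proof.
move=> h; exists (\max_(x <- w) x); apply/allP => x xw; rewrite /okl.
rewrite (big_rem x) //= leq_maxl andbT lt0n; apply: contra h => /eqP <- //.
Qed.
Lemma rread_pad T k : rread (T ++ nseq k [::]) = rread T.
Proof. by rewrite /rread rev_cat flatten_cat rev_nseq; elim: k => //= k ->. Qed.
(** A Knuth class determines its highest weight word, hence its tableau. *)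
Lemma knuth_isT T T' : 0 \notin rread T -> isT leq ltn T -> isT leq ltn T' -> size T = size T' ->
  knuth_eq (rread T) (rread T') -> T = T'.
Proof.
move=> z h1 h2 sz k; have [L aL] := okl_exists z.
have o1 : okT L T by apply: okT_knuth aL (KnuthRefl _); exact: isT_sorted h1.
have o2 : okT L T' by apply: okT_knuth aL k; exact: isT_sorted h2.
apply: (bw_inj o1 o2 sz); have sz' : size T' <= (size T).+1 by rewrite sz.
have := knuth_cl o1 o2 (ltn0Sn (size T)) (leqnSn _) sz' k.
by rewrite !cl_hw // => p _; apply: (hw_isT _).2.
Qed.
Lemma Pt_unique T w : 0 \notin w -> isT leq ltn T -> knuth_eq w (rread T) ->
  Pt w = [seq r <- T | r != [::]].
Proof.
move=> z hT k; have [h1 h2 h3] := Pt_ok w.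
have k' : knuth_eq (rread (Pt w)) (rread T) by apply: KnuthTrans (KnuthSym h3) k.
have e : Pt w ++ nseq (size T) [::] = T ++ nseq (size (Pt w)) [::].
  apply: knuth_isT; rewrite ?rread_pad ?size_cat ?size_nseq 1?addnC //; try exact: isT_pad.
  by rewrite -(perm_mem (knuth_perm h3)).
have := congr1 (filter (fun r => r != [::])) e; rewrite !filter_cat !filter_nseq /= !cats0.
by move/all_filterP: h2 => ->.
Qed.
Lemma Pt_knuth v w : 0 \notin v -> knuth_eq v w -> Pt v = Pt w.
Proof.
move=> z k; have [h1 h2 h3] := Pt_ok w.
by rewrite (Pt_unique z h1 (KnuthTrans k h3)); apply/all_filterP.
Qed.

Definition no1 := filter (fun x => x != 1).
(** The candidate for charge: in the insertion tableau, the letters other than 1 of the first row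
    are rotated to the front at cost one each, then the 1's are removed. [L] bounds the letters and
    is the depth of the recursion. As it passes through the tableau, (C4) is immediate and (C3) is
    the work. *)
Fixpoint Fc L (w : seq nat) : nat :=
  if L is L'.+1 then size (no1 (head [::] (Pt w))) +
     Fc L' (map predn (no1 (head [::] (Pt w)) ++ rread (behead (Pt w))))
  else 0.
Lemma Fc_knuth L v w : 0 \notin v -> knuth_eq v w -> Fc L v = Fc L w.
Proof. by case: L => //= L z k; rewrite (Pt_knuth z k). Qed.

Lemma rread_cons R T : rread (R :: T) = rread T ++ R.
Proof. by rewrite /rread rev_cons flatten_rcons. Qed.
Lemma rread_rcons R T : rread (rcons T R) = R ++ rread T.
Proof. by rewrite /rread rev_rcons. Qed.
Lemma rread_cat A B : rread (A ++ B) = rread B ++ rread A.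
Proof. by rewrite /rread rev_cat flatten_cat. Qed.

Lemma scanB_joinl c u v : size u = size v -> scanB 0 c (joinb 2 u v) = joinb 2 u (scanB 0 c v).
Proof.
rewrite /joinb; elim: u v c => [|b u IH] [|a v] c //= [sz].
have [-> ->] : scan 0 c ([seq 2 + i | i <- b] ++ a) = [seq 2 + i | i <- b] ++ scan 0 c a /\
  cnt 0 c ([seq 2 + i | i <- b] ++ a) = cnt 0 c a.
  by elim: b => //= x b [-> ->].
by rewrite IH.
Qed.

(* One step of E is the insertion of row p + 1 into row p. *)
Lemma EB_step L A (a b : seq nat) B : let T := A ++ [:: a; b] ++ B in okT L T ->
  exists a' b' : seq nat, let T' := A ++ [:: a'; b'] ++ B in
  [/\ okT L T', bw L T' = EB (size A) (bw L T), knuth_eq (b ++ a) (b' ++ a')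
    & bw L [:: a'; b'] = EB 0 (bw L [:: a; b])].
Proof.
move=> T oT; have oS : okT L [:: a; b] by move: oT; rewrite !okT_cat => /and3P[].
have hS : isT leq ltn (take (size [:: a; b]).-1 [:: a; b]).
  split=> [[|i]|i] j; rewrite /inT /ent /= ?nth_nil //.
  by move=> hj; apply: (sortedP 0) hj; case/andP: oS => /andP[].
have [] := insert_cl oS erefl hS; move: (col_insert_row _ _) => R sR tR oR kR eR.
have [a' [b' eab]] : exists a' b' : seq nat, R ++ nseq (2 - size R) [::] = [:: a'; b'].
  by case: R sR {tR oR kR eR} => [|a' [|b' [|? ?]]] //= _; [exists [::], [::]|exists a', [::]|exists a', b'].
have eR' : bw L [:: a'; b'] = bw L R.
  rewrite -eab; apply: eq_bw => r; rewrite nth_cat; case: ltnP => // h; rewrite nth_nseq [RHS]nth_default //.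
  by case: ifP.
have e0 : bw L [:: a'; b'] = EB 0 (bw L [:: a; b]) by rewrite eR' eR.
exists a', b'; split=> //.
- move: oT; rewrite !okT_cat => /and3P[-> _ ->]; rewrite andbT /= -eab okT_cat oR.
  exact: okT_nseq.
- rewrite !bw_cat; have -> : EB (size A) = EB (size A + 0) by rewrite addn0.
  rewrite EB_join ?bw_lt //; last first.
    by rewrite !size_map size_zip !size_map minnn.
  by rewrite /EB scanB_joinl ?size_bw // e0.
have -> : b' ++ a' = rread R by rewrite -(rread_pad R (2 - size R)) eab /rread /= cats0.
by have -> : b ++ a = rread [:: a; b] by rewrite /rread /= cats0.
Qed.

Lemma knuth_2rows L (x y x' y' : seq nat) : okT L [:: x; y] -> okT L [:: x'; y'] ->
  EB 0 (bw L [:: x; y]) = EB 0 (bw L [:: x'; y']) -> knuth_eq (y ++ x) (y' ++ x').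
Proof.
move=> o1 o2 e.
have [x1 [y1 [oo1 _ k1 e1]]] := @EB_step L [::] x y [::] o1.
have [x2 [y2 [oo2 _ k2' e2]]] := @EB_step L [::] x' y' [::] o2.
have : [:: x1; y1] = [:: x2; y2] by apply: (bw_inj oo1 oo2) => //; rewrite /= e1 e2.
by case=> ex ey; rewrite ex ey in k1; apply: KnuthTrans k1 (KnuthSym k2').
Qed.
Lemma scan_nseq0 c j : scan 0 c (nseq j 0) = nseq j 0 /\ cnt 0 c (nseq j 0) = c + j.
Proof. by elim: j c => [|j IH] c /=; [rewrite addn0|have [-> ->] := IH c.+1; rewrite addSnnS]. Qed.

Definition f2 := filter (fun x => 2 < x).
Lemma count_f2 s (z : seq nat) : count_mem s (f2 z) = if 2 < s then count_mem s z else 0.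
Proof.
rewrite /f2 count_filter; case: ifP => h; first by apply: eq_count => t /=; lia.
by apply/eqP; rewrite -leqn0 leqNgt -has_count; apply/hasP => [] [t _ /=]; lia.
Qed.

Definition pcl L (w : seq nat) := all (okl L) w /\ forall k, 0 < k -> count_mem k.+1 w <= count_mem k w.
Lemma pcl0 L w : pcl L w -> 0 \notin w. Proof. by case=> /allP h _; apply/negP => /h. Qed.
Lemma pcl_perm L v w : perm_eq v w -> pcl L v -> pcl L w.
Proof.
move=> p [h1 h2]; split; first by rewrite -(perm_all _ p).
by move/seq.permP: p => p k; rewrite -!p; exact: h2.
Qed.
Lemma pcl_predn L w : 1 \notin w -> all (okl L.+1) w ->
  (forall k, 1 < k -> count_mem k.+1 w <= count_mem k w) -> pcl L (map predn w).
Proof.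
move=> n1 aw h; have h1 x : x \in w -> 1 < x by move=> xw; have := allP aw x xw; rewrite /okl; case: x xw => [|[|x]] //; move: n1 => /negP.
split.
  by apply/allP => x /mapP [y yw ->]; have := h1 y yw; have := allP aw y yw; rewrite /okl; lia.
move=> k k0; rewrite !count_map.
have e j : 0 < j -> count (preim predn (pred1 j)) w = count_mem j.+1 w.
  by move=> j0; apply: eq_in_count => x /h1 /=; lia.
by rewrite !e //; apply: h.
Qed.

Definition C3 L := forall v x, pcl L (rcons v x) -> x != 1 -> Fc L (rcons v x) = (Fc L (x :: v)).+1.
Lemma C3_rot L (v r : seq nat) : C3 L -> pcl L (v ++ r) -> 1 \notin r -> Fc L (v ++ r) = size r + Fc L (r ++ v).
Proof.
move=> c3; elim/last_ind: r v => [|r x IH] v; first by rewrite cats0.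
rewrite mem_rcons inE negb_or eq_sym => h /andP[x1 r1]; rewrite -rcons_cat c3 ?rcons_cat //.
rewrite -cat_cons IH //; last first.
  by apply: pcl_perm h; apply/seq.permP => P; rewrite -cats1 !count_cat /=; lia.
by rewrite size_rcons -cats1 -catA.
Qed.

Section Level.
Variable L : nat.
Hypothesis c3 : C3 L.

(** The recursion step of [Fc] read off an arbitrary tabloid. By [VAL] it gives the right value as
    soon as the 1's lie in the first row, which allows evaluating [Fc] without computing insertion
    tableaux. *)
Definition HT (T : seq (seq nat)) := size (no1 (head [::] T)) + Fc L (map predn (no1 (head [::] T) ++ rread (behead T))).

Lemma sorted_split1 (r : seq nat) : sorted leq r -> 0 \notin r ->
  r = nseq (count_mem 1 r) 1 ++ no1 r.
Proof.
elim: r => //= x r IH s; rewrite inE negb_or eq_sym => /andP[x0 r0].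
have {}IH := IH (path_sorted s) r0; case: (x =P 1) => [->|x1] /=; first by rewrite -IH.
have /allP g : all (leq x) r by apply: order_path_min s; exact: leq_trans.
have c0 : count_mem 1 r = 0 by apply/count_memPn/negP => /g; lia.
by rewrite c0 /= in IH *; rewrite -IH.
Qed.
Lemma sorted_split2 (r : seq nat) : sorted leq r -> 0 \notin r ->
  no1 r = nseq (count_mem 2 r) 2 ++ [seq x <- r | 2 < x].
Proof.
elim: r => //= x r IH s; rewrite inE negb_or eq_sym => /andP[x0 r0].
have {}IH := IH (path_sorted s) r0; case: (x =P 1) => [->|x1] /=; first by rewrite -IH.
case: (x =P 2) => [->|x2] /=; first by rewrite -IH.
have x3 : 2 < x by case: x x0 x1 x2 {s} => [|[|[]]].
have /allP g : all (leq x) r by apply: order_path_min s; exact: leq_trans.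
have c0 : count_mem 2 r = 0 by apply/count_memPn/negP => /g; lia.
by rewrite x3 c0 /= in IH *; rewrite -IH.
Qed.

Lemma okT_no0 L' T : okT L' T -> 0 \notin rread T.
Proof. by move/rread_ok/allP => h; apply/negP => /h. Qed.
Lemma pcl_rows (T : seq (seq nat)) : okT L.+1 T -> ones_in_first_row T -> pcl L.+1 (rread T) ->
   pcl L (map predn (no1 (head [::] T) ++ rread (behead T))).
Proof.
move=> oT one [h1 h2]; set w := _ ++ _.
have e k : 1 < k -> count_mem k w = count_mem k (rread T).
  move=> k1; rewrite /w; case: (T) => [|r T'] //=; rewrite rread_cons !count_cat addnC; congr (_ + _).
  by rewrite /no1 count_filter; apply: eq_count => x /=; lia.
apply: pcl_predn.
- rewrite mem_cat mem_filter /=; apply/negP => /flattenP [r]; rewrite mem_rev => rT xr.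
  by case/negP: one; apply/flattenP; exists r.
- apply/allP => x xw; apply: (allP h1); move: xw; rewrite /w; case: (T) => [|r T'] //=.
  by rewrite rread_cons !mem_cat mem_filter orbC => /orP[->//|/andP[_ ->]]; rewrite orbT.
by move=> k k1; rewrite !e; [apply: h2|..]; lia.
Qed.

(** For [p > 0] only rows below the first change, by Knuth moves. For [p = 0] the 1's and 2's of the
    two rows stay in place; the letters above 2 of the second row are rotated to the front by (C3)
    at level [L], next to those of the first row, and there the two rows are compared by
    [knuth_2rows]. *)
Lemma HT_step T p : okT L.+1 T -> ones_in_first_row T -> pcl L.+1 (rread T) -> p.+1 < size T ->
  exists T', [/\ okT L.+1 T', size T' = size T, bw L.+1 T' = EB p (bw L.+1 T) & knuth_eq (rread T) (rread T')]
     /\ ones_in_first_row T' /\ HT T' = HT T.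
Proof.
move=> oT one pT pS.
have [A [a [b [B [eT eA]]]]] : exists A (a b : seq nat) B, T = A ++ [:: a; b] ++ B /\ size A = p.
  exists (take p T), (nth [::] T p), (nth [::] T p.+1), (drop p.+2 T).
  split; last by rewrite size_take; case: ltnP; lia.
  by rewrite -{1}(cat_take_drop p T) (drop_nth [::]) ?(drop_nth [::] pS) //; lia.
have pz := okT_no0 oT; subst T p.
have [a' [b' [oT' eb kab e0]]] := EB_step oT.
have kk : knuth_eq (rread (A ++ [:: a; b] ++ B)) (rread (A ++ [:: a'; b'] ++ B)).
  have e (x y : seq nat) : rread (A ++ [:: x; y] ++ B) = rread B ++ (y ++ x) ++ rread A.
    by rewrite !rread_cat -!catA; congr (_ ++ _); rewrite /rread /= cats0 -catA.
  by rewrite !e; apply: knuth_ctx.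
exists (A ++ [:: a'; b'] ++ B); split; first by split=> //; rewrite !size_cat.
case: A eb one pT pz oT oT' kk {pS} => [|r A] eb one pT pz oT oT' kk.
  have zs (x y : seq nat) C : okT L.+1 ([:: x; y] ++ C) -> [/\ sorted leq x, sorted leq y, 0 \notin x & 0 \notin y].
    move=> h; have := okT_no0 h; case/andP: h => /= /and3P[-> -> _] _; rewrite /= 2!rread_cons !mem_cat !negb_or.
    by case/andP=> /andP[_ ->] ->.
  have [sa sb za zb] := zs _ _ _ oT; have [sa' sb' za' zb'] := zs _ _ _ oT'.
  set m := count_mem 1 a; set k2 := count_mem 2 a; set b2 := count_mem 2 b.
  have b1 : count_mem 1 b = 0.
    by apply/count_memPn; move: one; rewrite /ones_in_first_row /= mem_cat negb_or => /andP[].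
  (* All 1's are in [a], so the partition content lets each 2 of [b] be matched with a 1 of [a]. *)
  have b2m : b2 <= m.
    case: pT => _ /(_ 1 erefl); rewrite cat0s /= 2!rread_cons !count_cat -/m -/b2 b1.
    have -> : count_mem 1 (rread B) = 0.
      apply/count_memPn/negP => /flattenP [r]; rewrite mem_rev => rB xr.
      by case/negP: one; rewrite /= mem_cat; apply/orP; right; apply/flattenP; exists r.
    by rewrite !add0n; apply: leq_trans; rewrite -addnA addnCA leq_addr.
  pose us x y := [seq blk s [:: x; y] | s <- iota 3 L.-1].
  have cb (s r : nat) x y : count_mem r (blk s [:: x; y]) = count_mem s (nth [::] [:: x; y] r) by exact: count_blk.
  have sc s c x y : count_mem s y <= c -> scan 0 c (blk s [:: x; y]) = blk s [:: x; y] /\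
      cnt 0 c (blk s [:: x; y]) = c - count_mem s y + count_mem s x.
    move=> h; have [h1 h2] := scan_sorted 0 c (sorted_blk s [:: x; y]).
    by rewrite !cb /= in h1 h2; split; [apply/h1|apply: h2].
  have bi x y x' y' s : blk s [:: x; y] = blk s [:: x'; y'] -> count_mem s x = count_mem s x' /\ count_mem s y = count_mem s y'.
    by move=> e; have := cb s 0 x y; have := cb s 1 x y; rewrite e !cb /= => -> ->.
  (* For [L = 0] all letters are 1 and there is no block of 2's to speak of. *)
  case: (posnP L) => [L0|L0].
    have no (x : seq nat) : all (okl 1) x -> no1 x = [::] /\ forall y, y != 1 -> count_mem y x = 0.
      move=> h; have e : forall y, y \in x -> y = 1 by move=> y /(allP h); rewrite /okl -eqn_leq => /eqP <-.
      split; first by apply/eqP; rewrite -[_ == _]negbK -has_filter; apply/hasP => [] [y /e ->].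
      by move=> y y1; apply/count_memPn/negP => /e ey; rewrite ey in y1.
    have oo (x y : seq nat) C : okT L.+1 ([:: x; y] ++ C) -> all (okl 1) x by rewrite /okT L0 => /andP[_ /= /andP[]].
    have ob (x y : seq nat) C : okT L.+1 ([:: x; y] ++ C) -> all (okl 1) y by rewrite /okT L0 => /andP[_ /= /and3P[]].
    have := e0; rewrite L0 /bw /= /EB /=; have h0 : count_mem 1 b <= 0 by rewrite b1.
    have [-> _] := sc 1 0 a b h0.
    case=> /bi [ea1 eb1]; have z' : count_mem 1 b' = 0 by rewrite eb1.
    split; last by rewrite /HT /= (no _ (oo _ _ _ oT)).1 (no _ (oo _ _ _ oT')).1 L0 /=.
    move: one; rewrite /ones_in_first_row /= !mem_cat !negb_or => /andP[_ ->].
    by rewrite andbT; apply/count_memPn.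
  have bwE x y : bw L.+1 [:: x; y] = blk 1 [:: x; y] :: blk 2 [:: x; y] :: us x y.
    by rewrite /bw /us; case: (L) L0.
  have := e0; rewrite !bwE /EB /=.
  have h0 : count_mem 1 b <= 0 by rewrite b1.
  have h2 : count_mem 2 b <= 0 - count_mem 1 b + count_mem 1 a by rewrite b1 subn0 add0n.
  have [-> ->] := sc 1 0 a b h0.
  have [-> ->] := sc 2 (0 - count_mem 1 b + count_mem 1 a) a b h2.
  rewrite b1 subn0 add0n -/m -/k2 -/b2 => [] [] /bi [ea1 eb1] /bi [ea2 eb2] eus.
  split.
    move: one; rewrite /ones_in_first_row /= !mem_cat !negb_or => /andP[_ ->].
    by rewrite andbT; apply/count_memPn; rewrite eb1.
  have no1b (x : seq nat) : count_mem 1 x = 0 -> no1 x = x.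
    by move/count_memPn => h; apply/all_filterP/allP => y yx; apply: contraNneq h => <-.
  have HE x y : sorted leq x -> sorted leq y -> 0 \notin x -> 0 \notin y -> count_mem 1 y = 0 ->
      okT L.+1 ([:: x; y] ++ B) -> ones_in_first_row ([:: x; y] ++ B) -> pcl L.+1 (rread ([:: x; y] ++ B)) ->
      HT ([:: x; y] ++ B) = count_mem 2 x + size (f2 x) + size (f2 y) +
        Fc L (map predn ((f2 y ++ nseq (count_mem 2 x) 2 ++ f2 x) ++ rread B ++ nseq (count_mem 2 y) 2)).
    move=> sx sy zx zy y1 o1 o2 o3; have := pcl_rows o1 o2 o3; rewrite /HT /= rread_cons (sorted_split2 sx zx) -/(f2 x).
    have ey : y = nseq (count_mem 2 y) 2 ++ f2 y by rewrite -{1}(no1b y y1) (sorted_split2 sy zy).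
    set k := count_mem 2 y in ey *; set F := f2 y in ey *; rewrite ey.
    set N := nseq (count_mem 2 x) 2.
    have -> : (N ++ f2 x) ++ rread B ++ nseq k 2 ++ F = ((N ++ f2 x) ++ rread B ++ nseq k 2) ++ F by rewrite -!catA.
    rewrite map_cat => pp; rewrite (C3_rot c3 pp); last by apply/negP => /mapP [[|[|[|z]]]]; rewrite mem_filter.
    by rewrite size_map size_cat size_nseq -map_cat -!catA !addnA.
  have pT' : pcl L.+1 (rread ([:: a'; b'] ++ B)) by apply: pcl_perm (knuth_perm kk) pT.
  rewrite [LHS]HE //; last 2 first.
  - by rewrite eb1.
  - move: one; rewrite /ones_in_first_row /= !mem_cat !negb_or => /andP[_ ->].
    by rewrite andbT; apply/count_memPn; rewrite eb1.
  rewrite [RHS]HE // ea2 eb2.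
  have szE (x : seq nat) : sorted leq x -> 0 \notin x -> size x = count_mem 1 x + count_mem 2 x + size (f2 x).
    by move=> sx zx; rewrite {1}(sorted_split1 sx zx) (sorted_split2 sx zx) !size_cat !size_nseq addnA.
  have := perm_size (knuth_perm kab); rewrite !size_cat (szE a) // (szE b) // (szE a') // (szE b') //.
  rewrite ea1 ea2 eb1 eb2 => szz.
  congr (_ + _); first by move: szz; clear; move: (count_mem 1 a) (count_mem 2 a) (count_mem 1 b) (count_mem 2 b) (size (f2 a)) (size (f2 b)) (size (f2 a')) (size (f2 b')) => *; lia.
  apply: esym; apply: Fc_knuth.
    apply/negP => /mapP [z]; have ha : all (fun z => 1 < z) ((f2 b ++ nseq k2 2 ++ f2 a) ++ rread B ++ nseq b2 2).
      rewrite !all_cat -!andbA; apply/and5P; split; try (by apply/allP => y /nseqP [->]); try (by apply/allP => y; rewrite mem_filter => /andP[/ltnW]).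
      apply/allP => y yB; have : y \in rread ([:: a; b] ++ B) by rewrite rread_cat mem_cat yB.
      move/(allP pT.1); rewrite /okl => /andP[y0 _].
      suff : y != 1 by clear -y0; lia.
      apply/eqP => y1; case/negP: one; rewrite /= mem_cat; apply/orP; right; move: yB; rewrite y1 => /flattenP [r].
      by rewrite mem_rev => rB xr; apply/flattenP; exists r.
    by case: z => [|[|z]] /(allP ha).
  apply: knuth_predn.
    rewrite !all_cat -!andbA; apply/and5P; split; try (by apply/allP => y /nseqP [->]); try (by apply/allP => y; rewrite mem_filter => /andP[/ltnW/ltnW]).
    apply/allP => y yB; have : y \in rread ([:: a; b] ++ B) by rewrite rread_cat mem_cat yB.
    by move/(allP pT.1); rewrite /okl => /andP[].
  apply: knuth_catr.
  have ok2 (x y : seq nat) : sorted leq x -> sorted leq y -> okT L.+1 ([:: x; y] ++ B) -> 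
     okT L.+1 [:: nseq k2 2 ++ f2 x; f2 y].
    move=> sx sy /andP[_ /= /and3P[ax ay _]]; rewrite /okT /= !andbT; apply/andP; split; apply/andP; split.
    - have := sorted_filter leq_trans (fun z => 2 < z) sx; rewrite -/(f2 x).
      have : all (leq 2) (f2 x) by apply/allP => z; rewrite mem_filter => /andP[/ltnW].
      move: (f2 x) => F hF1 hF2; elim: (k2) => //= j IHj; rewrite path_min_sorted ?IHj //.
      by rewrite all_cat hF1 andbT; apply/allP => z /nseqP [->].
    - exact: sorted_filter leq_trans _ _ sy.
    - rewrite all_cat; apply/andP; split; first by apply/allP => z /nseqP [-> _] /=; rewrite ltnS.
      by apply/allP => z; rewrite mem_filter => /andP[_ /(allP ax)].
    by apply/allP => z; rewrite mem_filter => /andP[_ /(allP ay)].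
  have bw2 (x y : seq nat) : bw L.+1 [:: nseq k2 2 ++ f2 x; f2 y] = [::] :: nseq k2 0 :: us x y.
    have cf := count_f2.
    rewrite bwE; congr [:: _, _ & _].
    - by apply/esym/eq_blk => // [[|[|r]]] /=; rewrite ?nth_nil ?count_cat ?cf ?count_nseq //= ?mul0n.
    - apply/esym/eq_blk; first by elim: (k2) => //= j; case: j => //= j ->; rewrite andbT.
      by case=> [|[|r]] /=; rewrite ?nth_nil ?count_cat ?cf ?count_nseq ?mul0n ?mul1n ?addn0.
    apply/eq_in_map => s; rewrite mem_iota => hs; apply/esym/eq_blk; first exact: sorted_blk.
    case=> [|[|r]]; rewrite cb /= ?nth_nil // ?count_cat ?cf ?count_nseq.
      have [-> h4] : (2 < s) = true /\ (2 == s) = false by clear -hs; lia.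
      by rewrite [pred1 _ _]h4.
    by have -> : 2 < s by clear -hs; lia.
  apply: (@knuth_2rows L.+1 _ _ _ _ (ok2 _ _ sa sb oT) (ok2 _ _ sa' sb' oT')); rewrite !bw2 eus /EB /=.
  have [-> ->] := scan_nseq0 0 k2; congr [:: _, _ & _]; apply: eq_flat; rewrite ?shape_scanB // !flatten_scanB.
  (* The truncated rows start with [k2] open brackets, at most the counter [m - b2 + k2] of the full
     rows, so raising the already raised blocks again gives the same result. *)
  by rewrite scan_le // add0n leq_addl.
have kt : knuth_eq (rread (A ++ [:: a; b] ++ B)) (rread (A ++ [:: a'; b'] ++ B)).
  have e (x y : seq nat) : rread (A ++ [:: x; y] ++ B) = rread B ++ (y ++ x) ++ rread A.
    by rewrite !rread_cat -!catA; congr (_ ++ _); rewrite /rread /= cats0 -catA.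
  by rewrite !e; apply: knuth_ctx.
split.
  have m1 (T : seq (seq nat)) : (1 \in flatten T) = (1 \in rread T).
    by apply/flattenP/flattenP => [] [z zT xz]; exists z; rewrite ?mem_rev // -mem_rev.
  rewrite /ones_in_first_row -[behead _]/(A ++ [:: a'; b'] ++ B) (m1 (A ++ [:: a'; b'] ++ B)).
  by rewrite -(perm_mem (knuth_perm kt)) -(m1 (A ++ [:: a; b] ++ B)); exact: one.
have pp := pcl_rows oT one pT; rewrite /HT /=; congr (_ + _); apply: esym; apply: Fc_knuth.
  exact: pcl0 pp.
apply: knuth_predn; last by apply: knuth_catl.
apply/allP => x; rewrite mem_cat mem_filter => h.
have : x \in rread ((r :: A) ++ [:: a; b] ++ B).
  by rewrite rread_cons mem_cat; case/orP: h => [/andP[_ ->]|->]; rewrite ?orbT.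
by move/(allP pT.1); rewrite /okl => /andP[].
Qed.

(** Raising along the longest element leads from [T] to a tableau of the same Knuth class, and [HT]
    is constant on the way. *)
Lemma VAL T : okT L.+1 T -> ones_in_first_row T -> pcl L.+1 (rread T) -> Fc L.+1 (rread T) = HT T.
Proof.
case: T => [|r T0]; first by move=> *; rewrite /HT /=.
set T := r :: T0 => oT one pT.
have [T' [[o' s' b' k'] [one' H']]] : exists T', [/\ okT L.+1 T', size T' = size T, bw L.+1 T' = cl (size T) (bw L.+1 T) & knuth_eq (rread T) (rread T')]
     /\ ones_in_first_row T' /\ HT T' = HT T.
  rewrite /cl; have : all (fun p => p.+1 < size T) (w0w (size T).-1 0) by apply/allP => p /mem_w0w; rewrite /T /=; lia.
  move: (w0w _ _) => v; move: T oT one pT => {r T0}; elim: v => [|p v IH] T oT one pT /=.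
    by move=> _; exists T; split=> //; split=> //; exact: KnuthRefl.
  case/andP=> pS pv; have [T1 [[o1 s1 b1 k1] [on1 h1]]] := HT_step oT one pT pS.
  have [|T2 [[o2 s2 b2 k2] [on2 h2]]] := IH T1 o1 on1 (pcl_perm (knuth_perm k1) pT); first by rewrite s1.
  exists T2; rewrite h2 -h1 s2 s1; split=> //; split=> //; first by rewrite b2 b1.
  exact: KnuthTrans k1 k2.
have tT : isT leq ltn T'.
  apply/(hw_isT o') => p; have [h|h] := ltnP p.+1 (size T); first by rewrite b'; exact: cl_fix.
  apply: EB_notin; apply: sub_all (bw_lt L.+1 T') => b hb; apply/negP => /(allP hb) /=; rewrite s'; lia.
have z := pcl0 pT; rewrite -H' /= (Pt_unique z tT k').
have e : HT [seq r <- T' | r != [::]] = HT T'.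
  rewrite /HT; case: T' {o' s' b' k' one' H'} tT => //= r' T1 tT.
  have rr (X : seq (seq nat)) : rread [seq r <- X | r != [::]] = rread X.
    by elim: X => //= x X IHX; case: eqP => [->|_] /=; rewrite !rread_cons ?cats0 IHX.
  case: eqP => [r0|_] /=; last by rewrite rr.
  have nil : T1 = nseq (size T1) [::].
    apply/all_pred1P/allP => x xT; have := index_mem x T1; rewrite xT => ix.
    rewrite /=; apply/negPn/negP => x0.
    have h : inT (r' :: T1) (index x T1).+1 0 by rewrite /inT /= nth_index // lt0n size_eq0.
    by have := isT_in tT h (leq0n _); rewrite /inT /= r0.
  by rewrite nil filter_nseq /= r0 /= -[nseq _ _]cat0s rread_pad.
by rewrite -e.
Qed.

Lemma sorted_snoc (R z : seq nat) m x : sorted leq R -> R = nseq m 1 ++ z -> {in z, forall y, y <= x} -> 0 < x ->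
  sorted leq (R ++ [:: x]).
Proof.
case: R => // y R sR eR hz x0; rewrite cats1 /= rcons_path [path _ _ _]sR /=.
have : last y R \in y :: R by exact: mem_last.
by rewrite eR mem_cat => /orP[/nseqP [-> _]|/hz].
Qed.

Lemma isT_ones L' (T : seq (seq nat)) : okT L' T -> isT leq ltn T -> ones_in_first_row T.
Proof.
case: T => [|r0 T0] oT tT //; apply/negP => /flattenP [r rT xr].
have i := index_mem r T0; rewrite rT in i.
have h : inT (r0 :: T0) (index r T0).+1 (index 1 r) by rewrite /inT /= nth_index // index_mem.
have [_ /(_ _ _ h) [h1 h2]] := tT.
have e1 : ent (r0 :: T0) (index r T0).+1 (index 1 r) = 1 by rewrite /ent /= nth_index // nth_index.
have [_] := okT_nth (index r T0) oT; move: h1 h2; rewrite e1 /inT /ent => h1 + /allP /(_ _ (mem_nth 0 h1)) /andP[h3 _].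
by rewrite /= ltnS leqn0 => /eqP h2; rewrite h2 in h3.
Qed.

(** [x :: v] is evaluated on the tableau of [v] with [x] as an extra bottom row. For [rcons v x] the
    letter is row inserted into the first row: either it is appended, adding one to its size, or it
    bumps some [y], which becomes a row of its own; then (C3) at level [L], applied to [y], supplies
    the missing one. *)
Lemma C3_succ : C3 L.+1.
Proof.
move=> v x pv x1.
have [t1 t2 t3] := Pt_ok v; set T := Pt v in t1 t2 t3; have zv := pcl0 pv.
have av : all (okl L.+1) v by case: pv; rewrite all_rcons => /andP[].
have ox : okl L.+1 x by case: pv; rewrite all_rcons => /andP[].
have oT : okT L.+1 T by apply: okT_knuth av t3; exact: isT_sorted t1.
have one : ones_in_first_row T := isT_ones oT t1.
have perm1 : perm_eq (rcons v x) (x :: v) by rewrite perm_rcons.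
set R0 := head [::] T; set Rs := behead T.
have eT : rread T = rread Rs ++ R0 by rewrite /R0 /Rs; case: (T) => [|? ?] //; rewrite rread_cons.
have oR : okT L.+1 (R0 :: Rs) by rewrite /R0 /Rs; case: (T) oT => //; rewrite /okT.
have one2 : ones_in_first_row (R0 :: Rs) by [].
have [sR0 aR0] := okT_nth 0 oR; rewrite /= in sR0 aR0.
have zR0 : 0 \notin R0 by apply/negP => /(allP aR0).
have oRs : okT L.+1 Rs by move: oR; rewrite -cat1s okT_cat => /andP[].
have x2 : 1 < x by move: ox x1; rewrite /okl; lia.
set z := no1 R0; set m := count_mem 1 R0; have eR0 := sorted_split1 sR0 zR0; rewrite -/z -/m in eR0.
have kv : knuth_eq (x :: v) (rread (R0 :: rcons Rs [:: x])).
  by rewrite rread_cons rread_rcons /=; apply: knuth_cons; rewrite -eT.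
have kv2 : knuth_eq (rcons v x) (rread Rs ++ (R0 ++ [:: x])).
  by rewrite -cats1 catA -eT; apply: knuth_catr.
have E2 : Fc L.+1 (x :: v) = size z + Fc L (map predn (z ++ x :: rread Rs)).
  rewrite (Fc_knuth _ _ kv); last by rewrite -(perm_mem perm1).
  rewrite VAL /HT /=; last 3 first.
  - rewrite -cat1s okT_cat -cats1 okT_cat oRs; move: oR; rewrite -cat1s okT_cat => /andP[-> _].
    by move: ox; rewrite /okT /okl /= !andbT.
  - rewrite /ones_in_first_row /= -cats1 flatten_cat mem_cat negb_or; apply/andP; split; first exact: one.
    by rewrite /= inE eq_sym.
  - by apply: pcl_perm (knuth_perm kv) _; apply: pcl_perm perm1 pv.
  by rewrite rread_rcons.
rewrite E2 -addnS (Fc_knuth _ zv kv2).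
have pv2 := pcl_perm (knuth_perm kv2) pv.
have [/allP hz|] := boolP (all (geq x) z).
  have e : rread Rs ++ (R0 ++ [:: x]) = rread ((R0 ++ [:: x]) :: Rs) by rewrite rread_cons.
  have no : no1 (R0 ++ [:: x]) = z ++ [:: x] by rewrite /no1 filter_cat /= x1.
  rewrite e VAL -?e //.
  - by rewrite /HT [head _ _]/= [behead _]/= no size_cat addn1 -catA addSnnS.
  rewrite -cat1s okT_cat oRs andbT /okT /= !andbT all_cat aR0 /= andbT; apply/andP; split=> //.
  exact: sorted_snoc eR0 hz (ltnW x2).
rewrite -has_predC => hz; set k := find (predC (geq x)) z.
have ez : z = take k z ++ nth 0 z k :: drop k.+1 z by rewrite -drop_nth ?cat_take_drop // -has_find.
set P := take k z in ez; set y := nth 0 z k in ez; set Q := drop k.+1 z in ez.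
have xy : x < y by have := nth_find 0 hz; rewrite /= -/k -/y -ltnNge.
have Px : all (geq x) P.
  apply/(all_nthP 0) => i; rewrite size_take; have kz : k < size z by rewrite /k -has_find.
  rewrite kz => ik; rewrite nth_take //; by have /negbFE := before_find 0 ik.
have sz : sorted leq z by apply: sorted_filter sR0; exact: leq_trans.
set z' := P ++ x :: Q.
have kz : knuth_eq (z ++ [:: x]) (y :: z') by rewrite ez; apply: knuth_row_insert; rewrite -?ez.
have kR : knuth_eq (R0 ++ [:: x]) (y :: nseq m 1 ++ z').
  rewrite eR0 ez catA /z' catA; apply: knuth_row_insert => //; rewrite -?catA -?ez -?eR0 //.
  by rewrite all_cat Px andbT; apply/allP => t /nseqP [-> _] /=; exact: ltnW.
have kk : knuth_eq (rread Rs ++ (R0 ++ [:: x])) (rread ((nseq m 1 ++ z') :: [:: y] :: Rs)).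
  by rewrite !rread_cons -catA; apply: knuth_catl.
have yz : y \in z by rewrite ez mem_cat mem_head orbT.
have yR : y \in R0 by move: yz; rewrite mem_filter => /andP[].
have oy : 0 < y <= L.+1 := allP aR0 _ yR.
have z'1 : no1 (nseq m 1 ++ z') = z'.
  rewrite /no1 filter_cat filter_nseq /=; apply/all_filterP/allP => t.
  rewrite /z' mem_cat inE => h; apply/eqP => te; subst t.
  have : 1 \in z by rewrite ez mem_cat inE; case/or3P: h => [->//|/eqP e|->]; [by rewrite -e in x2|rewrite !orbT].
  by rewrite mem_filter.
have sz' : size z' = size z by rewrite ez !size_cat.
rewrite (Fc_knuth _ _ kk); last exact: pcl0 pv2.
have pk := pcl_perm (knuth_perm kk) pv2.
have o3 : okT L.+1 ((nseq m 1 ++ z') :: [:: y] :: Rs).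
  have h12 : all (fun x => 0 < x <= L.+1) (nseq m 1 ++ z') by have := pk.1; rewrite !rread_cons all_cat => /andP[_].
  have h2 : all (fun x => 0 < x <= L.+1) z' by move: h12; rewrite all_cat => /andP[].
  suff sm : sorted leq (nseq m 1 ++ z').
    rewrite -cat1s -[_ :: Rs]cat1s !okT_cat oRs andbT; apply/andP; split; apply/andP; split; rewrite all_seq1 //.
    by rewrite all_seq1.
  have szz : sorted leq z'.
    move: sz; rewrite ez /z' => sz; have sP : sorted leq P by apply: (subseq_sorted leq_trans (prefix_subseq _ _)) sz.
    have sQ : path leq y Q by move: sz; rewrite sorted_cat_cons => /andP[].
    have /= pQ : all (leq y) Q by apply: order_path_min sQ; exact: leq_trans.
    rewrite sorted_cat_cons; apply/andP; split.
      case: (P) Px sP => //= p P' /andP[px Px] sP; rewrite rcons_path sP /=.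
      by have : last p P' \in p :: P' := mem_last _ _; rewrite inE => /orP[/eqP ->//|/(allP Px)].
    rewrite path_min_sorted ?(path_sorted sQ) //; apply: sub_all pQ => t; apply: leq_trans; exact: ltnW.
  have : all (leq 1) z' by apply: sub_all h2 => t /andP[].
  move: (z') szz => F szF hF; elim: (m) => //= j IHj; rewrite path_min_sorted ?IHj //.
  by rewrite all_cat hF andbT; apply/allP => t /nseqP [->].
have one3 : ones_in_first_row ((nseq m 1 ++ z') :: [:: y] :: Rs).
  rewrite /ones_in_first_row /= inE negb_or eq_sym; apply/andP; split; last exact: one.
  by have := ltn_trans x2 xy; case: (y) => [|[]].
rewrite VAL // /HT [head _ _]/= [behead _]/= z'1 sz' rread_cons; congr (_ + _).
have pp := pcl_rows o3 one3 pk; rewrite [head _ _]/= [behead _]/= z'1 rread_cons in pp.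
rewrite catA cats1 map_rcons c3.
- congr _.+1; rewrite -map_cons.
  have ww : knuth_eq (y :: z' ++ rread Rs) (z ++ x :: rread Rs).
    by rewrite -[z ++ _]/(z ++ [:: x] ++ rread Rs) catA -cat_cons; apply/knuth_catr/KnuthSym.
  have al : all (ltn 1) (y :: z' ++ rread Rs).
    apply/allP => t ht; have : t.-1 \in map predn (z' ++ rread Rs ++ [:: y]).
      by apply: map_f; move: ht; rewrite inE !mem_cat mem_seq1; case/or3P=> ->; rewrite ?orbT.
    by move/(allP pp.1); rewrite /okl /=; case: t {ht} => [|[|t]].
  apply: Fc_knuth; first by apply/negP => /mapP [[|[|t]] /(allP al)].
  by apply: knuth_predn ww; apply: sub_all al => t /ltnW.
- by rewrite -map_rcons -cats1 -catA.
by have := leq_ltn_trans x2 xy; case: (y) => [|[|[]]].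
Qed.
End Level.

Lemma C3_all L : C3 L.
Proof.
elim: L => [|L IH]; last exact: C3_succ.
by move=> v x [/allP /(_ x)]; rewrite mem_rcons mem_head /okl => /(_ erefl); lia.
Qed.

Lemma C2_all L v m : pcl L.+1 (v ++ nseq m 1) -> 1 \notin v -> Fc L.+1 (v ++ nseq m 1) = Fc L (map predn v).
Proof.
(* In this tabloid the first row consists of the 1's alone, so [VAL] has nothing to rotate. *)
move=> pv v1; pose T := nseq m 1 :: sing v.
have rs : rread (sing v) = v by rewrite /rread /sing -map_rev revK; elim: (v) => //= x t ->.
have e : v ++ nseq m 1 = rread T by rewrite rread_cons rs.
have n0 : no1 (nseq m 1) = [::] by rewrite /no1 filter_nseq.
rewrite e (VAL (@C3_all L)) -?e // ?/HT /= ?n0 ?rs //.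
  apply/andP; split; first by rewrite /= sorted_sing andbT; elim: (m) => //= -[|j].
  have := pv.1; rewrite all_cat /= => /andP[h1 h2]; apply/andP; split; first exact: h2.
  by apply/allP => r /mapP [x]; rewrite mem_rev => /(allP h1) ? -> /=; rewrite andbT.
rewrite /ones_in_first_row /=; apply/negP => /flattenP [r /mapP [x]]; rewrite mem_rev => xv ->.
by rewrite inE => /eqP e1; rewrite -e1 in xv; rewrite xv in v1.
Qed.

Lemma is_charge_exists : exists c, is_charge c.
Proof.
(* The depth is the largest letter: it does not change under permutations and, when letters remain,
   drops by one in (C2). *)
pose mx := foldr maxn 0; exists (fun w => Fc (mx w) w).
have mxP w : all (leq^~ (mx w)) w.
  elim: w => //= x w IH; rewrite leq_maxl; apply: sub_all IH => y /= h; rewrite leq_max h orbT //.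
have pc w : partition_content w -> pcl (mx w) w.
  move=> [h1 h2]; split=> //; apply/allP => x xw; rewrite /okl (allP (mxP w) _ xw) andbT lt0n.
  by apply: contra h1 => /eqP <-.
have mxperm v w : perm_eq v w -> mx v = mx w.
  have le a b : perm_eq a b -> mx a <= mx b.
    move=> p; suff h s : {subset s <= b} -> mx s <= mx b by apply: h => x; rewrite (perm_mem p).
    elim: s => //= x s IH h; rewrite geq_max IH ?andbT; last by move=> y ys; apply: h; rewrite inE ys orbT.
    by apply: (allP (mxP b)); apply: h; rewrite mem_head.
  by move=> p; apply/eqP; rewrite eqn_leq !le // perm_sym.
split=> //.
- move=> v m h v1; have pv := pc _ h.
  case: v v1 h pv => [|x v] v1 h pv.
    case: m h pv => // m h pv; have e1 : mx (nseq m.+1 1) = 1 by rewrite /mx; elim: (m) => //= j ->.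
    by have := @C2_all 0 [::] m.+1; rewrite !cat0s in pv *; rewrite e1 in pv * => ->.
  have g2 y : y \in x :: v -> 1 < y.
    move=> yv; have := pv.1; rewrite all_cat => /andP[/allP /(_ y yv)]; rewrite /okl => /andP[y0 _] _.
    have : y != 1 by apply: contraNneq v1 => <-.
    lia.
  have e : mx ((x :: v) ++ nseq m 1) = (mx (map predn (x :: v))).+1.
    have e1 w : mx (w ++ nseq m 1) = maxn (mx w) (mx (nseq m 1)).
      by elim: w => [|y w IH] /=; rewrite ?max0n // IH maxnA.
    have e2 : mx (nseq m 1) <= 1 by elim: (m) => //= j h2; rewrite geq_max h2.
    have e3 w y : 1 < y -> (forall t, t \in w -> 1 < t) -> mx (y :: w) = (mx (map predn (y :: w))).+1.
      elim: w y => [|t w IH] y y1 hw; first by rewrite /= !maxn0 prednK //; lia.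
      have := IH t (hw _ (mem_head _ _)); rewrite /= => h'; rewrite h' ; last by move=> q qw; apply: hw; rewrite inE qw orbT.
      by case: y y1 => // y _; rewrite maxnSS.
    rewrite e1 e3 ?g2 ?mem_head //; last by move=> t tv; apply: g2; rewrite inE tv orbT.
    by apply/maxn_idPl; apply: leq_trans e2 _.
  by rewrite e in pv *; apply: C2_all.
- move=> v x h x1; rewrite (@mxperm (x :: v) (rcons v x)); last by rewrite perm_sym perm_rcons.
  by apply: C3_all => //; exact: pc.
move=> v w h k; rewrite -(mxperm _ _ (knuth_perm k)); apply: Fc_knuth => //.
by case: h.
Qed.
End ChargeExistence.

(** * Charge along strings and under rotation *)

Module ChargeRecursion.
From Stdlib Require Import ClassicalEpsilon.
From mathcomp Require Import all_boot zify.
Import Defs Scan FilteredSets Columns KnuthMoves Dominance Windows Folding TabloidWords ColumnInsertion TableauWords Katabolism ChargeExistence.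

Lemma charge_ok : is_charge charge.
Proof. exact: epsilon_spec is_charge_exists. Qed.

Lemma pc_perm v w : perm_eq v w -> partition_content v -> partition_content w.
Proof.
move=> p [h1 h2]; split; first by rewrite -(perm_mem p).
by move/seq.permP: p => p k; rewrite -!p; exact: h2.
Qed.
Lemma charge_rot (v r : seq nat) : partition_content (v ++ r) -> 1 \notin r -> charge (v ++ r) = size r + charge (r ++ v).
Proof.
have [_ _ c3 _] := charge_ok; elim/last_ind: r v => [|r x IH] v; first by rewrite cats0.
rewrite mem_rcons inE negb_or eq_sym => h /andP[x1 r1]; rewrite -rcons_cat c3 ?rcons_cat //.
rewrite -cat_cons IH //; last first.
  by apply: pc_perm h; apply/seq.permP => P; rewrite -cats1 !count_cat /=; lia.
by rewrite size_rcons -cats1 -catA.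
Qed.

Lemma size_rowt r u : size (rowt r u) = count_mem r (flatten u).
Proof.
rewrite /rowt size_flatten /shape -map_comp count_flatten -[in RHS](mkseq_nth [::] u) /mkseq -map_comp; congr sumn.
by apply: eq_map => s /=; rewrite size_nseq.
Qed.

Section G.
Variable l : nat.
Hypothesis l1 : 1 < l.
Definition okb (u : bword) := [/\ sorted geq (shape u), all (sorted geq) u & all (all (gtn l)) u].
Definition gch (u : bword) := charge_tabloid (tab l u).

Lemma pc_tab u : okb u -> partition_content (rread (tab l u)).
Proof.
move=> [h1 h2 h3]; have oT : okT (size u) (tab l u) := okT_tab l erefl.
have bT : bw (size u) (tab l u) = u by exact: bw_tab.
split; first exact: okT_no0 oT.
have cf k : count_mem k (rread (tab l u)) = count_mem k (flatten (tab l u)).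
  by rewrite /rread !count_flatten map_rev sumn_rev.
have e k : 0 < k <= size u -> count_mem k (rread (tab l u)) = nth 0 (shape u) k.-1.
  move=> hk; rewrite cf -size_blk -{2}bT (nth_map [::]) ?size_bw; last by lia.
  rewrite (nth_map 0) ?size_iota; last by lia.
  by rewrite nth_iota ?add1n ?prednK //; lia.
move=> k k0; have [h|h] := leqP k.+1 (size u).
  rewrite !e; try by lia.
  have sh : k.-1.+1 < size (shape u) by rewrite size_map prednK.
  by have := sortedP 0 h1 _ sh; rewrite prednK.
rewrite (_ : count_mem k.+1 _ = 0) //; apply/count_memPn/negP => /(allP (rread_ok oT)); rewrite /okl; lia.
Qed.

(** By [EB_step], raising replaces two adjacent rows by Knuth equivalent ones, and (C4) applies. *)
Lemma gch1 p u : p.+1 < l -> okb u -> gch (EB p u) = gch u.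
Proof.
move=> pl ou; have [h1 h2 h3] := ou; have oT : okT (size u) (tab l u) := okT_tab l erefl.
have bT : bw (size u) (tab l u) = u by exact: bw_tab.
have sT : size (tab l u) = l by rewrite size_mkseq.
have pc := pc_tab ou; rewrite /gch; set T := tab l u in oT bT sT pc *.
have [A [a [b [B [eT eA]]]]] : exists A (a b : seq nat) B, T = A ++ [:: a; b] ++ B /\ size A = p.
  exists (take p T), (nth [::] T p), (nth [::] T p.+1), (drop p.+2 T).
  split; last by rewrite size_take; case: ltnP; lia.
  have pS : p.+1 < size T by rewrite sT.
  by rewrite -{1}(cat_take_drop p T) (drop_nth [::]) ?(drop_nth [::] pS) //; lia.
rewrite eT in oT; have [a' [b' [oT' eb kab _]]] := EB_step oT; rewrite -eT bT eA in eb.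
have -> : tab l (EB p u) = A ++ [:: a'; b'] ++ B.
  rewrite -eb -(tab_bw oT'); congr (tab _ _).
    by rewrite -sT eT !size_cat.
  by rewrite (tab_bw oT').
have [_ _ _ c4] := charge_ok; apply: esym; apply: c4; first exact: pc.
have e (x y : seq nat) : flatten (rev (A ++ [:: x; y] ++ B)) = rread B ++ (y ++ x) ++ rread A.
  by rewrite -/(rread _) !rread_cat -!catA; congr (_ ++ _); rewrite /rread /= cats0 -catA.
by rewrite eT !e; apply: knuth_ctx.
Qed.

Lemma gch3 : gch [::] = 0.
Proof.
have [c1 _ _ _] := charge_ok; rewrite /gch /charge_tabloid (_ : flatten _ = [::]) //.
rewrite -/(rread _) (_ : tab l [::] = [::] ++ nseq l [::]) ?rread_pad //.
apply: (@eq_from_nth _ [::]); rewrite size_mkseq ?size_nseq // => i il.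
by rewrite nth_mkseq // nth_nseq il.
Qed.

(** The letters of the first row other than 1, which end the reading word, are rotated to the front
    by (C3) at cost one each; they are the letters of [u] in row 0. Then (C2) removes the 1's and
    leaves the reading word of [kat]. *)
Lemma gch2 m u : okb (nseq m 0 :: u) ->
  gch (nseq m 0 :: u) = count_mem 0 (flatten u) + gch (map (rotb l) u).
Proof.
set u2 := _ :: u => ou; have [h1 h2 h3] := ou; have oT : okT (size u2) (tab l u2) := okT_tab l erefl.
have bT : bw (size u2) (tab l u2) = u2 by exact: bw_tab.
have sT : size (tab l u2) = l by rewrite size_mkseq.
have pc := pc_tab ou.
have one : ones_in_first_row (tab l u2).
  have e1 : blk 1 (tab l u2) = nseq m 0 by case: bT.
  by rewrite ones_blk e1 size_nseq.
have r0 : head [::] (tab l u2) = rowt 0 u2 by rewrite /tab; case: (l) l1.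
have ekat : tab l (map (rotb l) u) = kat (tab l u2).
  have ok' := okT_kat oT; rewrite -[RHS](tab_bw ok') size_kat sT; congr tab.
  by rewrite (bw_kat _ l1 sT) bT.
rewrite /gch ekat /charge_tabloid -!/(rread _).
move: (tab l u2) sT oT pc one r0 {bT ekat} => T sT oT pc one r0.
case: T sT oT pc one r0 => [|R Rs] sT oT pc one r0; first by move: l1; rewrite -sT.
rewrite /= in r0; have [sR aR] := okT_nth 0 oT; rewrite /= in sR aR.
have zR : 0 \notin R by apply/negP => /(allP aR).
have cR : count_mem 1 R = m by rewrite r0 count_rowt /= count_nseq mul1n.
have eR := sorted_split1 sR zR; rewrite cR in eR.
have n1 : 1 \notin rread Rs.
  apply: contra one => /flattenP [r]; rewrite mem_rev => rT xr; apply/flattenP; by exists r.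
have szz : size (no1 R) = count_mem 0 (flatten u).
  have : size R = m + count_mem 0 (flatten u).
    by rewrite r0 size_rowt /u2 [flatten _]/= count_cat count_nseq mul1n.
  by rewrite {1}eR size_cat size_nseq => /addnI.
have [_ c2 _ _] := charge_ok.
have e : rread (R :: Rs) = (rread Rs ++ nseq m 1) ++ no1 R by rewrite rread_cons {1}eR catA.
rewrite e in pc *; rewrite (charge_rot pc); last by rewrite mem_filter.
rewrite szz; congr (_ + _); rewrite catA c2.
- congr charge; rewrite /kat rot1_cons rread_rcons map_cat; congr (_ ++ _).
  rewrite /rread -map_rev map_flatten; congr flatten; apply/eq_in_map => r; rewrite mem_rev => rRs.
  congr map; apply/esym/all_filterP/allP => x xr; apply: contraNneq n1 => <-.
  by apply/flattenP; exists r; rewrite ?mem_rev.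
- by rewrite -catA; apply: pc_perm pc; rewrite perm_catC.
by rewrite mem_cat negb_or n1 mem_filter.
Qed.
End G.
End ChargeRecursion.

(** * Length and uniqueness of the longest 0-Hecke element *)

Module HeckeNormalForm.
From mathcomp Require Import all_boot all_order all_algebra zify.
Import Scan FilteredSets Columns KnuthMoves Dominance Windows Folding TabloidWords.

Import Order.TTheory GRing.Theory Num.Theory.

(* The 0-Hecke action on integer sequences: the p-th generator sorts the
   entries p and p + 1 increasingly. *)
Fixpoint sact (p : nat) (s : seq int) : seq int := match p, s with
  | 0, x :: y :: s' => if (y <= x)%R then y :: x :: s' else s
  | p'.+1, x :: s' => x :: sact p' s'
  | _, _ => s end.
Definition sactw v s := foldr sact s v.
(** Pairs already in increasing order. A generator adds at most one, so the final value bounds the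
    length of a sorting word from below. *)
Fixpoint inv (s : seq int) : nat := if s is x :: s' then count (fun y => x < y)%R s' + inv s' else 0.

Lemma size_sact p s : size (sact p s) = size s.
Proof. by elim: p s => [|p IH] [|x s] //=; [case: s => // y s; case: ifP|rewrite IH]. Qed.
Lemma perm_sact p s : perm_eq (sact p s) s.
Proof.
elim: p s => [|p IH] [|x s] //=; last by rewrite perm_cons.
by case: s => // y s; case: ifP => // _; apply/seq.permP => P /=; lia.
Qed.
Lemma inv_sact p s : inv (sact p s) = (inv s + ((p.+1 < size s) && (nth 0%R s p.+1 < nth 0%R s p)%R))%N.
Proof.
elim: p s => [|p IH] [|x s] //=; last by rewrite IH (seq.permP (perm_sact p s)) ltnS addnA.
case: s => [|y s] //=.
case h : (y < x)%R.
  by rewrite (ltW h) /= h (lt_gtF h) /=; lia.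
case h2 : (y <= x)%R; last by rewrite addn0.
by have -> : y = x by [lia]; rewrite /= ltxx; lia.
Qed.
Lemma inv_sact_le p s : inv (sact p s) <= (inv s).+1.
Proof. by rewrite inv_sact; case: (_ && _) => /=; lia. Qed.
Lemma inv_sactw v s : inv (sactw v s) <= inv s + size v.
Proof. by elim: v => [|p v IH] /=; [lia|have := inv_sact_le p (sactw v s); lia]. Qed.
Lemma sactw_hrel a b s : hrel a b -> sactw a s = sactw b s.
Proof.
case=> [i|i j ij|i].
- elim: i s => [|i IH] [|x s] //=; last by congr (_ :: _); exact: IH.
  by case: s => // y s /=; case: ifP => h /=; rewrite ?h //; case: ifP => // h2; have -> : x = y by lia.
- elim: i j s ij => [|i IH] [|j] [|x s] //= ij; last by congr (_ :: _); exact: IH.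
  by case: s j ij => [|y s] [|j] //= _; case: ifP.
elim: i s => [|i IH] [|x s] //=; last by congr (_ :: _); exact: IH.
case: s => // y [|z s] /=; first by case: ifP => //= h; case: ifP => // h'; have -> : x = y by lia.
case e1 : (y <= x)%R; case e2 : (z <= x)%R; case e3 : (z <= y)%R;
  case e4 : (x <= y)%R; case e5 : (x <= z)%R; case e6 : (y <= z)%R; try (exfalso; lia);
  do 4 rewrite /= ?(e1, e2, e3, e4, e5, e6); try done; repeat congr (_ :: _); lia.
Qed.
Lemma sactw_heq a b s : heq a b -> sactw a s = sactw b s.
Proof.
move=> h; elim: h s => {a b} [u a b v r|w|u v _ IH|u v w _ IH1 _ IH2] s //.
- by rewrite /sactw !foldr_cat -!/(sactw _ _) (sactw_hrel _ r).
- by rewrite IH1 IH2.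
Qed.

Definition tri m := ('C(m.+1, 2))%N.
Lemma size_w0w m lo : size (w0w m lo) = tri m.
Proof.
elim: m lo => // m IH lo; have -> : w0w m.+1 lo = rev (iota lo m.+1) ++ w0w m lo.+1 by [].
by rewrite size_cat size_rev size_iota IH /tri [RHS]binS bin1 addnC.
Qed.
Lemma sorted_sact (s : seq int) : (forall p, p.+1 < size s -> sact p s = s) -> sorted <=%R s.
Proof.
move=> h; apply/(sortedP 0%R) => p hp; have := inv_sact p s; rewrite (h p hp) hp /=.
by case: leP => //= _; rewrite addn1 => /n_Sn.
Qed.
Lemma inv_iota k m : inv [seq (Posz i) | i <- iota k m.+1] = tri m.
Proof.
elim: m k => // m IH k; have -> : iota k m.+2 = k :: iota k.+1 m.+1 by [].
have -> : inv [seq Posz i | i <- k :: iota k.+1 m.+1] =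
  (count (fun y => k%:Z < y)%R [seq Posz i | i <- iota k.+1 m.+1] + inv [seq Posz i | i <- iota k.+1 m.+1])%N by [].
rewrite IH /tri [RHS]binS bin1 addnC; congr (_ + _)%N.
rewrite -[RHS](size_iota k.+1) -(size_map Posz); apply/eqP; rewrite -all_count all_map.
by apply/allP => i; rewrite mem_iota /=; lia.
Qed.
(* Any word equal to the staircase sorts the decreasing sequence. *)
Lemma w0w_reduced n v : heq (w0w n 0) v -> tri n <= size v.
Proof.
move=> h; pose s := [seq Posz i | i <- rev (iota 0 n.+1)].
have sz : size s = n.+1 by rewrite size_map size_rev size_iota.
have e := sactw_heq s h; have sw w : size (sactw w s) = n.+1.
  by elim: w => [|p w IH] /=; rewrite ?sz // size_sact.
have srt : sorted <=%R (sactw (w0w n 0) s).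
  apply: sorted_sact => p; rewrite sw => pn.
  have := sactw_heq s (@w0w_absl n 0 p _); apply; lia.
have pm w : perm_eq (sactw w s) s.
  by elim: w => [|p w IH] //=; apply: perm_trans (perm_sact _ _) IH.
have es : sactw (w0w n 0) s = [seq Posz i | i <- iota 0 n.+1].
  apply: (sorted_eq le_trans le_anti) => //.
    by rewrite sorted_map; apply: sub_sorted (iota_sorted 0 n.+1) => x y.
  by apply: perm_trans (pm _) _; apply: perm_map; rewrite perm_rev.
have i0 : inv s = 0.
  have : sorted >=%R s.
    rewrite /s sorted_map rev_sorted; apply: sub_sorted (iota_sorted 0 n.+1) => x y /=; lia.
  elim: (s) => //= x t IH st; have {}IH := IH (path_sorted st); rewrite IH addn0.
  have : all (fun y => y <= x)%R t by apply: order_path_min st => a b c /=; lia.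
  move=> ha; apply/eqP; rewrite -leqn0 leqNgt -has_count; apply/hasP => [] [y /(allP ha)]; lia.
by have := inv_sactw v s; rewrite -e es inv_iota i0.
Qed.

Definition run m k := rev (iota (m.+1 - k) k).
(** A generator on the right of a run either extends it, is absorbed, or passes to the left as [i]
    (far) or as [i.-1] (braid), where it lies below [m]. *)
Lemma run_right m k i : k <= m.+1 -> i <= m ->
  exists j k', [/\ all (gtn m) j, size j <= 1, k' <= m.+1 & heq (run m k ++ [:: i]) (j ++ run m k')].
Proof.
move=> km im.
have runS k0 : k0 <= m -> run m k0.+1 = rcons (run m k0) (m - k0).
  by move=> h; rewrite /run subSS subSn // -rev_cons.
case: (ltngtP i.+1 (m.+1 - k)) => h.
- exists [:: i], k; split=> //=; first by lia.
  have : heq (i :: run m k) (run m k ++ [:: i]).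
    by apply: heq_comm_seq; apply/allP => r; rewrite mem_rev mem_iota; lia.
  exact: Hsym.
- case: k km h => [|k] km h; first by lia.
  case: (eqVneq i (m.+1 - k.+1)) => [ei|ne].
    exists [::], k.+1; split=> //; rewrite runS ?cat0s; last by lia.
    rewrite -cats1 -catA; have -> : i = m - k by lia.
    by apply: heq_catl; exact: hrel_heq (Hidem _).
  exists [:: i.-1], k.+1; split=> //=; first by lia.
  have -> : run m k.+1 = rev (iota i.+1 (m - i)) ++ [:: i; i.-1] ++ rev (iota (m - k) (i.-1 - (m - k))).
    rewrite /run subSS; have -> : k.+1 = ((i.-1 - (m - k)) + 2 + (m - i)) by lia.
    rewrite !iotaD !rev_cat; have -> : m - k + (i.-1 - (m - k) + 2) = i.+1 by lia.
    have -> : m - k + (i.-1 - (m - k)) = i.-1 by lia.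
    rewrite /= prednK; last by lia.
    by [].
  set A := rev (iota i.+1 _); set B := rev (iota (m - k) _).
  apply: Htrans (_ : heq _ (A ++ [:: i; i.-1; i] ++ B)) _.
    rewrite -!catA; apply: heq_catl; rewrite -[[:: i; i.-1; i] ++ B]/([:: i; i.-1] ++ (i :: B)); apply: heq_catl.
    apply: Hsym; apply: heq_comm_seq; apply/allP => r; rewrite mem_rev mem_iota; lia.
  apply: Htrans (_ : heq _ (A ++ [:: i.-1; i; i.-1] ++ B)) _.
    apply: heq_catl; apply: heq_catr; have := hrel_heq (Hbraid i.-1); rewrite prednK; last by lia.
    exact: Hsym.
  have -> : A ++ [:: i.-1; i; i.-1] ++ B = (A ++ [:: i.-1]) ++ [:: i; i.-1] ++ B by rewrite -!catA.
  rewrite [X in heq _ X]/= -cat_cons; apply: heq_catr; apply: Hsym; apply: heq_comm_seq; apply/allP => r; rewrite mem_rev mem_iota; lia.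
exists [::], k.+1; split=> //; first by lia.
rewrite cat0s runS; last by lia.
have -> : i = m - k by lia.
by rewrite cats1; exact: Hrefl.
Qed.
Lemma run_nf m v : all (gtn m.+1) v ->
  exists u k, [/\ all (gtn m) u, k <= m.+1 & heq v (u ++ run m k)].
Proof.
elim/last_ind: v => [|v i IH]; first by move=> _; exists [::], 0; split=> //; exact: Hrefl.
rewrite all_rcons => /andP[im /IH [u [k [au km h]]]].
have [j [k' [aj _ k'm h']]] := @run_right m k i km im.
exists (u ++ j), k'; split=> //; first by rewrite all_cat au.
rewrite -cats1; apply: Htrans (heq_catr [:: i] h) _; rewrite -!catA; exact: heq_catl.
Qed.
Fixpoint fullw m := if m is m'.+1 then fullw m' ++ run m' m'.+1 else [::].
(** Normal form as a product of runs. Only the product of all full runs attains the size [tri m],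
    which makes the longest element unique. *)
Lemma nform m v : all (gtn m) v ->
  exists u, [/\ heq v u, size u <= tri m & size u = tri m -> u = fullw m].
Proof.
elim: m v => [|m IH] v av.
  by exists v; case: v av => // _; split=> //; exact: Hrefl.
have [u [k [au km h]]] := run_nf av; have [u' [h1 h2 h3]] := IH u au.
exists (u' ++ run m k); split.
- by apply: Htrans h (heq_catr _ h1).
- rewrite size_cat size_rev size_iota /tri binS bin1 addnC; rewrite /tri in h2; lia.
rewrite size_cat size_rev size_iota /tri binS bin1 => e; rewrite /tri in h2 h3.
by have ek : k = m.+1 by [lia]; rewrite h3 ?ek //; lia.
Qed.
End HeckeNormalForm.

(** * Demazure operators on rational functions satisfy the 0-Hecke relations *)

Module DemazureOperators.
From HB Require Import structures.
From mathcomp Require Import all_boot all_order all_fingroup all_algebra.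
From mathcomp Require Import generic_quotient fraction mpoly ring zify.
Import Defs Scan FilteredSets Columns KnuthMoves Dominance Windows Folding TabloidWords JacobiTrudi.
Import Order.TTheory GRing.Theory Num.Theory.
Local Open Scope ring_scope.

Lemma subf_div (F : fieldType) (a b c d : F) : b != 0 -> d != 0 -> a / b - c / d = (a * d - c * b) / (b * d).
Proof. by move=> b0 d0; field; rewrite b0 d0. Qed.

Section Ratfun.
Variable l : nat.
Notation F := (ratfun l).

Lemma ratfunP (f : F) : exists p q : {mpoly int[l]}, q != 0 /\ f = toratfun p / toratfun q.
Proof.
exists (repr f).1, (repr f).2; have d0 := denom_ratioP (repr f); split=> //.
rewrite -{1}[f]reprK; apply: (canRL (mulfK (_ : toratfun (repr f).2 != 0))); first by rewrite tofrac_eq0.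
rewrite /toratfun; move: (repr f) d0 => y d0.
rewrite !piE; apply/eqP; rewrite FracField.equivf_def /FracField.equivf.
by rewrite /FracField.mulf !numden_Ratio ?mulr1 ?mul1r ?oner_eq0 // mulrC.
Qed.

Variable s : 'S_l.
Lemma msym_neq0 (q : {mpoly int[l]}) : q != 0 -> msym s q != 0.
Proof. by apply: contra => /eqP e; apply/eqP/(@inj_msym _ _ s); rewrite e msym0. Qed.
Lemma tofrac_neq0 (q : {mpoly int[l]}) : q != 0 -> toratfun q != 0.
Proof. by rewrite tofrac_eq0. Qed.
Lemma fpermM : {morph fperm s : f g / f * g}.
Proof.
move=> f g; have [p [q [q0 ->]]] := ratfunP f; have [p' [q' [q'0 ->]]] := ratfunP g.
rewrite mulf_div /toratfun -!tofracM -/(toratfun (p * p')) -/(toratfun (q * q')) !fperm_div ?mulf_neq0 //.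
by rewrite mulf_div /toratfun -!tofracM !msymM.
Qed.
Lemma fperm1 : fperm s 1 = 1.
Proof.
have e : (1 : F) = toratfun 1 / toratfun 1 by rewrite /toratfun tofrac1 divr1.
by rewrite {1}e fperm_div ?oner_eq0 // msym1 -e.
Qed.
Lemma fpermB : {morph fperm s : f g / f - g}.
Proof.
move=> f g; have [p [q [q0 ->]]] := ratfunP f; have [p' [q' [q'0 ->]]] := ratfunP g.
have n := tofrac_neq0 (msym_neq0 q0); have n' := tofrac_neq0 (msym_neq0 q'0).
rewrite subf_div ?tofrac_neq0 // /toratfun -!tofracM -tofracB.
rewrite -/(toratfun (p * q' - p' * q)) -/(toratfun (q * q')) !fperm_div ?mulf_neq0 //.
rewrite [msym s (p * q' - p' * q)]msymB (msymM s p q') (msymM s p' q) (msymM s q q').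
rewrite [RHS](subf_div _ _ n n') /toratfun tofracM tofracB !tofracM; reflexivity.
Qed.
HB.instance Definition _ := GRing.isZmodMorphism.Build F F (fperm s) fpermB.
HB.instance Definition _ := GRing.isMonoidMorphism.Build F F (fperm s) (conj fperm1 fpermM).

Lemma fperm_x i : fperm s (xvar i) = xvar (s i).
Proof.
have e (p : {mpoly int[l]}) : toratfun p = toratfun p / toratfun 1 by rewrite /toratfun tofrac1 divr1.
rewrite /xvar (e 'X_i) fperm_div ?oner_eq0 // msym1 -e msymX; congr (toratfun 'X_[_]).
by apply/mnmP => j; rewrite mnmE !mnm1E -(inj_eq (@perm_inj _ s)) permKV.
Qed.
Lemma xvar_neq0 (i : 'I_l) : xvar i != 0.
Proof. apply: tofrac_neq0; apply/eqP => /(congr1 (mcoeff U_(i)%MM)).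
by rewrite mcoeffXU eqxx mcoeff0. Qed.
Lemma xvar_inj : injective (@xvar l).
Proof.
move=> i j /eqP; rewrite /xvar /toratfun tofrac_eq => /eqP /(congr1 (mcoeff U_(j))).
by rewrite !mcoeffXU eqxx; case: eqP.
Qed.
End Ratfun.

Lemma fpermMm l (s t : 'S_l) f : fperm s (fperm t f) = fperm (t * s)%g f.
Proof.
have [p [q [q0 ->]]] := ratfunP f.
by rewrite !fperm_div ?msym_neq0 // !msymMm.
Qed.

Section Braid.
Variables (F : fieldType) (s t : {rmorphism F -> F}) (x y z : F).
Hypotheses (sx : s x = y) (sy : s y = x) (sz : s z = z) (tx : t x = x) (ty : t y = z) (tz : t z = y).
Hypotheses (ss : forall f, s (s f) = f) (tt : forall f, t (t f) = f) (sts : forall f, s (t (s f)) = t (s (t f))).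
Hypotheses (xy : x - y != 0) (yz : y - z != 0) (xz : x - z != 0).
(** Stated over an abstract field: the images of [f] under the six permutations become atoms,
    identified only by [sts], and [field] decides. *)
Lemma dem_braid f (P := fun f => (x * f - y * s f) / (x - y)) (R := fun f => (y * f - z * t f) / (y - z)) :
  P (R (P f)) = R (P (R f)).
Proof.
have yx : y - x != 0 by rewrite -opprB oppr_eq0.
have zy : z - y != 0 by rewrite -opprB oppr_eq0.
rewrite /P /R !(rmorphB, rmorphM, fmorphV, sx, sy, sz, tx, ty, tz, ss, tt) /= sts.
move: (s f) (t f) (s (t f)) (t (s f)) (t (s (t f))) => a b c d e.
by field; rewrite ?xy ?xz ?yz ?yx ?zy.
Qed.
Lemma dem_idem f (P := fun f => (x * f - y * s f) / (x - y)) : P (P f) = P f.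
Proof.
have yx : y - x != 0 by rewrite -opprB oppr_eq0.
rewrite /P !(rmorphB, rmorphM, fmorphV, sx, sy, ss) /=; move: (s f) => a.
by field; rewrite ?xy ?yx.
Qed.
End Braid.
Lemma dem_comm (F : fieldType) (s t : {rmorphism F -> F}) (x y z w f : F) (P := fun f => (x * f - y * s f) / (x - y))
  (R := fun f => (z * f - w * t f) / (z - w)) : s z = z -> s w = w -> t x = x -> t y = y ->
  (forall f, s (t f) = t (s f)) -> x - y != 0 -> z - w != 0 -> P (R f) = R (P f).
Proof.
move=> sz sw tx ty st xy zw; rewrite /P /R !(rmorphB, rmorphM, fmorphV, sz, sw, tx, ty) /= st.
move: (s f) (t f) (t (s f)) => a b c; by field; rewrite ?xy ?zw.
Qed.

Section NatIndexed.
Variable n : nat.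
Notation l := n.+1.
Notation F := (ratfun n.+1).
Definition X (r : nat) : F := xvar (inord r).
Definition tp (p : nat) : 'S_l := tperm (inord p) (inord p.+1).
Definition sF (p : nat) : {rmorphism F -> F} := fperm (tp p).
Definition demn p (f : F) : F := (X p * f - X p.+1 * sF p f) / (X p - X p.+1).
Definition dw (v : seq nat) (f : F) := foldr demn f v.

Lemma lposE (i : 'I_n) : lpos i = inord i.
Proof. by apply: val_inj; rewrite /= inordK // ltnW // ltnS. Qed.
Lemma rposE (i : 'I_n) : rpos i = inord i.+1.
Proof. by apply: val_inj; rewrite /= inordK // ltnS. Qed.
Lemma demazureE (i : 'I_n) f : demazure i f = demn i f.
Proof. by rewrite /demazure /demn /X /sF /tp -lposE -rposE. Qed.
Lemma demazure_wordE (w : seq 'I_n) f : demazure_word w f = dw (map val w) f.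
Proof. by elim: w => //= i w ->; rewrite demazureE. Qed.

Lemma inord_eq (a b : nat) : (a < l)%N -> (b < l)%N -> (inord a == inord b :> 'I_l) = (a == b).
Proof. by move=> ha hb; rewrite -val_eqE /= !inordK. Qed.
Lemma sX p r : (p.+1 < l)%N -> (r < l)%N ->
  sF p (X r) = X (if r == p then p.+1 else if r == p.+1 then p else r).
Proof.
move=> pl rl; rewrite /sF /= fperm_x /X; congr xvar; rewrite /tp permE /= !inord_eq //; last by lia.
by case: ifP => // _; case: ifP.
Qed.
Lemma X_neq p r : (p < l)%N -> (r < l)%N -> p != r -> X p != X r.
Proof. by move=> pl rl; apply: contra => /eqP /xvar_inj /eqP; rewrite inord_eq. Qed.
Lemma nzX p : (p.+1 < l)%N -> X p != X p.+1.
Proof. by move=> pl; apply: X_neq => //; lia. Qed.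
Lemma sF_inv p f : sF p (sF p f) = f.
Proof. by rewrite /sF /= fpermMm /tp tperm2 (_ : fperm 1 f = f) //; have [a [b [b0 ->]]] := ratfunP f; rewrite fperm_div // !msym1m. Qed.

Lemma tp_braid p : (p.+2 < l)%N -> (tp p * tp p.+1 * tp p = tp p.+1 * tp p * tp p.+1)%g.
Proof.
move=> pl; have c (a b : 'S_l) : (a^-1 = a -> a * b * a = b ^ a)%g by rewrite conjgE => ->; rewrite mulgA.
have d a b : (a < l)%N -> (b < l)%N -> a != b -> inord a != inord b :> 'I_l by move=> al bl; rewrite inord_eq.
rewrite !c ?tpermV // /tp !tpermJ tpermR tpermL !tpermD //; apply: d; lia.
Qed.
Lemma tp_comm p r : (p.+1 < r)%N -> (r.+1 < l)%N -> (tp p * tp r = tp r * tp p)%g.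
Proof.
move=> pr rl; have d a b : (a < l)%N -> (b < l)%N -> a != b -> inord a != inord b :> 'I_l by move=> al bl; rewrite inord_eq.
by rewrite conjgC /tp tpermJ !tpermD //; apply: d; lia.
Qed.

Lemma dw_cat u v f : dw (u ++ v) f = dw u (dw v f). Proof. by rewrite /dw foldr_cat. Qed.
Lemma sXl p : (p.+1 < l)%N -> sF p (X p) = X p.+1.
Proof. by move=> pl; rewrite sX ?eqxx //; exact: ltnW. Qed.
Lemma sXr p : (p.+1 < l)%N -> sF p (X p.+1) = X p.
Proof. by move=> pl; rewrite sX // gtn_eqF // eqxx. Qed.
Lemma sXo p r : (p.+1 < l)%N -> (r < l)%N -> r != p -> r != p.+1 -> sF p (X r) = X r.
Proof. by move=> pl rl h1 h2; rewrite sX // (negPf h1) (negPf h2). Qed.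
Lemma subX p r : (p < l)%N -> (r < l)%N -> p != r -> X p - X r != 0.
Proof. by move=> pl rl pr; rewrite subr_eq0 X_neq. Qed.
Lemma dw_hrel a b f : all (gtn n) a -> hrel a b -> dw a f = dw b f.
Proof.
move=> + h; case: h => [i|i j ij|i] /=; rewrite ?andbT.
- case/andP=> i_n _; have il : (i.+1 < l)%N by rewrite ltnS.
  by apply: (dem_idem (sXl il) (sXr il) (@sF_inv i)); apply: subX; lia.
- case/andP=> i_n j_n; have il : (i.+1 < l)%N by rewrite ltnS.
  have jl : (j.+1 < l)%N by rewrite ltnS.
  have o p r : (p.+1 < l)%N -> (r.+1 < l)%N -> ((p.+1 < r) || (r.+1 < p))%N -> sF p (X r) = X r /\ sF p (X r.+1) = X r.+1.
    by move=> h1 h2 h3; split; apply: sXo => //; lia.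
  have [o1 o2] := o i j il jl (introT orP (or_introl ij)).
  have [o3 o4] := o j i jl il (introT orP (or_intror ij)).
  apply: (dem_comm _ o1 o2 o3 o4); [|apply: subX; lia|apply: subX; lia].
  by move=> g; rewrite /sF /= (fpermMm (tp i) (tp j)) (fpermMm (tp j) (tp i)) (tp_comm ij jl).
case/and3P=> i_n i1_n _; have il : (i.+1 < l)%N by rewrite ltnS.
have il2 : (i.+2 < l)%N by rewrite ltnS.
have o1 : sF i (X i.+2) = X i.+2 by apply: sXo => //; lia.
have o2 : sF i.+1 (X i) = X i by apply: sXo => //; lia.
apply: (dem_braid (sXl il) (sXr il) o1 o2 (sXl il2) (sXr il2) (@sF_inv i) (@sF_inv i.+1)); try (by apply: subX; lia).
have e (a' b' c' : 'S_l) g : fperm a' (fperm b' (fperm c' g)) = fperm (c' * b' * a')%g g.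
  by rewrite (fpermMm b' c') (fpermMm a').
move=> g; exact: (etrans (e (tp i) (tp i.+1) (tp i) g)
  (etrans (congr1 (fun t => fperm t g) (tp_braid il2)) (esym (e (tp i.+1) (tp i) (tp i.+1) g)))).
Qed.
Lemma dw_heq u v f : all (gtn n) u -> heq u v -> dw u f = dw v f.
Proof.
move=> + h; elim: h f => {u v} [u a b v r|w|u v h IH|u v w h1 IH1 h2 IH2] f au.
- rewrite !dw_cat; congr (dw u _); apply: dw_hrel r.
  by move: au; rewrite !all_cat => /and3P[].
- by [].
- by rewrite IH // (heq_all _ h).
by rewrite IH1 // IH2 // -(heq_all _ h1).
Qed.
Lemma piw_dw v f : all (gtn n) v -> piw X sF v f (dw v f).
Proof.
elim: v => //= p v IH /andP[pn /IH {}IH]; exists (dw v f) => //.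
by rewrite /pirel /demn mulrC divfK // subr_eq0 nzX //; move: pn => /=; lia.
Qed.
End NatIndexed.

Section MonField.
Variable F : fieldType.
(** Exponents may be negative; factoring out [(u * v) ^ r] leaves a difference of natural powers. *)
Lemma div_pow (u v : F) (r : int) (k : nat) : u != 0 -> v != 0 ->
  u * (u ^ (r + k%:Z) * v ^ r) - v * (v ^ (r + k%:Z) * u ^ r) =
  (u - v) * \sum_(e < k.+1) u ^ (r + k%:Z - e%:Z) * v ^ (r + e%:Z).
Proof.
move=> u0 v0; transitivity ((u * v) ^ r * (u ^+ k.+1 - v ^+ k.+1)).
  by rewrite !expfzDr // -!exprnP expfzMl !exprS; ring.
rewrite subrXX mulrCA; congr (_ * _); rewrite mulr_sumr; apply: eq_bigr => e _.
have ek := ltn_ord e.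
have -> : r + k%:Z - e%:Z = r + (k.+1.-1 - e)%N%:Z by lia.
by rewrite !expfzDr // -!exprnP expfzMl; ring.
Qed.
Lemma div_pow_neg (u v : F) (r : int) (k : nat) : u != 0 -> v != 0 ->
  u * (u ^ r * v ^ (r + k.+1%:Z)) - v * (v ^ r * u ^ (r + k.+1%:Z)) =
  (u - v) * - \sum_(t < k) u ^ (r + t.+1%:Z) * v ^ (r + k.+1%:Z - t.+1%:Z).
Proof.
move=> u0 v0; transitivity (- ((u * v) ^ r * (u * v) * (u ^+ k - v ^+ k))).
  by rewrite !expfzDr // -!exprnP expfzMl !exprS; ring.
rewrite subrXX [RHS]mulrN; congr (- _); rewrite mulrCA; congr (_ * _); rewrite mulr_sumr.
rewrite (reindex_inj rev_ord_inj) /=; apply: eq_bigr => t _; have tk := ltn_ord t.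
have -> : r + k.+1%:Z - t.+1%:Z = r + (k - t)%N%:Z by lia.
have -> : (k.-1 - (k - t.+1) = t)%N by lia.
have -> : (k - t = (k - t.+1).+1)%N by lia.
by rewrite !expfzDr // -!exprnP expfzMl !exprS; ring.
Qed.
End MonField.
End DemazureOperators.

(** * Triangularity of the key polynomials *)

Module KeyTriangularity.
From Stdlib Require Import ClassicalEpsilon.
From HB Require Import structures.
From mathcomp Require Import all_boot all_order all_fingroup all_algebra.
From mathcomp Require Import generic_quotient fraction mpoly ring zify.
Import Defs Scan FilteredSets Columns KnuthMoves Dominance Windows Folding TabloidWords JacobiTrudi HeckeNormalForm DemazureOperators.
Import Order.TTheory GRing.Theory Num.Theory.
Local Open Scope ring_scope.

Section HeckeWords.
Variable n : nat.
Implicit Types w : seq 'I_n.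

Lemma hecke_heq w w' : hecke_eq w w' -> heq (map val w) (map val w').
Proof.
elim=> {w w'} [u a b v r|w|v w _ IH|u v w _ IH1 _ IH2].
- rewrite !map_cat; apply: Hstep; case: r => [i|i j ij|i j ij] /=.
  + exact: Hidem.
  + exact: Hcomm.
  + by rewrite ij; exact: Hbraid.
- exact: Hrefl.
- exact: Hsym.
exact: Htrans IH1 IH2.
Qed.
Lemma heq_hecke (i0 : 'I_n) a b : heq a b -> all (gtn n) a ->
  hecke_eq [seq insubd i0 p | p <- a] [seq insubd i0 p | p <- b].
Proof.
have v p : (p < n)%N -> val (insubd i0 p) = p by move=> h; rewrite val_insubd h.
elim=> {a b} [u a b w r|w|a b h IH|a b c h1 IH1 h2 IH2] ha.
- rewrite !map_cat; apply: HeckeStep; have aa : all (gtn n) a by move: ha; rewrite !all_cat => /and3P[].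
  case: r aa => [i|i j ij|i] /= aa.
  + exact: HeckeIdem.
  + by apply: HeckeComm; case/and3P: aa => h1 h2 _; rewrite [X in (X.+1 < _)%N]v // [X in (_ < X)%N]v.
  + by apply: HeckeBraid; case/and4P: aa => h1 h2 _ _; rewrite [LHS]v // [in RHS]v.
- exact: HeckeRefl.
- by apply: HeckeSym; apply: IH; rewrite (heq_all _ h).
by apply: HeckeTrans (IH1 ha) (IH2 _); rewrite -(heq_all _ h1).
Qed.
Lemma all_val w : all (gtn n) (map val w).
Proof. by apply/allP => p /mapP [i _ ->] /=. Qed.

(** [hecke_w0] is some longest word; by [nform] it and the staircase have the same normal form. The
    case [n = 0] is separate because [insubd] needs a default generator. *)
Lemma hecke_w0_heq : heq (map val (hecke_w0 n)) (w0w n 0).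
Proof.
case: (posnP n) => [n0|n_gt0].
  have -> : hecke_w0 n = [::] by case: (hecke_w0 n) => // i; have := ltn_ord i; rewrite {2}n0.
  by rewrite n0; exact: Hrefl.
pose i0 := Ordinal n_gt0.
have vi a : all (gtn n) a -> map val [seq insubd i0 p | p <- a] = a.
  move=> ha; rewrite -map_comp map_id_in // => p pa /=; rewrite val_insubd.
  by have := allP ha p pa => /= ->.
have ast : all (gtn n) (w0w n 0) by apply/allP => p /mem_w0w /=; lia.
have bound w : hecke_reduced w -> (size w <= tri n)%N.
  move=> rw; have [u [h1 h2 _]] := nform (all_val w).
  have au : all (gtn n) u by rewrite -(heq_all _ h1) all_val.
  have := rw [seq insubd i0 p | p <- u]; rewrite size_map => h; apply: leq_trans (h _) h2.
  have := heq_hecke i0 h1 (all_val w); rewrite -map_comp map_id_in //.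
  by move=> i _ /=; apply: val_inj; rewrite val_insubd ltn_ord.
have stred : hecke_reduced [seq insubd i0 p | p <- w0w n 0].
  move=> v h; rewrite size_map size_w0w -(size_map val); apply: w0w_reduced.
  by have := hecke_heq h; rewrite vi.
have ex : exists w, @hecke_longest n w.
  exists [seq insubd i0 p | p <- w0w n 0]; split=> // v /bound.
  by rewrite size_map size_w0w.
have [rw mw] : hecke_longest (hecke_w0 n) := epsilon_spec (inhabits [::]) _ ex.
have sz : (tri n <= size (hecke_w0 n))%N by have := mw _ stred; rewrite size_map size_w0w.
have [u [h1 h2 h3]] := nform (all_val (hecke_w0 n)).
have [u' [h1' h2' h3']] := nform ast.
have e : u = fullw n.
  apply: h3; apply/eqP; rewrite eqn_leq h2; apply: leq_trans sz _.
  have au : all (gtn n) u by rewrite -(heq_all _ h1) all_val.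
  have := rw [seq insubd i0 p | p <- u]; rewrite size_map; apply.
  have := heq_hecke i0 h1 (all_val _); rewrite -map_comp map_id_in //.
  by move=> i _ /=; apply: val_inj; rewrite val_insubd ltn_ord.
have e' : u' = fullw n by apply: h3'; apply/eqP; rewrite eqn_leq h2' w0w_reduced.
by apply: Htrans h1 _; rewrite e -e'; exact: Hsym.
Qed.

Definition D (f : ratfun n.+1) := dw (w0w n 0) f.
Lemma demazure_w0 f : demazure_word (hecke_w0 n) f = D f.
Proof. by rewrite demazure_wordE; apply: dw_heq hecke_w0_heq; exact: all_val. Qed.
Lemma D_dem (i : 'I_n) f : D (demazure i f) = D f.
Proof.
rewrite demazureE /D -[demn _ _]/(dw [:: val i] f) -dw_cat; apply: dw_heq.
  rewrite all_cat; apply/andP; split; last by rewrite /= ltn_ord.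
  by apply/allP => p /mem_w0w /=; lia.
by apply: w0w_absr; rewrite /= add0n ltn_ord.
Qed.
End HeckeWords.

Lemma dem_add_aux (F : fieldType) (x y d f g f' g' : F) :
  (x * (f + g) - y * (f' + g')) / d = (x * f - y * f') / d + (x * g - y * g') / d.
Proof. by rewrite -mulrDl; congr (_ / _); ring. Qed.
Lemma dem_mulz_aux (F : fieldType) (x y d f f' : F) (c : int) :
  (x * (f *~ c) - y * (f' *~ c)) / d = ((x * f - y * f') / d) *~ c.
Proof. by rewrite !mulrzAr -mulrzBl mulrzAl. Qed.
Lemma sum_iota (V : zmodType) N (f : nat -> V) : \sum_(e <- iota 0 N) f e = \sum_(e < N) f e.
Proof. by rewrite -(big_mkord xpredT f) /index_iota subn0. Qed.
Lemma dem_pow_pos (F : fieldType) (u v R : F) (p r : int) (k : nat) : u != 0 -> v != 0 -> p = r + k%:Z ->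
  u * (R * (u ^ p * v ^ r)) - v * (R * (v ^ p * u ^ r)) = (\sum_(e < k.+1) R * (u ^ (p - e%:Z) * v ^ (r + e%:Z))) * (u - v).
Proof.
move=> u0 v0 ->; transitivity (R * (u * (u ^ (r + k%:Z) * v ^ r) - v * (v ^ (r + k%:Z) * u ^ r))); first by ring.
by rewrite div_pow // -mulr_sumr; ring.
Qed.
Lemma dem_pow_neg (F : fieldType) (u v R : F) (p r : int) (k : nat) : u != 0 -> v != 0 -> r = p + k.+1%:Z ->
  u * (R * (u ^ p * v ^ r)) - v * (R * (v ^ p * u ^ r)) = (- \sum_(t < k) R * (u ^ (p + t.+1%:Z) * v ^ (r - t.+1%:Z))) * (u - v).
Proof.
move=> u0 v0 ->; transitivity (R * (u * (u ^ p * v ^ (p + k.+1%:Z)) - v * (v ^ p * u ^ (p + k.+1%:Z)))); first by ring.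
by rewrite div_pow_neg // -mulr_sumr; ring.
Qed.

Section Weights.
Variable n : nat.
Notation l := n.+1.
Notation F := (ratfun n.+1).
Notation W := (weight n.+1).
Implicit Types (a b : W) (i : 'I_n).

Lemma pos_neq i : lpos i != rpos i.
Proof. by rewrite -val_eqE /= /bump /= ltn_eqF. Qed.
Definition upd b i (e : int) : W :=
  [ffun k => if k == lpos i then b k - e else if k == rpos i then b k + e else b k].
Lemma updl b i e : upd b i e (lpos i) = b (lpos i) - e.
Proof. by rewrite ffunE eqxx. Qed.
Lemma updr b i e : upd b i e (rpos i) = b (rpos i) + e.
Proof. by rewrite ffunE eq_sym (negPf (pos_neq i)) eqxx. Qed.
Lemma upd0 b i : upd b i 0 = b.
Proof. by apply/ffunP => k; rewrite ffunE ?subr0 ?addr0; case: ifP => // _; case: ifP. Qed.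
Lemma upd_swap b i : upd b i (b (lpos i) - b (rpos i)) = [ffun k => b (tperm (lpos i) (rpos i) k)].
Proof.
apply/ffunP => k; rewrite !ffunE; case: tpermP => [->|->|/eqP/negPf -> /eqP/negPf -> //].
- by rewrite eqxx subKr.
by rewrite eq_sym (negPf (pos_neq i)) eqxx addrC subrK.
Qed.

Definition rest b i : F := \prod_(k < l | (k != lpos i) && (k != rpos i)) xvar k ^ b k.
Lemma xmon_split b i : xmon b = rest b i * (xvar (lpos i) ^ b (lpos i) * xvar (rpos i) ^ b (rpos i)).
Proof.
rewrite /xmon (bigD1 (lpos i)) //= (bigD1 (rpos i)) /=; last by rewrite eq_sym pos_neq.
by rewrite mulrA mulrC.
Qed.
Lemma rest_upd b i e : rest (upd b i e) i = rest b i.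
Proof. by apply: eq_bigr => k /andP[/negPf h1 /negPf h2]; rewrite ffunE h1 h2. Qed.
Lemma fperm_rest b i : fperm (tperm (lpos i) (rpos i)) (rest b i) = rest b i.
Proof.
rewrite rmorph_prod; apply: eq_bigr => k /andP[h1 h2].
by rewrite fmorphXz /= fperm_x tpermD // eq_sym.
Qed.
Lemma subxv i : xvar (lpos i) - xvar (rpos i) != 0.
Proof. by rewrite subr_eq0; apply: contraNneq (pos_neq i) => /xvar_inj ->. Qed.

Lemma dem_mon b i : demazure i (xmon b) =
  if b (rpos i) <= b (lpos i) then \sum_(e < `|b (lpos i) - b (rpos i)|.+1) xmon (upd b i e%:Z)
  else - \sum_(t < `|b (rpos i) - b (lpos i)|.-1) xmon (upd b i (- t.+1%:Z)).
Proof.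
have n0 := subxv i; apply: (canLR (mulfK n0)).
have -> : fperm (tperm (lpos i) (rpos i)) (xmon b) =
    rest b i * (xvar (rpos i) ^ b (lpos i) * xvar (lpos i) ^ b (rpos i)).
  by rewrite (xmon_split b i) !rmorphM /= fperm_rest !fmorphXz /= !fperm_x tpermL tpermR.
rewrite (xmon_split b i); set u := xvar (lpos i); set v := xvar (rpos i); set p := b (lpos i); set r := b (rpos i).
have u0 : u != 0 := xvar_neq0 _; have v0 : v != 0 := xvar_neq0 _.
case: ifP => h.
  have ep : p = r + `|p - r|%:Z by lia.
  rewrite (dem_pow_pos _ u0 v0 ep); congr (_ * _); apply: eq_bigr => e _.
  by rewrite (xmon_split _ i) rest_upd updl updr.
have er : r = p + `|r - p|.-1.+1%:Z by lia.
rewrite (dem_pow_neg _ u0 v0 er); congr (- _ * _); apply: eq_bigr => t _.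
by rewrite (xmon_split _ i) rest_upd updl updr opprK.
Qed.

Definition wf b : nat -> int := fun k => b (inord k).
(** The value that [D] will turn out to take on the truncation of [xmon b] ([D_trunc]). *)
Definition shw b : F := sh (xs l (@X n) 0) l (wf b).

Lemma shw_anti b b' i : b' (lpos i) = b (rpos i) - 1 -> b' (rpos i) = b (lpos i) + 1 ->
  (forall k, k != lpos i -> k != rpos i -> b' k = b k) -> shw b' = - shw b.
Proof.
move=> h1 h2 h3; rewrite /shw /sh.
set M' := (X in \det X = _); set M := (X in _ = - \det X).
have -> : M' = xrow (lpos i) (rpos i) M.
  apply/matrixP => r c; rewrite [RHS]mxE !mxE /wf !inord_val.
  have vl : (lpos i : nat) = i by [].
  have vr : (rpos i : nat) = i.+1 by [].
  case: tpermP => [->|->|/eqP n1 /eqP n2].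
  - by rewrite h1 vl vr; congr hZ; lia.
  - by rewrite h2 vl vr; congr hZ; lia.
  by rewrite h3.
rewrite xrowE det_mulmx -/(perm_mx _) det_perm odd_tperm pos_neq.
by rewrite expr1 mulN1r.
Qed.

Lemma char0 (f : F) : f = - f -> f = 0.
Proof.
move=> e; have : f *+ 2 = 0 by rewrite mulr2n {2}e subrr.
move/eqP; rewrite -mulr_natr mulf_eq0 => /orP[/eqP //|].
have -> : (2%:R : F) = toratfun 2%:R by rewrite /toratfun rmorph_nat.
rewrite tofrac_eq0 => /eqP /(congr1 (mcoeff 0%MM)); rewrite mcoeff0 -[2%:R]/(1 + 1) mcoeffD mcoeff1 eqxx.
by [].
Qed.

(** Exchanging two adjacent rows of the determinant pairs the terms [e] and [K + 1 - e], where [K]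
    is the difference of the two parts, with opposite signs; only [e = 0] survives. So
    [xmon b -> shw b] does not change under a Demazure operator; [shw_neg] is the same for
    increasing parts. *)
Lemma shw_pos b i : b (rpos i) <= b (lpos i) ->
  \sum_(e < `|b (lpos i) - b (rpos i)|.+1) shw (upd b i e%:Z) = shw b.
Proof.
move=> h; rewrite big_ord_recl upd0 -[RHS]addr0; congr (_ + _).
apply: char0; rewrite -sumrN {1}(reindex_inj rev_ord_inj) /=; apply: eq_bigr => e _.
have el := ltn_ord e.
apply: (@shw_anti _ _ i); rewrite ?updl ?updr /bump /=.
- by move: (nat_of_ord e) el => {}e el; move: (b (lpos i)) (b (rpos i)) h el => p r h el; lia.
- by move: (nat_of_ord e) el => {}e el; move: (b (lpos i)) (b (rpos i)) h el => p r h el; lia.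
by move=> k /negPf k1 /negPf k2; rewrite !ffunE k1 k2.
Qed.
Lemma shw_neg b i : b (lpos i) < b (rpos i) ->
  - \sum_(t < `|b (rpos i) - b (lpos i)|.-1) shw (upd b i (- t.+1%:Z)) = shw b.
Proof.
move=> h; set K := `|_|.-1; apply/eqP; rewrite eq_sym -subr_eq0 opprK; apply/eqP.
have KE : K = `|b (rpos i) - b (lpos i)|.-1 by [].
move: K KE => K KE.
have -> : shw b + \sum_(t < K) shw (upd b i (- t.+1%:Z)) = \sum_(t < K.+1) shw (upd b i (- t%:Z)).
  by rewrite big_ord_recl upd0.
apply: char0; rewrite -sumrN {1}(reindex_inj rev_ord_inj) /=; apply: eq_bigr => t _.
have tl := ltn_ord t.
apply: (@shw_anti _ _ i); rewrite ?updl ?updr /=.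
- by move: (nat_of_ord t) tl => {}t tl; move: (b (lpos i)) (b (rpos i)) h tl KE => p r h tl KE; lia.
- by move: (nat_of_ord t) tl => {}t tl; move: (b (lpos i)) (b (rpos i)) h tl KE => p r h tl KE; lia.
by move=> k /negPf k1 /negPf k2; rewrite !ffunE k1 k2.
Qed.

Definition seqw b : seq int := mkseq (wf b) l.
Definition sq b : nat := absz (\sum_(k < l) b k ^+ 2).
(** The rank for the triangularity: sum of squares first, then the inversions within one orbit; the
    factor exceeds every value of [inv]. *)
Definition M b : nat := (sq b * (l * l).+1 + inv (seqw b))%N.
Lemma inv_lt b : (inv (seqw b) < (l * l).+1)%N.
Proof.
rewrite ltnS; have : size (seqw b) = l by rewrite size_mkseq.
have h s : (inv s <= size s * size s)%N.
  elim: s => //= x s IH; have := count_size (fun y => x < y) s; rewrite mulSn mulnS.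
  by move: (size s) (count _ s) (inv s) (size s * size s)%N IH => a b' c d; lia.
by move=> e; have := h (seqw b); rewrite e.
Qed.
Lemma M_lt b b' : (sq b' < sq b)%N -> (M b' < M b)%N.
Proof. by move=> h; rewrite /M; have := inv_lt b'; move: (inv _) (inv _) ((l * l).+1) h => x y z h hx; nia. Qed.
Lemma sq_upd b i e : (sq (upd b i e))%:Z = (sq b)%:Z + 2%:Z * e * (e - (b (lpos i) - b (rpos i))).
Proof.
have sqE c : (sq c)%:Z = \sum_(k < l) c k ^+ 2 by rewrite /sq gez0_abs // sumr_ge0 // => k _; exact: sqr_ge0.
rewrite !sqE (bigD1 (lpos i)) //= (bigD1 (rpos i)) /=; last by rewrite eq_sym pos_neq.
rewrite [in RHS](bigD1 (lpos i)) //= [in RHS](bigD1 (rpos i)) /=; last by rewrite eq_sym pos_neq.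
rewrite updl updr; set S1 := \sum_(_ | _) _; set S2 := \sum_(_ | _) _.
have -> : S1 = S2 by apply: eq_bigr => k /andP[/negPf h1 /negPf h2]; rewrite ffunE h1 h2.
by move: S2 (b (lpos i)) (b (rpos i)) => S p r; ring.
Qed.

Lemma wf_lpos b i : nth 0 (seqw b) i = b (lpos i).
Proof. by rewrite nth_mkseq ?lposE // ltnW // ltnS. Qed.
Lemma wf_rpos b i : nth 0 (seqw b) i.+1 = b (rpos i).
Proof. by rewrite nth_mkseq ?rposE // ltnS. Qed.
Lemma nth_sact p (s : seq int) k : (p.+1 < size s)%N -> nth 0 (sact p s) k =
  if nth 0 s p.+1 <= nth 0 s p then nth 0 s (if k == p then p.+1 else if k == p.+1 then p else k) else nth 0 s k.
Proof.
elim: p s k => [|p IH] [|x s] k //=; last first.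
  rewrite ltnS => h; case: k => [|k] /=; first by case: ifP.
  by rewrite IH // !eqSS; case: ifP => // _; case: ifP => // _; case: ifP.
case: s => // y s _; rewrite /=; case: ifP => // _.
by case: k => [|[|k]].
Qed.
Lemma seqw_act i a : seqw (hecke_act i a) = sact i (seqw a).
Proof.
have il : (i.+1 < size (seqw a))%N by rewrite size_mkseq ltnS.
apply: (@eq_from_nth _ 0); first by rewrite size_sact !size_mkseq.
move=> k; rewrite size_mkseq => kl; rewrite nth_sact // wf_lpos wf_rpos nth_mkseq // /wf /hecke_act.
case: ifP => _; last by rewrite nth_mkseq.
rewrite ffunE lposE rposE permE /= !inord_eq // ?ltnS //; last by apply: ltnW.
rewrite [in RHS]fun_if wf_rpos [in RHS]fun_if wf_lpos nth_mkseq // -lposE -rposE.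
by case: ifP => // _; case: ifP.
Qed.
Lemma M_act i a : a (rpos i) < a (lpos i) -> M (hecke_act i a) = (M a).+1.
Proof.
move=> h; rewrite /M seqw_act inv_sact size_mkseq ltnS ltn_ord wf_lpos wf_rpos h /= addn1 addnS; congr (_ * _ + _).+1.
apply/eqP; rewrite -eqz_nat /hecke_act (ltW h) -upd_swap sq_upd subrr mulr0 addr0 //.
Qed.

Definition LS (s : seq (int * W)) : F := \sum_(cb <- s) xmon cb.2 *~ cb.1.
Definition JS (s : seq (int * W)) : F := \sum_(cb <- s) shw cb.2 *~ cb.1.
Definition low N (s : seq (int * W)) := all (fun cb => M cb.2 < N)%N s.

Lemma LS_cat s t : LS (s ++ t) = LS s + LS t. Proof. by rewrite /LS big_cat. Qed.
Lemma JS_cat s t : JS (s ++ t) = JS s + JS t. Proof. by rewrite /JS big_cat. Qed.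
Definition scl (c : int) (s : seq (int * W)) := [seq (c * cb.1, cb.2) | cb <- s].
Lemma LS_scl c s : LS (scl c s) = LS s *~ c.
Proof. rewrite /LS /scl big_map; elim: s => [|cb s IH]; first by rewrite !big_nil mul0rz.
by rewrite !big_cons mulrzDl IH /= [c * _]mulrC mulrzA. Qed.
Lemma JS_scl c s : JS (scl c s) = JS s *~ c.
Proof. rewrite /JS /scl big_map; elim: s => [|cb s IH]; first by rewrite !big_nil mul0rz.
by rewrite !big_cons mulrzDl IH /= [c * _]mulrC mulrzA. Qed.
Lemma low_scl c N s : low N (scl c s) = low N s. Proof. by rewrite /low all_map. Qed.

Lemma dem_list b i : exists s, [/\ demazure i (xmon b) = LS s, low (M b).+2 s & JS s = shw b].
Proof.
rewrite dem_mon; case: (lerP (b (rpos i)) (b (lpos i))) => h.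
  exists [seq (1, upd b i e%:Z) | e <- iota 0 `|b (lpos i) - b (rpos i)|.+1]; split.
  - by rewrite /LS big_map sum_iota; apply: eq_bigr => e _; rewrite /= mulr1z.
  - apply/allP => cb /mapP [e]; rewrite mem_iota => /andP[_ el] -> /=.
    (* The end terms are [b] itself and the swapped weight, which has rank one more; strictly in
       between the sum of squares drops. *)
    have [e0|e0] := eqVneq e 0%N; first by rewrite e0 upd0; exact: leqW.
    have [ek|ek] := eqVneq e%:Z (b (lpos i) - b (rpos i)).
      rewrite ek upd_swap; have lt : b (rpos i) < b (lpos i) by move: el ek e0; lia.
      by have := M_act lt; rewrite /hecke_act (ltW lt) => ->.
    apply: ltn_trans (M_lt _) (leqW (ltnSn _)); rewrite -ltz_nat sq_upd.
    by move: (b (lpos i)) (b (rpos i)) el e0 ek h (sq b) => p r el e0 ek h z; nia.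
  by rewrite /JS big_map sum_iota -(shw_pos h); apply: eq_bigr => e _; rewrite /= mulr1z.
exists [seq (-1, upd b i (- t.+1%:Z)) | t <- iota 0 `|b (rpos i) - b (lpos i)|.-1]; split.
- by rewrite /LS big_map sum_iota -sumrN; apply: eq_bigr => t _; rewrite /= mulrN1z.
- apply/allP => cb /mapP [t]; rewrite mem_iota => /andP[_ tl] -> /=.
  apply: ltn_trans (M_lt _) (leqW (ltnSn _)); rewrite -ltz_nat sq_upd.
  by move: (b (lpos i)) (b (rpos i)) tl h (sq b) => p r tl h z; nia.
by rewrite /JS big_map sum_iota -(shw_neg h) -sumrN; apply: eq_bigr => t _; rewrite /= mulrN1z.
Qed.
Lemma dem_lead b i : b (rpos i) < b (lpos i) -> exists s,
  [/\ demazure i (xmon b) = xmon (hecke_act i b) + LS s, low (M (hecke_act i b)) s & shw (hecke_act i b) + JS s = shw b].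
Proof.
move=> h; rewrite dem_mon (ltW h) M_act //.
have ea : hecke_act i b = upd b i `|b (lpos i) - b (rpos i)|%:Z.
  by rewrite /hecke_act (ltW h) -upd_swap; congr upd; move: (b (lpos i)) (b (rpos i)) h => p r; lia.
exists [seq (1, upd b i e%:Z) | e <- iota 0 `|b (lpos i) - b (rpos i)|]; split.
- by rewrite /LS big_map sum_iota big_ord_recr /= -ea addrC.
- apply/allP => cb /mapP [e]; rewrite mem_iota => /andP[_ el] -> /=.
  have [e0|e0] := eqVneq e 0%N; first by rewrite e0 upd0.
  apply: ltn_trans (M_lt _) (ltnSn _); rewrite -ltz_nat sq_upd.
  by move: (b (lpos i)) (b (rpos i)) el e0 h (sq b) => p r el e0 h z; nia.
rewrite -(shw_pos (ltW h)) big_ord_recr /= -ea [RHS]addrC; congr (_ + _).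
by rewrite /JS big_map sum_iota; apply: eq_bigr => e _; rewrite mulr1z.
Qed.

Lemma demD i f g : demazure i (f + g) = demazure i f + demazure i g.
Proof. by rewrite /demazure rmorphD; exact: dem_add_aux. Qed.
Lemma demMz i f (c : int) : demazure i (f *~ c) = demazure i f *~ c.
Proof. by rewrite /demazure rmorphMz; exact: dem_mulz_aux. Qed.
Lemma dem_LS i N s : low N s -> exists t, [/\ demazure i (LS s) = LS t, low N.+1 t & JS t = JS s].
Proof.
elim: s => [|[c b] s IH] /=.
  move=> _; exists [::]; split; [|by []|by []].
  by rewrite /LS big_nil /demazure rmorph0 !mulr0 subr0 mul0r.
case/andP=> h1 /IH [t [t1 t2 t3]]; have [t' [u1 u2 u3]] := dem_list b i.
exists (scl c t' ++ t); split.
- by rewrite LS_cat LS_scl /LS big_cons -/(LS s) demD demMz t1 u1.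
- rewrite /low all_cat -!/(low _ _) low_scl t2 andbT; apply: sub_all u2 => cb hcb.
  by apply: leq_trans hcb _; rewrite ltnS.
by rewrite JS_cat JS_scl u3 t3 {2}/JS big_cons.
Qed.

(** Every letter really moves the weight, which holds for words of minimal size. Then the rank of
    the leading weight grows by one at each letter and the lower terms stay lower. *)
Fixpoint strictw (w : seq 'I_n) (a : W) : bool :=
  if w is i :: w' then (hecke_act_word w' a (rpos i) < hecke_act_word w' a (lpos i)) && strictw w' a else true.
Lemma act_triv i a : a (lpos i) <= a (rpos i) -> hecke_act i a = a.
Proof.
move=> h; rewrite /hecke_act; case: ifP => // h'; have e : a (lpos i) = a (rpos i) by lia.
by rewrite -upd_swap e subrr upd0.
Qed.
Lemma not_strict w a : ~~ strictw w a -> exists w', (size w' < size w)%N /\ hecke_act_word w' a = hecke_act_word w a.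
Proof.
elim: w => //= i w IH; rewrite negb_and -leNgt => /orP[h|/IH [w' [h1 h2]]].
  by exists w; split; rewrite // act_triv.
by exists (i :: w'); split=> //=; rewrite h2.
Qed.
Lemma dem_word_lead w a : strictw w a -> exists s,
  [/\ demazure_word w (xmon a) = xmon (hecke_act_word w a) + LS s, low (M (hecke_act_word w a)) s
    & shw (hecke_act_word w a) + JS s = shw a].
Proof.
elim: w => [|i w IH] /=.
  by move=> _; exists [::]; split; rewrite /LS /JS ?big_nil ?addr0.
case/andP=> h /IH [s [s1 s2 s3]]; have [t [t1 t2 t3]] := dem_lead h.
have [u [u1 u2 u3]] := dem_LS i s2; exists (t ++ u); split.
- by rewrite s1 demD t1 u1 LS_cat addrA.
- by rewrite /low all_cat -!/(low _ _) t2 /=; rewrite M_act // in u2 *.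
by rewrite JS_cat addrA t3 u3.
Qed.

Lemma decr_act_exists a : exists w, hecke_act_word w (decr_rearr a) = a.
Proof.
have [k] := ubnP (inv (seqw a)); elim: k a => // k IH a; rewrite ltnS => hk.
have sz b : size (codom b) = l by rewrite size_codom card_ord.
have cE b : codom b = seqw b.
  apply: (@eq_from_nth _ 0); rewrite ?sz ?size_mkseq // => j jl.
  rewrite nth_mkseq // /wf (nth_map ord0) ?size_enum_ord //; congr (b _); apply: val_inj.
  by rewrite /= nth_enum_ord // inordK.
have [/forallP h|] := boolP [forall i : 'I_n, a (rpos i) <= a (lpos i)].
  exists [::] => /=; apply/ffunP => j; rewrite ffunE cE sorted_sort.
  - by rewrite nth_mkseq // /wf inord_val.
  - by move=> x y z /= h1 h2; exact: le_trans h2 h1.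
  apply/(sortedP 0) => m; rewrite size_mkseq ltnS => mn.
  by rewrite (wf_lpos a (Ordinal mn)) (wf_rpos a (Ordinal mn)); exact: h.
rewrite negb_forall => /existsP [i]; rewrite -ltNge => lt.
pose a' : W := [ffun k => a (tperm (lpos i) (rpos i) k)].
have el : a' (lpos i) = a (rpos i) by rewrite ffunE tpermL.
have er : a' (rpos i) = a (lpos i) by rewrite ffunE tpermR.
have ea : hecke_act i a' = a.
  rewrite /hecke_act el er (ltW lt); apply/ffunP => j; rewrite !ffunE tpermK //.
have hlt : a' (rpos i) < a' (lpos i) by rewrite el er.
have ds : decr_rearr a' = decr_rearr a.
  have pm : perm_eq (seqw a') (seqw a) by rewrite -ea seqw_act perm_sym; exact: perm_sact.
  apply/ffunP => j; rewrite !ffunE !cE; congr (nth 0 _ j).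
  apply/perm_sortP => //; first by move=> x y /=; exact: le_total.
  - by move=> x y z /= h1 h2; exact: le_trans h2 h1.
  by move=> x y /=; rewrite andbC; exact: le_anti.
have [|w hw] := IH a'.
  have e : inv (seqw a) = (inv (seqw a')).+1.
    by rewrite -{1}ea seqw_act inv_sact size_mkseq ltnS ltn_ord wf_lpos wf_rpos hlt addn1.
  by rewrite e in hk.
by exists (i :: w); rewrite -ds /= hw.
Qed.

(** A minimal word is strict, so [xmon a] leads. The last clause is the invariance of
    [xmon b -> shw b] under the Demazure operators of that word, applied to the dominant
    monomial. *)
Lemma key_list a : exists s, [/\ key a = xmon a + LS s, low (M a) s & shw a + JS s = shw (decr_rearr a)].
Proof.
pose Q w := hecke_act_word w (decr_rearr a) = a /\
    forall v : seq 'I_n, hecke_act_word v (decr_rearr a) = a -> (size w <= size v)%N.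
have ex : exists w, Q w.
  have [w0 h0] := decr_act_exists a; have [k] := ubnP (size w0); elim: k w0 h0 => // k IH w0 h0; rewrite ltnS => hk.
  have [h|h] := classic (exists v, hecke_act_word v (decr_rearr a) = a /\ (size v < size w0)%N).
    by case: h => v [h1 h2]; apply: (IH v h1); exact: leq_trans h2 hk.
  exists w0; split=> // v hv; rewrite leqNgt; apply/negP => lt; apply: h; by exists v.
have [h1 h2] : Q (key_word a) := epsilon_spec (inhabits [::]) _ ex.
have st : strictw (key_word a) (decr_rearr a).
  apply/negPn/negP => /not_strict [w' [lt e]]; have := h2 w'; rewrite e h1 => /(_ erefl); by rewrite leqNgt lt.
have := dem_word_lead st; rewrite h1; exact.
Qed.
End Weights.
End KeyTriangularity.

(** * Existence of the truncation, and its image under the longest operator *)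

Module Truncation.
From Stdlib Require Import ClassicalEpsilon.
From HB Require Import structures.
From mathcomp Require Import all_boot all_order all_fingroup all_algebra.
From mathcomp Require Import generic_quotient fraction mpoly ring zify.
Import Defs Scan FilteredSets Columns KnuthMoves Dominance Windows Folding TabloidWords JacobiTrudi HeckeNormalForm DemazureOperators KeyTriangularity.
Import Order.TTheory GRing.Theory Num.Theory.
Local Open Scope ring_scope.

Section Trunc.
Variable n : nat.
Notation l := n.+1.
Notation F := (ratfun n.+1).
Notation W := (weight n.+1).
Implicit Types (a b : W) (i : 'I_n) (s t : seq (int * W)).

Definition Ls (V : zmodType) (phi : W -> V) s : V := \sum_(cb <- s) phi cb.2 *~ cb.1.
Lemma Ls_cat (V : zmodType) (phi : W -> V) s t : Ls phi (s ++ t) = Ls phi s + Ls phi t. Proof. by rewrite /Ls big_cat. Qed.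
Lemma Ls_cons (V : zmodType) (phi : W -> V) cb s : Ls phi (cb :: s) = phi cb.2 *~ cb.1 + Ls phi s. Proof. by rewrite /Ls big_cons. Qed.
Lemma Ls_scl (V : zmodType) (phi : W -> V) c s : Ls phi (scl c s) = Ls phi s *~ c.
Proof.
rewrite /Ls /scl big_map; elim: s => [|cb s IH]; first by rewrite !big_nil mul0rz.
by rewrite !big_cons mulrzDl IH /= [c * _]mulrC mulrzA.
Qed.

Lemma coef_Ls (V : zmodType) (phi : W -> V) s : (forall b, \sum_(cb <- s | cb.2 == b) cb.1 = 0) -> Ls phi s = 0.
Proof.
move=> h; have -> : Ls phi s = \sum_(b <- undup (unzip2 s)) \sum_(cb <- s | cb.2 == b) phi cb.2 *~ cb.1.
  rewrite (exchange_big_dep xpredT) //= /Ls [LHS]big_seq [RHS]big_seq; apply: eq_bigr => cb cs.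
  rewrite -big_filter (_ : [seq b <- _ | _] = [:: cb.2]) ?big_seq1 //.
  rewrite (_ : [seq b <- _ | _] = [seq b <- undup (unzip2 s) | pred1 cb.2 b]); last by apply: eq_filter => b; rewrite /= eq_sym.
  apply: filter_pred1_uniq; first exact: undup_uniq.
  by rewrite mem_undup; apply: map_f.
apply: big1 => b _; transitivity (phi b *~ (\sum_(cb <- s | cb.2 == b) cb.1)); last by rewrite h mulr0z.
by rewrite mulrz_sumr; apply: eq_bigr => cb /eqP ->.
Qed.

Definition mn (m : nat) b : 'X_{1..l} := [multinom absz (b k + m%:Z)%R | k < l].
Definition big b := (\max_(k < l) absz (b k))%N.
Lemma xmon_mn m b : (big b <= m)%N -> xmon b * (\prod_(i < l) xvar i) ^+ m = toratfun 'X_[mn m b].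
Proof.
move=> h; rewrite mpolyXE_id /toratfun rmorph_prod /xmon -prodrXl -big_split /=; apply: eq_bigr => k _.
have hb : (absz (b k) <= m)%N by apply: leq_trans h; exact: (leq_bigmax k).
rewrite rmorphXn /= mnmE [in RHS]exprnP gez0_abs; last by move: hb; clear; lia.
by rewrite expfzDr ?xvar_neq0 // -exprnP.
Qed.
Lemma prodx_neq0 m : (\prod_(i < l) xvar i : F) ^+ m != 0.
Proof. by rewrite expf_neq0 // prodf_seq_neq0; apply/allP => k _; rewrite xvar_neq0. Qed.

(** Linear independence of the Laurent monomials, in the form used: a function on weights extends to
    Laurent polynomials. A common power of the product of the variables clears all negative
    exponents. *)
Lemma LS_inj (V : zmodType) (phi : W -> V) s : LS s = 0 -> Ls phi s = 0.
Proof.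
move=> e; apply: coef_Ls => b.
pose m := (big b + \sum_(cb <- s) big cb.2)%N.
have hm cb : cb \in s -> (big cb.2 <= m)%N.
  by move=> cs; rewrite /m (big_rem cb) //= addnCA leq_addr.
have : toratfun (\sum_(cb <- s) 'X_[mn m cb.2] *~ cb.1) = 0.
  rewrite -[RHS](mul0r ((\prod_(i < l) xvar i) ^+ m)) -e /LS mulr_suml /toratfun rmorph_sum big_seq [RHS]big_seq.
  by apply: eq_bigr => cb cs; rewrite mulrzAl xmon_mn ?hm // rmorphMz.
move/eqP; rewrite tofrac_eq0 => /eqP /(congr1 (mcoeff (mn m b))); rewrite mcoeff0 raddf_sum /= => h0; rewrite -[RHS]h0.
rewrite big_mkcond big_seq [RHS]big_seq; apply: eq_bigr => cb cs; rewrite raddfMz /= mcoeffX.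
have -> : (mn m cb.2 == mn m b) = (cb.2 == b).
  apply/eqP/eqP => [h|->//]; apply/ffunP => k; have := congr1 (fun q : 'X_{1..l} => q k) h; rewrite !mnmE => hk.
  have h1 : (absz (cb.2 k) <= m)%N by apply: leq_trans (hm _ cs); exact: (leq_bigmax k).
  have h2 : (absz (b k) <= m)%N by apply: leq_trans (leq_addr _ _); exact: (leq_bigmax k).
  by move: (cb.2 k) (b k) hk h1 h2 => x y; clear; lia.
by case: eqP => _; rewrite ?mulr1n ?mulr0n ?mul0rz // -mulrzr mul1r intz.
Qed.
Lemma LS_eq (V : zmodType) (phi : W -> V) s t : LS s = LS t -> Ls phi s = Ls phi t.
Proof.
move=> e; have := @LS_inj V phi (s ++ scl (-1) t); rewrite LS_cat LS_scl e mulrN1z subrr => /(_ erefl).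
by rewrite Ls_cat Ls_scl mulrN1z => /eqP; rewrite subr_eq0 => /eqP.
Qed.

Lemma laurent_LS f : laurent f -> exists s, f = LS s.
Proof.
case=> p [m ->]; exists [seq (p@_mm, [ffun k => (mm k)%:Z - m%:Z]) | mm <- msupp p].
rewrite /LS big_map; apply: (canLR (mulfK (prodx_neq0 m))); rewrite mulr_suml {1}(mpolyE p) /toratfun rmorph_sum.
apply: eq_bigr => mm _; rewrite mulrzAl /= /xmon -prodrXl -big_split /=.
rewrite -mul_mpolyC rmorphM /= mpolyXE_id rmorph_prod -mulrzl; congr (_ * _).
  have -> : (p@_mm)%:MP_[l] = (p@_mm)%:~R :> {mpoly int[l]}.
    by rewrite -[in LHS](intz p@_mm) rmorph_int.
  by rewrite rmorph_int.
apply: eq_bigr => k _; rewrite rmorphXn ffunE exprnP [in RHS]exprnP -expfzDr ?xvar_neq0 //.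
by rewrite subrK.
Qed.
Lemma LS_laurent s : laurent (LS s).
Proof.
pose m := (\sum_(cb <- s) big cb.2)%N.
have hm cb : cb \in s -> (big cb.2 <= m)%N.
  by move=> cs; rewrite /m (big_rem cb) //= leq_addr.
exists (\sum_(cb <- s) 'X_[mn m cb.2] *~ cb.1), m; apply: (canRL (mulfK (prodx_neq0 m))).
rewrite /LS mulr_suml /toratfun rmorph_sum big_seq [RHS]big_seq.
by apply: eq_bigr => cb cs; rewrite mulrzAl xmon_mn ?hm // rmorphMz.
Qed.

Definition nonneg a := [forall i, 0 <= a i].
Definition klist a : seq (int * W) := epsilon (inhabits [::]) (fun s =>
  [/\ key a = xmon a + LS s, low (M a) s & shw a + JS s = shw (decr_rearr a)]).
Lemma klistP a : [/\ key a = xmon a + LS (klist a), low (M a) (klist a) & shw a + JS (klist a) = shw (decr_rearr a)].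
Proof. exact: (epsilon_spec (inhabits [::]) _ (key_list a)). Qed.

(* The truncation of the monomial a, by recursion on M a, from the triangularity of the key polynomials. *)
Fixpoint phiN (N : nat) a : F := if N is N'.+1 then
  (if nonneg a then key a else 0) - Ls (phiN N') (klist a) else 0.
Definition phi a := phiN (M a).+1 a.
Lemma phiN_indep N a : (M a < N)%N -> phiN N a = phi a.
Proof.
have main N1 : forall N2 a, (M a < N1)%N -> (M a < N2)%N -> phiN N1 a = phiN N2 a.
  elim: N1 => // N1 IH [//|N2] a0; rewrite !ltnS => h1 h2 /=; congr (_ - _).
  have [_ lw _] := klistP a0; rewrite /Ls big_seq [RHS]big_seq; apply: eq_bigr => cb cs.
  have hb := allP lw cb cs; congr (_ *~ _); apply: IH; exact: leq_trans hb _.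
by move=> h; apply: main.
Qed.
Lemma phi_key a : phi a + Ls phi (klist a) = if nonneg a then key a else 0.
Proof.
have [_ lw _] := klistP a; rewrite {1}/phi.
have -> : phiN (M a).+1 a = (if nonneg a then key a else 0) - Ls (phiN (M a)) (klist a) by [].
have -> : Ls (phiN (M a)) (klist a) = Ls phi (klist a).
  rewrite /Ls big_seq [RHS]big_seq; apply: eq_bigr => cb cs; congr (_ *~ _); apply: phiN_indep; exact: (allP lw).
by rewrite subrK.
Qed.

Definition lrep (f : F) : seq (int * W) := epsilon (inhabits [::]) (fun s => f = LS s).
Lemma lrepP f : laurent f -> f = LS (lrep f).
Proof. by move=> h; exact: (epsilon_spec (inhabits [::]) _ (laurent_LS h)). Qed.
(** [poly_trunc] is a choice, so its defining property is available only after some such operator is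
    exhibited. *)
Lemma trunc_exists : exists P, @is_poly_trunc n P.
Proof.
exists (fun f => Ls phi (lrep f)); split.
  move=> c f g lf lg; rewrite -Ls_scl -Ls_cat; apply: LS_eq.
  rewrite LS_cat LS_scl -(lrepP lf) -(lrepP lg) -lrepP //.
  by rewrite (lrepP lf) (lrepP lg) -LS_scl -LS_cat; exact: LS_laurent.
move=> a; have [ke _ _] := klistP a.
have e : key a = LS ((1, a) :: klist a) by rewrite /LS big_cons mulr1z -ke.
have -> : Ls phi (lrep (key a)) = Ls phi ((1, a) :: klist a).
  by apply: LS_eq; rewrite -lrepP // e; exact: LS_laurent.
by rewrite Ls_cons mulr1z phi_key.
Qed.
Lemma poly_truncP : is_poly_trunc (@poly_trunc n).
Proof. exact: (epsilon_spec (inhabits id) _ trunc_exists). Qed.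

Notation P := (@poly_trunc n).
Lemma xmon_laurent a : laurent (xmon a).
Proof. by have := LS_laurent [:: (1, a)]; rewrite /LS big_seq1 mulr1z. Qed.
Lemma P0 : P 0 = 0.
Proof.
have [lin _] := poly_truncP; have l0 : laurent (0 : F) by have := LS_laurent [::]; rewrite /LS big_nil.
by have := lin (-1) 0 0 l0 l0; rewrite mul0rz addr0 mulrN1z addNr.
Qed.
Lemma P_LS s : P (LS s) = Ls (fun b => P (xmon b)) s.
Proof.
have [lin _] := poly_truncP; elim: s => [|[c b] s IH]; first by rewrite /LS /Ls !big_nil P0.
rewrite Ls_cons -IH /LS big_cons -/(LS s) lin //; first exact: xmon_laurent.
exact: LS_laurent.
Qed.

Lemma dwD v (f g : F) : all (gtn n) v -> dw v (f + g) = dw v f + dw v g.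
Proof. by move=> _; elim: v => //= p v ->; rewrite /demn rmorphD; exact: dem_add_aux. Qed.
Lemma dwMz v (f : F) (c : int) : dw v (f *~ c) = dw v f *~ c.
Proof. by elim: v => //= p v ->; rewrite /demn rmorphMz; exact: dem_mulz_aux. Qed.
Lemma w0_lt : all (gtn n) (w0w n 0).
Proof. by apply/allP => p /mem_w0w /=; lia. Qed.
Lemma D_add f g : @D n (f + g) = D f + D g. Proof. exact: dwD w0_lt. Qed.
Lemma D_mulz f c : @D n (f *~ c) = D f *~ c. Proof. exact: dwMz. Qed.
Lemma D_LS (f : W -> F) s : D (Ls f s) = Ls (fun b => D (f b)) s.
Proof.
elim: s => [|cb s IH]; last by rewrite !Ls_cons D_add D_mulz IH.
rewrite /Ls !big_nil /D; have := dwMz (w0w n 0) 0 0; rewrite !mulr0z; by [].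
Qed.
Lemma D_word w f : D (@demazure_word n w f) = D f.
Proof. by elim: w => //= i w <-; rewrite D_dem. Qed.

Lemma decr_nonneg a : nonneg (decr_rearr a) = nonneg a.
Proof.
have sz : size (sort >=%R (codom a)) = l by rewrite size_sort size_codom card_ord.
apply/forallP/forallP => h k; last first.
  rewrite ffunE; have : nth 0 (sort >=%R (codom a)) k \in codom a by rewrite -(mem_sort >=%R) mem_nth // sz.
  by case/codomP=> j ->.
have : a k \in sort >=%R (codom a) by rewrite mem_sort codom_f.
case/(nthP 0) => j; rewrite sz => jl <-; have := h (Ordinal jl); by rewrite ffunE.
Qed.
Lemma decr_sorted a (i j : 'I_l) : (i <= j)%N -> decr_rearr a j <= decr_rearr a i.
Proof.
move=> ij; rewrite !ffunE; have sz : size (sort >=%R (codom a)) = l by rewrite size_sort size_codom card_ord.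
have tr : transitive (>=%R : rel int) by move=> x y z /= h1 h2; exact: le_trans h2 h1.
have st : sorted >=%R (sort >=%R (codom a)) by apply: sort_sorted => x y /=; exact: le_total.
by have := sorted_leq_nth tr (fun x => lexx x) 0 st; apply; rewrite // inE sz.
Qed.

Lemma D_xmon a : nonneg a -> D (xmon a) = shw a.
Proof.
move/forallP => h; have := @pi_Sg _ l (@X n) (@sF n) (@sX n) n 0 l l (wf a) erefl erefl (leqnn _) (leqnn _).
have -> : minn 0 l = 0%N by [].
have h' j : (j < l)%N -> 0 <= wf a j by move=> _; exact: h.
move/(_ h') => pw; have pw' := piw_dw (xmon a) w0_lt.
have e1 : Sg l (@X n) l l (wf a) = xmon a.
  rewrite /Sg subnn sh0 mulr1 /xmon; apply: eq_bigr => k _; rewrite /X /wf inord_val.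
  by rewrite exprnP gez0_abs.
have e2 : Sg l (@X n) 0 l (wf a) = shw a.
  by rewrite /Sg big_ord0 mul1r subn0.
rewrite e1 e2 in pw; apply: (piw_uniq (@nzX n) _ pw' pw).
by apply: sub_all w0_lt => p.
Qed.
(** All indices in the last row of the determinant are negative. *)
Lemma shw0 a : a ord_max < 0 -> shw a = 0.
Proof.
move=> h; rewrite /shw /sh (expand_det_row _ ord_max) big1 // => j _; rewrite mxE.
have -> : wf a (ord_max : 'I_l) = a ord_max by rewrite /wf inord_val.
have : a ord_max - (ord_max : 'I_l)%:Z + j%:Z < 0.
  by have := ltn_ord j; move: (nat_of_ord j) (a ord_max) h => jj aa h /=; lia.
by case: (_ + _) => // m _; rewrite mul0r.
Qed.

(** Induction on the rank: by [key_list] the claim for the monomial follows from that for [key a].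
    There [D] absorbs the key word and sees the dominant monomial if [a] is nonnegative; otherwise
    the truncation is 0, and so is the determinant, as the last part of [decr_rearr a] is
    negative. *)
Lemma D_trunc a : D (P (xmon a)) = shw a.
Proof.
have [_ kP] := poly_truncP.
have [k] := ubnP (M a); elim: k a => // k IH a; rewrite ltnS => hk.
have [ke lw js] := klistP a.
have lx : laurent (xmon a) := xmon_laurent a.
have Pk : P (key a) = P (xmon a) + Ls (fun b => P (xmon b)) (klist a).
  have -> : key a = LS ((1, a) :: klist a) by rewrite /LS big_cons mulr1z -ke.
  by rewrite P_LS Ls_cons mulr1z.
have e1 : D (P (xmon a)) = D (P (key a)) - Ls (fun b => D (P (xmon b))) (klist a).
  by rewrite Pk D_add D_LS addrK.
have e2 : Ls (fun b => D (P (xmon b))) (klist a) = JS (klist a).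
  rewrite /Ls /JS big_seq [RHS]big_seq; apply: eq_bigr => cb cs; rewrite IH //.
  exact: leq_trans (allP lw cb cs) hk.
have e3 : D (P (key a)) = shw (decr_rearr a).
  rewrite kP -/(nonneg a); case: ifP => ha.
    by rewrite /key D_word D_xmon // decr_nonneg.
  rewrite shw0; last first.
    rewrite ltNge; apply/negP => h; move/negP: ha; apply; rewrite -decr_nonneg; apply/forallP => j.
    by apply: le_trans h _; apply: decr_sorted; rewrite -ltnS.
  by have := D_LS (fun=> 0) [::]; rewrite /Ls !big_nil.
by rewrite e1 e2 e3 -js addrK.
Qed.

Lemma catalan_sum (s : seq (int * W)) f : f = LS s ->
  demazure_word (hecke_w0 n) (P f) = JS s.
Proof.
move=> ->; rewrite demazure_w0 P_LS D_LS /Ls /JS; apply: eq_bigr => cb _.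
by rewrite D_trunc.
Qed.
End Trunc.
End Truncation.

(** * Expansion of the geometric series over the roots *)

Module RootExpansion.
From Stdlib Require Import FunctionalExtensionality.
From mathcomp Require Import all_boot all_order all_fingroup all_algebra ring zify.
From mathcomp Require Import fraction mpoly.
Import Defs Scan FilteredSets Columns KnuthMoves Dominance Windows Folding JacobiTrudi Characters CharacterRecursion HeckeNormalForm DemazureOperators KeyTriangularity.
Import Order.TTheory GRing.Theory Num.Theory.
Local Open Scope ring_scope.

Section Roots.
Variable (V : zmodType).
Implicit Types (f : (nat -> int) -> V) (w : nat -> int) (rs : seq (nat * nat)).
Definition addw w (r : nat * nat) (k : nat) : nat -> int :=
  fun j => w j + (k * (j == r.1))%N%:Z - (k * (j == r.2))%N%:Z.
(** The coefficient of [q^d] when the series [(1 - q R)^-1] for the raising operators [R] of the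
    roots [rs] act on [f] at [w]. Keeping [f] abstract serves both monomials and determinants. *)
Fixpoint VV f rs w (d : nat) : V :=
  if rs is r :: rs' then \sum_(k < d.+1) VV f rs' (addw w r k) (d - k) else if d == 0%N then f w else 0.

Lemma tri_sum (F : nat -> nat -> V) d :
  \sum_(k < d.+1) \sum_(k' < (d - k).+1) F k k' = \sum_(k < d.+1) \sum_(k' < d.+1 | (k + k' <= d)%N) F k k'.
Proof.
apply: eq_bigr => k _; rewrite (big_ord_widen d.+1 (F k)); last by rewrite ltnS leq_subr.
by apply: eq_bigl => k'; have := ltn_ord k; move: (nat_of_ord k) (nat_of_ord k') => a b; lia.
Qed.
Lemma addwC w r r' k k' : addw (addw w r k) r' k' = addw (addw w r' k') r k.
Proof. by apply: functional_extensionality => j; rewrite /addw; ring. Qed.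
Lemma VV_swap f r r' rs w d : VV f (r :: r' :: rs) w d = VV f (r' :: r :: rs) w d.
Proof.
rewrite /= (tri_sum (fun k k' => VV f rs (addw (addw w r k) r' k') (d - k - k'))).
rewrite (tri_sum (fun k k' => VV f rs (addw (addw w r' k) r k') (d - k - k'))).
rewrite (exchange_big_dep xpredT) //=; apply: eq_bigr => k _; apply: eq_big => [k'|k' _]; first by rewrite addnC.
by rewrite addwC subnAC.
Qed.
Lemma VV_front f a r rs w d : VV f (a ++ r :: rs) w d = VV f (r :: a ++ rs) w d.
Proof.
elim: a w d => [|b a IH] w d //; rewrite [(b :: a) ++ rs]/= VV_swap /=.
by apply: eq_bigr => k _; rewrite IH.
Qed.
Lemma VV_perm f rs rs' w d : perm_eq rs rs' -> VV f rs w d = VV f rs' w d.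
Proof.
elim: rs rs' w d => [|h hs IH] rs' w d; first by rewrite perm_sym => /perm_nilP ->.
move=> p; have : h \in rs' by rewrite -(perm_mem p) inE eqxx.
move=> /splitPr e; case: e p => s1 s2 p.
have p' : perm_eq hs (s1 ++ s2).
  by rewrite -(perm_cons h); apply: perm_trans p _; rewrite perm_catC /= perm_cons perm_catC.
by rewrite VV_front /=; apply: eq_bigr => k _; rewrite (IH _ _ _ p').
Qed.

Definition addv w (c : nat) (v : seq nat) : nat -> int := fun j =>
  w j + (if j == 0%N then sumn v else 0%N)%:Z - (if (c <= j)%N then nth 0%N v (j - c) else 0%N)%:Z.
Lemma addv_cons w c k v : (0 < c)%N -> addv (addw w (0%N, c) k) c.+1 v = addv w c (k :: v).
Proof.
move=> c0; apply: functional_extensionality => j; rewrite /addv /addw /=.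
case: (ltngtP j c) => h.
- by case: (j == 0%N); rewrite ?muln1 ?muln0 ?PoszD; ring.
- have -> : (j - c = (j - c.+1).+1)%N by lia.
  by rewrite /= gtn_eqF; [rewrite muln0; ring|lia].
by rewrite h subnn /= gtn_eqF // muln1 muln0; ring.
Qed.
(** The multiplicities of one row of roots are gathered in a vector [v]; none exceeds [d], so the
    range below [K] catches them all. *)
Lemma VV_row f K rs w c t d : (d < K)%N -> (0 < c)%N ->
  VV f ([seq (0%N, j) | j <- iota c t] ++ rs) w d =
  \sum_(v <- vecs K t | (sumn v <= d)%N) VV f rs (addv w c v) (d - sumn v).
Proof.
elim: t c w d => [|t IH] c w d dK c0.
  rewrite /= big_cons big_nil /= addr0 subn0; congr (VV f rs _ d).
  by apply: functional_extensionality => j; rewrite /addv /= nth_nil; do 2 case: ifP => _; rewrite ?addr0 ?subr0.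
rewrite [iota c t.+1]/= map_cons cat_cons [VV _ _ _ _]/=.
have step k : (k <= d)%N -> VV f ([seq (0%N, j) | j <- iota c.+1 t] ++ rs) (addw w (0%N, c) k) (d - k) =
   \sum_(v <- vecs K t | (k + sumn v <= d)%N) VV f rs (addv w c (k :: v)) (d - (k + sumn v)).
  move=> kd; rewrite IH //; last by apply: leq_ltn_trans dK; exact: leq_subr.
  apply: eq_big => [v|v _]; first by rewrite leq_subRL.
  by rewrite addv_cons // subnDA.
rewrite (eq_bigr (fun k : 'I_d.+1 => \sum_(v <- vecs K t | (k + sumn v <= d)%N) VV f rs (addv w c (nat_of_ord k :: v)) (d - (k + sumn v)))); last first.
  by move=> k _; apply: step; rewrite -ltnS.
rewrite (big_ord_widen K (fun k => \sum_(v <- vecs K t | (k + sumn v <= d)%N) VV f rs (addv w c (k :: v)) (d - (k + sumn v)))) //.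
have -> : vecs K t.+1 = [seq k :: v | k <- iota 0 K, v <- vecs K t] by [].
rewrite [RHS]big_mkcond big_allpairs_dep /= sum_iota.
rewrite big_mkcond; apply: eq_bigr => k _; rewrite -big_mkcond /=; case: ifP => // h.
by rewrite big1 // => v hv; exfalso; move: hv h; move: (nat_of_ord k) => kk; lia.
Qed.

Definition shr (r : nat * nat) := (r.1.+1, r.2.+1).
Definition consw (z : int) (u : nat -> int) : nat -> int := fun j => if j is j'.+1 then u j' else z.
Lemma VV_shift f rs w d : VV f (map shr rs) w d = VV (fun u => f (consw (w 0%N) u)) rs (fun j => w j.+1) d.
Proof.
elim: rs w d => [|r rs IH] w d /=.
  by case: ifP => // _; congr f; apply: functional_extensionality => [] [].
by apply: eq_bigr => k _; rewrite IH /addw /= !muln0 addr0 subr0.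
Qed.
Lemma VV_trans f rs w z d : VV f rs (fun j => w j - z j) d = VV (fun u => f (fun j => u j - z j)) rs w d.
Proof.
elim: rs w d => [|r rs IH] w d //=; apply: eq_bigr => k _; rewrite -IH; congr VV.
by apply: functional_extensionality => j; rewrite /addw; ring.
Qed.

Fixpoint rootsL (ns : seq nat) (L : nat) : seq (nat * nat) := match L with
  | L'.+1 => if L' == 0%N then [::] else
     [seq (0%N, j) | j <- iota (head 0%N ns) (L'.+1 - head 0%N ns)] ++ map shr (rootsL (behead ns) L')
  | _ => [::] end.

(** The first row is [VV_row]. The remaining roots do not touch position 0, so that entry and the
    translation by [v] are moved into the function ([VV_shift], [VV_trans]) and the induction
    hypothesis is used for the new function [fv]. *)
Lemma Lst_VV f MU D ns ms d : (d < D)%N -> okns ns (size ms) -> all (geq MU) ms ->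
  \sum_(eg <- Lst (Kfun MU D) ns ms | eg.1 == d) f (nth 0 eg.2) =
  VV f (rootsL ns (size ms)) (fun j => (nth 0%N ms j)%:Z) d.
Proof.
elim: ms ns f d => [//|m ms IH] ns f d dD okn /andP[mM aM].
case: ms IH okn aM => [|m' ms'] IH okn aM.
  rewrite /= big_cons big_nil /= [in RHS]eq_sym; case: ifP => // _; rewrite addr0; congr f.
  by apply: functional_extensionality => [] [|[|j]].
set ms := m' :: ms' in IH okn aM *.
have {}okn : [&& 0 < head 0 ns, head 0 ns <= (size ms).+1, head 0 ns <= (kk (behead ns) (size ms)).+1
   & okns (behead ns) (size ms)]%N by move: okn => /=.
case/and4P: okn => n0 nL nk okn; set c := head 0%N ns in n0 nL nk *.
have -> : Lst (Kfun MU D) ns (m :: ms) = [seq ((eg.1 + sumn v)%N, addr m c.-1 eg.2 v)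
      | eg <- Lst (Kfun MU D) (behead ns) ms, v <- vecs (Kfun MU D (size ms)) (size ms - c.-1)] by [].
have -> : rootsL ns (size (m :: ms)) = [seq (0%N, j) | j <- iota c ((size ms).+1 - c)] ++ map shr (rootsL (behead ns) (size ms)) by [].
set K := Kfun MU D (size ms); have dK : (d < K)%N by rewrite /K /Kfun; lia.
rewrite (VV_row f (map shr (rootsL (behead ns) (size ms))) (fun j => (nth 0%N (m :: ms) j)%:Z) ((size ms).+1 - c) dK n0).
have -> : ((size ms).+1 - c = size ms - c.-1)%N by lia.
rewrite big_mkcond big_allpairs_dep exchange_big /= [RHS]big_mkcond /=.
rewrite big_seq [RHS]big_seq; apply: eq_bigr => v vv.
have sv : size v = (size ms - c.-1)%N by move: vv; rewrite mem_vecs => /andP[/eqP].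
case: ifP => hv; last first.
  by apply: big1 => eg _; case: eqP => // e; move: hv; rewrite -e leq_addl.
pose z j : int := (if (j < c.-1)%N then 0%N else nth 0%N v (j - c.-1))%:Z.
pose fv u := f (consw (m + sumn v)%N%:Z (fun j => u j - z j)).
transitivity (\sum_(eg <- Lst (Kfun MU D) (behead ns) ms | eg.1 == (d - sumn v)%N) fv (nth 0 eg.2)).
  rewrite [RHS]big_mkcond big_seq [RHS]big_seq; apply: eq_bigr => eg heg.
  have -> : (eg.1 + sumn v == d)%N = (eg.1 == d - sumn v)%N.
    by move: (eg.1) (sumn v) hv => e sv'; clear; lia.
  case: ifP => // _; rewrite /fv; congr f; apply: functional_extensionality => [] [|j] //.
  have [se _ _] := @Lst_ok 2 erefl (fun=> 0%N) erefl MU D _ _ okn aM _ heg.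
  rewrite /addr [consw _ _ _]/= [nth _ (_ :: _) _]/=; have [jl|jl] := ltnP j (size eg.2); first by rewrite nth_mkseq.
  rewrite nth_default ?size_mkseq // nth_default // /z; case: ifP => _; first by rewrite subr0.
  by rewrite nth_default ?subr0 // sv -se leq_sub2r.
rewrite IH //; last by apply: leq_ltn_trans dD; exact: leq_subr.
rewrite VV_shift.
have -> : (fun j => addv (fun j => (nth 0%N (m :: ms) j)%:Z) c v j.+1) = (fun j => (nth 0%N ms j)%:Z - z j).
  apply: functional_extensionality => j; rewrite /addv /z /= addr0; congr (_ - _%:Z).
  have -> : (c <= j.+1)%N = ~~ (j < c.-1)%N by lia.
  by case: (ltnP j c.-1) => h //=; congr (nth 0%N v _); lia.
rewrite (VV_trans (fun u => f (consw _ u))) /fv; congr (VV _ _ _ _).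
apply: functional_extensionality => u; congr (f (consw _ _)).
by rewrite /addv /= leqNgt n0 /= subr0 PoszD.
Qed.

Lemma mem_rootsL ns L a b : okns ns L -> ((a, b) \in rootsL ns L) = [&& (a < b)%N, (b < L)%N & (a + nth 0%N ns a <= b)%N].
Proof.
elim: L ns a b => [//|L IH] ns a b; rewrite /= ; case: eqP => [->|L0] /=.
  by move=> _; case: b => [|b]; rewrite ?ltn0 ?andbF // !ltnS ltn0 andbF.
case/and4P=> n0 nL _ okn; rewrite mem_cat; case: a => [|a].
  have -> : ((0%N, b) \in [seq shr r | r <- rootsL (behead ns) L]) = false.
    by apply/negP => /mapP [r _ []].
  rewrite orbF add0n nth0; apply/mapP/and3P => [[j]|[h1 h2 h3]].
    by rewrite mem_iota => hj [->]; split; lia.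
  by exists b => //; rewrite mem_iota; lia.
have -> : ((a.+1, b) \in [seq (0%N, j) | j <- iota (head 0%N ns) (L.+1 - head 0%N ns)]) = false.
  by apply/negP => /mapP [j _ []].
rewrite /=; case: b => [|b]; first by apply/negP => /mapP [r _ []].
have -> : nth 0%N ns a.+1 = nth 0%N (behead ns) a by rewrite nth_behead.
rewrite addSn !ltnS -(IH (behead ns)) //.
by rewrite -[(a.+1, b.+1)]/(shr (a, b)) mem_map // => [] [x y] [x' y'] [-> ->].
Qed.
Lemma uniq_rootsL ns L : uniq (rootsL ns L).
Proof.
elim: L ns => [//|L IH] ns /=; case: eqP => // _; rewrite cat_uniq; apply/and3P; split.
- by rewrite map_inj_uniq ?iota_uniq // => x y [].
- by apply/hasPn => r /mapP [[x y] _ ->]; apply/negP => /mapP [j _ []].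
by rewrite map_inj_uniq // => [] [x y] [x' y'] [-> ->].
Qed.
End Roots.
End RootExpansion.

(** * The quotient of alternants as a Jacobi-Trudi determinant *)

Module SchurDeterminant.
From mathcomp Require Import all_boot all_order all_fingroup all_algebra.
From mathcomp Require Import fraction mpoly ring zify.
Import Defs Scan FilteredSets Columns KnuthMoves Dominance Windows Folding TabloidWords JacobiTrudi HeckeNormalForm DemazureOperators KeyTriangularity.
Import Order.TTheory GRing.Theory Num.Theory.
Local Open Scope ring_scope.

(** The coefficients are those of the product of [1 - y t] over the removed variables. *)
Lemma hZ_remove (A : comNzRingType) (ys zs : seq A) : exists e : nat -> A,
  forall z, hZ zs z = \sum_(c < (size ys).+1) e c * hZ (ys ++ zs) (z - c%:Z).
Proof.
elim: ys zs => [|y ys IH] zs; first by exists (fun=> 1) => z; rewrite big_ord1 mul1r subr0.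
have [e he] := IH (y :: zs).
exists (fun c => (if (c <= size ys)%N then e c else 0) - y * (if (0 < c)%N then e c.-1 else 0)) => z.
have -> : hZ zs z = hZ (y :: zs) z - y * hZ (y :: zs) (z - 1) by rewrite (hZ_cons y zs z) addrK.
have pm u : hZ (ys ++ y :: zs) u = hZ ((y :: ys) ++ zs) u.
  by apply: hZ_perm; rewrite perm_catC /= perm_cons perm_catC.
rewrite !he; under [X in _ = X]eq_bigr => c _ do rewrite mulrBl.
rewrite sumrB; congr (_ - _).
  rewrite [size _]/= [RHS]big_ord_recr /= ltnn mul0r addr0; apply: eq_bigr => c _.
  by rewrite -ltnS ltn_ord pm.
rewrite [size _]/= [RHS]big_ord_recl /= mulr0 mul0r add0r mulr_sumr; apply: eq_bigr => c _.
by rewrite mulrA pm; congr (_ * hZ _ _); rewrite /bump /=; lia.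
Qed.
Lemma hZ1 (A : comNzRingType) (y : A) m : hZ [:: y] (Posz m) = y ^+ m.
Proof.
by rewrite /= big_ord_recr /= subnn mulr1 big1 ?add0r // => j _; rewrite subn_eq0 leqNgt ltn_ord mulr0.
Qed.

Section Schur.
Variables (F : fieldType) (n : nat) (y : 'I_n.+1 -> F).
Hypothesis inj : injective y.
Let ys := [seq y i | i <- enum 'I_n.+1].

Lemma alternant_neq0 : \det (\matrix_(i < n.+1, j < n.+1) y i ^+ (n - j)) != 0.
Proof.
pose a : 'rV[F]_n.+1 := \row_i y i; pose s : 'S_n.+1 := perm (@rev_ord_inj n.+1).
have -> : (\matrix_(i < n.+1, j < n.+1) y i ^+ (n - j)) = (row_perm s (Vandermonde n.+1 a))^T.
  by apply/matrixP => i j; rewrite !mxE permE /= subSS.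
rewrite det_tr row_permE det_mulmx det_perm mulf_neq0 ?signr_eq0 // det_Vandermonde.
rewrite prodf_seq_neq0; apply/allP => i _; apply/implyP => _; rewrite prodf_seq_neq0; apply/allP => j _; apply/implyP => ij.
by rewrite !mxE subr_eq0; apply/eqP => /inj e; rewrite e ltnn in ij.
Qed.
(** Powers of one variable are combinations of complete functions in all of them, with coefficients
    [Em] independent of [la]. Both alternants thus have the factor [Em]; for [la = 0] the other
    factor is unitriangular. *)
Lemma jacobi_trudi (la : nat -> nat) :
  \det (\matrix_(i < n.+1, j < n.+1) y i ^+ (la j + (n - j))) / \det (\matrix_(i < n.+1, j < n.+1) y i ^+ (n - j))
  = sh ys n.+1 (fun k => (la k)%:Z).
Proof.
have ex k : exists e : nat -> F, forall z, hZ [:: y k] z = \sum_(c < n.+1) e c * hZ ys (z - c%:Z).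
  have [e he] := hZ_remove [seq y i | i <- rem k (enum 'I_n.+1)] [:: y k].
  have sz : size [seq y i | i <- rem k (enum 'I_n.+1)] = n by rewrite size_map size_rem ?mem_enum // size_enum_ord.
  exists e => z; rewrite he sz; apply: eq_bigr => c _; congr (_ * _); apply: hZ_perm.
  rewrite -[[:: y k]]/(map y [:: k]) -map_cat; apply: perm_map; rewrite perm_catC perm_sym /=.
  by apply: perm_to_rem; rewrite mem_enum.
have [e he] : exists e : 'I_n.+1 -> nat -> F, forall k z, hZ [:: y k] z = \sum_(c < n.+1) e k c * hZ ys (z - c%:Z).
  have [e he] := fin_all_exists ex; by exists e.
pose Em : 'M[F]_n.+1 := \matrix_(b, k) e k (n - b)%N.
pose Hm (al : nat -> nat) : 'M[F]_n.+1 := \matrix_(a, b) hZ ys ((al a)%:Z - a%:Z + b%:Z).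
have main (al : nat -> nat) : \matrix_(i < n.+1, j < n.+1) y i ^+ (al j + (n - j)) = (Hm al *m Em)^T.
  apply/matrixP => k j; rewrite !mxE -hZ1 he (reindex_inj rev_ord_inj) /=; apply: eq_bigr => b _.
  rewrite !mxE subSS mulrC; congr (hZ _ _ * _).
  by have := ltn_ord b; have := ltn_ord j; move: (nat_of_ord b) (nat_of_ord j) => bb jj; lia.
have d0 : \det (Hm (fun=> 0%N)) = 1.
  rewrite -det_tr det_trig; last first.
    apply/is_trig_mxP => i j ij; rewrite !mxE; have -> : (0%:Z - j%:Z + i%:Z)%R = Negz (j - i).-1 by move: ij; lia.
    by [].
  by apply: big1 => i _; rewrite !mxE sub0r addNr /= hl0.
have e0 : \matrix_(i < n.+1, j < n.+1) y i ^+ (n - j) = (Hm (fun=> 0%N) *m Em)^T by rewrite -main.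
have nz := alternant_neq0; rewrite main {1}e0; rewrite e0 in nz; rewrite !det_tr !det_mulmx d0 mul1r in nz *.
by rewrite mulfK.
Qed.
End Schur.

Lemma schurE n la : schur n la = sh (xs n.+1 (@X n) 0) n.+1 (fun k => (nth 0%N la k)%:Z).
Proof.
rewrite /schur (jacobi_trudi (@xvar_inj n.+1)); apply: sh_perm.
have -> // : [seq xvar i | i <- enum 'I_n.+1] = xs n.+1 (@X n) 0.
rewrite /xs subn0 -val_enum_ord -map_comp; apply: eq_map => i /=.
by rewrite /X inord_val.
Qed.
End SchurDeterminant.

(** * The graded character summed over highest weight words *)

Module HighestWeightSum.
From Stdlib Require Import FunctionalExtensionality.
From mathcomp Require Import all_boot all_order all_fingroup all_algebra.
From mathcomp Require Import fraction mpoly ring zify.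
Import Defs Scan FilteredSets Columns KnuthMoves Dominance Windows Folding JacobiTrudi Characters CharacterRecursion TabloidWords ColumnInsertion TableauWords Katabolism ChargeExistence ChargeRecursion HeckeNormalForm DemazureOperators KeyTriangularity Truncation RootExpansion SchurDeterminant.
Import Order.TTheory GRing.Theory Num.Theory.
Local Open Scope ring_scope.

Section MorphSh.
Variables (A B : comNzRingType) (f : {rmorphism A -> B}).
Lemma rmorph_hl (zs : seq A) m : f (hl zs m) = hl [seq f z | z <- zs] m.
Proof.
elim: zs m => [|z zs IH] m /=; first by rewrite rmorph_nat.
by rewrite rmorph_sum; apply: eq_bigr => j _; rewrite rmorphM rmorphXn IH.
Qed.
Lemma rmorph_sh (zs : seq A) r al : f (sh zs r al) = sh [seq f z | z <- zs] r al.
Proof.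
rewrite /sh -det_map_mx; congr (\det _); apply/matrixP => a b; rewrite !mxE.
by case: (_ + _) => m /=; [exact: rmorph_hl|rewrite rmorph0].
Qed.
End MorphSh.

Lemma msymXU (R : comNzRingType) l (s : 'S_l) i : msym s ('X_i : {mpoly R[l]}) = 'X_(s i).
Proof.
rewrite msymX; congr 'X_[_]; apply/mnmP => j.
by rewrite mnmE !mnm1E -(inj_eq (@perm_inj _ s)) permKV.
Qed.

Section Generic.
Variable n : nat.
Hypothesis n0 : (0 < n)%N.
Notation l := n.+1.
Notation A := {mpoly {poly int}[n.+1]}.
Let l1 : (1 < l)%N. Proof. by rewrite ltnS. Qed.

Definition xA (r : nat) : A := 'X_(inord r).
Definition sA (p : nat) : {rmorphism A -> A} := msym (tp n p).
Definition qA : A := ('X : {poly int})%:MP.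
(** The shift mixes [q] with the variables, so it is an endomorphism of a ring containing [q]:
    polynomials over [Z[q]] instead of [ratfun]. *)
Definition PhiA : {rmorphism A -> A} :=
  mmap (@mpolyC l {poly int} : {rmorphism {poly int} -> A}) (fun i : 'I_l => if (i < n)%N then xA i.+1 else qA * xA 0).

Lemma sxA p r : (p.+1 < l)%N -> (r < l)%N ->
  sA p (xA r) = xA (if r == p then p.+1 else if r == p.+1 then p else r).
Proof.
move=> pl rl; rewrite /sA /= msymXU /xA; congr 'X_[U_(_)]; rewrite /tp permE /= !inord_eq //; last by lia.
by case: ifP => // _; case: ifP.
Qed.
Lemma nzA p : (p.+1 < l)%N -> xA p != xA p.+1.
Proof.
move=> pl; apply/eqP => /(congr1 (mcoeff U_(inord p)%MM)); rewrite !mcoeffXU eqxx inord_eq //; last by lia.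
by rewrite gtn_eqF // => /eqP; rewrite oner_eq0.
Qed.
Lemma mmapXU (i : 'I_l) (B : comNzRingType) (f : {rmorphism {poly int} -> B}) (h : 'I_l -> B) : mmap f h 'X_i = h i.
Proof. by rewrite mmapX mmap1U. Qed.
Lemma PhxA r : (r.+1 < l)%N -> PhiA (xA r) = xA r.+1.
Proof.
move=> rl; have e : (inord r : 'I_l) = r :> nat by rewrite inordK // ltnW.
have rn : (r < n)%N := rl.
transitivity (if ((inord r : 'I_l) < n)%N then xA (inord r : 'I_l).+1 else qA * xA 0); first exact: mmapXU.
by rewrite e rn.
Qed.
Lemma PhlA : PhiA (xA l.-1) = qA * xA 0.
Proof.
have e : (inord n : 'I_l) = n :> nat by rewrite inordK.
transitivity (if ((inord n : 'I_l) < n)%N then xA (inord n : 'I_l).+1 else qA * xA 0); first exact: mmapXU.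
by rewrite e ltnn.
Qed.
Lemma PhqA : PhiA qA = qA. Proof. exact: mmapC. Qed.
Lemma sqA p : (p.+1 < l)%N -> sA p qA = qA.
Proof. by move=> _; rewrite /sA /= /qA -[_%:MP]mulr1 mul_mpolyC msymZ msym1. Qed.

Notation w0 := (w0w n 0).
Lemma w0A : all (gtn l.-1) w0. Proof. by apply/allP => p /mem_w0w /=; lia. Qed.
Lemma w0A' : all (fun p => p.+1 < l)%N w0. Proof. by apply/allP => p /mem_w0w /=; lia. Qed.
Definition shA (u : nat -> int) : A := sh (xs l xA 0) l u.

Lemma mw_count (h : seq nat) : all (gtn l) h -> mw xA h = \prod_(r < l) xA r ^+ count_mem (nat_of_ord r) h.
Proof.
elim: h => [|y h IH] /=; first by rewrite /mw big_nil big1 // => r _; rewrite expr0.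
case/andP=> yl /IH e; rewrite /mw big_cons -/(mw _ _) e.
rewrite (bigD1 (Ordinal yl)) //= [in RHS](bigD1 (Ordinal yl)) //= eqxx add1n exprS mulrA; congr (_ * _).
apply: eq_bigr => r ne; rewrite (_ : (y == r) = false) ?add0n //.
by apply: contraNF ne => /eqP e'; apply/eqP/val_inj.
Qed.

(** A highest weight word dominates the empty prefix, so [FG_dom] applies to the set of the empty
    word. *)
Lemma FG_single (h : seq nat) : (forall p, (p < n)%N -> E p h = h) -> FG (gtn l.-1) (fun w => pred1 h w).
Proof.
move=> hh; have h0 : hw 0 n [::] by [].
have h1 : hw 0 n h by move=> p /andP[_ hp]; exact: hh.
have f0 : FG (fun p => 0 <= p < n)%N (pre [::] (eq [::])).
  move=> v p _ _ w; have e : forall v w, pre [::] (eq [::]) (Eword v w) -> w = [::].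
    by move=> v' w' [x ex e]; apply: size0nil; rewrite -(size_Eword v') ex -e.
  rewrite /Fw => hW; have ew := e _ _ hW; rewrite ew in hW *; split=> // ne; by case: ne.
have f1 := FG_dom h0 h1 (fun p _ => leq0n _) f0.
apply: (@FG_ext _ (pre h (eq [::]))).
  by move=> w; split=> [[x -> <-]|/eqP ->]; [rewrite cats0 /=|exists [::]; rewrite ?cats0].
by apply: FG_sub f1 => p /=.
Qed.

Lemma w0_absorb p : (p < n)%N -> heq (w0 ++ [:: p]) w0.
Proof. by move=> h; apply: w0w_absr. Qed.
Lemma Eword_w0 w p : (p < n)%N -> E p (Eword w0 w) = Eword w0 w.
Proof. by move=> h; have := Eword_heq w (w0_absorb h); rewrite /Eword foldl_cat. Qed.
Lemma Eword_fix v w : (forall p, p \in v -> E p w = w) -> Eword v w = w.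
Proof.
elim: v => //= p v IH h; rewrite h ?mem_head //; apply: IH => q qv; apply: h; by rewrite inE qv orbT.
Qed.
Lemma w0_idem w : Eword w0 (Eword w0 w) = Eword w0 w.
Proof. by apply: Eword_fix => p /mem_w0w hp; apply: Eword_w0; lia. Qed.
Lemma vecs_Eword N w : (Eword w0 w \in vecs l N) = (w \in vecs l N).
Proof.
have := w0A'; elim: (w0) w => //= p v IH w /andP[pl pv]; rewrite IH //.
by rewrite vecs_E.
Qed.

(** The character of one component: the longest operator applied to the monomial of [h], computed
    once by strings and once by [pi_Sg]. *)
Lemma fibre_sh N h : h \in vecs l N -> Eword w0 h = h ->
  \sum_(w <- vecs l N | Eword w0 w == h) mw xA w = shA (fun r => (count_mem r h)%:Z).
Proof.
move=> hv hh; have hp p : (p < n)%N -> E p h = h by move=> pn; rewrite -hh; exact: Eword_w0.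
have lh : all (gtn l) h by move: hv; rewrite mem_vecs => /andP[].
have := @chr_piw _ l xA sA sxA N (fun=> 1) xpredT (fun p w _ => erefl) (fun p w _ _ _ => erefl) (fun p w _ => rmorph1 _) w0 (pred1 h) w0A (fun _ _ => erefl) (FG_single hp).
rewrite /chr; have -> : \sum_(w <- vecs l N | pred1 h w) 1 * mw xA w = Sg l xA l l (fun r => (count_mem r h)%:Z).
  rewrite -big_filter filter_pred1_uniq ?uniq_vecs // big_seq1 mul1r mw_count // /Sg subnn sh0 mulr1.
  by apply: eq_bigr => r _.
move=> e1; have e2 := @pi_Sg _ l xA sA sxA n 0 l l (fun r => (count_mem r h)%:Z) erefl erefl (leqnn _) (leqnn _) (fun _ _ => erefl).
rewrite (_ : minn 0 l = 0%N) // in e2.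
have := piw_uniq nzA w0A' e1 e2; rewrite /Sg big_ord0 mul1r subn0 => e3.
transitivity (\sum_(w <- vecs l N | pred1 h (Eword w0 w)) 1 * mw xA w); last exact: e3.
by apply: eq_bigr => w _; rewrite mul1r.
Qed.

Section Main.
Variables (ns : seq nat) (mu : l.-tuple nat).
Hypotheses (smu : sorted geq mu) (okn : okns ns l) (okc : okchain l 1 ns) (szn : size ns = n).
Notation g := (gch l).
Let smu' : size mu = l. Proof. exact: size_tuple. Qed.

Lemma gch_EBw v u : all (fun p => p.+1 < l)%N v -> CharacterRecursion.okb l u -> g (EBw v u) = g u.
Proof.
elim: v u => //= p v IH u /andP[pl pv] ou; rewrite IH //; first by apply: gch1.
case: ou => h1 h2 h3; split; rewrite ?shape_scanB ?all_sorted_scanB // all_scanB //=; move: pl; clear; lia.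
Qed.

(** The longest operator makes the character of [Sb] symmetric. The right side comes from [G_Lst]
    and [pi_Sg], the left side from grouping the words by their highest weight words, on whose
    components [g] is constant. *)
Lemma hw_sum MU D : all (geq MU) mu ->
  \sum_(h <- vecs l (sumn mu) | (Eword w0 h == h) && Sb l ns mu h) qA ^+ g (reshape mu h) * shA (fun r => (count_mem r h)%:Z)
  = \sum_(eg <- Lst (Kfun MU D) ns mu) qA ^+ eg.1 * shA (nth 0 eg.2).
Proof.
move=> aM.
have oks : okns ns (size mu) by rewrite smu'.
have g1 p u : (p.+1 < l)%N -> CharacterRecursion.okb l u -> g (EB p u) = g u by move=> pl ou; apply: gch1.
have g2 m u : CharacterRecursion.okb l (nseq m 0%N :: u) -> g (nseq m 0%N :: u) = (count_mem 0%N (flatten u) + g (map (rotb l) u))%N.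
  by move=> ou; apply: gch2.
have e1 := @G_pi _ l xA sA l1 sxA qA sqA g g1 w0 ns mu smu w0A.
have := @G_Lst _ l xA sA l1 sxA nzA PhiA qA PhxA PhlA PhqA sqA g (gch3 l) g1 g2 MU D ns mu smu oks _ aM.
rewrite smu' leqnn => /(_ erefl) eG; rewrite eG in e1.
have kl : (kk ns l <= l)%N.
  move: okn; rewrite /kk; case: (n) n0 => // m _ /=; by case/and4P.
have e2 : piw xA sA w0 (\sum_(eg <- Lst (Kfun MU D) ns mu) qA ^+ eg.1 * Sg l xA (kk ns l) l (nth 0 eg.2))
   (\sum_(eg <- Lst (Kfun MU D) ns mu) qA ^+ eg.1 * shA (nth 0 eg.2)).
  apply: piw_sum => eg heg _; apply: piw_mul.
    by move=> p /mem_w0w hp; rewrite rmorphXn sqA //; move: hp; clear; lia.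
  have [_ _ h3] := Lst_ok l1 (gch3 l) oks aM heg; rewrite smu' in h3.
  have := @pi_Sg _ l xA sA sxA n 0 (kk ns l) l (nth 0 eg.2) erefl erefl kl kl h3.
  by rewrite min0n {2}/Sg big_ord0 mul1r subn0.
rewrite -(piw_uniq nzA w0A' e1 e2) /chr.
transitivity (\sum_(w <- vecs l (sumn mu)) \sum_(h <- vecs l (sumn mu) | [&& Eword w0 h == h, Sb l ns mu h & Eword w0 w == h]) qA ^+ g (reshape mu w) * mw xA w).
  rewrite (exchange_big_dep (fun h => (Eword w0 h == h) && Sb l ns mu h)) /=; last by move=> w h _ /and3P[-> -> _].
  rewrite big_seq_cond [RHS]big_seq_cond; apply: eq_bigr => h /andP[hv /andP[/eqP hh hS]].
  rewrite -(fibre_sh hv hh) mulr_sumr; rewrite [LHS]big_seq_cond [RHS]big_seq_cond; apply: eq_big => [w|w /andP[wv /eqP ew]].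
    by rewrite hh eqxx hS.
  congr (qA ^+ _ * _); case/and4P: hS => /eqP szh srt _ _.
  have sw : size w = sumn mu by move: wv; rewrite mem_vecs => /andP[/eqP].
  have lw : all (gtn l) w by move: wv; rewrite mem_vecs => /andP[].
  have er : reshape mu h = EBw w0 (reshape mu w) by rewrite -ew reshape_Ew.
  rewrite er gch_EBw ?w0A' //; split; first by rewrite reshapeKl ?sw.
    by rewrite -(all_sorted_EBw w0) -er.
  apply/allP => b bu; apply/allP => r rb; apply: (allP lw).
  by rewrite -(reshapeKr (s := w) (sh := mu)) ?sw //; apply/flattenP; exists b.
rewrite [RHS]big_mkcond big_seq [RHS]big_seq; apply: eq_bigr => w wv; case: ifP => hS.
  rewrite -big_filter (_ : [seq h <- _ | _] = [:: Eword w0 w]) ?big_seq1 //.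
  rewrite (_ : [seq h <- _ | _] = [seq h <- vecs l (sumn mu) | pred1 (Eword w0 w) h]); last first.
    apply: eq_filter => h /=; rewrite [Eword w0 w == h]eq_sym; case e : (h == Eword w0 w); last by rewrite !andbF.
    by rewrite (eqP e) w0_idem eqxx hS.
  by apply: filter_pred1_uniq; rewrite ?uniq_vecs ?vecs_Eword.
apply: big1_seq => h /andP[/and3P[_ hs /eqP eh] _]; by rewrite eh hs in hS.
Qed.
End Main.
End Generic.
End HighestWeightSum.

(** * Tableaux, root ideals and the comparison of both sides *)

Module Assembly.
From Stdlib Require Import FunctionalExtensionality.
From mathcomp Require Import all_boot all_order all_fingroup all_algebra.
From mathcomp Require Import fraction mpoly ring zify.
Import Defs Scan FilteredSets Columns KnuthMoves Dominance Windows Folding JacobiTrudi Characters CharacterRecursion TabloidWords ColumnInsertion TableauWords Katabolism ChargeExistence ChargeRecursion HeckeNormalForm DemazureOperators KeyTriangularity Truncation RootExpansion SchurDeterminant HighestWeightSum.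
Import Order.TTheory GRing.Theory Num.Theory.
Local Open Scope ring_scope.

Section Tableaux.
Variable n : nat.
Hypothesis n0 : (0 < n)%N.
Notation l := n.+1.
Let l1 : (1 < l)%N. Proof. by rewrite ltnS. Qed.
Variables (ns : seq nat) (mu : l.-tuple nat).
Hypotheses (okc : okchain l 1 ns) (szn : size ns = n).
Notation w0 := (w0w n 0).
Let smu' : size mu = l. Proof. exact: size_tuple. Qed.

Lemma kat_Sb U : is_ssyt mu U -> katabolizable ns U = S l ns mu (bw l U).
Proof.
case/is_ssytP=> sU oU tU shU.
have sz : size mu = (size ns).+1 by rewrite szn smu'.
have oU' : okT (size mu) U by rewrite smu'.
have shU' : shape (bw (size mu) U) = mu by rewrite smu'.
have d0 : isT leq ltn (drop 1.-1 U) by rewrite drop0.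
have := @kat_S l ns mu U 1 l1 sz sU oU' shU' okc erefl d0.
by rewrite (isT_ones oU tU) smu' /katabolizable.
Qed.

Lemma ssyt_words : perm_eq [seq h <- vecs l (sumn mu) | (Eword w0 h == h) && Sb l ns mu h]
  [seq flatten (bw l U) | U <- SSYT mu & katabolizable ns U].
Proof.
have inj : {in SSYT mu &, injective (fun U => flatten (bw l U))}.
  move=> U U'; rewrite !mem_SSYT => /is_ssytP [s1 o1 _ h1] /is_ssytP [s2 o2 _ h2] e.
  by apply: (bw_inj o1 o2); [rewrite s1 s2|apply: eq_flat; rewrite ?h1 ?h2].
apply: uniq_perm; first by rewrite filter_uniq ?uniq_vecs.
  rewrite map_inj_in_uniq; first by apply: filter_uniq; exact: SSYT_uniq.
  by move=> U U' hU hU'; apply: inj; apply: (mem_subseq (filter_subseq (katabolizable ns) (SSYT mu))).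
move=> h; rewrite mem_filter; apply/andP/mapP.
  move=> [/andP[/eqP hh /and4P[/eqP szh a1 a2 hS]] hv].
  set u := reshape mu h in a1 a2 hS.
  have shu : shape u = mu by apply: reshapeKl; rewrite szh.
  have fu : flatten u = h by apply: reshapeKr; rewrite szh.
  have su : size u = l by rewrite -(size_map size u) -/(shape u) shu smu'.
  have bT : bw l (tab l u) = u by exact: bw_tab.
  have oT : okT l (tab l u) by exact: okT_tab.
  have tT : isT leq ltn (tab l u).
    apply/(hw_isT oT) => p; rewrite bT; have [pl|pl] := ltnP p n.
      apply: eq_flat; first by rewrite /EB shape_scanB.
      rewrite /EB flatten_scanB fu -/(E p h) -hh; exact: Eword_w0.
    apply: EB_notin; apply: sub_all a2 => b hb; apply/negP => /(allP hb) /=; rewrite ltnS => h'.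
    by move: (leq_ltn_trans pl h'); rewrite ltnn.
  have ss : is_ssyt mu (tab l u) by apply/is_ssytP; rewrite size_mkseq bT.
  exists (tab l u); last by rewrite bT.
  by rewrite mem_filter mem_SSYT ss andbT kat_Sb // bT.
move=> [U + ->]; rewrite mem_filter mem_SSYT => /andP[kU sU]; have := sU; move/is_ssytP => [s1 o1 t1 h1].
have rU : reshape mu (flatten (bw l U)) = bw l U by rewrite -{1}h1 flattenK.
have lU : all (all (gtn l)) (bw l U) by have := bw_lt l U; rewrite s1.
have sz : size (flatten (bw l U)) = sumn mu by rewrite size_flatten h1.
split; last first.
  rewrite mem_vecs sz eqxx andTb; apply/allP => x; case/flattenP => b bU xb; exact: (allP (allP lU b bU)).
apply/andP; split; last by rewrite /Sb sz eqxx rU sorted_bw lU -kat_Sb.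
by rewrite -flatten_EBw EBw_fix // => p _; apply: (hw_isT o1).2.
Qed.

Lemma ssyt_row U r : is_ssyt mu U -> (r < l)%N -> count_mem r (flatten (bw l U)) = nth 0%N (shape U) r.
Proof.
case/is_ssytP=> s1 o1 _ _ rl; rewrite -size_rowt (nth_map [::]) ?s1 //; congr size.
by rewrite -{2}(tab_bw o1) s1 nth_mkseq.
Qed.
Lemma ssyt_charge U : is_ssyt mu U -> gch l (reshape mu (flatten (bw l U))) = charge_tabloid U.
Proof.
case/is_ssytP=> s1 o1 _ h1; rewrite -{1}h1 flattenK /gch.
by have := tab_bw o1; rewrite s1 => ->.
Qed.
End Tableaux.

Lemma sum_ge a b : (\sum_(0 <= i < b | a <= i) 1 = b - a)%N.
Proof.
elim: b => [|b IH]; first by rewrite big_geq.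
by rewrite big_mkcond big_nat_recr //= -big_mkcond IH; case: leqP => h; lia.
Qed.
Lemma card_seg l a b : (b <= l)%N -> #|[set k : 'I_l | (a <= k < b)%N]| = (b - a)%N.
Proof.
move=> bl; rewrite -sum1dep_card -(big_mkord (fun k => a <= k < b)%N (fun=> 1%N)).
by rewrite -(big_nat_widen 0 b l) // sum_ge.
Qed.

Section NR.
Variables (n : nat) (Psi : {set 'I_n.+1 * 'I_n.+1}).
Hypothesis hPsi : root_ideal Psi.
Notation l := n.+1.
Notation c i := (nth 0%N (nr Psi) i).
Lemma size_nr : size (nr Psi) = n. Proof. by rewrite size_map size_enum_ord. Qed.
(** Row [i] of an upper order ideal is a final segment, so counting its complement locates it. *)
Lemma nr_mem (i : 'I_n) (j : 'I_l) : (i <= j)%N -> ((lpos i, j) \in Psi) = (i + c i <= j)%N.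
Proof.
move=> ij; have [h1 h2] := hPsi.
have -> : c i = #|[set j : 'I_l | (i <= j)%N && ((lpos i, j) \notin Psi)]|.
  by rewrite (nth_map i) ?size_enum_ord // nth_ord_enum.
set T := [set _ | _].
have cI := @card_seg l.
case mP : (_ \in Psi); apply/esym.
  rewrite -leq_subRL //; apply: leq_trans (_ : #|[set k : 'I_l | (i <= k < j)%N]| <= _)%N; last by rewrite cI // ltnW.
  apply: subset_leq_card; apply/subsetP => k; rewrite !inE => /andP[ik kP]; rewrite ik ltnNge.
  apply: contra kP => jk; apply: (h2 _ _ mP) => /=; last by rewrite /root_le /= leqnn.
  by have := h1 _ mP => /= lt; exact: leq_trans lt jk.
apply/negbTE; rewrite -ltnNge -ltn_subLR // ; apply: leq_trans (_ : #|[set k : 'I_l | (i <= k < j.+1)%N]| <= _)%N; first by rewrite cI ?subSn.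
apply: subset_leq_card; apply/subsetP => k; rewrite !inE ltnS => /andP[-> kj] /=.
apply: contraFN mP => kP; apply: (h2 _ _ kP) => /=; last by rewrite /root_le /= leqnn.
by have := h1 _ kP => /= lt; exact: leq_trans lt kj.
Qed.
Lemma nr_gt0 i : (i < n)%N -> (0 < c i)%N.
Proof.
move=> hi; have := @nr_mem (Ordinal hi) (lpos (Ordinal hi)) (leqnn _) => /= e.
rewrite lt0n; apply/eqP => e0; rewrite e0 addn0 leqnn in e; have [h1 _] := hPsi.
by have := h1 _ e; rewrite /= ltnn.
Qed.
Lemma nr_le i : (i < n)%N -> (i + c i <= l)%N.
Proof.
move=> hi; rewrite (nth_map (Ordinal hi)) ?size_enum_ord //.
rewrite -leq_subRL; last by exact: ltnW (ltnW _).
set T := [set _ | _]; apply: leq_trans (_ : #|[set k : 'I_l | (i <= k < l)%N]| <= _)%N; last by rewrite card_seg.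
by apply: subset_leq_card; apply/subsetP => k; rewrite !inE nth_enum_ord // ltn_ord andbT => /andP[].
Qed.
Lemma nr_step i : (i.+1 < n)%N -> (c i <= (c i.+1).+1)%N.
Proof.
move=> hi; have hi' : (i < n)%N := ltnW hi; have [h1 h2] := hPsi.
have [e|lt] : (i.+1 + c i.+1 = l)%N \/ (i.+1 + c i.+1 < l)%N by have := nr_le hi; lia.
  by have := nr_le hi'; lia.
pose j : 'I_l := Ordinal lt.
have ij : (i.+1 <= j)%N by rewrite /= leq_addr.
have := @nr_mem (Ordinal hi) j ij; rewrite /= leqnn => m1.
have ij' : (i <= j)%N by exact: ltnW.
have := @nr_mem (Ordinal hi') j ij' => /= m2.
have : (lpos (Ordinal hi'), j) \in Psi.
  by apply: (h2 _ _ m1) => /=; rewrite ?leq_addr // /root_le /= leqnSn leqnn.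
by rewrite m2; move: (c i) (c i.+1) => a b; lia.
Qed.
Lemma okns_gen ns L : (0 < L)%N -> (forall i, (i.+1 < L)%N -> (0 < nth 0%N ns i)%N /\ (i + nth 0%N ns i <= L)%N) ->
  (forall i, (i.+2 < L)%N -> (nth 0%N ns i <= (nth 0%N ns i.+1).+1)%N) -> okns ns L.
Proof.
elim: L ns => // L IH ns _ h1 h2; rewrite /=; case: eqP => //= L0.
have L0' : (1 < L.+1)%N by lia.
have [p1 p2] := h1 0%N L0'; rewrite add0n nth0 in p1 p2; rewrite p1 p2 /=.
apply/andP; split.
  rewrite /kk; case: eqP => [L1|L1]; first by rewrite L1 in p2.
  by have := h2 0%N; rewrite nth0 -nth_behead nth0; apply; lia.
apply: IH; first by lia.
  move=> i hi; rewrite nth_behead; have hi' : (i.+2 < L.+1)%N by rewrite ltnS.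
  by have [q1 q2] := h1 i.+1 hi'; split=> //; move: q2; rewrite addSn ltnS.
by move=> i hi; rewrite !nth_behead; apply: h2; lia.
Qed.
Lemma okns_nr : okns (nr Psi) l.
Proof.
apply: okns_gen => // i; rewrite !ltnS => hi; last exact: nr_step.
by split; [exact: nr_gt0|exact: nr_le].
Qed.
Lemma okchain_gen (ns : seq nat) m : (forall i, (i < size ns)%N -> (0 < nth 0%N ns i <= l)%N) ->
  (m.-1 <= head l ns)%N -> (forall i, (i.+1 < size ns)%N -> (nth 0%N ns i <= (nth 0%N ns i.+1).+1)%N) -> okchain l m ns.
Proof.
elim: ns m => //= m' ns IH m h1 h2 h3; have /andP[-> ->] := h1 0%N erefl; rewrite h2 /=.
apply: IH => [i hi||i hi]; [exact: (h1 i.+1)| |exact: (h3 i.+1)].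
case: ns h1 h3 => [|m2 ns] h1 h3 /=; first by have := h1 0%N erefl => /=; lia.
by have := h3 0%N erefl => /=; lia.
Qed.
Lemma okchain_nr : okchain l 1 (nr Psi).
Proof.
apply: okchain_gen => // i; rewrite size_nr => hi; last exact: nr_step.
by rewrite nr_gt0 //; apply: leq_trans (leq_addl _ _) (nr_le hi).
Qed.

Definition natp (r : 'I_l * 'I_l) : nat * nat := (nat_of_ord r.1, nat_of_ord r.2).
Definition rsP := [seq r <- index_enum ('I_l * 'I_l)%type | r \in Psi].
Lemma rsP_perm : perm_eq (map natp rsP) (rootsL (nr Psi) l).
Proof.
have [h1 h2] := hPsi.
apply: uniq_perm; rewrite ?uniq_rootsL //.
  rewrite map_inj_uniq ?filter_uniq ?index_enum_uniq // => [] [a b] [a' b'] [] /val_inj -> /val_inj -> //.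
case=> a b; rewrite (mem_rootsL _ _ okns_nr); apply/mapP/and3P.
  move=> [[i j]]; rewrite mem_filter => /andP[ijP _] [-> ->]; have lt := h1 _ ijP; rewrite /= in lt.
  have hi : (i < n)%N by rewrite -ltnS; apply: leq_ltn_trans lt (ltn_ord j).
  have e : lpos (Ordinal hi) = i by exact: val_inj.
  by split=> //; rewrite -(@nr_mem (Ordinal hi)) ?e // ltnW.
move=> [ab bl abc]; have hi : (a < n)%N by rewrite -ltnS; apply: leq_ltn_trans ab bl.
exists (lpos (Ordinal hi), Ordinal bl) => //; rewrite mem_filter mem_index_enum andbT nr_mem //=.
by exact: ltnW.
Qed.
End NR.

Arguments natp {n} r.
Lemma mulr5AC (R : comNzRingType) (a b c d e : R) : a * b * (c * (d * e)) = c * a * (d * b * e).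
Proof. by ring. Qed.

Section Catalan.
Variable n : nat.
Notation l := n.+1.
Notation F := (ratfun n.+1).
Definition wgt (u : nat -> int) : weight l := [ffun i => u (nat_of_ord i)].
Definition xf (u : nat -> int) : F := xmon (wgt u).
Definition shfn (u : nat -> int) : F := sh (xs l (@X n) 0) l u.
Lemma shw_wgt u : shw (wgt u) = shfn u.
Proof. by apply: eq_sh => k kl; rewrite /wf ffunE inordK. Qed.
Lemma xf_addw u (r : 'I_l * 'I_l) k : r.1 != r.2 -> (xvar r.1 / xvar r.2) ^+ k * xf u = xf (addw u (natp r) k).
Proof.
move=> ne; rewrite /xf /xmon (bigD1 r.1) //= (bigD1 r.2) /=; last by rewrite eq_sym.
rewrite [RHS](bigD1 r.1) //= [in RHS](bigD1 r.2) /=; last by rewrite eq_sym.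
have e1 : wgt (addw u (natp r) k) r.1 = wgt u r.1 + k%:Z.
  by rewrite !ffunE /addw /= eqxx val_eqE (negPf ne) muln1 muln0 subr0.
have e2 : wgt (addw u (natp r) k) r.2 = wgt u r.2 - k%:Z.
  by rewrite !ffunE /addw /= eqxx val_eqE eq_sym (negPf ne) muln1 muln0 addr0.
rewrite e1 e2 !expfzDr ?xvar_neq0 // exprMn exprVn -exprnP exprnN.
have -> : \prod_(i < l | (i != r.1) && (i != r.2)) xvar i ^ wgt (addw u (natp r) k) i =
  \prod_(i < l | (i != r.1) && (i != r.2)) xvar i ^ wgt u i.
  apply: eq_bigr => i /andP[/negPf i1 /negPf i2]; congr (_ ^ _).
  by rewrite !ffunE /addw /= !val_eqE i1 i2 !muln0 addr0 subr0.
exact: mulr5AC.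
Qed.
Lemma ser_VV (rs : seq ('I_l * 'I_l)) u d : all (fun r => r.1 != r.2) rs ->
  (\big[@ser_mul _/@ser_one _]_(r <- rs) ser_geom (xvar r.1 / xvar r.2)) d * xf u = VV xf (map natp rs) u d.
Proof.
elim: rs u d => [|r rs IH] u d /=.
  by move=> _; rewrite big_nil /ser_one; case: eqP => _; rewrite ?mul1r ?mul0r.
case/andP=> ne ars; rewrite big_cons /ser_mul mulr_suml; apply: eq_bigr => k _.
by rewrite -IH // -xf_addw // /ser_geom mulrAC mulrA mulrC mulrA [_ * (_ ^+ k)]mulrC.
Qed.
Lemma sum_list N (f g : nat -> F) : (forall k, exists s, f k = LS s /\ g k = JS s) ->
  exists s, \sum_(k < N) f k = LS s /\ \sum_(k < N) g k = JS s.
Proof.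
move=> h; elim: N => [|N [s [s1 s2]]]; first by exists [::]; rewrite !big_ord0 /LS /JS !big_nil.
have [t [t1 t2]] := h N; exists (s ++ t).
by rewrite !big_ord_recr /= s1 s2 t1 t2 LS_cat JS_cat.
Qed.
(** One list of weights must represent both sums, because [catalan_sum] sends [LS s] to [JS s]. *)
Lemma VV_list (rs : seq (nat * nat)) u d : exists s, VV xf rs u d = LS s /\ VV shfn rs u d = JS s.
Proof.
elim: rs u d => [|r rs IH] u d /=.
  case: eqP => _; last by exists [::]; rewrite /LS /JS !big_nil.
  by exists [:: (1, wgt u)]; rewrite /LS /JS !big_seq1 !mulr1z shw_wgt.
by apply: (@sum_list d.+1 (fun k => VV xf rs (addw u r k) (d - k)) (fun k => VV shfn rs (addw u r k) (d - k))) => k; exact: IH.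
Qed.
Lemma catalan_VV (Psi : {set 'I_l * 'I_l}) u d : root_ideal Psi ->
  catalan Psi (wgt u) (hecke_w0 n) d = VV shfn (map natp (rsP Psi)) u d.
Proof.
move=> hP; have [s [s1 s2]] := VV_list (map natp (rsP Psi)) u d.
rewrite /catalan -big_filter -/(rsP Psi) -/(xf u) ser_VV.
  by rewrite (catalan_sum s1) s2.
apply/allP => r; rewrite mem_filter => /andP[rP _]; have [h1 _] := hP.
by apply: contraTneq (h1 _ rP) => ->; rewrite ltnn.
Qed.
Lemma mu_wgt (mu : l.-tuple nat) : [ffun i => (tnth mu i)%:Z] = wgt (fun j => (nth 0%N mu j)%:Z).
Proof. by apply/ffunP => i; rewrite !ffunE (tnth_nth 0%N). Qed.
End Catalan.

Section Theta.
Variable n : nat.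
Notation l := n.+1.
Notation F := (ratfun n.+1).
Notation A := {mpoly {poly int}[n.+1]}.
(** Moves [q] from the coefficients to the outer indeterminate, so that an identity in [A] can be
    compared with [catalan] degree by degree. *)
Definition theta : {rmorphism A -> {poly F}} :=
  mmap (map_poly (intr : int -> F) : {rmorphism {poly int} -> {poly F}}) (fun i : 'I_l => (xvar i)%:P).
Lemma theta_q : theta (qA n) = 'X.
Proof.
transitivity (map_poly (intr : int -> F) 'X); first exact: mmapC.
exact: map_polyX.
Qed.
Lemma theta_sh u : theta (shA n u) = (shfn n u)%:P.
Proof.
rewrite /shA rmorph_sh /shfn (rmorph_sh (@polyC F)); congr (sh _ _ _).
rewrite /xs -!map_comp; apply: eq_map => r; exact: mmapXU.
Qed.
Lemma theta_coef (I : Type) (r : seq I) (P : pred I) (e : I -> nat) (u : I -> nat -> int) d :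
  (theta (\sum_(i <- r | P i) qA n ^+ e i * shA n (u i)))`_d = \sum_(i <- r | P i && (e i == d)) shfn n (u i).
Proof.
rewrite rmorph_sum coef_sum [RHS]big_mkcondr; apply: eq_bigr => i _.
rewrite rmorphM rmorphXn theta_q theta_sh mulrC coefCM coefXn eq_sym.
by case: eqP => _; rewrite ?mulr1 ?mulr0.
Qed.
End Theta.
End Assembly.

From mathcomp Require Import all_boot all_order all_fingroup all_algebra.
From mathcomp Require Import fraction mpoly.
Import Scan FilteredSets Columns KnuthMoves Dominance Windows Folding JacobiTrudi Characters CharacterRecursion TabloidWords ColumnInsertion TableauWords Katabolism ChargeExistence ChargeRecursion HeckeNormalForm DemazureOperators KeyTriangularity Truncation RootExpansion SchurDeterminant HighestWeightSum Assembly.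

Import GRing.Theory.
Local Open Scope ring_scope.

Lemma kat_coef n (ns : seq nat) (mu : n.+1.-tuple nat) d :
  (\sum_(U <- SSYT mu | katabolizable ns U) schur n (shape U) *: 'X^(charge_tabloid U) : {poly ratfun n.+1})`_d =
  \sum_(U <- [seq U <- SSYT mu | katabolizable ns U] | charge_tabloid U == d) shfn n (fun k => (nth 0%N (shape U) k)%:Z).
Proof.
rewrite coef_sum [RHS]big_mkcond big_filter; apply: eq_bigr => U _.
by rewrite coefZ coefXn eq_sym schurE; case: eqP => _; rewrite ?mulr1 ?mulr0.
Qed.

(** For the case of a single row, which the crystal argument leaves out as it assumes [0 < n]. *)
Lemma SSYT_row (mu : 1.-tuple nat) : perm_eq (SSYT mu) [:: [:: nseq (nth 0%N mu 0) 1%N]].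
Proof.
apply: uniq_perm; rewrite ?SSYT_uniq // => U; rewrite mem_SSYT inE.
apply/idP/eqP => [/is_ssytP [sU oU tU shU]|->].
  case: U sU oU tU shU => [|r [|? ?]] // _ oU tU shU; congr [:: _].
  have [_ ar] := okT_nth 0 oU; rewrite /= in ar.
  have er : all (pred1 1%N) r by apply: sub_all ar => x /= h; rewrite eqn_leq andbC.
  move/all_pred1P: er => ->; congr (nseq _ 1%N).
  have := congr1 (nth 0%N ^~ 0%N) shU => <-.
  rewrite [bw _ _]/= [shape _]/= size_blk /= cats0; apply/esym/eqP; rewrite -all_count.
  by apply: sub_all ar => x /= h; rewrite eqn_leq andbC.
apply/is_ssytP; split=> //.
- rewrite /okT /= !andbT; apply/andP; split; last by apply/allP => x /nseqP [->].
  by elim: (nth _ _ _) => //= k; case: k.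
- split=> [[|i]|i] j; rewrite /inT /ent /= ?nth_nil // size_nseq => h.
  by rewrite !nth_nseq h (ltnW h).
rewrite [bw _ _]/= [shape _]/= size_blk /= cats0 count_nseq mul1n.
by case: mu => [] [|m []].
Qed.
Lemma charge_ones m : charge_tabloid [:: nseq m 1%N] = 0%N.
Proof.
have [c1 c2 _ _] := charge_ok; rewrite /charge_tabloid /= cats0 -[nseq m 1%N]cat0s c2 //.
split; first by apply/negP => /nseqP [].
by move=> k k0; rewrite !count_nseq /=; case: k k0.
Qed.

(* l = n + 1; the polynomial indeterminate 'X on the right-hand side is q. *)
Theorem theorem2p18 (n : nat) (Psi : {set 'I_n.+1 * 'I_n.+1})
    (hPsi : root_ideal Psi) (mu : n.+1.-tuple nat) (hmu : sorted geq mu) :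
  forall d : nat,
    catalan Psi [ffun i => (tnth mu i)%:Z] (hecke_w0 n) d =
    (\sum_(U <- SSYT mu | katabolizable (nr Psi) U)
        schur n (shape U) *: 'X^(charge_tabloid U) : {poly ratfun n.+1})`_d.
Proof.
move=> d; rewrite mu_wgt (catalan_VV _ _ hPsi) kat_coef.
rewrite (VV_perm _ _ _ (rsP_perm hPsi)).
case: n Psi hPsi mu hmu => [|n] Psi hPsi mu hmu.
  have e0 : nr Psi = [::] by apply: size0nil; rewrite size_nr.
  rewrite e0 /=; have -> : [seq U <- SSYT mu | katabolizable [::] U] = SSYT mu by apply/all_filterP/allP.
  rewrite (perm_big _ (SSYT_row mu)) big_cons big_nil charge_ones eq_sym /=; case: eqP => _ //.
  rewrite addr0; apply: eq_sh => k; rewrite ltnS leqn0 => /eqP -> /=.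
  by rewrite size_nseq.
have n0 : (0 < n.+1)%N by [].
have smu : size mu = n.+2 by exact: size_tuple.
have okn := okns_nr hPsi; have okc := okchain_nr hPsi; have szn := size_nr Psi.
have aM : all (geq (sumn mu)) mu.
  by apply/allP => x xm /=; rewrite sumnE (big_rem x) //= leq_addr.
have okn' : okns (nr Psi) (size mu) by rewrite smu.
(* The bounds of [Lst] are chosen here: [sumn mu] for the parts and [d.+1] for the degree. *)
have e1 := Lst_VV (@shfn n.+1) (ltnSn d) okn' aM; rewrite smu in e1; rewrite -e1.
have H := hw_sum n0 hmu okn d.+1 aM.
have := congr1 (fun p => (theta n.+1 p)`_d) H; rewrite !theta_coef => H'.
rewrite -[LHS]H' -[LHS]big_filter_cond (perm_big _ (ssyt_words n0 mu okc szn)) big_map.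
rewrite big_seq_cond [RHS]big_seq_cond; apply: eq_big => [U|U].
  rewrite mem_filter mem_SSYT; case hU : (is_ssyt mu U); rewrite ?andbF // ssyt_charge //.
rewrite mem_filter mem_SSYT => /andP[/andP[_ hU] _]; apply: eq_sh => k kl.
by rewrite (ssyt_row hU).
Qed.
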